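(* Let $\mu$ be any deterministic Stieltjes measure on $[0,T]$ assigning positive measure to every nonempty open interval in $[0,T]$. Let $F:\Omega\times[0,T]\times\mathbb{R}^K\times\mathbb{R}^{K\times\infty}\to\mathbb{R}^K$ be a predictable, progressively measurable function such that: (a) $E\big[\int_{]0,T]}\|F(\omega,t,0,0)\|^2\,d\mu_t\big]<+\infty$; (b) (quadratic firm Lipschitz bound) there exist a constant $c\in\mathbb{R}$ and a measurable deterministic function $t\mapsto c_t$, uniformly bounded by $c$, such that for any $y_t,y'_t\in\mathbb{R}^K$ and $z_t,z'_t\in\mathbb{R}^{K\times\infty}$, $$\|F(\omega,t,y_t,z_t)-F(\omega,t,y'_t,z'_t)\|^2\le c_t\|y_t-y'_t\|^2+c\,\|z_t-z'_t\|^2_{M_t}\qquad d\mu\times d\mathbb{P}\text{-a.s.},$$ and $c_t(\Delta\mu_t)^2<1$ for all $t$. Then for any $Q\in L^2(\mathbb{R}^K;\mathcal{F}_T)$, the BSDE $$Q=Y_t-\int_{]t,T]}F(\omega,u,Y_{u-},Z_u)\,d\mu_u+\sum_{i=1}^\infty\int_{]t,T]}Z^i_u\,dM^i_u,\qquad t\in[0,T],$$ has a unique solution $(Y,Z)\in S^2\times H^2_M$.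
   Context: Setting: $T>0$ and $K\in\mathbb{N}$ are fixed. $(\Omega,\mathcal{F},\mathbb{P})$ is a probability space with a filtration $\{\mathcal{F}_t\}_{t\in[0,T]}$ satisfying the usual conditions (completeness, right continuity), $\mathcal{F}_0$ is trivial, and $L^2(\mathcal{F}_T)$ is a separable Hilbert space. $M^1,M^2,\ldots$ is a fixed (finite or countable, padded by zeros) sequence of square-integrable $\{\mathcal{F}_t\}$-martingales, as provided by the Davis–Varaiya martingale representation theorem: the $M^i$ are pairwise orthogonal ($E[M^i_TM^j_T]=0$, in the strong sense $\langle M^i,M^j\rangle=0$, for $i\ne j$); every square-integrable martingale $N$ can be written $N_t=N_0+\sum_i\int_{]0,t]}Z^i_u\,dM^i_u$ with predictable $Z^i$ satisfying $E[\sum_i\int_{[0,T]}(Z^i_u)^2d\langle M^i\rangle_u]<\infty$; and $\langle M^1\rangle\succ\langle M^2\rangle\succ\cdots$, where $\succ$ denotes absolute continuity (of each measure with respect to the preceding one) of the measures $A\mapsto E[\int_{[0,T]} I_A\,d\langle M^i\rangle]$ induced on $\Omega\times[0,T]$. $\mathbb{R}^{K\times\infty}$ is the space of infinite sequences $z=(z^i)_{i\in\mathbb{N}}$ with $z^i\in\mathbb{R}^K$; $\|\cdot\|$ is the Euclidean norm. A Stieltjes measure $\mu$ is identified with its right-continuous distribution function $\mu_t=\mu([0,t])$, which is nondecreasing; $\Delta\mu_t$ is its jump. Seminorm: regarding $\langle M^i\rangle$ as a measure on the predictable $\sigma$-algebra, take its Lebesgue decomposition $\langle M^i\rangle=m^{i,1}+m^{i,2}$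 with $m^{i,1}\ll\mu\times\mathbb{P}$ and $m^{i,2}$ singular to $\mu\times\mathbb{P}$; then $\|z_t\|^2_{M_t}:=\sum_i\|z^i_t\|^2\frac{dm^{i,1}_t}{d(\mu\times\mathbb{P})}$. Spaces: $H^2_M$ is the set of predictable $Z:\Omega\times[0,T]\to\mathbb{R}^{K\times\infty}$ with $E[\sum_i\int_{[0,T]}\|Z^i_t\|^2d\langle M^i\rangle_t]<\infty$, with $Z,\bar Z$ identified if $E[\sum_i\int_{[0,T]}\|Z^i_t-\bar Z^i_t\|^2d\langle M^i\rangle_t]=0$. $S^2$ is the set of adapted $Y:\Omega\times[0,T]\to\mathbb{R}^K$ with $E[\sup_{t\in[0,T]}\|Y_t\|^2]<\infty$, with indistinguishable processes identified. *)

(* Defs.v *)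
From HB Require Import structures.
From mathcomp Require Import all_boot all_order all_algebra.
From mathcomp Require Import all_classical all_reals all_analysis.

Set Implicit Arguments.
Unset Strict Implicit.
Unset Printing Implicit Defensive.
Import Order.TTheory GRing.Theory Num.Theory.
Import numFieldNormedType.Exports.

Local Open Scope classical_set_scope.
Local Open Scope ring_scope.

(** Conventions.  A process is a total function [Om -> R -> _]; only its values
    at times in [`[0, T]] are constrained or used.  A filtration is a family
    [Ft : R -> set (set Om)] of which only the [Ft t] with [t] in [`[0, T]]
    matter.  The martingales M^1, M^2, ... are indexed from 0. *)

(** Squared Euclidean norm; the norm of the library on matrices is the sup
    norm. *)
Definition sqnorm {R : realType} {K : nat} (v : 'rV[R]_K) : R :=
  \sum_(k < K) v ord0 k ^+ 2.

Definition rV_borel (R : realType) (K : nat) : set (set 'rV[R]_K) :=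
  g_sigma_preimage (fun (k : 'I_K) (v : 'rV[R]_K) => v ord0 k : R).
Arguments rV_borel : clear implicits.

Notation vec R K := (g_sigma_algebraType (rV_borel R K)).

Definition rVseq_cylinders (R : realType) (K : nat) :
    set (set (nat -> 'rV[R]_K)) :=
  [set C | exists i, exists2 B, rV_borel R K B & C = [set z | B (z i)]].
Arguments rVseq_cylinders : clear implicits.

Notation vecseq R K := (g_sigma_algebraType (rVseq_cylinders R K)).

Section Processes.
Context {d : measure_display} {Om : measurableType d} {R : realType}.
Variables (P : probability Om R) (Ft : R -> set (set Om)) (T : R).
Implicit Types X Y N I S : Om -> R -> R.

Definition filtration : Prop :=
  [/\ forall t : R, 0 <= t <= T -> sigma_algebra setT (Ft t),
      forall t : R, 0 <= t <= T -> Ft t `<=` measurable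
    & forall s t : R, 0 <= s -> s <= t -> t <= T -> Ft s `<=` Ft t].

(** Completeness also makes the ambient sigma-algebra complete, since [Ft 0]
    consists of measurable sets. *)
Definition usual_conditions : Prop :=
  P.-negligible `<=` Ft 0 /\
  (forall t : R, 0 <= t < T ->
     forall A, (forall s, t < s <= T -> Ft s A) -> Ft t A).

Definition trivial_sigma_algebra (G : set (set Om)) : Prop :=
  forall A, G A -> P A = 0%E \/ P A = 1%E.

Definition L2 (G : set (set Om)) (f : Om -> R) : Prop :=
  measurable_fun setT (f : g_sigma_algebraType G -> R) /\
  (\int[P]_w (f w ^+ 2)%:E < +oo)%E.

Definition separable_L2 (G : set (set Om)) : Prop :=
  exists2 u : nat -> Om -> R, (forall n, L2 G (u n)) &
    forall f, L2 G f -> forall e : R, 0 < e ->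
      exists n, (\int[P]_w ((f w - u n w) ^+ 2)%:E < e%:E)%E.

Definition adapted {d'} {E : measurableType d'} (Y : Om -> R -> E) : Prop :=
  forall t : R, 0 <= t <= T ->
    measurable_fun setT ((fun w => Y w t) : g_sigma_algebraType (Ft t) -> E).

Definition predictable_rectangles : set (set (Om * R)) :=
  [set C | (exists2 A, Ft 0 A & C = A `*` [set 0]) \/
           (exists A s t,
              [/\ 0 <= s, s < t, t <= T, Ft s A & C = A `*` `]s, t]])].

(** Its trace on [horizon] is the predictable sigma-algebra of
    Om x [0, T]. *)
Notation pred_type := (g_sigma_algebraType predictable_rectangles).

Definition horizon : set pred_type := setT `*` `[0, T].

Definition predictable {d'} {E : measurableType d'} (Z : Om -> R -> E) : Prop :=
  @measurable_fun _ _ pred_type E horizon (fun p => Z p.1 p.2).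

Definition cadlag (f : R -> R) : Prop :=
  (forall t : R, 0 <= t < T -> f s @[s --> t^'+] --> f t) /\
  (forall t : R, 0 < t <= T -> cvg (f s @[s --> t^'-])).

(** The last clause is E[X_t | Ft s] = X_s, spelled out. *)
Definition martingale X : Prop :=
  [/\ adapted X,
      forall t : R, 0 <= t <= T -> P.-integrable setT (fun w => (X w t)%:E)
    & forall s t : R, 0 <= s -> s <= t -> t <= T -> forall A, Ft s A ->
        (\int[P]_(w in A) (X w t)%:E = \int[P]_(w in A) (X w s)%:E)%E].

(** Martingales are taken in their cadlag versions. *)
Definition sq_martingale X : Prop :=
  [/\ martingale X, forall w, cadlag (X w)
    & forall t : R, 0 <= t <= T -> (\int[P]_w (X w t ^+ 2)%:E < +oo)%E].

(** [A] is the predictable covariation <X, Y>. *)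
Definition is_bracket X Y (A : Om -> R -> R) : Prop :=
  [/\ predictable A,
      forall w, A w 0 = 0,
      forall w, cadlag (A w) /\ bounded_variation 0 T (A w)
    & martingale (fun w t => X w t * Y w t - A w t)].

Section BracketIntegrals.
Variable A : Om -> cumulative R R.

(** Integral over the closed interval; an atom at 0 is excluded later by
    [A w t = 0] for [t <= 0]. *)
Definition bracket_int (w : Om) (f : R -> \bar R) : \bar R :=
  (\int[lebesgue_stieltjes_measure (A w)]_(t in `[0%R, T]) f t)%E.

Definition bracket_measure (C : set (Om * R)) : \bar R :=
  (\int[P]_w bracket_int w (fun t => (\1_C (w, t))%:E))%E.

End BracketIntegrals.

(** The process \sum_k coef_k * 1_(]left_k, right_k]). *)
Record simple_process := SimpleProcess {
  sp_size : nat;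
  sp_left : nat -> R;
  sp_right : nat -> R;
  sp_coef : nat -> Om -> R }.

Definition simple_predictable (H : simple_process) : Prop :=
  forall k, (k < sp_size H)%N ->
    [/\ 0 <= sp_left H k, sp_left H k < sp_right H k, sp_right H k <= T,
        measurable_fun setT
          (sp_coef H k : g_sigma_algebraType (Ft (sp_left H k)) -> R)
      & exists C : R, forall w, `|sp_coef H k w| <= C].

Definition simple_val (H : simple_process) (w : Om) (t : R) : R :=
  \sum_(k < sp_size H) sp_coef H k w * \1_(`]sp_left H k, sp_right H k]) t.

Definition simple_int (H : simple_process) (M : Om -> R -> R) w (t : R) : R :=
  \sum_(k < sp_size H) sp_coef H k w *
    (M w (Num.min (sp_right H k) t) - M w (Num.min (sp_left H k) t)).

(** [I] is the process t |-> \int_(]0, t]) Z dM, by the L^2 extension of the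
    integral of simple predictable processes; [A] is <M>. *)
Definition is_stoch_int (M : Om -> R -> R) (A : Om -> cumulative R R)
    (Z : Om -> R -> R) I : Prop :=
  [/\ predictable Z,
      (\int[P]_w bracket_int A w (fun t => (Z w t ^+ 2)%:E) < +oo)%E,
      sq_martingale I,
      forall w, I w 0 = 0
    & exists H : nat -> simple_process,
      [/\ forall n, simple_predictable (H n),
          (\int[P]_w bracket_int A w
             (fun t => ((simple_val (H n) w t - Z w t) ^+ 2)%:E))%E
            @[n --> \oo] --> 0%E
        & forall t : R, 0 <= t <= T ->
          (\int[P]_w ((simple_int (H n) M w t - I w t) ^+ 2)%:E)%E
            @[n --> \oo] --> 0%E]].

(** [S] is the process t |-> \sum_i \int_(]0, t]) Z^i dM^i, the series being
    taken in L^2. *)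
Definition is_stoch_int_series (M : nat -> Om -> R -> R)
    (A : nat -> Om -> cumulative R R) (Z : nat -> Om -> R -> R) S : Prop :=
  [/\ sq_martingale S,
      forall w, S w 0 = 0
    & exists2 I : nat -> Om -> R -> R,
        (forall i, is_stoch_int (M i) (A i) (Z i) (I i)) &
        forall t : R, 0 <= t <= T ->
          (\int[P]_w ((\sum_(i < n) I i w t - S w t) ^+ 2)%:E)%E
            @[n --> \oo] --> 0%E].

Definition S2 {K : nat} (Y : Om -> R -> 'rV[R]_K) : Prop :=
  adapted (Y : Om -> R -> vec R K) /\
  (\int[P]_w ereal_sup [set (sqnorm (Y w t))%:E | t in `[0%R, T]] < +oo)%E.

Definition H2_sqnorm {K : nat} (A : nat -> Om -> cumulative R R)
    (Z : nat -> Om -> R -> 'rV[R]_K) : \bar R :=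
  (\int[P]_w \sum_(i <oo) bracket_int (A i) w (fun t => (sqnorm (Z i w t))%:E))%E.

Definition H2 {K : nat} (A : nat -> Om -> cumulative R R)
    (Z : nat -> Om -> R -> 'rV[R]_K) : Prop :=
  (forall i, predictable (Z i : Om -> R -> vec R K)) /\
  (H2_sqnorm A Z < +oo)%E.

(** [A i] is <M^i>. *)
Definition martingale_basis (M : nat -> Om -> R -> R)
    (A : nat -> Om -> cumulative R R) : Prop :=
  [/\ forall i, sq_martingale (M i),
      forall i, is_bracket (M i) (M i) (fun w => A i w) /\
                (forall w t, t <= 0 -> A i w t = 0),
      forall i j, i != j ->
        (\int[P]_w (M i w T * M j w T)%:E = 0)%E /\
        is_bracket (M i) (M j) (fun _ _ => 0),
      forall i, bracket_measure (A i.+1) `<< bracket_measure (A i)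
    & forall N, sq_martingale N ->
        exists Z : nat -> Om -> R -> R,
        exists S : Om -> R -> R,
          [/\ forall i, predictable (Z i),
              (\int[P]_w \sum_(i <oo)
                 bracket_int (A i) w (fun t => (Z i w t ^+ 2)%:E) < +oo)%E,
              is_stoch_int_series M A Z S
            & \forall w \ae P, forall t : R, 0 <= t <= T ->
                N w t = N w 0 + S w t]].

Section BSDE.
Context {K : nat}.
Variable F : Om -> R -> 'rV[R]_K -> (nat -> 'rV[R]_K) -> 'rV[R]_K.

Definition predictable_driver : Prop :=
  @measurable_fun _ _ (pred_type * vec R K * vecseq R K)%type (vec R K)
    ((horizon `*` setT) `*` setT)
    (fun p => F p.1.1.1 p.1.1.2 p.1.2 p.2).

Definition progressive_driver : Prop :=
  forall t : R, 0 <= t <= T ->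
    @measurable_fun _ _
      (g_sigma_algebraType (Ft t) * R * vec R K * vecseq R K)%type (vec R K)
      (((setT `*` `[0, t]) `*` setT) `*` setT)
      (fun p => F p.1.1.1 p.1.1.2 p.1.2 p.2).

Definition left_lim (y : R -> 'rV[R]_K) (t : R) : 'rV[R]_K :=
  lim (y s @[s --> t^'-]).

(** The integrability clause gives a meaning to the Lebesgue-Stieltjes integral
    (the library integral is total).  Paths of a solution are then almost surely
    cadlag by the equation, so [left_lim (Y w) u] is the actual limit Y_(u-). *)
Definition bsde_solution (mu : {measure set R -> \bar R}) (M : nat -> Om -> R -> R)
    (A : nat -> Om -> cumulative R R) (Q : Om -> 'rV[R]_K)
    (Y : Om -> R -> 'rV[R]_K) (Z : nat -> Om -> R -> 'rV[R]_K) : Prop :=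
  let f w u := F w u (left_lim (Y w) u) (fun i => Z i w u) in
  (\forall w \ae P, forall k,
     mu.-integrable `]0, T] (fun u => (f w u ord0 k)%:E)) /\
  exists2 S : Om -> R -> 'rV[R]_K,
    (forall k, is_stoch_int_series M A
       (fun i w t => Z i w t ord0 k) (fun w t => S w t ord0 k)) &
    \forall w \ae P, forall t : R, 0 <= t <= T ->
      Q w = Y w t - \row_k (\int[mu]_(u in `]t, T]) f w u ord0 k)
            + (S w T - S w t).

End BSDE.

End Processes.

Definition singular {d} {X : measurableType d} {R : realType}
    (m nu : set X -> \bar R) : Prop :=
  exists N : set X, [/\ measurable N, nu N = 0%E & m (~` N) = 0%E].

(** [rho] is a version of d m1 / d nu, where m = m1 + m2 is the Lebesgue
    decomposition of [m] with respect to [nu]. *)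
Definition ac_part_density {d} {X : measurableType d} {R : realType}
    (m nu : set X -> \bar R) (rho : X -> R) : Prop :=
  exists m1 m2 : {measure set X -> \bar R},
    [/\ forall C, measurable C -> m C = (m1 C + m2 C)%E,
        m1 `<< nu,
        singular m2 nu,
        measurable_fun setT rho /\ (forall x, 0 <= rho x)
      & forall C, measurable C -> m1 C = (\int[nu]_(x in C) (rho x)%:E)%E].

(** ||z||^2_(M_t) at the outcome [w], where [rho i] is the density of the
    absolutely continuous part of <M^i>. *)
Definition M_sqnorm {Om : Type} {R : realType} {K : nat}
    (rho : nat -> Om * R -> R) (w : Om) (t : R) (z : nat -> 'rV[R]_K) : \bar R :=
  (\sum_(i <oo) (sqnorm (z i) * rho i (w, t))%:E)%E.

(* Main.v *)
Require Import Defs.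
From HB Require Import structures.
From mathcomp Require Import all_boot all_order all_algebra.
From mathcomp Require Import all_classical all_reals all_analysis.
From mathcomp Require Import measurable_realfun finmap ring lra.

(** The unknown is the driver process g = F(., Y_-, Z).  For a given
    predictable square-integrable g the linear equation is solved by the
    representation of the martingale E[Q + \int g dmu | F_t], so the theorem is a
    fixed point problem g |-> F(., Y_-, Z).  For two inputs with difference g
    and output differences y, z, s (s the stochastic integral of z), the energy
    identities E y_t^2 + E (s_T - s_t)^2 = E (\int_]t,T] g dmu)^2 and, because g
    and y_- are predictable, E (y_(t-) - g_t mu{t})^2 + E (s_T - s_(t-))^2 =
    E (\int_]t,T] g dmu)^2 show that the output mass on an open interval of small
    mu-measure is at most half the input mass there plus a multiple of the
    input mass to the right, and on an atom t at most a factor less than 1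
    (this is c_t (Delta mu_t)^2 < 1) plus a multiple of the mass to the right.
    Gluing such pieces by a real induction running backwards from T gives one
    weighted norm for which the map is a contraction. *)

Set Implicit Arguments.
Unset Strict Implicit.
Unset Printing Implicit Defensive.
Import Order.TTheory GRing.Theory Num.Theory.
Import numFieldNormedType.Exports.
Local Open Scope classical_set_scope.
Local Open Scope ring_scope.

(** * Square-integrable functions *)

Section FatouBound.
Local Open Scope ereal_scope.
Context {d} {X : measurableType d} {R : realType} (m : {measure set X -> \bar R}).

(** Iterating on the driver process keeps the whole argument in one space, L2 of [P \x mu]: the
    state and the integrands of a difference of two solutions are estimated from g by orthogonality
    alone, without an Ito formula. The obstacle is that at an atom [mu] offers no smallness beyond
    [ct t * mu{t}^2 < 1]. There the two summands of the energy identity are used separately. The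
    first says that y_(t-) is the jump g_t mu{t} up to an error paid by the mass strictly to the
    right of t; the second says that the bracket mass of z at t is paid from the right as well. This
    is why the constant in front of z may be arbitrary and smallness is asked of [ct] alone. Mass to
    the right may enter with any constant, because the weights are chosen from right to left and a
    new piece can be given a weight as small as necessary. The stochastic part serves these
    identities: cadlag versions and maximal functions allow the passage to left limits, and the
    isometry turns E (s_T - s_t)^2 into the bracket norm of z. *)

Lemma measurable_limn_einf D (fn : nat -> X -> \bar R) :
  (forall n, measurable_fun D (fn n)) ->
  measurable_fun D (fun x => limn_einf (fn ^~ x)).
Proof.
move=> mfn; rewrite /limn_einf; apply: measurableT_comp => //.
by apply: measurable_fun_limn_esup => n; exact: measurableT_comp.
Qed.

(** The limit agrees almost everywhere with the lower limit, to which Fatou applies; a lower limit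
    does not notice that the bound on the integrals starts only at some rank. *)
Lemma fatou_le (fn : nat -> X -> \bar R) (f : X -> \bar R) C :
  (forall n, measurable_fun setT (fn n)) -> measurable_fun setT f ->
  (forall n x, 0 <= fn n x) ->
  {ae m, forall x, fn n x @[n --> \oo] --> f x} ->
  (\forall n \near \oo, \int[m]_x fn n x <= C) -> \int[m]_x f x <= C.
Proof.
move=> mfn mf fn0 fnf bound.
have mi : measurable_fun setT (fun x => limn_einf (fn ^~ x)).
  exact: measurable_limn_einf.
have -> : \int[m]_x f x = \int[m]_x limn_einf (fn ^~ x).
  apply: ae_eq_integral => //; apply: filterS fnf => x fx _.
  apply/esym; rewrite is_cvg_limn_einfE; first exact/cvg_lim.
  by apply/cvg_ex; eexists; exact: fx.
apply: (le_trans (fatou _ measurableT _ _)) => //.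
rewrite limn_einf_lim; apply: lime_le; first exact: is_cvg_einfs.
case: bound => N _ bound; apply: nearW => k; apply: ge_ereal_inf.
exists (\int[m]_x fn (maxn k N) x).
  by exists (maxn k N) => //=; rewrite leq_maxl.
by apply: bound; rewrite /= leq_maxr.
Qed.

End FatouBound.

Section SquareIntegrable.
Context {d} {X : measurableType d} {R : realType} (m : {measure set X -> \bar R}).
Implicit Types f g h : X -> R.

Definition sqint f : Prop :=
  measurable_fun setT f /\ (\int[m]_x (f x ^+ 2)%:E < +oo)%E.

(** The real integral is total, so [ip] has a default value when the product is not integrable. This
    is why the bilinearity lemmas carry [sqint] hypotheses. *)
Definition ip f g : R := \int[m]_x (f x * g x).

Lemma sqint_mul f g : sqint f -> sqint g ->
  m.-integrable setT (EFin \o (fun x => f x * g x)).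
Proof.
move=> [mf f2] [mg g2].
have mfg : measurable_fun setT (fun x => f x * g x) by exact: measurable_funM.
apply/integrableP; split; first exact/measurable_EFinP.
apply: (@le_lt_trans _ _ (\int[m]_x ((f x ^+ 2)%:E + (g x ^+ 2)%:E))%E).
  apply: ge0_le_integral => //=.
  - by do 2 apply: measurableT_comp => //.
  - apply: emeasurable_funD; apply/measurable_EFinP; exact: measurable_funX.
  - move=> x _; rewrite lee_fin ler_norml.
    have := sqr_ge0 (f x - g x); have := sqr_ge0 (f x + g x).
    have := sqr_ge0 (f x); have := sqr_ge0 (g x).
    move: (f x) (g x) => a b; nra.
rewrite ge0_integralD //=; first exact: lte_add_pinfty.
- by move=> x _; rewrite lee_fin sqr_ge0.
- by apply/measurable_EFinP; exact: measurable_funX.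
- by move=> x _; rewrite lee_fin sqr_ge0.
- by apply/measurable_EFinP; exact: measurable_funX.
Qed.

Lemma sqint_sq f : sqint f -> m.-integrable setT (EFin \o (fun x => f x ^+ 2)).
Proof. by move=> ff; apply: eq_integrable (sqint_mul ff ff). Qed.

Lemma sqint_le f g : measurable_fun setT f -> (forall x, `|f x| <= `|g x|) ->
  sqint g -> sqint f.
Proof.
move=> mf fg [mg g2]; split=> //; apply: le_lt_trans g2.
apply: ge0_le_integral => //.
- by move=> x _; rewrite lee_fin sqr_ge0.
- by apply/measurable_EFinP; exact: measurable_funX.
- by apply/measurable_EFinP; exact: measurable_funX.
- by move=> x _; rewrite lee_fin -[leLHS]real_normK ?num_real// -[leRHS]real_normK
    ?num_real// lerXn2r// nnegrE.
Qed.

Lemma sqint0 : sqint (fun=> 0).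
Proof.
by split=> //; under eq_integral do rewrite expr0n/=; rewrite integral0.
Qed.

Lemma sqintZ a f : sqint f -> sqint (fun x => a * f x).
Proof.
move=> ff; split; first by apply: measurable_funM => //; exact: ff.1.
have := @integrableZl _ _ _ m _ measurableT (a ^+ 2) _ (sqint_sq ff).
move=> /integrableP[_]; apply: le_lt_trans; apply: ge0_le_integral => //.
- by move=> x _; rewrite lee_fin sqr_ge0.
- by apply/measurable_EFinP/measurable_funX/measurable_funM => //; exact: ff.1.
- apply/measurableT_comp => //; apply/measurable_EFinP/measurable_funM => //.
  exact/measurable_funX/ff.1.
- by move=> x _; rewrite /= lee_fin exprMn ler_norm.
Qed.

Lemma sqintN f : sqint f -> sqint (fun x => - f x).
Proof.
by move=> ff; have := sqintZ (-1) ff; under eq_fun do rewrite mulN1r.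
Qed.

Lemma sqintD f g : sqint f -> sqint g -> sqint (fun x => f x + g x).
Proof.
move=> ff gg; split; first by apply: measurable_funD; [exact: ff.1|exact: gg.1].
have := integrableD measurableT (integrableZl measurableT 2 (sqint_sq ff))
  (integrableZl measurableT 2 (sqint_sq gg)).
move=> /integrableP[mm]; apply: le_lt_trans; apply: ge0_le_integral => //.
- by move=> x _; rewrite lee_fin sqr_ge0.
- apply/measurable_EFinP/measurable_funX/measurable_funD => //; first exact: ff.1.
  exact: gg.1.
- exact: measurableT_comp.
- move=> x _; rewrite /= lee_fin; apply: le_trans (ler_norm _).
  by have := sqr_ge0 (f x - g x); move: (f x) (g x) => a b; nra.
Qed.

Lemma sqintB f g : sqint f -> sqint g -> sqint (fun x => f x - g x).
Proof. by move=> ff gg; apply: sqintD => //; exact: sqintN. Qed.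

Lemma sqint_sum I (r : seq I) (P : pred I) (F : I -> X -> R) :
  (forall i, P i -> sqint (F i)) -> sqint (fun x => \sum_(i <- r | P i) F i x).
Proof.
move=> FF; elim: r => [|i r IH].
  by under eq_fun do rewrite big_nil; exact: sqint0.
case: (boolP (P i)) => Pi; last first.
  by under eq_fun do rewrite big_cons (negbTE Pi).
by under eq_fun do rewrite big_cons Pi; apply: sqintD => //; exact: FF.
Qed.

Lemma sqint_indic f A : measurable A -> sqint f -> sqint (fun x => f x * \1_A x).
Proof.
move=> mA ff; apply: (sqint_le _ _ ff).
  by apply: measurable_funM; [exact: ff.1|exact: measurable_indic].
by move=> x; rewrite normrM indicE; case: (_ \in _); rewrite ?normr1 ?mulr1// normr0 mulr0.
Qed.

Lemma ipC f g : ip f g = ip g f.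
Proof. by rewrite /ip; under eq_fun do rewrite mulrC. Qed.

Lemma ipE f : sqint f -> (ip f f)%:E = (\int[m]_x (f x ^+ 2)%:E)%E.
Proof.
move=> ff; rewrite /ip /Rintegral.
rewrite fineK; first by under eq_integral do rewrite -expr2.
by apply: integrable_fin_num => //; exact: sqint_mul.
Qed.

Lemma ip_ge0 f : 0 <= ip f f.
Proof. by apply: Rintegral_ge0 => x _; rewrite -expr2 sqr_ge0. Qed.

Lemma ipDl f g h : sqint f -> sqint g -> sqint h ->
  ip (fun x => f x + g x) h = ip f h + ip g h.
Proof.
move=> ff gg hh; rewrite /ip; under eq_fun do rewrite mulrDl.
by rewrite RintegralD//; exact: sqint_mul.
Qed.

Lemma ipZl a f h : sqint f -> sqint h -> ip (fun x => a * f x) h = a * ip f h.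
Proof.
move=> ff hh; rewrite /ip; under eq_fun do rewrite -mulrA.
by rewrite RintegralZl//; exact: sqint_mul.
Qed.

Lemma ipNl f h : sqint f -> sqint h -> ip (fun x => - f x) h = - ip f h.
Proof.
move=> ff hh; rewrite -[RHS]mulN1r -(ipZl (-1) ff hh); congr ip.
by apply/funext => x; rewrite mulN1r.
Qed.

Lemma ipBl f g h : sqint f -> sqint g -> sqint h ->
  ip (fun x => f x - g x) h = ip f h - ip g h.
Proof. by move=> ff gg hh; rewrite ipDl ?ipNl//; exact: sqintN. Qed.

Lemma ipDr f g h : sqint f -> sqint g -> sqint h ->
  ip h (fun x => f x + g x) = ip h f + ip h g.
Proof. by move=> *; rewrite ipC ipDl// ipC [ip g h]ipC. Qed.

Lemma ipBr f g h : sqint f -> sqint g -> sqint h ->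
  ip h (fun x => f x - g x) = ip h f - ip h g.
Proof. by move=> *; rewrite ipC ipBl// ipC [ip g h]ipC. Qed.

Lemma ip_suml I (r : seq I) (P : pred I) (F : I -> X -> R) h :
  (forall i, P i -> sqint (F i)) -> sqint h ->
  ip (fun x => \sum_(i <- r | P i) F i x) h = \sum_(i <- r | P i) ip (F i) h.
Proof.
move=> FF hh; elim: r => [|i r IH].
  rewrite big_nil /ip; under eq_fun do rewrite big_nil mul0r.
  by rewrite Rintegral_cst// mul0r.
rewrite big_cons; case: (boolP (P i)) => Pi; last first.
  by rewrite -IH; congr ip; apply/funext => x; rewrite big_cons (negbTE Pi).
rewrite -IH -ipDl//; [|exact: FF|exact: sqint_sum].
by congr ip; apply/funext => x; rewrite big_cons Pi.
Qed.

Lemma ipDD f g : sqint f -> sqint g ->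
  ip (fun x => f x + g x) (fun x => f x + g x) = ip f f + 2 * ip f g + ip g g.
Proof.
move=> ff gg; have fg := sqintD ff gg.
by rewrite ipDl// !ipDr// [ip g f]ipC; ring.
Qed.

Lemma ip_orthD f g : sqint f -> sqint g -> ip f g = 0 ->
  ip (fun x => f x + g x) (fun x => f x + g x) = ip f f + ip g g.
Proof. by move=> ff gg fg; rewrite ipDD// fg mulr0 addr0. Qed.

Lemma ip_ae f f' g g' : sqint f -> sqint g -> sqint f' -> sqint g' ->
  {ae m, forall x, f x = f' x} -> {ae m, forall x, g x = g' x} ->
  ip f g = ip f' g'.
Proof.
move=> ff gg ff' gg' aef aeg; congr fine; apply: ae_eq_integral => //.
- by apply/measurable_EFinP/measurable_funM; [exact: ff.1|exact: gg.1].
- by apply/measurable_EFinP/measurable_funM; [exact: ff'.1|exact: gg'.1].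
- by apply: filterS2 aef aeg => x -> -> _.
Qed.

Lemma ipD_le f g : sqint f -> sqint g ->
  ip (fun x => f x + g x) (fun x => f x + g x) <= 2 * ip f f + 2 * ip g g.
Proof.
move=> ff gg; have := ip_ge0 (fun x => f x - g x).
have fg := sqintB ff gg.
by rewrite (ipDD ff gg) (ipBl ff gg fg) !ipBr// [ip g f]ipC; lra.
Qed.

(** Nonnegativity of the square of [f - a g] as a quadratic polynomial in [a], read at its
    minimiser. *)
Lemma ip_CauchySchwarz f g : sqint f -> sqint g -> ip f g ^+ 2 <= ip f f * ip g g.
Proof.
move=> ff gg.
have H a : 0 <= ip f f - 2 * a * ip f g + a ^+ 2 * ip g g.
  have ag := sqintZ a gg; have fag := sqintB ff ag.
  apply: le_trans (ip_ge0 (fun x => f x - a * g x)) _.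
  by rewrite ipBl// !ipBr// !ipZl// ![ip _ (fun x => a * g x)]ipC !ipZl// [ip g f]ipC; lra.
have [g0|g0] := eqVneq (ip g g) 0.
  (* With [ip g g = 0] the polynomial is affine; unless [ip f g = 0], it takes the value -1 at this
     [a]. *)
  have := H ((ip f f + 1) / ip f g / 2); rewrite g0 !mulr0 addr0.
  have [->|fg0] := eqVneq (ip f g) 0; first by rewrite expr0n.
  rewrite (_ : 2 * _ * _ = ip f f + 1); last by field.
  by move=> abs; exfalso; lra.
have gp : 0 < ip g g by rewrite lt0r g0 ip_ge0.
have := H (ip f g / ip g g).
rewrite (_ : _ + _ = ip f f - ip f g ^+ 2 / ip g g); last by field.
by rewrite subr_ge0 ler_pdivrMr.
Qed.

Lemma sqint_ae0 f : sqint f -> ip f f = 0 -> {ae m, forall x, f x = 0}.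
Proof.
move=> ff f0.
have : (\int[m]_x `|(f x ^+ 2)%:E| = 0)%E.
  under eq_integral do rewrite /= ger0_norm ?sqr_ge0//.
  by rewrite -ipE// f0.
move=> /(ae_eq_integral_abs m measurableT (measurable_int _ (sqint_sq ff))).
by apply: filterS => x /(_ I) /= [] /eqP; rewrite sqrf_eq0 => /eqP.
Qed.

(** Fatou in the second index turns a Cauchy modulus into a rate of convergence to the almost
    everywhere limit, and yields the square integrability of that limit at the same time. *)
Lemma sqint_fatou (fn : nat -> X -> R) f (e : nat -> R) :
  (forall n, sqint (fn n)) -> measurable_fun setT f ->
  {ae m, forall x, fn n x @[n --> \oo] --> f x} ->
  (forall n k, (n <= k)%N ->
     ip (fun x => fn k x - fn n x) (fun x => fn k x - fn n x) <= e n) ->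
  sqint f /\ forall n, ip (fun x => f x - fn n x) (fun x => f x - fn n x) <= e n.
Proof.
move=> fn2 mf fnf ebound.
have fB n : (\int[m]_x ((f x - fn n x) ^+ 2)%:E <= (e n)%:E)%E.
  have mB k : measurable_fun setT (fun x => ((fn k x - fn n x) ^+ 2)%:E).
    apply/measurable_EFinP/measurable_funX/measurable_funB; exact: (fn2 _).1.
  apply: (fatou_le mB).
  - by apply/measurable_EFinP/measurable_funX/measurable_funB => //; exact: (fn2 _).1.
  - by move=> k x; rewrite lee_fin sqr_ge0.
  - apply: filterS fnf => x fx; apply/cvg_EFin; first exact: nearW.
    apply: (@cvg_comp _ _ _ _ (fun z : R => z ^+ 2)); last exact: exprn_continuous.
    by apply: cvgB => //; exact: cvg_cst.
  - exists n => // k nk.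
    by rewrite -ipE ?lee_fin ?ebound//; exact: sqintB.
have fB2 n : sqint (fun x => f x - fn n x).
  split; last exact: le_lt_trans (fB n) (ltry _).
  by apply: measurable_funB => //; exact: (fn2 _).1.
split; last by move=> n; rewrite -lee_fin ipE.
by have := sqintD (fB2 0%N) (fn2 0%N); under eq_fun do rewrite subrK.
Qed.

End SquareIntegrable.

(** A limit given by a formula: it is measurable for any sigma-algebra for which the terms are,
    without a convergence hypothesis, and it agrees with the limit wherever one exists. It serves
    for right limits, left limits and limits of Picard iterates. *)
Definition lsup {X : Type} {R : realType} (fn : nat -> X -> R) (x : X) : R :=
  fine (limn_esup (fun n => (fn n x)%:E)).

Lemma lsup_cvg {X : Type} {R : realType} (fn : nat -> X -> R) x l :
  fn n x @[n --> \oo] --> l -> lsup fn x = l.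
Proof.
move=> fl; rewrite /lsup is_cvg_limn_esupE; last first.
  by apply/cvg_ex; exists l%:E; apply/cvg_EFin => //; exact: nearW.
by rewrite (cvg_lim _ (cvg_EFin (nearW _ _) fl))//.
Qed.

Lemma measurable_lsup {d} {X : measurableType d} {R : realType}
    (fn : nat -> X -> R) D :
  (forall n, measurable_fun D (fn n)) -> measurable_fun D (lsup fn).
Proof.
move=> mfn; apply: (measurableT_comp (@fine_measurable R _ measurableT)).
by apply: measurable_fun_limn_esup => n; exact/measurable_EFinP.
Qed.

Section FiniteMeasure.
Context {d} {X : measurableType d} {R : realType} (m : {measure set X -> \bar R}).
Hypothesis mfin : (m setT < +oo)%E.
Implicit Types f g h : X -> R.

Lemma sqint_cst (a : R) : sqint m (fun=> a).
Proof.
split=> //; rewrite integral_cst// lte_mul_pinfty//.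
by rewrite lee_fin sqr_ge0.
Qed.

Lemma sqint_bounded f (C : R) : measurable_fun setT f ->
  (forall x, `|f x| <= C) -> sqint m f.
Proof.
move=> mf fC; apply: (sqint_le mf _ (sqint_cst C)) => x.
exact: le_trans (ler_norm _).
Qed.

Lemma sqint_integrable f : sqint m f -> m.-integrable setT (EFin \o f).
Proof.
by move=> ff; apply: eq_integrable (sqint_mul ff (sqint_cst 1)) => // x _ /=; rewrite mulr1.
Qed.

Lemma Rintegral_sqr_le f : sqint m f ->
  (\int[m]_x f x) ^+ 2 <= fine (m setT) * ip m f f.
Proof.
move=> ff; have := ip_CauchySchwarz ff (sqint_cst 1).
rewrite /ip [X in _ <= _ * X](_ : _ = fine (m setT)); last first.
  by under eq_fun do rewrite mul1r; rewrite Rintegral_cst// mul1r.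
by under [in X in X -> _]eq_fun do rewrite mulr1; rewrite mulrC.
Qed.

Definition nrm f := Num.sqrt (ip m f f).

Lemma nrmD f g : sqint m f -> sqint m g -> nrm (fun x => f x + g x) <= nrm f + nrm g.
Proof.
move=> ff gg; rewrite -(@ler_pXn2r _ 2)// ?nnegrE ?addr_ge0 ?sqrtr_ge0//.
rewrite sqrrD !sqr_sqrtr ?ip_ge0// ipDD//.
rewrite lerD2r lerD2l -[leRHS]mulr_natl ler_pM2l// -sqrtrM ?ip_ge0//.
apply: le_trans (ler_norm _) _; rewrite -sqrtr_sqr ler_wsqrtr//.
exact: ip_CauchySchwarz.
Qed.

Section FastCauchy.
Variables (fn : nat -> X -> R) (s r : R).
Hypotheses (s0 : 0 <= s) (r0 : 0 <= r) (r1 : r < 1).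
Hypothesis fn2 : forall n, sqint m (fn n).
Hypothesis fnr : forall n, nrm (fun x => fn n.+1 x - fn n x) <= s * r ^+ n.

Let fnB n k := sqintB (fn2 k) (fn2 n).

Lemma nrm_fast_cauchy n k : (n <= k)%N ->
  nrm (fun x => fn k x - fn n x) <= s * r ^+ n / (1 - r).
Proof.
have r1' : 0 < 1 - r by rewrite subr_gt0.
(* The partial geometric sum keeps its factor [1 - r ^+ (k - n)], which lets the induction close. *)
move=> /subnK <-; apply: (@le_trans _ _ (s * r ^+ n * (1 - r ^+ (k - n)) / (1 - r))).
  elim: (k - n)%N => [|j IH].
    rewrite add0n /nrm (_ : (fun x => _) = (fun=> 0)); last first.
      by apply/funext => x; rewrite subrr.
    by rewrite subrr mulr0 mul0r /ip Rintegral_cst// mul0r mul0r sqrtr0.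
  rewrite addSn (_ : (fun x => _) = (fun x => (fn (j + n).+1 x - fn (j + n)%N x) +
      (fn (j + n)%N x - fn n x))); last by apply/funext => x; ring.
  apply: (le_trans (nrmD (fnB _ _) (fnB _ _))).
  apply: (le_trans (lerD (fnr _) IH)).
  rewrite ler_pdivlMr// mulrDl divfK ?gt_eqF// exprD exprS.
  by rewrite le_eqVlt; apply/orP; left; apply/eqP; ring.
rewrite ler_pM2r ?invr_gt0// ler_piMr ?mulr_ge0 ?exprn_ge0//.
by rewrite gerBl exprn_ge0.
Qed.

(** On a finite measure space the L2 norms of the increments dominate their L1 norms. These are
    therefore summable, and the telescoping series converges absolutely almost everywhere; geometric
    decay spares a passage to subsequences. *)
Lemma fast_cauchy_ae : {ae m, forall x, fn n x @[n --> \oo] --> lsup fn x}.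
Proof.
pose D n x := (`|fn n.+1 x - fn n x|)%:E.
have mD n : measurable_fun setT (D n).
  by apply/measurable_EFinP; apply: measurableT_comp => //; exact: (fnB _ _).1.
have ID n : (\int[m]_x D n x <= (Num.sqrt (fine (m setT)) * s * r ^+ n)%:E)%E.
  have ad : sqint m (fun x => `|fn n.+1 x - fn n x|).
    apply: (sqint_le _ _ (fnB n n.+1)); last by move=> x; rewrite normr_id.
    by apply: measurableT_comp => //; exact: (fnB _ _).1.
  rewrite -[leLHS]fineK ?lee_fin; last exact/integrable_fin_num/sqint_integrable.
  rewrite -(@ler_pXn2r _ 2)// ?nnegrE ?mulr_ge0 ?exprn_ge0 ?sqrtr_ge0//; last first.
    by apply: fine_ge0; apply: integral_ge0 => x _; rewrite lee_fin.
  apply: (le_trans (Rintegral_sqr_le ad)).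
  rewrite -mulrA exprMn sqr_sqrtr ?fine_ge0// ler_wpM2l ?fine_ge0//.
  rewrite (_ : ip m _ _ = nrm (fun x => fn n.+1 x - fn n x) ^+ 2).
    by rewrite lerXn2r ?nnegrE ?sqrtr_ge0 ?mulr_ge0 ?exprn_ge0.
  rewrite sqr_sqrtr ?ip_ge0// /ip; apply: eq_Rintegral => x _.
  by rewrite -!expr2 real_normK ?num_real.
have sumD : (\int[m]_x (\sum_(n <oo) D n x) < +oo)%E.
  rewrite integral_nneseries//; last by move=> n x _; rewrite lee_fin.
  apply: (@le_lt_trans _ _ (Num.sqrt (fine (m setT)) * s / (1 - r))%:E); last exact: ltry.
  apply: lime_le.
    by apply: is_cvg_nneseries => n _ _; apply: integral_ge0 => x _; rewrite lee_fin.
  apply: nearW => n.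
  apply: (@le_trans _ _ (\sum_(0 <= k < n) (Num.sqrt (fine (m setT)) * s * r ^+ k)%:E)%E).
    exact: lee_sum.
  rewrite sumEFin lee_fin; have r11 : r != 1 by rewrite lt_eqF.
  have := @geometric_seriesE R (Num.sqrt (fine (m setT)) * s) r r11.
  move=> /(congr1 (@^~ n)); rewrite /series /= => ->.
  rewrite ler_pM2r ?invr_gt0 ?subr_gt0//.
  by rewrite ler_piMr ?mulr_ge0 ?sqrtr_ge0// gerBl exprn_ge0.
have mS : measurable_fun setT (fun x => (\sum_(n <oo) D n x)%E).
  by apply: ge0_emeasurable_sum => // n x _ _; rewrite lee_fin.
have iS : m.-integrable setT (fun x => (\sum_(n <oo) D n x)%E).
  apply/integrableP; split => //; rewrite (eq_integral (fun x => \sum_(n <oo) D n x)%E); first exact: sumD.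
  move=> x _.
  by rewrite gee0_abs//; apply: nneseries_ge0 => n _ _; rewrite lee_fin.
have := integrable_ae measurableT iS.
apply: filterS => x /(_ I) Sfin.
suff /cvg_ex[l fl] : cvgn (fn ^~ x) by rewrite (lsup_cvg fl).
have cD : cvgn (series (fun n => fn n.+1 x - fn n x)).
  apply: normed_cvg; apply: nondecreasing_is_cvgn.
    by apply: (@nondecreasing_series _ (fun n => `|fn n.+1 x - fn n x|) predT 0%N).
  exists (fine (\sum_(n <oo) D n x)%E) => _ [n _ <-].
  rewrite -lee_fin fineK// /series /= -sumEFin.
  by apply: (@nneseries_lim_ge _ (D ^~ x) predT) => k _; rewrite lee_fin.
have -> : fn ^~ x = (fun n => fn 0%N x + series (fun n => fn n.+1 x - fn n x) n).
  apply/funext => n; rewrite /series /= telescope_sumr// addrC subrK//.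
by apply: is_cvgD => //; exact: is_cvg_cst.
Qed.

Lemma fast_cauchy_lim : sqint m (lsup fn) /\
  forall n, nrm (fun x => lsup fn x - fn n x) <= s * r ^+ n / (1 - r).
Proof.
have mf : measurable_fun setT (lsup fn) by apply: measurable_lsup => n; exact: (fn2 _).1.
have r1' : 0 < 1 - r by rewrite subr_gt0.
have pos n : 0 <= s * r ^+ n / (1 - r) by rewrite !mulr_ge0 ?invr_ge0 ?exprn_ge0// ltW.
have [|lf lb] := @sqint_fatou _ _ _ m fn _ (fun n => (s * r ^+ n / (1 - r)) ^+ 2)
    fn2 mf fast_cauchy_ae.
  move=> n k nk; rewrite -[leLHS]sqr_sqrtr ?ip_ge0//.
  by rewrite lerXn2r ?nnegrE ?sqrtr_ge0//; exact: nrm_fast_cauchy.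
split=> // n; rewrite -(@ler_pXn2r _ 2)// ?nnegrE ?sqrtr_ge0//.
by rewrite sqr_sqrtr ?ip_ge0.
Qed.

End FastCauchy.

Lemma ip_cvg (fn gn : nat -> X -> R) f g :
  (forall n, sqint m (fn n)) -> (forall n, sqint m (gn n)) ->
  sqint m f -> sqint m g ->
  nrm (fun x => fn n x - f x) @[n --> \oo] --> 0 ->
  nrm (fun x => gn n x - g x) @[n --> \oo] --> 0 ->
  ip m (fn n) (gn n) @[n --> \oo] --> ip m f g.
Proof.
move=> fn2 gn2 f2 g2 ff gg.
have CS a b : sqint m a -> sqint m b -> `|ip m a b| <= nrm a * nrm b.
  move=> aa bb; rewrite -sqrtrM ?ip_ge0// -sqrtr_sqr ler_wsqrtr//.
  exact: ip_CauchySchwarz.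
apply/cvgrPdist_le => e e0.
have lim0 : nrm (fun x => fn n x - f x) * nrm (fun x => gn n x - g x) +
    nrm (fun x => fn n x - f x) * nrm g + nrm f * nrm (fun x => gn n x - g x)
    @[n --> \oo] --> 0.
  rewrite (_ : 0 = 0 * 0 + 0 * nrm g + nrm f * 0); last by ring.
  apply: cvgD; first apply: cvgD; first exact: cvgM.
  - by apply: cvgM => //; exact: cvg_cst.
  - by apply: cvgM => //; exact: cvg_cst.
move/cvgr0Pnorm_le: lim0 => /(_ _ e0); apply: filterS => n.
have fB := sqintB (fn2 n) f2; have gB := sqintB (gn2 n) g2.
rewrite distrC => /(le_trans (ler_norm _)); apply: le_trans.
rewrite (_ : _ - _ = ip m (fun x => fn n x - f x) (fun x => gn n x - g x) +
  ip m (fun x => fn n x - f x) g + ip m f (fun x => gn n x - g x)).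
  apply: (le_trans (ler_normD _ _)); apply: lerD; last exact: CS.
  by apply: (le_trans (ler_normD _ _)); apply: lerD; exact: CS.
by rewrite (ipBl (fn2 n) f2 gB) (ipBl (fn2 n) f2 g2) !ipBr//; ring.
Qed.

End FiniteMeasure.

Section DominatedL2.
Context {d} {X : measurableType d} {R : realType} (m : {measure set X -> \bar R}).

Lemma nrm_dominated_cvg (fn : nat -> X -> R) (f g : X -> R) :
  (forall n, measurable_fun setT (fn n)) -> measurable_fun setT f ->
  {ae m, forall x, fn n x @[n --> \oo] --> f x} ->
  {ae m, forall x, forall n, `|fn n x| <= `|g x|} -> sqint m g ->
  sqint m f /\ nrm m (fun x => fn n x - f x) @[n --> \oo] --> 0.
Proof.
move=> mfn mf fnf fng gg.
have fg : {ae m, forall x, `|f x| <= `|g x|}.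
  apply: filterS2 fnf fng => x fx gx; have fx' : `|fn n x| @[n --> \oo] --> `|f x| by exact: cvg_norm.
  rewrite -(cvg_lim _ fx')//; apply: limr_le; last exact: nearW.
  by apply/cvg_ex; eexists; exact: fx'.
have ff : sqint m f.
  split=> //; apply: le_lt_trans gg.2; apply: ae_ge0_le_integral => //.
  - by move=> x _; rewrite lee_fin sqr_ge0.
  - exact/measurable_EFinP/measurable_funX.
  - by move=> x _; rewrite lee_fin sqr_ge0.
  - exact/measurable_EFinP/measurable_funX/gg.1.
  - apply: filterS fg => x fx _; rewrite lee_fin -[leLHS]real_normK ?num_real//.
    by rewrite -[leRHS]real_normK ?num_real// lerXn2r// nnegrE.
split=> //.
have fn2 n : sqint m (fn n).
  split=> //; apply: le_lt_trans gg.2; apply: ae_ge0_le_integral => //.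
  - by move=> x _; rewrite lee_fin sqr_ge0.
  - exact/measurable_EFinP/measurable_funX.
  - by move=> x _; rewrite lee_fin sqr_ge0.
  - exact/measurable_EFinP/measurable_funX/gg.1.
  - apply: filterS fng => x fx _; rewrite lee_fin -[leLHS]real_normK ?num_real//.
    by rewrite -[leRHS]real_normK ?num_real// lerXn2r// nnegrE.
have mB n : measurable_fun setT (fun x => ((fn n x - f x) ^+ 2)%:E).
  exact/measurable_EFinP/measurable_funX/measurable_funB.
have [| | | |_ _ lim0] := @dominated_convergence _ _ _ m _ measurableT
    (fun n x => ((fn n x - f x) ^+ 2)%:E) (cst 0%E) (fun x => (4 * g x ^+ 2)%:E) mB.
- exact: measurable_cst.
- apply: filterS fnf => x fx _; apply/cvg_EFin; first exact: nearW.
  rewrite (_ : 0 = (f x - f x) ^+ 2); last by rewrite subrr expr0n.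
  apply: (@cvg_comp _ _ _ _ (fun z : R => z ^+ 2)); last exact: exprn_continuous.
  by apply: cvgB => //; exact: cvg_cst.
- have := integrableZl measurableT 4 (sqint_sq gg).
  by apply: eq_integrable => // x _ /=.
- apply: filterS2 fg fng => x fx gx n _; rewrite /= lee_fin ger0_norm ?sqr_ge0//.
  rewrite (_ : 4 * _ = (2 * `|g x|) ^+ 2); last first.
    by rewrite exprMn real_normK ?num_real//; congr (_ * _); ring.
  rewrite -[leLHS]real_normK ?num_real// lerXn2r ?nnegrE ?mulr_ge0//.
  apply: (le_trans (ler_normB _ _)); rewrite mulr_natl mulr2n.
  exact: lerD.
have {}lim0 : ip m (fun x => fn n x - f x) (fun x => fn n x - f x) @[n --> \oo] --> 0.
  move: lim0; rewrite integral0 => /fine_cvgP[_]; apply: cvg_trans; apply: near_eq_cvg; near=> n => /=.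
  by rewrite -ipE//; exact: sqintB.
rewrite -(sqrtr0 R); apply: (@cvg_comp _ _ _ _ Num.sqrt) lim0 _.
exact: sqrt_continuous.
Unshelve. all: by end_near. Qed.

End DominatedL2.

(** [G] is an arbitrary family and measurability refers to the sigma-algebra it generates. Members
    of the filtration and the generating class [past] of the strict past are thus treated alike. *)
Definition mfunG {X : pointedType} {d'} {E : measurableType d'}
    (G : set (set X)) (f : X -> E) : Prop :=
  measurable_fun setT (f : g_sigma_algebraType G -> E).

Section SubSigmaAlgebra.
Context {d} {X : measurableType d}.
Implicit Types G H : set (set X).

Lemma mfunG_sub G H {d'} {E : measurableType d'} (f : X -> E) :
  G `<=` <<s H >> -> mfunG G f -> mfunG H f.
Proof.
move=> GH mf _ B mB; have := mf measurableT B mB.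
by apply: smallest_sub => //; exact: smallest_sigma_algebra.
Qed.

Lemma mfunG_measurable G {d'} {E : measurableType d'} (f : X -> E) :
  G `<=` measurable -> mfunG G f -> measurable_fun setT f.
Proof.
move=> GH mf _ B mB; have := mf measurableT B mB.
by apply: smallest_sub => //; exact: sigma_algebra_measurable.
Qed.

Lemma measurable_idG G : G `<=` measurable ->
  measurable_fun setT (idfun : X -> g_sigma_algebraType G).
Proof. by move=> mG; apply: (mfunG_measurable mG) => _ B mB; rewrite setTI. Qed.

End SubSigmaAlgebra.

(** * Conditional expectation *)

Section Orthogonality.
Context {d} {X : measurableType d} {R : realType} (m : {measure set X -> \bar R}).
Hypothesis mfin : (m setT < +oo)%E.
Variable G : set (set X).
Hypothesis mG : G `<=` measurable.

Let subG A : <<s G >> A -> measurable A.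
Proof. by apply: smallest_sub => //; exact: sigma_algebra_measurable. Qed.

Import HBNNSimple.

(** The simple approximations of [h] are built on the smaller sigma-algebra, so their level sets
    belong to [<<s G>>] and their integrals against [D] vanish; domination by [|h * D|] carries this
    to [h]. *)
Lemma Rintegral_mfunG_ge0 (D : X -> R) (h : X -> R) :
  m.-integrable setT (EFin \o D) ->
  (forall A, <<s G >> A -> \int[m]_(x in A) D x = 0) ->
  mfunG G h -> (forall x, 0 <= h x) ->
  m.-integrable setT (EFin \o (fun x => h x * D x)) -> \int[m]_x (h x * D x) = 0.
Proof.
move=> D1 orth mh h0 hD1.
have mD : measurable_fun setT D by apply/measurable_EFinP; exact: measurable_int D1.
have mh' : measurable_fun setT ((EFin \o h) : g_sigma_algebraType G -> \bar R).
  exact/measurable_EFinP.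
pose hn n : X -> R := nnsfun_approx measurableT mh' n.
have mhn n : mfunG G (hn n) by exact: measurable_funP.
have hn0 n x : 0 <= nnsfun_approx measurableT mh' n x by [].
have hnh x : hn n x @[n --> \oo] --> h x.
  have : EFin \o hn^~ x @ \oo --> (h x)%:E.
    by apply: (@cvg_nnsfun_approx _ (g_sigma_algebraType G) _ _ measurableT
      (EFin \o h) mh') => // y _; rewrite lee_fin.
  by move=> /fine_cvgP[_].
have hnle n x : `|hn n x| <= `|h x|.
  rewrite ger0_norm; last exact: hn0.
  rewrite ger0_norm// -lee_fin /hn nnsfun_approxE.
  by apply: le_approx => // y _; rewrite lee_fin.
have mhn' n : measurable_fun setT (hn n) by exact: (mfunG_measurable mG).
have hnD n : (\int[m]_x (hn n x * D x)%:E = 0)%E.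
  have gA y : <<s G >> (hn n @^-1` [set y]).
    by rewrite -[X in <<s _ >> X]setTI; exact: mhn.
  have i0 y : m.-integrable setT (fun x => (\1_(hn n @^-1` [set y]) x * D x)%:E).
    apply: le_integrable D1 => //.
      apply/measurable_EFinP/measurable_funM => //; apply: measurable_indic.
      exact: subG.
    move=> x _; rewrite lee_fin normrM indicE.
    by case: (_ \in _); rewrite ?normr1 ?mul1r// normr0 mul0r.
  have z0 y : (\int[m]_x (\1_(hn n @^-1` [set y]) x * D x)%:E = 0)%E.
    rewrite -[LHS]fineK; last exact: integrable_fin_num.
    congr EFin; rewrite -(orth _ (gA y)) Rintegral_mkcond.
    congr fine; apply: eq_integral => x _.
    by rewrite patchE indicE; case: (_ \in _); rewrite ?mul1r ?mul0r.
  transitivity (\int[m]_x (\sum_(y <- fset_set (range (hn n)))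
      y%:E * (\1_(hn n @^-1` [set y]) x * D x)%:E))%E.
    apply: eq_integral => x _; rewrite sumEFin; congr EFin.
    rewrite {1}/hn fimfunE fsbig_finite// mulr_suml; apply: eq_bigr => y _.
    by rewrite mulrA.
  rewrite integral_sum//; last by move=> y; exact: integrableZl.
  by apply: big1 => y _; rewrite integralZl// z0 mule0.
have [| | | | |_ _ lim] := @dominated_convergence _ _ _ m _ measurableT
    (fun n x => (hn n x * D x)%:E) (fun x => (h x * D x)%:E) (fun x => `|(h x * D x)%:E|%E).
- by move=> n; apply/measurable_EFinP/measurable_funM.
- exact: measurable_int hD1.
- apply: aeW => x _; apply/cvg_EFin; first exact: nearW.
  by apply: cvgM => //; exact: cvg_cst.
- exact: integrable_abse.
- apply: aeW => x n _; rewrite lee_fin !normrM ler_wpM2r//.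
rewrite /Rintegral; suff -> : (\int[m]_x (h x * D x)%:E = 0)%E by [].
have lim0 : (fun=> 0%E : \bar R) @ \oo --> (\int[m]_x (h x * D x)%:E)%E.
  move: lim; apply: cvg_trans; apply: near_eq_cvg; apply: nearW => n /=.
  by rewrite hnD.
by apply: (cvg_unique _ lim0) => //; exact: cvg_cst.
Qed.

Lemma Rintegral_mfunG (D : X -> R) (h : X -> R) :
  m.-integrable setT (EFin \o D) ->
  (forall A, <<s G >> A -> \int[m]_(x in A) D x = 0) -> mfunG G h ->
  m.-integrable setT (EFin \o (fun x => h x * D x)) -> \int[m]_x (h x * D x) = 0.
Proof.
move=> D1 orth mh hD1.
have mD : measurable_fun setT D by apply/measurable_EFinP; exact: measurable_int D1.
have part (g : X -> R) : mfunG G g -> (forall x, `|g x| <= `|h x|) ->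
    m.-integrable setT (EFin \o (fun x => g x * D x)).
  move=> mg gh; apply: le_integrable hD1 => //.
    apply/measurable_EFinP/measurable_funM => //; exact: (mfunG_measurable mG).
  by move=> x _; rewrite lee_fin !normrM ler_wpM2r.
have mpos : mfunG G (fun x => Num.max (h x) 0) by exact: measurable_maxr.
have mneg : mfunG G (fun x => Num.max (- h x) 0).
  by apply: measurable_maxr => //; exact: measurable_funN.
have pE : m.-integrable setT (EFin \o (fun x => Num.max (h x) 0 * D x)).
  apply: part => // x.
  by rewrite ger0_norm ?le_max ?lexx ?orbT// ge_max ler_norm normr_ge0.
have nE : m.-integrable setT (EFin \o (fun x => Num.max (- h x) 0 * D x)).
  apply: part => // x.
  by rewrite ger0_norm ?le_max ?lexx ?orbT// ge_max -normrN ler_norm normr_ge0.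
have hE x : h x * D x = Num.max (h x) 0 * D x - Num.max (- h x) 0 * D x.
  rewrite -mulrBl; congr (_ * _); case: (lerP 0 (h x)) => hx.
    by rewrite max_r ?subr0// oppr_le0.
  by rewrite max_l ?sub0r ?opprK// oppr_ge0 ltW.
under eq_Rintegral do rewrite hE; rewrite RintegralB//.
rewrite Rintegral_mfunG_ge0 ?Rintegral_mfunG_ge0 ?subr0// => x.
  by rewrite le_max lexx orbT.
by rewrite le_max lexx orbT.
Qed.

Lemma orth_mfunG (D : X -> R) (h : X -> R) : sqint m D ->
  (forall A, <<s G >> A -> \int[m]_(x in A) D x = 0) ->
  mfunG G h -> sqint m h -> ip m h D = 0.
Proof.
move=> D2 orth mh h2; apply: Rintegral_mfunG => //; last exact: sqint_mul.
exact: sqint_integrable.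
Qed.

End Orthogonality.

Lemma probability_lty {d} {X : measurableType d} {R : realType}
  (P : probability X R) : (P setT < +oo)%E.
Proof. exact: (le_lt_trans (probability_le1 P measurableT) (ltry 1)). Qed.

Section ConditionalExpectation.
Context {d} {X : measurableType d} {R : realType} (P : probability X R).
Variable G : set (set X).
Hypothesis mG : G `<=` measurable.

Let subG A : <<s G >> A -> measurable A.
Proof. by apply: smallest_sub => //; exact: sigma_algebra_measurable. Qed.

(** Seen as a map into the smaller sigma-algebra the identity is measurable, and its law [PG] is the
    restriction of [P] on which the Radon-Nikodym theorem is applied. *)
Let idG : X -> g_sigma_algebraType G := idfun.
Let midG : measurable_fun setT idG. Proof. exact: measurable_idG. Qed.
HB.instance Definition _ := isMeasurableFun.Build _ _ _ _ idG midG.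
Let PG := distribution P idG.

(** The Radon-Nikodym density of [A |-> \int_A xi] is at first only integrable. Truncated on the
    event [An n] where it is at most n in absolute value, it is orthogonal to its difference from
    [xi] cut to the same event, so Pythagoras bounds its norm by that of [xi]; Fatou removes the
    truncation. *)
Lemma condexp_exists (xi : X -> R) : sqint P xi ->
  exists2 Y, mfunG G Y /\ sqint P Y &
    forall A, <<s G >> A -> \int[P]_(x in A) Y x = \int[P]_(x in A) xi x.
Proof.
move=> xi2; have xi1 : P.-integrable setT (EFin \o xi).
  by apply: sqint_integrable => //; exact: probability_lty.
pose nu0 : {charge set X -> \bar R} := induced_charge xi1.
pose nu' : {charge set (g_sigma_algebraType G) -> \bar R} := pushforward nu0 idG.
pose nu := nu' midG.
have dom : nu `<< PG.
  apply/null_content_dominatesP => A mA; rewrite /PG /distribution /pushforward /= => PA.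
  rewrite /nu /nu' /pushforward /= /nu0 /induced_charge.
  apply: null_set_integral => //; first exact: subG.
  by apply: measurable_funTS; exact: measurable_int xi1.
pose f := Radon_Nikodym nu PG.
have f1 := Radon_Nikodym_integrable dom.
have mf : measurable_fun setT (f : g_sigma_algebraType G -> \bar R).
  exact: measurable_int f1.
have mf' : measurable_fun setT (f : X -> \bar R) by exact: (mfunG_measurable mG mf).
have f1' : P.-integrable setT (f : X -> \bar R).
  apply/integrableP; split => //.
  move/integrableP: f1 => [_]; rewrite ge0_integral_pushforward//.
  exact: measurableT_comp.
pose Y (x : X) : R := fine (f x).
have ffin x : f x = (Y x)%:E by rewrite fineK//; exact: Radon_Nikodym_fin_num.
have mY : mfunG G Y by apply: (measurableT_comp (@fine_measurable R _ measurableT)).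
have mY' : measurable_fun setT Y by exact: (mfunG_measurable mG).
have Y1 : P.-integrable setT (EFin \o Y).
  by apply: eq_integrable f1' => // x _; rewrite /= ffin.
have YE A : <<s G >> A -> \int[P]_(x in A) Y x = \int[P]_(x in A) xi x.
  move=> GA; have nuA : (\int[P]_(x in A) (xi x)%:E = \int[PG]_(x in A) f x)%E.
    exact: Radon_Nikodym_integral dom GA.
  rewrite /Rintegral nuA.
  rewrite integral_pushforward//; last first.
    by apply: (integrableS measurableT) => //; exact: subG.
  by congr fine; apply: eq_integral => x _; rewrite /= ffin.
exists Y => //; split=> //.
pose An n := [set x | `|Y x| <= n%:R].
have GAn n : <<s G >> (An n).
  have : measurable_fun setT ((fun x => `|Y x|) : g_sigma_algebraType G -> R).
    exact: measurableT_comp.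
  move=> /(_ measurableT `]-oo, n%:R]%classic (measurable_itv _)); rewrite setTI.
  by congr (<<s _ >> _); apply/seteqP; split => x; rewrite /An /= in_itv.
have mAn n := subG (GAn n).
pose Yn n x := Y x * \1_(An n) x.
have mYn n : mfunG G (Yn n).
  by apply: measurable_funM => //; apply: measurable_indic; exact: GAn.
have Yn2 n : sqint P (Yn n).
  apply: (sqint_bounded (C := n%:R) (probability_lty P)).
    exact: (mfunG_measurable mG).
  move=> x; rewrite /Yn indicE; case: (boolP (x \in An n)) => [/set_mem xA|_].
    by rewrite mulr1.
  by rewrite mulr0 normr0.
have xin2 n : sqint P (fun x => xi x * \1_(An n) x) by exact: sqint_indic.
have Ynxi n : ip P (Yn n) (Yn n) <= ip P xi xi.
  pose D x := xi x * \1_(An n) x - Yn n x.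
  have D2 : sqint P D by exact: sqintB.
  have orth : ip P (Yn n) D = 0.
    apply: (orth_mfunG (probability_lty P) mG) => // A GA.
    have GA' : <<s G >> (A `&` An n).
      exact: (@measurableI _ (g_sigma_algebraType G) _ _ GA (GAn n)).
    rewrite -[RHS](subrr (\int[P]_(x in A `&` An n) xi x)) -{2}YE//.
    have sA B : <<s G >> B -> P.-integrable B (EFin \o xi) /\ P.-integrable B (EFin \o Y).
      by move=> GB; split; apply: (integrableS measurableT) => //; exact: subG.
    rewrite -RintegralB//; [|exact: subG|exact: (sA _ GA').1|exact: (sA _ GA').2].
    rewrite Rintegral_mkcondr; apply: eq_Rintegral => x _.
    by rewrite /D /Yn patchE indicE; case: (_ \in _); rewrite ?mulr1 ?mulr0 ?subr0.
  apply: (@le_trans _ _ (ip P (fun x => xi x * \1_(An n) x) (fun x => xi x * \1_(An n) x))).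
    have -> : (fun x => xi x * \1_(An n) x) = (fun x => Yn n x + D x).
      by apply/funext => x; rewrite /D addrC subrK.
    by rewrite ip_orthD// lerDl ip_ge0.
  rewrite -lee_fin !ipE//; apply: ge0_le_integral => //.
  - by move=> x _; rewrite lee_fin sqr_ge0.
  - exact/measurable_EFinP/measurable_funX/(xin2 n).1.
  - exact/measurable_EFinP/measurable_funX/xi2.1.
  - move=> x _; rewrite lee_fin exprMn indicE.
    by case: (_ \in _); rewrite ?expr1n ?mulr1// expr0n mulr0 sqr_ge0.
split=> //; apply: (@le_lt_trans _ _ (ip P xi xi)%:E); last exact: ltry.
apply: (@fatou_le _ _ _ P (fun n x => ((Yn n x) ^+ 2)%:E)).
- by move=> n; apply/measurable_EFinP/measurable_funX; exact: (Yn2 n).1.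
- exact/measurable_EFinP/measurable_funX.
- by move=> n x; rewrite lee_fin sqr_ge0.
- apply: aeW => x; apply: cvg_near_cst.
  near=> n; rewrite /Yn indicE mem_set ?mulr1//= /An/=.
  by near: n; exact: nbhs_infty_ger.
- by apply: nearW => n; rewrite -ipE// lee_fin.
Unshelve. all: by end_near. Qed.

End ConditionalExpectation.

(** * Discrete martingales *)

Section DiscreteMartingale.
Context {d} {X : measurableType d} {R : realType} (P : probability X R).
Variables (G : nat -> set (set X)) (Y : nat -> X -> R).
Hypothesis mG : forall k, G k `<=` measurable.
Hypothesis Gs : forall k, G k `<=` G k.+1.
Hypothesis aY : forall k, mfunG (G k) (Y k).
Hypothesis Y2 : forall k, sqint P (Y k).
Hypothesis incrY : forall k A, <<s G k >> A ->
  \int[P]_(x in A) (Y k.+1 x - Y k x) = 0.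

Lemma dmart_orth k h : mfunG (G k) h -> sqint P h ->
  ip P h (fun x => Y k.+1 x - Y k x) = 0.
Proof.
move=> mh h2; apply: (orth_mfunG (probability_lty P) (@mG k)) => //.
- exact: sqintB.
- exact: incrY.
Qed.

Let mfunGS k (f : X -> R) : mfunG (G k) f -> mfunG (G k.+1) f.
Proof. by apply: mfunG_sub => A /Gs; exact: sub_sigma_algebra. Qed.

Fixpoint run_max k x : R :=
  if k is k'.+1 then Num.max (run_max k' x) `|Y k x| else `|Y 0%N x|.

Lemma run_max_ge0 k x : 0 <= run_max k x.
Proof. by elim: k => [|k IH] //=; rewrite le_max IH. Qed.

Lemma run_max_ge k j x : (j <= k)%N -> `|Y j x| <= run_max k x.
Proof.
elim: k => [|k IH]; first by rewrite leqn0 => /eqP ->.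
rewrite leq_eqVlt => /predU1P[->|]; first by rewrite /= le_max lexx orbT.
by rewrite ltnS => /IH jk; rewrite /= le_max jk.
Qed.

Lemma run_max_le k c x : (forall j, (j <= k)%N -> `|Y j x| <= c) -> run_max k x <= c.
Proof.
elim: k => [|k IH] le /=; first exact: le.
by rewrite ge_max le// IH// => j jk; apply: le; exact: leqW.
Qed.

Lemma run_max_mfunG k : mfunG (G k) (run_max k).
Proof.
elim: k => [|k IH]; first by apply: measurableT_comp => //; exact: aY.
apply: measurable_maxr; first exact: (mfunGS IH).
by apply: measurableT_comp => //; exact: aY.
Qed.

Let absY2 k : sqint P (fun x => `|Y k x|).
Proof.
apply: (sqint_le _ _ (Y2 k)) => [|x]; last by rewrite normr_id.
by apply: measurableT_comp => //; exact: (Y2 k).1.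
Qed.

Lemma run_max_sqint k : sqint P (run_max k).
Proof.
elim: k => [|k IH]; first exact: absY2.
apply: (sqint_le _ _ (sqintD IH (absY2 k.+1))).
  exact: (mfunG_measurable (@mG _) (@run_max_mfunG k.+1)).
move=> x; rewrite (ger0_norm (run_max_ge0 k.+1 x)) /=.
rewrite (ger0_norm (addr_ge0 (run_max_ge0 k x) (normr_ge0 _))).
by rewrite ge_max lerDl lerDr normr_ge0 run_max_ge0.
Qed.

Let lin_ip_le (a b a' b' : R) (f g f' g' h k h' k' : X -> R) :
  sqint P f -> sqint P g -> sqint P f' -> sqint P g' ->
  sqint P h -> sqint P k -> sqint P h' -> sqint P k' ->
  (forall x, a * (f x * g x) - b * (f' x * g' x) <=
             a' * (h x * k x) - b' * (h' x * k' x)) ->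
  a * ip P f g - b * ip P f' g' <= a' * ip P h k - b' * ip P h' k'.
Proof.
move=> f2 g2 f2' g2' h2 k2 h2' k2' le.
have im c (u v : X -> R) : sqint P u -> sqint P v ->
    P.-integrable setT (EFin \o (fun x => c * (u x * v x))).
  by move=> u2 v2; exact: (integrableZl measurableT c (sqint_mul u2 v2)).
rewrite /ip -!RintegralZl//; try exact: sqint_mul.
rewrite -!RintegralB//; try exact: im.
have im2 c c' (u v u' v' : X -> R) : sqint P u -> sqint P v -> sqint P u' ->
    sqint P v' ->
    P.-integrable setT (EFin \o (fun x => c * (u x * v x) - c' * (u' x * v' x))).
  move=> u2 v2 u2' v2'.
  by apply: eq_integrable (integrableB measurableT (im c _ _ u2 v2) (im c' _ _ u2' v2')).
by apply: le_Rintegral => //; exact: im2.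
Qed.

(* The potential [2 m ^+ 2 - 4 m |y|] has nonpositive expectation along the
   martingale and dominates [m ^+ 2 - 4 y ^+ 2]. *)
Lemma discrete_Doob n : ip P (run_max n) (run_max n) <= 4 * ip P (Y n) (Y n).
Proof.
have M2 := run_max_sqint.
have abs2 k : ip P (fun x => `|Y k x|) (fun x => `|Y k x|) = ip P (Y k) (Y k).
  by apply: eq_Rintegral => x _; rewrite -!expr2 real_normK ?num_real.
have key k : 2 * ip P (run_max k) (run_max k)
    - 4 * ip P (run_max k) (fun x => `|Y k x|) <= 0.
  elim: k => [|k IH].
    by rewrite /= abs2; have := ip_ge0 P (Y 0%N); lra.
  apply: le_trans IH.
  (* The sign makes [h * Y k] equal to [run_max k * |Y k|]; known at step [k], [h] is orthogonal to
     the next increment. *)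
  pose sg x : R := if 0 <= Y k x then 1 else -1.
  pose h x := run_max k x * sg x.
  have mh : mfunG (G k) h.
    apply: measurable_funM; first exact: run_max_mfunG.
    apply: measurable_fun_ifT => //.
    by apply: measurable_fun_ler => //; exact: aY.
  have h2 : sqint P h.
    apply: (sqint_le (mfunG_measurable (@mG _) mh) _ (M2 k)) => x.
    by rewrite /h /sg; case: ifP => _; rewrite ?mulr1// mulrN1 normrN.
  have := dmart_orth mh h2; rewrite ipBr// => /eqP; rewrite subr_eq0 => /eqP hY.
  have hk : ip P h (Y k) = ip P (run_max k) (fun x => `|Y k x|).
    apply: eq_Rintegral => x _; rewrite /h /sg; case: ifPn => [Y0|].
      by rewrite mulr1 ger0_norm.
    by rewrite -ltNge => Y0; rewrite ltr0_norm// mulrN1 mulrN mulNr.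
  have step x : 2 * (run_max k.+1 x * run_max k.+1 x) -
      4 * (run_max k.+1 x * `|Y k.+1 x|) <=
      2 * (run_max k x * run_max k x) - 4 * (h x * Y k.+1 x).
    have hy : h x * Y k.+1 x <= run_max k x * `|Y k.+1 x|.
      rewrite /h -mulrA ler_wpM2l ?run_max_ge0// (le_trans (ler_norm _))//.
      by rewrite normrM /sg; case: ifP; rewrite ?normrN normr1 mul1r.
    have := run_max_ge0 k x; have := normr_ge0 (Y k.+1 x).
    move: hy => /=; case: (leP (run_max k x) `|Y k.+1 x|) => [h1|h1] hy a0 b0; nra.
  have := lin_ip_le (M2 k.+1) (M2 k.+1) (M2 k.+1) (absY2 k.+1) (M2 k) (M2 k) h2 (Y2 k.+1) step.
  by rewrite hY hk.
have := key n; have := @lin_ip_le 1 4 2 4 _ _ _ _ _ _ _ _ (M2 n) (M2 n) (Y2 n) (Y2 n)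
  (M2 n) (M2 n) (M2 n) (absY2 n).
rewrite mul1r => H; suff : forall x, 1 * (run_max n x * run_max n x) - 4 * (Y n x * Y n x) <=
  2 * (run_max n x * run_max n x) - 4 * (run_max n x * `|Y n x|) by move/H; lra.
move=> x; have := sqr_ge0 (run_max n x - 2 * `|Y n x|).
by rewrite -[Y n x * _]expr2 -[Y n x ^+ 2]real_normK ?num_real//; nra.
Qed.

(* Greedy count of the displacements of size at least [e]: [osc k] is the pair
   of the value at the last counted time and of the count. *)
Variable e : R.

Fixpoint osc k x : R * nat :=
  if k is k'.+1 then
    let uc := osc k' x in
    if e <= `|Y k x - uc.1| then (Y k x, uc.2.+1) else uc
  else (Y 0%N x, 0%N).

Lemma osc_mfunG k :
  mfunG (G k) (fun x => (osc k x).1) /\ mfunG (G k) (fun x => (osc k x).2%:R : R).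
Proof.
elim: k => [|k [IH1 IH2]]; first by split; [exact: (@aY 0%N)|exact: measurable_cst].
have mle : measurable_fun setT
    ((fun x => e <= `|Y k.+1 x - (osc k x).1|) : g_sigma_algebraType (G k.+1) -> bool).
  apply: measurable_fun_ler => //; apply: measurableT_comp => //.
  by apply: measurable_funB; [exact: aY|exact: (mfunGS IH1)].
split.
- rewrite /mfunG (_ : (fun x => _) = (fun x =>
    if e <= `|Y k.+1 x - (osc k x).1| then Y k.+1 x else (osc k x).1)).
    by apply: measurable_fun_ifT; [exact: mle|exact: (@aY k.+1)|exact: (mfunGS IH1)].
  by apply/funext => x /=; case: ifP.
- rewrite /mfunG (_ : (fun x => _) = (fun x =>
    if e <= `|Y k.+1 x - (osc k x).1| then (osc k x).2%:R + 1 else (osc k x).2%:R)).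
    apply: measurable_fun_ifT; [exact: mle| |exact: (mfunGS IH2)].
    by apply: measurable_funD => //; exact: (mfunGS IH2).
  by apply/funext => x /=; case: ifP => //= _; rewrite natr1.
Qed.

Lemma osc_sqint k : sqint P (fun x => (osc k x).1).
Proof.
elim: k => [|k IH]; first exact: Y2.
have IH' : sqint P (fun x => `|(osc k x).1|).
  apply: (sqint_le _ _ IH) => [|x]; last by rewrite normr_id.
  by apply: measurableT_comp => //; exact: IH.1.
apply: (sqint_le _ _ (sqintD (absY2 k.+1) IH')).
  exact: (mfunG_measurable (@mG _) (osc_mfunG k.+1).1).
move=> x /=; rewrite [leRHS]ger0_norm ?addr_ge0//.
by case: ifP => _ /=; rewrite ?lerDl ?lerDr normr_ge0.
Qed.

Lemma osc_count_le k x : ((osc k x).2 <= k)%N.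
Proof. by elim: k => //= k IH; case: ifP => //= _; exact: leqW. Qed.

Lemma osc_count_sqint k : sqint P (fun x => (osc k x).2%:R : R).
Proof.
apply: (sqint_bounded (C := k%:R) (probability_lty P)).
  exact: (mfunG_measurable (@mG _) (osc_mfunG k).2).
by move=> x; rewrite ger0_norm// ler_nat osc_count_le.
Qed.

(* [e ^+ 2 * count + (Y - u) ^+ 2] grows in expectation at most like [Y ^+ 2]. *)
Lemma osc_bound n : 0 <= e ->
  e ^+ 2 * \int[P]_x ((osc n x).2%:R) <= ip P (Y n) (Y n).
Proof.
move=> e0.
have one2 : sqint P (fun=> 1 : R) by exact: (sqint_cst (probability_lty P)).
pose D k x := Y k x - (osc k x).1.
have D2 k : sqint P (D k) by apply: sqintB => //; exact: osc_sqint.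
have mD k : mfunG (G k) (D k).
  by apply: measurable_funB; [exact: aY|exact: (osc_mfunG k).1].
pose C k x : R := (osc k x).2%:R.
have key k : e ^+ 2 * ip P (C k) (fun=> 1) - (-1) * ip P (D k) (D k) <= ip P (Y k) (Y k).
  elim: k => [|k IH].
    have -> : ip P (C 0%N) (fun=> 1) = 0.
      rewrite /ip; under eq_Rintegral do rewrite /C mul0r.
      by rewrite Rintegral_cst// mul0r.
    have -> : ip P (D 0%N) (D 0%N) = 0.
      rewrite /ip; under eq_Rintegral do rewrite /D subrr mul0r.
      by rewrite Rintegral_cst// mul0r.
    by rewrite !mulr0 subrr ip_ge0.
  pose dY x := Y k.+1 x - Y k x.
  have dY2 : sqint P dY by exact: sqintB.
  have dYD : ip P (D k) dY = 0 by exact: dmart_orth.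
  have dYY : ip P (Y k) dY = 0 by apply: dmart_orth.
  have EY : ip P (Y k.+1) (Y k.+1) = ip P (Y k) (Y k) + ip P dY dY.
    rewrite -ip_orthD//; apply: eq_Rintegral => x _.
    by rewrite /dY addrC subrK.
  have ED := ip_orthD (D2 k) dY2 dYD.
  have DD2 := sqintD (D2 k) dY2.
  have step x : e ^+ 2 * (C k.+1 x * 1) - (-1) * (D k.+1 x * D k.+1 x) <=
     e ^+ 2 * (C k x * 1) - (-1) * ((D k x + dY x) * (D k x + dY x)).
    have -> : D k x + dY x = Y k.+1 x - (osc k x).1 by rewrite /D /dY; ring.
    rewrite /D /C /=; case: ifPn => [eY|_]; last exact: lexx.
    rewrite /= subrr -natr1 !mulr1 !mulN1r !opprK mulr0 addr0 mulrDr mulr1 lerD2l.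
    by rewrite -expr2 -[leRHS]real_normK ?num_real// lerXn2r// nnegrE.
  have := lin_ip_le (osc_count_sqint k.+1) one2 (D2 k.+1) (D2 k.+1)
    (osc_count_sqint k) one2 DD2 DD2 step.
  by move=> /le_trans; apply; rewrite ED EY; move: IH; rewrite -/(C k); lra.
have := key n; have := ip_ge0 P (D n).
have -> : ip P (C n) (fun=> 1) = \int[P]_x ((osc n x).2%:R).
  by apply: eq_Rintegral => x _; rewrite /C mulr1.
by lra.
Qed.

Lemma osc_no_jump k x : 0 < e -> `|Y k x - (osc k x).1| < e.
Proof.
move=> e0; case: k => [|k] /=; first by rewrite subrr normr0.
by case: ifPn; rewrite /= ?subrr ?normr0// -ltNge.
Qed.

Lemma osc_count_nd j k x : (j <= k)%N -> ((osc j x).2 <= (osc k x).2)%N.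
Proof.
move=> /subnK <-; elim: (k - j)%N => // i IH.
by rewrite addSn /=; case: ifP => _ //=; exact: leqW.
Qed.

(** Each value stays within [e] of the last counted one. If nothing were counted between [j] and
    [k], both [Y j] and [Y k] would be within [e] of the same number. *)
Lemma osc_count_lt j k x : 0 < e -> (j <= k)%N ->
  2 * e <= `|Y k x - Y j x| -> ((osc j x).2 < (osc k x).2)%N.
Proof.
move=> e0 jk Ye; rewrite ltn_neqAle osc_count_nd// andbT; apply/eqP => same.
have uE : (osc k x).1 = (osc j x).1.
  move: same; rewrite -(subnK jk) {Ye}; elim: (k - j)%N => // i IH.
  have := osc_count_nd x (leq_addl i j).
  by rewrite addSn /=; case: ifP => _ //= cle cj; move: cle; rewrite cj ltnn.
have := osc_no_jump k x e0; have := osc_no_jump j x e0; rewrite uE.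
have := ler_normB (Y k x - (osc j x).1) (Y j x - (osc j x).1).
rewrite (_ : _ - _ - _ = Y k x - Y j x); last by ring.
by move=> h1 h2 h3; move: Ye; apply/negP; rewrite -ltNge; lra.
Qed.

End DiscreteMartingale.

(** * Dyadic grids and regularisation of paths *)

Section DyadicGrid.
Context {R : realType} (T : R).
Hypothesis T0 : 0 < T.

(** The minimum freezes the grid at [T] beyond the index [2 ^ n], so that no bound on indices has to
    be carried along. *)
Definition grid (n k : nat) : R := T * (minn k (2 ^ n))%:R / 2 ^+ n.

Lemma grid0 n : grid n 0 = 0.
Proof. by rewrite /grid min0n mulr0 mul0r. Qed.

Lemma grid_end n k : (2 ^ n <= k)%N -> grid n k = T.
Proof.
by move=> nk; rewrite /grid (minn_idPr nk) natrX mulfK// expf_neq0// pnatr_eq0.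
Qed.

Lemma grid_le n : {homo grid n : j k / (j <= k)%N >-> j <= k}.
Proof.
move=> j k jk; rewrite /grid ler_pM2r ?invr_gt0 ?exprn_gt0// ler_pM2l// ler_nat.
by rewrite leq_min (leq_trans (geq_minl _ _))// geq_minr.
Qed.

Lemma grid_ge0 n k : 0 <= grid n k.
Proof. by rewrite /grid !mulr_ge0 ?invr_ge0 ?exprn_ge0// ltW. Qed.

Lemma grid_leT n k : grid n k <= T.
Proof. by rewrite -(grid_end (leq_maxl (2 ^ n) k)) grid_le// leq_maxr. Qed.

Lemma grid_itv n k : 0 <= grid n k <= T.
Proof. by rewrite grid_ge0 grid_leT. Qed.

Lemma gridS n k : grid n.+1 k.*2 = grid n k.
Proof.
rewrite /grid expnS mul2n (_ : minn k.*2 (2 ^ n).*2 = (minn k (2 ^ n)).*2).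
  by rewrite -mul2n natrM exprS; field.
rewrite /minn ltn_double; by case: ifP.
Qed.

Lemma grid_step n k : grid n k.+1 <= grid n k + T / 2 ^+ n.
Proof.
rewrite /grid -mulrDl ler_pM2r ?invr_gt0 ?exprn_gt0// -{3}[T]mulr1 -mulrDr.
rewrite ler_pM2l// natr1 ler_nat geq_min; apply/orP.
case: (leqP k (2 ^ n)) => kn; [left|right] => //.
Qed.

Lemma grid_lift n m k : (n <= m)%N -> exists j, grid n k = grid m j.
Proof.
move=> /subnK <-; elim: (m - n)%N => [|i [j IH]]; first by exists k.
by exists j.*2; rewrite addSn gridS.
Qed.

Definition dyadic : set R := [set q | exists n k, q = grid n k].

Lemma grid_idx n k j : grid n j < grid n k -> (j < k)%N.
Proof. by move=> jk; rewrite ltnNge; apply/negP => /(grid_le n); rewrite leNgt jk. Qed.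

(** For [t < T] the point is strictly later than [t]: along these points the right limit is probed
    and the value at [t] itself is ignored. *)
Definition grid_up n t : R :=
  grid n (find (fun k => t < grid n k) (iota 0 (2 ^ n).+1)).

Lemma grid_upP n t : 0 <= t < T ->
  t < grid_up n t /\ grid_up n t <= t + T / 2 ^+ n.
Proof.
move=> /andP[t0 tT]; rewrite /grid_up.
set p := fun k => t < grid n k; set s := iota 0 (2 ^ n).+1.
have hp : has p s.
  apply/hasP; exists (2 ^ n)%N; first by rewrite mem_iota add0n ltnSn.
  by rewrite /p grid_end.
have fs := hp; rewrite has_find size_iota in fs.
have := nth_find 0%N hp; rewrite nth_iota// add0n => tk; split=> //.
case E : (find p s) fs tk => [|j] fs tk.
  by rewrite grid0 addr_ge0// divr_ge0 ?exprn_ge0// ltW.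
have : p (nth 0%N s j) = false by apply: before_find; rewrite E.
rewrite nth_iota ?add0n; last exact: ltnW.
rewrite /p => /negbT; rewrite -leNgt => jt.
by apply: le_trans (grid_step _ _) _; rewrite lerD2r.
Qed.

Lemma grid_leftP n t : 0 < t <= T ->
  exists2 k, (k < 2 ^ n)%N & grid n k < t <= grid n k.+1.
Proof.
move=> /andP[t0 tT].
have ex : exists k, t <= grid n k by exists (2 ^ n)%N; rewrite grid_end.
case: (ex_minnP ex) => -[|k] tk kmin; first by move: tk; rewrite grid0 leNgt t0.
have kt : grid n k < t.
  by rewrite ltNge; apply/negP => /kmin; rewrite ltnn.
exists k; last by rewrite kt tk.
by rewrite ltnNge; apply/negP => nk; move: kt; rewrite grid_end// ltNge tT.
Qed.

Lemma cvg_step_size : T / 2 ^+ n @[n --> \oo] --> 0.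
Proof.
under eq_fun do rewrite -exprVn; apply: (@cvg_geometric _ T 2^-1).
by rewrite ger0_norm ?invr_ge0// invf_lt1// ltr1n.
Qed.

Lemma dyadicT : dyadic T.
Proof. by exists 0%N, 1%N; rewrite grid_end. Qed.

Lemma cvg_grid_up t : 0 <= t < T -> grid_up n t @[n --> \oo] --> t.
Proof.
move=> tT; apply: (@squeeze_cvgr _ _ _ _ (fun=> t) (fun n => t + T / 2 ^+ n)).
- by apply: nearW => n; have [/ltW -> ->] := grid_upP n tT.
- exact: cvg_cst.
- by rewrite -[X in _ --> X]addr0; apply: cvgD; [exact: cvg_cst|exact: cvg_step_size].
Qed.

Lemma dyadic_dense a b : 0 <= a -> a < b -> b <= T -> exists2 q, dyadic q & a < q < b.
Proof.
move=> a0 ab bT; have aT : 0 <= a < T by rewrite a0 (lt_le_trans ab bT).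
have := cvg_grid_up aT => /cvgr_lt/(_ _ ab) [n _ /(_ _ (leqnn n))] /= nb.
exists (grid_up n a); first by eexists; eexists.
by rewrite nb andbT; exact: (grid_upP n aT).1.
Qed.

End DyadicGrid.

Section Chains.
Context {R : realType}.
Variables (D : set R) (y : R -> R).

Definition displaced (r : rel R) (e : R) : rel R :=
  fun a b => r a b && (e <= `|y a - y b|).

(** The oscillation criterion for one-sided limits, stated on the countable set [D]: a path without
    a one-sided limit at some time makes infinitely many displacements of some fixed size near
    it. *)
Definition no_long_chain (e : R) : Prop := exists k : nat, forall s : seq R,
  (forall q, q \in s -> D q) -> sorted (displaced <%R e) s -> (size s <= k)%N.

Lemma no_long_chain_gt e : no_long_chain e -> exists k : nat, forall s : seq R,
  (forall q, q \in s -> D q) -> sorted (displaced >%R e) s -> (size s <= k)%N.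
Proof.
move=> [k kP]; exists k => s sD ss; rewrite -size_rev; apply: kP.
  by move=> q; rewrite mem_rev; exact: sD.
rewrite rev_sorted; apply: sub_sorted ss => a b.
by rewrite /displaced /= distrC.
Qed.

(** Of two points whose values are [2 * e] apart, at least one has a value at distance [e] from that
    of the current head, by the triangle inequality; this one becomes the new head. *)
Lemma chain_extend (r : rel R) (e : R) (I : set R) x0 : D x0 -> I x0 ->
  (forall x, D x -> I x -> exists p q, [/\ D p, I p, r p x & [/\ D q, I q, r q x &
    2 * e <= `|y p - y q|]]) ->
  forall k, exists2 s : seq R, (forall q, q \in s -> D q /\ I q) &
    sorted (displaced r e) s /\ size s = k.+1.
Proof.
move=> Dx0 Ix0 ext; elim=> [|k [s sD [ss sk]]].
  by exists [:: x0] => // q; rewrite inE => /eqP ->.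
case: s sk sD ss => // x s /= [sk] sD ss.
have [Dx Ix] := sD x (mem_head _ _).
have [p [q [Dp Ip px [Dq Iq qx pq]]]] := ext x Dx Ix.
have [yp|yp] := leP e `|y p - y x|.
  exists [:: p, x & s].
    by move=> z; rewrite inE => /predU1P[->|/sD].
  by rewrite /= ss sk /displaced px yp.
have yq : e <= `|y q - y x|.
  rewrite leNgt; apply/negP => yq; move: pq; apply/negP; rewrite -ltNge.
  rewrite (_ : y p - y q = (y p - y x) - (y q - y x)); last by ring.
  by apply: (le_lt_trans (ler_normB _ _)); rewrite mulr_natl mulr2n ltrD.
exists [:: q, x & s].
  by move=> z; rewrite inE => /predU1P[->|/sD].
by rewrite /= ss sk /displaced qx yq.
Qed.

End Chains.

Section Regularization.
Context {R : realType} (T : R).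
Hypothesis T0 : 0 < T.
Variable y : R -> R.
Local Notation D := (dyadic T).
Hypothesis nochain : forall e, 0 < e -> no_long_chain D y e.

(** Before [T] this is the right limit along dyadic times; the value at [T], which has no right
    neighbour in the horizon, is kept. *)
Definition right_version (t : R) : R :=
  if t < T then lsup (fun n (_ : unit) => y (grid_up T n t)) tt else y T.

(** If the Cauchy condition failed, a chain starting at [T] could be prolonged without end at its
    early side, moving down towards [t]. *)
Let right_cauchy t e : 0 <= t < T -> 0 < e -> exists2 r, 0 < r &
  forall p q, D p -> D q -> t < p < t + r -> t < q < t + r -> `|y p - y q| < e.
Proof.
move=> /andP[t0 tT] e0; apply: contrapT => abs.
have [k kP] := nochain (divr_gt0 e0 (ltr0n R 2)).
have [|s sD [ss sk]] := @chain_extend _ D y <%R (e / 2) [set x | t < x] T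
    (dyadicT T) tT _ k.
  move=> x Dx tx.
  have : ~ (forall p q, D p -> D q -> t < p < t + (x - t) -> t < q < t + (x - t) ->
      `|y p - y q| < e).
    by move=> H; apply: abs; exists (x - t) => //; rewrite subr_gt0.
  move=> /existsNP[p /existsNP[q /not_implyP[Dp /not_implyP[Dq]]]].
  rewrite (addrC t) subrK => /not_implyP[/andP[tp px] /not_implyP[/andP[tq qx]]].
  move=> /negP; rewrite -leNgt => pq.
  by exists p, q; split=> //; split=> //; rewrite mulrC divfK.
by have := kP s (fun q qs => (sD q qs).1) ss; rewrite sk ltnn.
Qed.

(** Mirror image of the previous argument: the chain starts at 0 and climbs towards [t], which is
    why the order is reversed. *)
Let left_cauchy t e : 0 < t <= T -> 0 < e -> exists2 r, 0 < r &
  forall p q, D p -> D q -> t - r < p < t -> t - r < q < t -> `|y p - y q| < e.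
Proof.
move=> /andP[t0 tT] e0; apply: contrapT => abs.
have [k kP] := no_long_chain_gt (nochain (divr_gt0 e0 (ltr0n R 2))).
have D0 : D 0 by exists 0%N, 0%N; rewrite grid0.
have [|s sD [ss sk]] := @chain_extend _ D y >%R (e / 2) [set x | x < t] 0 D0 t0 _ k.
  move=> x Dx tx.
  have : ~ (forall p q, D p -> D q -> t - (t - x) < p < t -> t - (t - x) < q < t ->
      `|y p - y q| < e).
    by move=> H; apply: abs; exists (t - x) => //; rewrite subr_gt0.
  move=> /existsNP[p /existsNP[q /not_implyP[Dp /not_implyP[Dq]]]].
  rewrite subKr => /not_implyP[/andP[tp px] /not_implyP[/andP[tq qx]]].
  move=> /negP; rewrite -leNgt => pq.
  by exists p, q; split=> //; split=> //; rewrite mulrC divfK.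
by have := kP s (fun q qs => (sD q qs).1) ss; rewrite sk ltnn.
Qed.

Let grid_upD n t : D (grid_up T n t).
Proof. by eexists; eexists; reflexivity. Qed.

Let near_up t r : 0 <= t < T -> 0 < r ->
  \forall n \near \oo, t < grid_up T n t < t + r.
Proof.
move=> tT r0; have := cvg_grid_up T0 tT.
have tr : t < t + r by rewrite ltrDl.
move=> /cvgr_lt/(_ _ tr); apply: filterS => n ->.
by rewrite andbT; exact: (grid_upP T0 n tT).1.
Qed.

Lemma cvg_right_version t : 0 <= t < T ->
  y (grid_up T n t) @[n --> \oo] --> right_version t.
Proof.
move=> tT; rewrite /right_version; case/andP: (tT) => t0 ->.
suff /cvg_ex[l yl] : cvgn (fun n => y (grid_up T n t)) by rewrite (lsup_cvg yl).
apply/cauchy_cvgP/cauchy_exP => e e0; have [r r0 rP] := right_cauchy tT e0.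
have [N _ NP] := near_up tT r0; exists (y (grid_up T N t)).
exists N => // n Nn; rewrite /= /ball /=; apply: rP => //; first exact: NP (leqnn _).
exact: NP.
Qed.

Let right_close t e : 0 <= t < T -> 0 < e -> exists2 r, 0 < r &
  forall s, t < s < t + r -> s < T -> `|right_version s - right_version t| <= e.
Proof.
move=> tT e0; have [r r0 rP] := right_cauchy tT e0; exists r => // s /andP[ts sr] sT.
have sT' : 0 <= s < T by rewrite sT (le_trans _ (ltW ts))//; case/andP: tT.
have sr0 : 0 < t + r - s by rewrite subr_gt0.
have st := cvg_right_version sT'; have tt := cvg_right_version tT.
have cB : `|y (grid_up T n s) - y (grid_up T n t)| @[n --> \oo] -->
    `|right_version s - right_version t| by apply: cvg_norm; exact: cvgB.
rewrite -(cvg_lim _ cB)//; apply: limr_le.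
  by apply/cvg_ex; eexists; exact: cB.
near=> n; apply/ltW/rP => //.
- have /andP[h1] : s < grid_up T n s < s + (t + r - s).
    by near: n; exact: near_up.
  by rewrite addrC subrK => ->; rewrite andbT (lt_trans ts).
- by near: n; exact: near_up.
Unshelve. all: by end_near. Qed.

Lemma right_version_cadlag : cadlag T right_version.
Proof.
split=> [t tT|t tT].
  apply/cvgrPdist_le => e e0; have [r r0 rP] := right_close tT e0.
  near=> s; rewrite distrC; apply: rP.
    apply/andP; split; near: s; first by apply: nbhs_right_gt.
    by apply: nbhs_right_lt; rewrite ltrDl.
  by near: s; apply: nbhs_right_lt; case/andP: tT.
apply/cauchy_cvgP/cauchy_exP => e e0.
have [r r0 rP] := left_cauchy tT (divr_gt0 e0 (ltr0n R 2)).
case/andP: (tT) => t0 tT'.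
have close s : 0 <= s -> t - r < s < t -> forall q, D q -> t - r < q < t ->
    `|y q - right_version s| <= e / 2.
  move=> s0 /andP[rs st] q Dq qt.
  have sT : 0 <= s < T by rewrite s0 (lt_le_trans st).
  have cB : `|y q - y (grid_up T n s)| @[n --> \oo] --> `|y q - right_version s|.
    by apply: cvg_norm; apply: cvgB; [exact: cvg_cst|exact: cvg_right_version].
  rewrite -(cvg_lim _ cB)//; apply: limr_le.
    by apply/cvg_ex; eexists; exact: cB.
  have ts : 0 < t - s by rewrite subr_gt0.
  near=> n; apply/ltW/rP => //.
  have /andP[h1] : s < grid_up T n s < s + (t - s) by near: n; exact: near_up.
  by rewrite (addrC s) subrK => ->; rewrite andbT (lt_trans rs).
have m0 : Num.max 0 (t - r) < t by rewrite gt_max t0 ltrBlDr ltrDl.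
have [|q Dq /andP[mq qt]] := @dyadic_dense _ _ T0 _ _ _ m0 tT'.
  by rewrite le_max lexx.
move: mq; rewrite gt_max => /andP[q0 rq].
exists (y q).
suff : \forall s \near t^'-, `|y q - right_version s| < e by exact: filterS.
near=> s.
apply: (@le_lt_trans _ _ (e / 2)); last by rewrite ltr_pdivrMr// ltr_pMr// ltr1n.
apply: close => //; last by rewrite rq qt.
- by near: s; apply: nbhs_left_ge.
- apply/andP; split; near: s; last by apply: nbhs_left_lt.
  by apply: nbhs_left_gt; rewrite ltrBlDr ltrDl.
Unshelve. all: by end_near. Qed.

End Regularization.

(** * Filtrations and square-integrable martingales *)

Section Filtration.
Context {d} {Om : measurableType d} {R : realType} (P : probability Om R).
Variables (Ft : R -> set (set Om)) (T : R).
Hypothesis HF : filtration Ft T.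
Hypothesis HN : P.-negligible `<=` Ft 0.

Lemma Ft_sigma t : 0 <= t <= T -> <<s Ft t >> = Ft t.
Proof. by move=> tT; apply: sigma_algebra_id; case: HF => + _ _; exact. Qed.

Lemma Ft_measurable t : 0 <= t <= T -> Ft t `<=` measurable.
Proof. by case: HF => _ + _; exact. Qed.

Lemma Ft_le s t : 0 <= s -> s <= t -> t <= T -> Ft s `<=` Ft t.
Proof. by case: HF => _ _ +; exact. Qed.

Lemma mfunFt_le s t {d'} {E : measurableType d'} (f : Om -> E) :
  0 <= s -> s <= t -> t <= T -> mfunG (Ft s) f -> mfunG (Ft t) f.
Proof. by move=> s0 st tT; apply: mfunG_sub => A /(Ft_le s0 st tT); exact: sub_sigma_algebra. Qed.

Lemma mfunFt_measurable t {d'} {E : measurableType d'} (f : Om -> E) :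
  0 <= t <= T -> mfunG (Ft t) f -> measurable_fun setT f.
Proof. by move=> tT; apply: mfunG_measurable; exact: Ft_measurable. Qed.

Lemma negligible_Ft t A : 0 <= t <= T -> P.-negligible A -> Ft t A.
Proof. by move=> /andP[t0 tT] /HN; apply: Ft_le. Qed.

Lemma ae_Ft t (Q : Om -> Prop) : 0 <= t <= T -> {ae P, forall w, Q w} -> Ft t [set w | Q w].
Proof.
move=> tT Qae; rewrite -(Ft_sigma tT) -(setCK [set w | Q w]).
by apply: sigma_algebraC; rewrite Ft_sigma//; exact: negligible_Ft.
Qed.

(** Completeness is the reason: the null set where the two functions differ, and all its subsets,
    belong to [Ft t]. *)
Lemma mfunFt_ae t {d'} {E : measurableType d'} (f g : Om -> E) : 0 <= t <= T ->
  {ae P, forall w, f w = g w} -> mfunG (Ft t) f -> mfunG (Ft t) g.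
Proof.
move=> tT fg mf _ B mB; rewrite setTI.
have EFt : <<s Ft t >> [set w | f w = g w] by rewrite Ft_sigma//; exact: ae_Ft.
have -> : g @^-1` B = (f @^-1` B `&` [set w | f w = g w]) `|`
    (g @^-1` B `&` ~` [set w | f w = g w]).
  apply/seteqP; split => w /=.
    by move=> gB; have [e|e] := pselect (f w = g w); [left; rewrite e|right].
  by move=> [[fB <-]|[]].
apply: (@measurableU _ (g_sigma_algebraType (Ft t))).
  apply: (@measurableI _ (g_sigma_algebraType (Ft t))) => //.
  by rewrite -[X in measurable X]setTI; exact: mf.
apply: sub_sigma_algebra; apply: negligible_Ft => //.
by apply: negligibleS fg => w [].
Qed.

(** A square-integrable martingale without path regularity: what conditional expectations yield
    before regularisation, and all that the orthogonality arguments use. *)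
Definition wmartingale (x : Om -> R -> R) : Prop :=
  [/\ forall t, 0 <= t <= T -> mfunG (Ft t) (x^~ t),
      forall t, 0 <= t <= T -> sqint P (x^~ t)
    & forall s t, 0 <= s -> s <= t -> t <= T -> forall A, Ft s A ->
        \int[P]_(w in A) x w t = \int[P]_(w in A) x w s].

Lemma sq_martingale_wmartingale X : sq_martingale P Ft T X -> wmartingale X.
Proof.
move=> [[aX iX mX] cX X2]; split.
- exact: aX.
- move=> t tT; split; last exact: X2.
  exact: (mfunFt_measurable tT (aX t tT)).
- by move=> s t s0 st tT A FA; congr fine; exact: mX.
Qed.

Lemma wmartingale_orth x s t h : wmartingale x -> 0 <= s -> s <= t -> t <= T ->
  mfunG (Ft s) h -> sqint P h -> ip P h (fun w => x w t - x w s) = 0.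
Proof.
move=> [ax x2 mx] s0 st tT mh h2.
have sT : 0 <= s <= T by rewrite s0 (le_trans st).
have tT' : 0 <= t <= T by rewrite tT (le_trans s0).
apply: (orth_mfunG (probability_lty P) (Ft_measurable sT)) => //.
  by apply: sqintB; exact: x2.
move=> A; rewrite Ft_sigma// => FA.
have i r : 0 <= r <= T -> P.-integrable A (EFin \o x^~ r).
  move=> rT; apply: (integrableS measurableT) => //; first exact: Ft_measurable FA.
  by apply: (sqint_integrable (probability_lty P)); exact: x2.
rewrite RintegralB; [|exact: Ft_measurable FA|exact: i|exact: i].
by rewrite (mx s t)// subrr.
Qed.

Hypothesis T0 : 0 < T.

Lemma grid_increment x n k A : wmartingale x -> <<s Ft (grid T n k) >> A ->
  \int[P]_(w in A) (x w (grid T n k.+1) - x w (grid T n k)) = 0.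
Proof.
move=> [ax x2 mx]; rewrite Ft_sigma ?grid_itv// => FA.
have mA := Ft_measurable (grid_itv T0 n k) FA.
have i r : 0 <= r <= T -> P.-integrable A (EFin \o x^~ r).
  move=> rT; apply: (integrableS measurableT) => //.
  by apply: (sqint_integrable (probability_lty P)); exact: x2.
rewrite RintegralB//; [|exact/i/grid_itv|exact/i/grid_itv].
by rewrite (mx (grid T n k))// ?subrr// ?grid_ge0 ?grid_leT// grid_le.
Qed.

Section GridMartingale.
Variable x : Om -> R -> R.
Hypothesis wx : wmartingale x.
Variable n : nat.
Let G k := Ft (grid T n k).
Let Y k := x^~ (grid T n k).

Let mG k : G k `<=` measurable. Proof. exact/Ft_measurable/grid_itv. Qed.
Let Gs k : G k `<=` G k.+1.
Proof. by apply: Ft_le; rewrite ?grid_ge0 ?grid_leT// grid_le. Qed.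
Let aY k : mfunG (G k) (Y k). Proof. by case: wx => + _ _; apply; exact: grid_itv. Qed.
Let Y2 k : sqint P (Y k). Proof. by case: wx => _ + _; apply; exact: grid_itv. Qed.
Let incrY k A : <<s G k >> A -> \int[P]_(w in A) (Y k.+1 w - Y k w) = 0.
Proof. exact: grid_increment. Qed.

Lemma grid_Doob N : sqint P (run_max Y N) /\
  ip P (run_max Y N) (run_max Y N) <= 4 * ip P (Y N) (Y N).
Proof.
split; first exact: (run_max_sqint mG Gs aY Y2).
exact: (discrete_Doob mG Gs aY Y2 incrY).
Qed.

Lemma grid_osc e N : 0 <= e ->
  measurable_fun setT (fun w => (osc Y e N w).2%:R : R) /\
  e ^+ 2 * \int[P]_w ((osc Y e N w).2%:R) <= ip P (Y N) (Y N).
Proof.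
move=> e0; split; last exact: (osc_bound mG Gs aY Y2 incrY).
exact: (mfunG_measurable (@mG _) (osc_mfunG Gs aY e N).2).
Qed.

End GridMartingale.

End Filtration.

(** * Maximal functions and oscillations along the dyadic times *)

Section DyadicPaths.
Context {d} {Om : measurableType d} {R : realType} (P : probability Om R).
Variables (Ft : R -> set (set Om)) (T : R).
Hypothesis HF : filtration Ft T.
Hypothesis HN : P.-negligible `<=` Ft 0.
Hypothesis T0 : 0 < T.
Variable x : Om -> R -> R.
Hypothesis wx : wmartingale P Ft T x.

Let Y n k w := x w (grid T n k).
Let endT n : Y n (2 ^ n)%N = x^~ T.
Proof. by apply/funext => w; rewrite /Y grid_end. Qed.

(** All grids end at [T], so Doob's inequality is uniform in the grid; the grids are nested, so the
    maxima increase and monotone convergence reaches the supremum over all dyadic times. *)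
Lemma Doob_dyadic : exists2 U, sqint P U & (forall w, 0 <= U w) /\
  {ae P, forall w, forall q, dyadic T q -> `|x w q| <= U w}.
Proof.
pose M n := run_max (Y n) (2 ^ n)%N.
have [M2 ME] : (forall n, sqint P (M n)) /\
    forall n, ip P (M n) (M n) <= 4 * ip P (x^~ T) (x^~ T).
  split=> n; have [m2 mE] := grid_Doob HF T0 wx n (2 ^ n)%N; first exact: m2.
  by rewrite -(endT n).
have M0 n w : 0 <= M n w by exact: run_max_ge0.
have Mnd w : nondecreasing_seq (M^~ w).
  apply/nondecreasing_seqP => n; apply: run_max_le => j jn.
  rewrite /Y -gridS; apply: (@run_max_ge _ _ _ (Y n.+1)).
  by rewrite expnS mul2n leq_double.
pose g n w := ((M n w) ^+ 2)%:E.
have mg n : measurable_fun setT (g n).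
  by apply/measurable_EFinP/measurable_funX; exact: (M2 n).1.
have g0 n w : (0 <= g n w)%E by rewrite lee_fin sqr_ge0.
have gnd w : nondecreasing_seq (g^~ w).
  by move=> a b ab; rewrite lee_fin lerXn2r ?nnegrE//; exact: Mnd.
have gcv w : cvgn (g^~ w) by exact: ereal_nondecreasing_is_cvgn.
pose h w := limn (g^~ w).
have h0 w : (0 <= h w)%E by apply: lime_ge => //; exact: nearW.
have mh : measurable_fun setT h by apply: (emeasurable_fun_cvg g) => // w _; exact: gcv.
have hI : (\int[P]_w h w < +oo)%E.
  rewrite monotone_convergence//.
  apply: (@le_lt_trans _ _ (4 * ip P (x^~ T) (x^~ T))%:E); last exact: ltry.
  apply: lime_le.
    apply: ereal_nondecreasing_is_cvgn => a b ab; apply: ge0_le_integral => //.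
    by move=> w _; exact: gnd.
  by apply: nearW => n; rewrite -ipE ?lee_fin.
have hint : P.-integrable setT h.
  apply/integrableP; split=> //; apply: le_lt_trans hI.
  by under eq_integral do rewrite gee0_abs//.
(* [fine] replaces an infinite supremum by 0; this happens only on a null set, whence the almost
   sure clause. *)
pose U w := Num.sqrt (fine (h w)).
have U2 w : U w ^+ 2 = fine (h w) by rewrite sqr_sqrtr// fine_ge0.
exists U.
  split.
    have ms : measurable_fun setT (Num.sqrt : R -> R).
      by apply: continuous_measurable_fun; exact: sqrt_continuous.
    apply: (measurableT_comp ms).
    exact: (measurableT_comp (@fine_measurable R _ measurableT)).
  apply: le_lt_trans hI; apply: ge0_le_integral => //.
  - by move=> w _; rewrite lee_fin sqr_ge0.
  - under eq_fun do rewrite U2.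
    by apply/measurable_EFinP; exact: (measurableT_comp (@fine_measurable R _ measurableT)).
  - move=> w _; rewrite U2; have := h0 w; case: (h w) => //= r _.
split; first by move=> w; exact: sqrtr_ge0.
have := integrable_ae measurableT hint; apply: filterS => w /(_ I) hfin q [n [k ->]].
apply: (@le_trans _ _ (M n w)).
  rewrite /M; case: (leqP k (2 ^ n)) => kn; first exact: (@run_max_ge _ _ _ (Y n)).
  by rewrite grid_end ?(ltnW kn)// -(@grid_end _ T n (2 ^ n)%N)//; exact: (@run_max_ge _ _ _ (Y n)).
rewrite -(@ler_pXn2r _ 2)// ?nnegrE ?sqrtr_ge0// U2 -lee_fin fineK//.
by apply: lime_ge; [exact: gcv|exists n => // j; exact: gnd].
Qed.

(** Every step of a chain with displacements [2 * e] raises the greedy count at least once, so the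
    length of the chain is paid for by the count. *)
Let chain_count e w N a s i : 0 < e -> a = grid T N i -> (i <= 2 ^ N)%N ->
  (forall q, q \in s -> exists k, q = grid T N k) ->
  path (displaced (x w) <%R (2 * e)) a s ->
  ((osc (Y N) e i w).2 + size s <= (osc (Y N) e (2 ^ N)%N w).2)%N.
Proof.
move=> e0; elim: s a i => [|b s IH] a i ai iN sN /=.
  by rewrite addn0 => _; exact: osc_count_nd.
move=> /andP[/andP[ab disp] bs].
have [j bj jN] : exists2 j, b = grid T N j & (j <= 2 ^ N)%N.
  have [k bk] := sN b (mem_head _ _); exists (minn k (2 ^ N)); last exact: geq_minr.
  by rewrite bk /grid -minnA minnn.
have ij : (i < j)%N by apply: (grid_idx T0 (n := N)); rewrite -ai -bj.
rewrite addnS -addSn; apply: leq_trans (IH b j bj jN _ bs); last first.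
  by move=> q qs; apply: sN; rewrite inE qs orbT.
rewrite leq_add2r; apply: (osc_count_lt _ (ltnW ij)) => //.
by rewrite /Y -ai -bj distrC.
Qed.

(** The expected greedy counts are bounded uniformly in the grid, so by Fatou their lower limit is
    almost surely finite. Chains of unbounded length would drive the counts to infinity, because a
    finite chain of dyadic times lies on every sufficiently fine grid. *)
Lemma no_long_chain_ae e : 0 < e -> {ae P, forall w, no_long_chain (dyadic T) (x w) e}.
Proof.
move=> e0; pose e' := e / 2; have e'0 : 0 < e' by rewrite divr_gt0.
have ee' : e = 2 * e' by rewrite mulrC divfK.
pose C n w := (osc (Y n) e' (2 ^ n)%N w).2.
have osc_n n := grid_osc HF T0 wx n (2 ^ n)%N (ltW e'0).
pose f n w := ((C n w)%:R : R)%:E.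
have mf n : measurable_fun setT (f n) by apply/measurable_EFinP; exact: (osc_n n).1.
have f0 n w : (0 <= f n w)%E by rewrite lee_fin.
pose K := ip P (x^~ T) (x^~ T) / e' ^+ 2.
have fK n : (\int[P]_w f n w <= K%:E)%E.
  have fin : (\int[P]_w f n w)%E \is a fin_num.
    apply: integrable_fin_num => //; apply: (sqint_integrable (probability_lty P)).
    apply: (sqint_bounded (C := (2 ^ n)%:R) (probability_lty P)); first exact: (osc_n n).1.
    by move=> w; rewrite ger0_norm// ler_nat osc_count_le.
  rewrite -[leLHS]fineK// lee_fin ler_pdivlMr ?exprn_gt0// mulrC -(endT n).
  exact: (osc_n n).2.
pose h w := limn_einf (f^~ w).
have mh : measurable_fun setT h by exact: measurable_limn_einf.
have h0 w : (0 <= h w)%E.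
  rewrite /h limn_einf_lim; apply: lime_ge; first exact: is_cvg_einfs.
  by apply: nearW => n; apply: le_ereal_inf_tmp => _ [k _ <-].
have hI : P.-integrable setT h.
  apply/integrableP; split=> //; apply: (@le_lt_trans _ _ K%:E); last exact: ltry.
  under eq_integral do rewrite gee0_abs//.
  apply: (le_trans (fatou _ measurableT _ _)) => //.
  rewrite limn_einf_lim; apply: lime_le; first exact: is_cvg_einfs.
  apply: nearW => k; apply: ge_ereal_inf; exists (\int[P]_w f k w)%E => //.
  by exists k => /=.
have := integrable_ae measurableT hI; apply: filterS => w /(_ I) hfin.
apply: contrapT => nobound.
suff fy : f n w @[n --> \oo] --> +oo%E.
  move: hfin; rewrite /h is_cvg_limn_einfE; last by apply/cvg_ex; eexists; exact: fy.
  by rewrite (cvg_lim _ fy).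
apply/cvgeyPge => A; have [k Ak] : exists k : nat, A <= k%:R.
  by exists (Num.truncn A).+1; apply/ltW/truncnS_gt.
have : ~ forall s : seq R, (forall q, q \in s -> dyadic T q) ->
    sorted (displaced (x w) <%R e) s -> (size s <= k)%N.
  by move=> H; apply: nobound; exists k.
move=> /existsNP[s /not_implyP[sD /not_implyP[ss /negP]]]; rewrite -ltnNge => ks.
have [N sN] : exists N, forall n, (N <= n)%N ->
    forall q, q \in s -> exists i, q = grid T n i.
  elim: s sD {ss ks} => [|a s IH] sD; first by exists 0%N.
  have [N1 H1] : exists N, forall n, (N <= n)%N -> forall q, q \in s -> exists i, q = grid T n i.
    by apply: IH => q qs; apply: sD; rewrite inE qs orbT.
  have [N2 [i ai]] := sD a (mem_head _ _).
  exists (maxn N1 N2) => n; rewrite geq_max => /andP[n1 n2] q.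
  rewrite inE => /predU1P[->|]; last exact: H1.
  by rewrite ai; exact: grid_lift.
exists N => // n /= Nn; rewrite lee_fin (le_trans Ak)// ler_nat.
case: s sD ss ks sN => // a s sD /= ss ks sN.
have [i ai] := sN n Nn a (mem_head _ _).
have iN : a = grid T n (minn i (2 ^ n)) by rewrite ai /grid -minnA minnn.
move: ss; rewrite ee' => ss.
have := @chain_count e' w n a s _ e'0 iN (geq_minr _ _) _ ss.
move=> H; apply: leq_trans (H _) => [|q qs]; last by apply: sN => //; rewrite inE qs orbT.
by apply: (@leq_trans (size s)) => //; exact: leq_addl.
Qed.

End DyadicPaths.

(** * Cadlag versions of martingales *)

Section CadlagVersion.
Context {d} {Om : measurableType d} {R : realType} (P : probability Om R).
Variables (Ft : R -> set (set Om)) (T : R).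
Hypothesis HF : filtration Ft T.
Hypothesis HU : usual_conditions P Ft T.
Hypothesis T0 : 0 < T.
Let HN : P.-negligible `<=` Ft 0 := HU.1.

Lemma Rintegral_ip A (f : Om -> R) : \int[P]_(w in A) f w = ip P \1_A f.
Proof.
rewrite Rintegral_mkcond; apply: eq_Rintegral => x _.
by rewrite patchE indicE; case: (_ \in _); rewrite ?mul1r ?mul0r.
Qed.

Lemma indic_sqint A : measurable A -> sqint P (\1_A : Om -> R).
Proof.
move=> mA; apply: (sqint_bounded (C := 1) (probability_lty P)) => [|x].
  exact: measurable_indic.
by rewrite ger0_norm// indicE; case: (_ \in _).
Qed.

Lemma nrm_sub0 (f : Om -> R) : nrm P (fun w => f w - f w) = 0.
Proof.
rewrite /nrm /ip; under eq_Rintegral do rewrite subrr mul0r.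
by rewrite Rintegral_cst// mul0r sqrtr0.
Qed.

Lemma EFin_Rintegral A (f : Om -> R) : measurable A -> sqint P f ->
  (\int[P]_(w in A) f w)%:E = (\int[P]_(w in A) (f w)%:E)%E.
Proof.
move=> mA f2; rewrite fineK//; apply: integrable_fin_num => //.
by apply: (integrableS measurableT) => //; exact: (sqint_integrable (probability_lty P)).
Qed.

(** At [T] the variable [xi] itself is taken rather than another version, so that the terminal
    condition is an equality of functions. *)
Lemma condexp_process (xi : Om -> R) : mfunG (Ft T) xi -> sqint P xi ->
  exists2 x : Om -> R -> R, wmartingale P Ft T x & x^~ T = xi.
Proof.
move=> mxi xi2.
have TT : 0 <= T <= T by rewrite lexx ltW.
have H t : exists Y : Om -> R, 0 <= t <= T -> [/\ mfunG (Ft t) Y, sqint P Y,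
    forall A, Ft t A -> \int[P]_(w in A) Y w = \int[P]_(w in A) xi w & t = T -> Y = xi].
  have [->|tT] := eqVneq t T; first by exists xi.
  have [tT'|] := boolP (0 <= t <= T); last by move=> /negP nt; exists xi.
  have [Y [mY Y2] YE] := condexp_exists (Ft_measurable HF tT') xi2.
  exists Y => _; split; [exact: mY|exact: Y2| |by move=> tE; rewrite tE eqxx in tT].
  by move=> A FA; apply: YE; exact: sub_sigma_algebra.
have [Y YP] := choice H; exists (fun w t => Y t w); last first.
  by have [_ _ _] := YP T TT; exact.
split; [by move=> t tT; have [] := YP t tT|by move=> t tT; have [] := YP t tT|].
move=> s t s0 st tT A FA.
have sT : 0 <= s <= T by rewrite s0 (le_trans st).
have tT' : 0 <= t <= T by rewrite tT (le_trans s0).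
have [_ _ sE _] := YP s sT; have [_ _ tE _] := YP t tT'.
by rewrite sE// tE//; exact: (Ft_le HF s0 st tT).
Qed.

Lemma cvg_cadlag_up (f : R -> R) t : cadlag T f -> 0 <= t < T ->
  f (grid_up T n t) @[n --> \oo] --> f t.
Proof.
move=> [cf _] tT; move/cvg_at_rightP: (cf t tT); apply; split.
  by move=> n; exact: (grid_upP T0 n tT).1.
exact: cvg_grid_up.
Qed.

Lemma dyadic_bound (f : R -> R) (u : R) t : cadlag T f ->
  (forall q, dyadic T q -> `|f q| <= u) -> 0 <= t <= T -> `|f t| <= u.
Proof.
move=> cf fu /andP[t0]; rewrite le_eqVlt => /predU1P[->|tT].
  by apply: fu; exact: dyadicT.
have tT' : 0 <= t < T by rewrite t0.
have cB : `|f (grid_up T n t)| @[n --> \oo] --> `|f t|.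
  by apply: cvg_norm; exact: cvg_cadlag_up.
rewrite -(cvg_lim _ cB)//; apply: limr_le.
  by apply/cvg_ex; eexists; exact: cB.
by apply: nearW => n; apply: fu; eexists; eexists.
Qed.

Lemma Doob_cadlag X : sq_martingale P Ft T X -> exists2 U, sqint P U &
  (forall w, 0 <= U w) /\ {ae P, forall w, forall t, 0 <= t <= T -> `|X w t| <= U w}.
Proof.
move=> sX; have [_ cX _] := sX.
have [U U2 [U0 UX]] := Doob_dyadic HF T0 (sq_martingale_wmartingale HF sX).
exists U => //; split=> //; apply: filterS UX => w UXw t tT.
exact: (dyadic_bound (cX w)).
Qed.

(** Right limits along dyadic times are used on an almost sure event [E] of good paths, and 0
    elsewhere. Completeness puts [E] in every [Ft t], which keeps the process adapted although all
    of its paths, without exception, are made cadlag. *)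
Lemma cadlag_martingale_exists (xi : Om -> R) : mfunG (Ft T) xi -> sqint P xi ->
  exists2 N, sq_martingale P Ft T N & {ae P, forall w, N w T = xi w}.
Proof.
move=> mxi xi2; have [x wx xT] := condexp_process mxi xi2.
have [ax x2 mx] := wx.
have [U U2 [U0 UX]] := Doob_dyadic HF T0 wx.
have chains : {ae P, forall w, forall n : nat, no_long_chain (dyadic T) (x w) n.+1%:R^-1}.
  by apply: ae_foralln => n; apply: (no_long_chain_ae HF T0 wx); rewrite invr_gt0.
pose E := [set w | (forall n : nat, no_long_chain (dyadic T) (x w) n.+1%:R^-1) /\
  (forall q, dyadic T q -> `|x w q| <= U w)].
have Eae : {ae P, forall w, E w} by apply: filterS2 chains UX => w.
have FE t : 0 <= t <= T -> <<s Ft t >> E.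
  by move=> tT; rewrite (Ft_sigma HF tT); exact: (ae_Ft HF HN).
have nochain w : E w -> forall e, 0 < e -> no_long_chain (dyadic T) (x w) e.
  (* With the index [Num.truncn e^-1] the threshold is at most [e]; countably many thresholds thus
     decide the property for all [e]. *)
  move=> [ch _] e e0; have [k kP] := ch (Num.truncn e^-1).
  exists k => s sD ss; apply: kP => //; apply: sub_sorted ss => a b.
  rewrite /displaced => /andP[-> /=]; apply: le_trans.
  rewrite -[leRHS]invrK lef_pV2 ?posrE ?invr_gt0//.
  exact/ltW/truncnS_gt.
pose N w t := \1_E w * right_version T (x w) t.
have NE w t : E w -> N w t = right_version T (x w) t.
  by move=> Ew; rewrite /N indicE mem_set// mul1r.
have NnE w t : ~ E w -> N w t = 0.
  by move=> Ew; rewrite /N indicE memNset// mul0r.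
have cN w : cadlag T (N w).
  have [Ew|Ew] := pselect (E w).
    have -> : N w = right_version T (x w) by apply/funext => t; rewrite NE.
    by apply: right_version_cadlag => //; exact: nochain.
  have -> : N w = (fun=> 0) by apply/funext => t; rewrite NnE.
  by split=> t _; [exact: cvg_cst|exact: is_cvg_cst].
have cvN w t : E w -> 0 <= t < T -> x w (grid_up T n t) @[n --> \oo] --> N w t.
  by move=> Ew tT; rewrite NE//; apply: cvg_right_version => //; exact: nochain.
have NT w : E w -> N w T = x w T by move=> Ew; rewrite NE// /right_version ltxx.
have NU w t : 0 <= t <= T -> `|N w t| <= U w.
  move=> tT; have [Ew|Ew] := pselect (E w); last by rewrite NnE// normr0.
  case/andP: (tT) => t0; rewrite le_eqVlt => /predU1P[->|tT'].
    by rewrite NT//; apply: Ew.2; exact: dyadicT.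
  have tT2 : 0 <= t < T by rewrite t0.
  have cB : `|x w (grid_up T n t)| @[n --> \oo] --> `|N w t|.
    by apply: cvg_norm; exact: cvN.
  rewrite -(cvg_lim _ cB)//; apply: limr_le.
    by apply/cvg_ex; eexists; exact: cB.
  by apply: nearW => n; apply: Ew.2; eexists; eexists.
have aN t : 0 <= t <= T -> mfunG (Ft t) (N^~ t).
  move=> tT; case/andP: (tT) => t0; rewrite le_eqVlt => /predU1P[tE|tT'].
    have -> : N^~ t = (fun w => \1_E w * x w T).
      by apply/funext => w; rewrite /N /right_version tE ltxx.
    apply: measurable_funM; first by apply: measurable_indic; exact: FE.
    by rewrite tE; apply: ax; rewrite lexx ltW.
  have tT2 : 0 <= t < T by rewrite t0.
  (* [N^~ t] is a limit of values at grid points before [s], hence known at every [s > t]; right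
     continuity of the filtration brings this back to [t]. *)
  have later s : t < s <= T -> mfunG (Ft s) (N^~ t).
    move=> /andP[ts sT]; have s0 : 0 <= s <= T by rewrite sT (le_trans t0)// ltW.
    have [m _ mP] : \forall n \near \oo, grid_up T n t < s.
      by have := cvg_grid_up T0 tT2 => /cvgr_lt/(_ _ ts).
    have -> : N^~ t = (fun w => \1_E w * lsup (fun n w => x w (grid_up T (n + m)%N t)) w).
      apply/funext => w; have [Ew|Ew] := pselect (E w); last first.
        by rewrite NnE// indicE memNset// mul0r.
      rewrite indicE mem_set// mul1r; apply/esym/lsup_cvg.
      have := cvN w t Ew tT2.
      by move/(cvg_comp _ _ (cvg_addnr m)).
    apply: measurable_funM; first by apply: measurable_indic; exact: FE.
    apply: measurable_lsup => n.
    have ups : 0 <= grid_up T (n + m) t <= s.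
      by rewrite grid_ge0//= ltW//; apply: mP; rewrite /= leq_addl.
    case/andP: ups => u0 us; apply: (mfunFt_le HF u0 us sT).
    by apply: ax; rewrite u0 (le_trans us).
  move=> _ B mB; rewrite setTI; apply: sub_sigma_algebra.
  apply: (HU.2 t tT2) => s ts.
  have sT : 0 <= s <= T by case/andP: ts => ts ->; rewrite (le_trans t0)// ltW.
  have : <<s Ft s >> ((N^~ t) @^-1` B).
    by rewrite -[X in <<s _ >> X]setTI; exact: (later s ts measurableT B mB).
  by rewrite (Ft_sigma HF sT).
have N2 t : 0 <= t <= T -> sqint P (N^~ t).
  move=> tT; apply: (sqint_le (mfunFt_measurable HF tT (aN t tT)) _ U2) => w.
  by rewrite [leRHS]ger0_norm//; exact: NU.
(* At grid points after [t] the martingale property already gives the integral of the terminal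
   value; the maximal function [U] lets the limit pass in L2. *)
have NxT t A : 0 <= t <= T -> Ft t A -> \int[P]_(w in A) N w t = \int[P]_(w in A) x w T.
  move=> tT FA; have mA := Ft_measurable HF tT FA.
  rewrite !Rintegral_ip; case/andP: (tT) => t0; rewrite le_eqVlt => /predU1P[tE|tT'].
    have TT : 0 <= T <= T by rewrite lexx ltW.
    rewrite tE; apply: ip_ae; try exact: indic_sqint.
    - exact: N2.
    - exact: x2.
    - exact: aeW.
    - by apply: filterS Eae => w; exact: NT.
  have tT2 : 0 <= t < T by rewrite t0.
  have gT n : 0 <= grid_up T n t <= T by exact: grid_itv.
  have [| | | | |_ cv] := @nrm_dominated_cvg _ _ _ P (fun n w => x w (grid_up T n t)) (N^~ t) U.
  - by move=> n; exact: (x2 _ (gT n)).1.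
  - exact: (N2 t tT).1.
  - by apply: filterS Eae => w Ew; exact: cvN.
  - apply: filterS Eae => w Ew n; rewrite [leRHS]ger0_norm//; apply: Ew.2.
    by eexists; eexists.
  - exact: U2.
  have cst0 : nrm P (fun w => (\1_A w : R) - \1_A w) @[n --> \oo] --> 0.
    by rewrite nrm_sub0; exact: cvg_cst.
  have iA := indic_sqint mA.
  have lim := ip_cvg (fun=> iA) (fun n => x2 _ (gT n)) iA (N2 t tT) cst0 cv.
  apply: (cvg_unique _ lim) => //.
  rewrite (_ : (fun n => _) = (fun=> ip P \1_A (x^~ T))); first exact: cvg_cst.
  apply/funext => n; rewrite -!Rintegral_ip; apply/esym; apply: mx => //.
  - by case/andP: (gT n).
  - by case/andP: (gT n).
  - have /andP[u0 uT] := gT n; apply: (Ft_le HF t0 _ uT) => //.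
    exact/ltW/(grid_upP T0 n tT2).1.
exists N; last by apply: filterS Eae => w Ew; rewrite NT// -xT.
split; [split; [exact: aN| |]|exact: cN|by move=> t tT; exact: (N2 t tT).2].
  by move=> t tT; apply: (sqint_integrable (probability_lty P)); exact: N2.
move=> s t s0 st tT A FA.
have sT : 0 <= s <= T by rewrite s0 (le_trans st).
have tT' : 0 <= t <= T by rewrite tT (le_trans s0).
have mA := Ft_measurable HF sT FA.
rewrite -(EFin_Rintegral mA (N2 t tT')) -(EFin_Rintegral mA (N2 s sT)).
by rewrite (NxT s)// (NxT t)//; exact: (Ft_le HF s0 st tT).
Qed.

End CadlagVersion.

(** * Bracket kernels *)

Section KernelProduct.
Local Open Scope ereal_scope.
Context {d d'} {X : measurableType d} {Y : measurableType d'} {R : realType}.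
Variables (P : {measure set X -> \bar R}) (k : R.-ker X ~> Y).
Hypothesis kfin : forall x, k x setT < +oo.

Lemma measurable_xsection_ker C : measurable C ->
  measurable_fun setT (fun x => k x (xsection C x)).
Proof.
move=> mC.
have kb x : exists M : R, forall U, measurable U -> mrestr (k x) measurableT U < M%:E.
  exists (fine (k x setT) + 1)%R => U mU; rewrite EFinD fineK ?ge0_fin_numE//.
  apply: (@le_lt_trans _ _ (k x setT)).
    by rewrite /mrestr setIT le_measure//; exact: mem_set.
  by rewrite lteDl ?lte_fin// ge0_fin_numE.
have [_] := measurable_prod_subset_xsection_kernel kb mC.
by apply: eq_measurable_fun => x _; rewrite /mrestr /= setIT.
Qed.

Definition kprod (C : set (X * Y)) : \bar R := \int[P]_x k x (xsection C x).

Let kprod0 : kprod set0 = 0.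
Proof. by rewrite /kprod integral0_eq// => x _; rewrite xsection0 measure0. Qed.

Let kprod_ge0 C : 0 <= kprod C.
Proof. exact: integral_ge0. Qed.

Let kprod_additive : semi_sigma_additive kprod.
Proof.
move=> F mF tF mUF.
have -> : kprod (\bigcup_n F n) = \sum_(n <oo) kprod (F n).
  rewrite -integral_nneseries//; last by move=> n; exact: measurable_xsection_ker.
  apply: eq_integral => x _; rewrite xsection_bigcup measure_semi_bigcup//.
  - by move=> n; exact: measurable_xsection.
  - exact: trivIset_xsection.
  - by apply: bigcup_measurable => n _; exact: measurable_xsection.
by apply: is_cvg_nneseries.
Qed.

HB.instance Definition _ := isMeasure.Build _ _ _ kprod kprod0 kprod_ge0 kprod_additive.

Definition mkprod : {measure set (X * Y) -> \bar R} := kprod.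

Import HBNNSimple.

(** Measurability of the inner integral and the iterated formula are obtained together: on simple
    functions through the measurability of sections, then by monotone convergence. *)
Lemma kprod_integral f : measurable_fun setT f -> (forall p, 0 <= f p) ->
  measurable_fun setT (fun x => \int[k x]_y f (x, y)) /\
  \int[kprod]_p f p = \int[P]_x \int[k x]_y f (x, y).
Proof.
move=> mf f0; pose g := nnsfun_approx measurableT mf.
have mgn n : measurable_fun setT (EFin \o g n) by exact/measurable_EFinP.
have mgx n x : measurable_fun setT (fun y => (g n (x, y))%:E).
  exact: (measurableT_comp (mgn n) (measurable_pair1 x)).
have gnd n m p : (n <= m)%N -> (g n p)%:E <= (g m p)%:E.
  by move=> nm; rewrite lee_fin; exact/lefP/nd_nnsfun_approx.
have gcv p : (g n p)%:E @[n --> \oo] --> f p by exact: cvg_nnsfun_approx.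
have g0 n p : 0 <= (g n p)%:E by rewrite lee_fin.
have mI n : measurable_fun setT (fun x => \int[k x]_y (g n (x, y))%:E) /\
    \int[kprod]_p (g n p)%:E = \int[P]_x \int[k x]_y (g n (x, y))%:E.
  pose h r x := r%:E * k x (xsection (g n @^-1` [set r]) x).
  have mh r : measurable_fun setT (h r).
    by apply: measurable_funeM; exact: measurable_xsection_ker.
  have h0 r x : 0 <= h r x.
    have [r0|r0] := leP 0%R r; first by rewrite mule_ge0// lee_fin.
    by rewrite /h preimage_nnfun0// xsection0 measure0 mule0.
  have mset r : measurable (g n @^-1` [set r]) by [].
  have mind r x : measurable_fun setT (fun y => \1_(g n @^-1` [set r]) (x, y) : R).
    have mi : measurable_fun setT (\1_(g n @^-1` [set r]) : X * Y -> R).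
      exact: measurable_indic.
    exact: (measurableT_comp mi (measurable_pair1 x)).
  have inner x : \int[k x]_y (g n (x, y))%:E = \sum_(r \in range (g n)) h r x.
    transitivity (\int[k x]_y (\sum_(r \in range (g n))
        (r * \1_(g n @^-1` [set r]) (x, y))%:E)).
      by apply: eq_integral => y _; rewrite fsumEFin// -fimfunE.
    rewrite ge0_integral_fsum//; last 2 first.
    - by move=> r; apply/measurable_EFinP/measurable_funM.
    - by move=> r y _; rewrite nnfun_muleindic_ge0.
    apply: eq_fsbigr => r _; rewrite /h.
    have mr : measurable (xsection (g n @^-1` [set r]) x) by exact: measurable_xsection.
    have [r0|r0] := leP 0%R r; last first.
      rewrite preimage_nnfun0// xsection0 measure0 mule0.
      by apply: integral0_eq => y _; rewrite indic0 mulr0.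
    under eq_integral do rewrite EFinM.
    rewrite ge0_integralZl_EFin//; last exact/measurable_EFinP.
    congr (_ * _); rewrite -[in RHS](setIT (xsection _ _)) -integral_indic//.
    by apply: eq_integral => y _; rewrite !indicE mem_xsection.
  have -> : (fun x => \int[k x]_y (g n (x, y))%:E) = fun x => \sum_(r \in range (g n)) h r x.
    by apply/funext => x; exact: inner.
  split; first exact: emeasurable_fsum.
  rewrite ge0_integral_fsum//.
  transitivity (\int[kprod]_p (\sum_(r \in range (g n))
      (r * \1_(g n @^-1` [set r]) p)%:E)).
    by apply: eq_integral => p _; rewrite fsumEFin// -fimfunE.
  rewrite ge0_integral_fsum//; last 2 first.
  - by move=> r; apply/measurable_EFinP/measurable_funM.
  - by move=> r p _; rewrite nnfun_muleindic_ge0.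
  apply: eq_fsbigr => r _.
  have [r0|r0] := leP 0%R r; last first.
    rewrite integral0_eq; last by move=> p _; rewrite preimage_nnfun0// indic0 mulr0.
    rewrite integral0_eq// => x _; rewrite /h preimage_nnfun0// xsection0 measure0.
    by rewrite mule0.
  under eq_integral do rewrite EFinM.
  rewrite ge0_integralZl_EFin//.
  rewrite ge0_integralZl_EFin//; last exact: measurable_xsection_ker.
    by congr (_ * _); rewrite integral_indic// setIT.
  by apply/measurable_EFinP; exact: measurable_indic.
have innerE x : \int[k x]_y f (x, y) = limn (fun n => \int[k x]_y (g n (x, y))%:E).
  rewrite -monotone_convergence//.
  - by apply: eq_integral => y _; apply/esym/cvg_lim => //; exact: gcv.
  - by move=> y _ i j; exact: gnd.
have innernd x : nondecreasing_seq (fun n => \int[k x]_y (g n (x, y))%:E).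
  by move=> i j ij; apply: ge0_le_integral => // y _; exact: gnd.
split.
  apply: (emeasurable_fun_cvg (fun n x => \int[k x]_y (g n (x, y))%:E)).
    by move=> n; exact: (mI n).1.
  by move=> x _; rewrite innerE; apply: ereal_nondecreasing_is_cvgn.
transitivity (limn (fun n => \int[kprod]_p (g n p)%:E)).
  rewrite -monotone_convergence//.
  - by apply: eq_integral => p _; apply/esym/cvg_lim => //; exact: gcv.
  - by move=> p _ i j; exact: gnd.
under eq_fun do rewrite (mI _).2.
rewrite -monotone_convergence//.
- by apply: eq_integral => x _; rewrite innerE.
- by move=> n; exact: (mI n).1.
- by move=> n x _; apply: integral_ge0 => y _; exact: g0.
Qed.

End KernelProduct.

Section BracketKernel.
Context {d} {Om : measurableType d} {R : realType} (P : probability Om R) (T : R).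
Hypothesis T0 : 0 < T.
Variable A : Om -> cumulative R R.
Hypothesis A0 : forall w t, t <= 0 -> A w t = 0.
Hypothesis mA : forall t, 0 <= t <= T -> measurable_fun setT (fun w => A w t).

Local Notation LS w := (lebesgue_stieltjes_measure (A w)).

Lemma LS_oc w a b : a <= b -> LS w `]a, b]%classic = (A w b - A w a)%:E.
Proof.
move=> ab; rewrite /lebesgue_stieltjes_measure /measure_extension.
by rewrite measurable_mu_extE/=; [rewrite wlength_itv_bnd|exact: is_ocitv].
Qed.

(* The Lebesgue-Stieltjes measure, on [R] instead of its copy [measurableTypeR R]. *)
Definition LSR (w : Om) (U : set R) : \bar R := LS w U.

Section LSRMeasure.
Variable w : Om.

Let LSR0 : LSR w set0 = 0%E. Proof. exact: (measure0 (LS w)). Qed.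
Let LSR_ge0 U : (0 <= LSR w U)%E. Proof. exact: (measure_ge0 (LS w)). Qed.
Let LSR_additive : semi_sigma_additive (LSR w).
Proof. exact: (@measure_semi_sigma_additive _ _ _ (LS w)). Qed.

HB.instance Definition _ := isMeasure.Build _ R R (LSR w) LSR0 LSR_ge0 LSR_additive.

End LSRMeasure.

Definition bracket_kernel w : {measure set R -> \bar R} :=
  mrestr (LSR w) (measurable_itv `[0, T]).

Lemma LSR_oc w a b : a <= b -> LSR w `]a, b]%classic = (A w b - A w a)%:E.
Proof. exact: LS_oc. Qed.

Lemma bracket_kernelE w U : bracket_kernel w U = LSR w (U `&` `[0, T]%classic).
Proof. by []. Qed.

(** Half-open intervals are the sets whose measure is known. As [A] vanishes up to time 0, the
    interval []-1, 0]] is null and the closed end 0 can be traded for an open end at a negative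
    time. *)
Let LSR_clamp w U : measurable U -> LSR w (U `&` `[0, T]%classic) = LSR w (U `&` `]-1, T]%classic).
Proof.
move=> mU.
have N0 : LSR w `]-1, 0]%classic = 0%E.
  by rewrite LSR_oc ?lerN10// !A0 ?lerN10// subrr.
have mN : measurable (`]-1, 0[%classic : set R) by [].
have N0' (B : set R) : measurable B -> B `<=` `]-1, 0]%classic -> LSR w B = 0%E.
  by move=> mB BN; exact: (subset_measure0 mB (measurable_itv `]-1, 0]) BN N0).
have -> : U `&` `]-1, T] = (U `&` `[0, T]) `|` (U `&` `]-1, 0[).
  rewrite -setIUr; congr (_ `&` _); apply/seteqP; split => t /=; rewrite !in_itv /=.
    by move=> /andP[t1 tT]; case: (leP 0 t) => t0; [left; rewrite tT|right; rewrite t1].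
  move=> [/andP[t0 tT]|/andP[t1 t0]]; first by rewrite tT (lt_le_trans _ t0)// ltrN10.
  by rewrite t1 (le_trans (ltW t0))// ltW.
rewrite measureU0//; [exact: measurableI|exact: measurableI|].
apply: N0'; first exact: measurableI.
by move=> t [_] /=; rewrite !in_itv /= => /andP[-> /ltW].
Qed.

Lemma bracket_kernel_oc w a b : 0 <= a -> a <= b -> b <= T ->
  bracket_kernel w `]a, b]%classic = (A w b - A w a)%:E.
Proof.
move=> a0 ab bT; rewrite bracket_kernelE setIidl ?LSR_oc// => t /=.
rewrite !in_itv /= => /andP[at_ tb].
by rewrite (le_trans tb)// (le_trans a0)// ltW.
Qed.

Lemma bracket_kernel_setT w : bracket_kernel w setT = (A w T)%:E.
Proof.
rewrite bracket_kernelE LSR_clamp// setTI LSR_oc; last by rewrite (le_trans (lerN10 R))// ltW.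
by rewrite (A0 _ (t := -1)) ?lerN10// subr0.
Qed.

Let mkernel_oc a b : measurable_fun setT (fun w => bracket_kernel w `]a, b]%classic).
Proof.
have mA' t : t <= T -> measurable_fun setT (fun w => A w t).
  move=> tT; case: (leP 0 t) => t0; first by apply: mA; rewrite t0.
  rewrite (_ : (fun w => _) = cst 0)//; apply/funext => w.
  by rewrite A0// ltW.
have E : `]a, b]%classic `&` `]-1, T]%classic = `]Num.max a (-1), Num.min b T]%classic :> set R.
  apply/seteqP; split => t /=; rewrite !in_itv /= gt_max le_min.
    by move=> [/andP[-> ->] /andP[-> ->]].
  by move=> /andP[/andP[-> ->] /andP[-> ->]].
have [ab|ab] := leP (Num.max a (-1)) (Num.min b T); last first.
  rewrite (_ : (fun w => _) = cst 0%E)//; apply/funext => w.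
  by rewrite bracket_kernelE LSR_clamp// E set_itv_ge ?measure0// bnd_simp -leNgt ltW.
rewrite (_ : (fun w => _) =
    fun w => (A w (Num.min b T) - A w (Num.max a (-1)))%:E); last first.
  by apply/funext => w; rewrite bracket_kernelE LSR_clamp// E LSR_oc.
apply/measurable_EFinP/measurable_funB; apply: mA'.
  by rewrite ge_min lexx orbT.
by apply: (le_trans ab); rewrite ge_min lexx orbT.
Qed.

(** Dynkin's theorem on half-open intervals, whose measure is an increment of [A] between clamped
    times; the total mass [A w T] is finite, so complements are differences. *)
Lemma measurable_bracket_kernel U : measurable U ->
  measurable_fun setT (bracket_kernel ^~ U).
Proof.
have finT w : (bracket_kernel w setT < +oo)%E by rewrite bracket_kernel_setT ltry.
move: U; apply: (@dynkin_induction _ _ (@ocitv R)) => //.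
- exact: ocitvI.
- rewrite (_ : (fun w => _) = fun w => (A w T)%:E).
    by apply/measurable_EFinP; apply: mA; rewrite lexx ltW.
  by apply/funext => w; exact: bracket_kernel_setT.
- by move=> _ [[a b] _ <-]; exact: mkernel_oc.
- move=> S mS mkS.
  rewrite (_ : (fun w => _) = fun w => (bracket_kernel w setT - bracket_kernel w S)%E).
    apply: emeasurable_funB => //.
    rewrite (_ : (fun w => _) = fun w => (A w T)%:E).
      by apply/measurable_EFinP; apply: mA; rewrite lexx ltW.
    by apply/funext => w; exact: bracket_kernel_setT.
  apply/funext => w; rewrite -setTD measureD// ?setTI//; exact: finT.
- move=> F mF tF mkF.
  rewrite (_ : (fun w => _) = fun w => (\sum_(n <oo) bracket_kernel w (F n))%E).
    by apply: ge0_emeasurable_sum => // n _; exact: mkF.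
  by apply/funext => w; rewrite measure_semi_bigcup//; exact: bigcup_measurable.
Qed.

HB.instance Definition _ := isKernel.Build _ _ Om R R bracket_kernel measurable_bracket_kernel.

Lemma bracket_kernel_fin w : (bracket_kernel w setT < +oo)%E.
Proof. by rewrite bracket_kernel_setT ltry. Qed.

Lemma bracket_intE w (f : R -> \bar R) : measurable_fun setT f ->
  (forall t, (0 <= f t)%E) -> bracket_int T A w f = (\int[bracket_kernel w]_t f t)%E.
Proof.
move=> mf f0; have mid : measurable_fun setT (idfun : measurableTypeR R -> R).
  by move=> _ B mB; rewrite setTI; exact: mB.
pose D : set R := `[0, T]%classic; rewrite /bracket_int -/D.
have mD : measurable D by exact: measurable_itv.
transitivity (\int[pushforward (LS w) (idfun : measurableTypeR R -> R)]_(t in D) f t)%E.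
  by rewrite ge0_integral_pushforward//; exact: measurable_funTS.
transitivity (\int[LSR w]_(t in D) f t)%E; first by [].
transitivity (\int[bracket_kernel w]_(t in D) f t)%E.
  by apply: eq_measure_integral => B mB BT; rewrite bracket_kernelE setIidl.
rewrite [RHS](_ : _ = \int[bracket_kernel w]_(t in D `|` ~` D) f t)%E; last first.
  by rewrite setUCr.
have mC : measurable (~` D) by exact: measurableC.
rewrite ge0_integral_setU//; last 2 first.
- exact: measurable_funTS.
- by apply/disj_set2P; rewrite setICr.
rewrite [X in (_ + X)%E](_ : _ = 0%E) ?adde0//; apply: null_set_integral => //.
  exact: measurable_funTS.
by rewrite bracket_kernelE setICl measure0.
Qed.


Definition bracket_ker : R.-ker Om ~> R := bracket_kernel.

(* [K] is the measure [bracket_measure P T A] on the product sigma-algebra. *)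
Definition is_bracketK (K : {measure set (Om * R) -> \bar R}) : Prop :=
  (K setT < +oo)%E /\
  forall f : Om * R -> \bar R, measurable_fun setT f -> (forall p, (0 <= f p)%E) ->
    measurable_fun setT (fun w => bracket_int T A w (fun t => f (w, t))) /\
    (\int[K]_p f p = \int[P]_w bracket_int T A w (fun t => f (w, t)))%E.

Lemma bracketK_exists : P.-integrable setT (fun w => (A w T)%:E) ->
  exists K, is_bracketK K.
Proof.
move=> iA; exists (mkprod P (k := bracket_ker) bracket_kernel_fin); split.
  have -> : mkprod P (k := bracket_ker) bracket_kernel_fin setT = (\int[P]_w (A w T)%:E)%E.
    apply: eq_integral => w _; rewrite -bracket_kernel_setT.
    apply: (congr1 (bracket_kernel w)).
    by apply/seteqP; split => // t _; rewrite /xsection /=; exact: mem_set.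
  apply: (@le_lt_trans _ _ (\int[P]_w `|(A w T)%:E|)%E); last by case/integrableP: iA.
  apply: ge0_le_integral => //.
  - by move=> w _; rewrite -bracket_kernel_setT.
  - by apply/measurable_EFinP; apply: mA; rewrite lexx ltW.
  - by do 2 apply: measurableT_comp => //; apply: mA; rewrite lexx ltW.
  - by move=> w _; rewrite lee_fin ler_norm.
move=> f mf f0.
have E w : bracket_int T A w (fun t => f (w, t)) = (\int[bracket_ker w]_t f (w, t))%E.
  by apply: bracket_intE => //; exact: (measurableT_comp mf (measurable_pair1 w)).
have [m1 m2] := kprod_integral P bracket_kernel_fin mf f0.
split; first by under eq_fun do rewrite E.
by under [RHS]eq_integral do rewrite E.
Qed.

End BracketKernel.

(** * Products of martingale increments *)

Section Increments.
Context {d} {Om : measurableType d} {R : realType} (P : probability Om R).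
Variables (Ft : R -> set (set Om)) (T : R).
Hypothesis HF : filtration Ft T.
Implicit Types M B : Om -> R -> R.

Definition bounded_rv (X : Om -> R) : Prop := exists C, forall w, `|X w| <= C.

Lemma bounded_rvM X X' : bounded_rv X -> bounded_rv X' -> bounded_rv (fun w => X w * X' w).
Proof.
move=> [C XC] [C' XC']; exists (C * C') => w; rewrite normrM.
by apply: ler_pM.
Qed.

Lemma sqint_boundedM X f : bounded_rv X -> measurable_fun setT X -> sqint P f ->
  sqint P (fun w => X w * f w).
Proof.
move=> [C XC] mX f2; apply: (sqint_le _ _ (sqintZ C f2)).
  by apply: measurable_funM => //; exact: f2.1.
move=> w; rewrite !normrM ler_wpM2r//.
exact: le_trans (XC w) (ler_norm _).
Qed.

Lemma integrable_boundedM X f : bounded_rv X -> measurable_fun setT X ->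
  P.-integrable setT (EFin \o f) -> P.-integrable setT (EFin \o (fun w => X w * f w)).
Proof.
move=> [C XC] mX f1.
apply: (le_integrable measurableT _ _ (integrableZl measurableT C f1)).
  apply/measurable_EFinP/measurable_funM => //.
  by apply/measurable_EFinP; exact: measurable_int f1.
move=> w _; rewrite /= lee_fin !normrM ler_wpM2r//.
exact: le_trans (XC w) (ler_norm _).
Qed.

(** The product of the increments is the increment of [M * M'] minus [M p * (M' q - M' p)] and its
    mirror image, and these two terms have mean zero against [Y]. The increment of [M * M' - B] has
    mean zero as well, which leaves that of [B]. *)
Lemma ip_increment M M' B Y p q : wmartingale P Ft T M -> wmartingale P Ft T M' ->
  martingale P Ft T (fun w t => M w t * M' w t - B w t) ->
  (forall t, 0 <= t <= T -> P.-integrable setT (fun w => (B w t)%:E)) ->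
  0 <= p -> p <= q -> q <= T -> mfunG (Ft p) Y -> bounded_rv Y ->
  ip P (fun w => Y w * (M w q - M w p)) (fun w => M' w q - M' w p) =
  \int[P]_w (Y w * (B w q - B w p)).
Proof.
move=> wM wM' [aN iN mN] iB p0 pq qT mY bY.
have pT : 0 <= p <= T by rewrite p0 (le_trans pq).
have qT' : 0 <= q <= T by rewrite qT (le_trans p0).
have [aM M2 _] := wM; have [aM' M2' _] := wM'.
have mY' := mfunFt_measurable HF pT mY.
pose N w t := M w t * M' w t - B w t.
have iB' t : 0 <= t <= T -> P.-integrable setT (EFin \o (fun w => B w t)) by exact: iB.
have iN' t : 0 <= t <= T -> P.-integrable setT (EFin \o (fun w => N w t)) by exact: iN.
have dN1 : P.-integrable setT (EFin \o (fun w => N w q - N w p)).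
  by apply: eq_integrable (integrableB measurableT (iN' q qT') (iN' p pT)).
have dB1 : P.-integrable setT (EFin \o (fun w => B w q - B w p)).
  by apply: eq_integrable (integrableB measurableT (iB' q qT') (iB' p pT)).
have YN0 : \int[P]_w (Y w * (N w q - N w p)) = 0.
  apply: (Rintegral_mfunG (Ft_measurable HF pT)) => //; last exact: integrable_boundedM.
    move=> A; rewrite (Ft_sigma HF pT) => FA; have mA := Ft_measurable HF pT FA.
    have iA t : 0 <= t <= T -> P.-integrable A (EFin \o (fun w => N w t)).
      by move=> tT; apply: (integrableS measurableT mA) => //; exact: iN'.
    rewrite RintegralB//; [|exact: iA..].
    by rewrite /Rintegral (mN p q)// subrr.
have YM2 : sqint P (fun w => Y w * M w p) by apply: sqint_boundedM => //; exact: M2.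
have YM2' : sqint P (fun w => Y w * M' w p) by apply: sqint_boundedM => //; exact: M2'.
have mYM : mfunG (Ft p) (fun w => Y w * M w p) by apply: measurable_funM => //; exact: aM.
have mYM' : mfunG (Ft p) (fun w => Y w * M' w p) by apply: measurable_funM => //; exact: aM'.
have o1 := wmartingale_orth HF wM' p0 pq qT mYM YM2.
have o2 := wmartingale_orth HF wM p0 pq qT mYM' YM2'.
have dM2 := sqintB (M2 q qT') (M2 p pT); have dM2' := sqintB (M2' q qT') (M2' p pT).
transitivity (\int[P]_w (Y w * (N w q - N w p) + Y w * (B w q - B w p)) -
   ip P (fun w => Y w * M w p) (fun w => M' w q - M' w p) -
   ip P (fun w => Y w * M' w p) (fun w => M w q - M w p)).
  rewrite /ip -RintegralB//; last 2 first.
  - apply: eq_integrable (integrableD measurableT (integrable_boundedM bY mY' dN1)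
      (integrable_boundedM bY mY' dB1)) => //.
  - exact: sqint_mul.
  rewrite -RintegralB//; last 2 first.
  - apply: eq_integrable (integrableB measurableT (integrableD measurableT
      (integrable_boundedM bY mY' dN1) (integrable_boundedM bY mY' dB1))
      (sqint_mul YM2 dM2')) => //.
  - exact: sqint_mul.
  by apply: eq_Rintegral => w _; rewrite /N; ring.
rewrite o1 o2 !subr0 RintegralD//; [|exact: integrable_boundedM..].
by rewrite YN0 add0r.
Qed.

(** The intervals are cut at each other's endpoints; increments over disjoint intervals are
    orthogonal, so only the overlap contributes. Writing its right end as
    [Num.max a' (Num.min b b')] makes the increment of [B] vanish when the overlap is empty. *)
Lemma ip_increments_le M M' B X X' a b a' b' :
  wmartingale P Ft T M -> wmartingale P Ft T M' ->
  martingale P Ft T (fun w t => M w t * M' w t - B w t) ->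
  (forall t, 0 <= t <= T -> P.-integrable setT (fun w => (B w t)%:E)) ->
  0 <= a -> a <= b -> b <= T -> a <= a' -> a' <= b' -> b' <= T ->
  mfunG (Ft a) X -> bounded_rv X -> mfunG (Ft a') X' -> bounded_rv X' ->
  ip P (fun w => X w * (M w b - M w a)) (fun w => X' w * (M' w b' - M' w a')) =
  \int[P]_w (X w * X' w * (B w (Num.max a' (Num.min b b')) - B w a')).
Proof.
move=> wM wM' mN iB a0 ab bT aa' ab' bT' mX bX mX' bX'.
have a0' : 0 <= a' by exact: le_trans aa'.
have aT' : a' <= T by exact: le_trans bT'.
have aT2 : 0 <= a' <= T by rewrite a0'.
have bT2 : 0 <= b <= T by rewrite bT (le_trans a0).
have bT2' : 0 <= b' <= T by rewrite bT' (le_trans a0').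
have aT3 : 0 <= a <= T by rewrite a0 (le_trans ab).
have [aM M2 _] := wM; have [aM' M2' _] := wM'.
pose Y w := X w * X' w.
have mXa : mfunG (Ft a') X by exact: (mfunFt_le HF a0 aa' aT' mX).
have mY : mfunG (Ft a') Y by exact: measurable_funM.
have bY : bounded_rv Y by exact: bounded_rvM.
have mY' := mfunFt_measurable HF aT2 mY.
have dM2' s t : 0 <= s <= T -> 0 <= t <= T -> sqint P (fun w => M' w t - M' w s).
  by move=> sT tT; apply: sqintB; exact: M2'.
have YdM s t : 0 <= s <= T -> 0 <= t <= T -> sqint P (fun w => Y w * (M w t - M w s)).
  by move=> sT tT; apply: sqint_boundedM => //; apply: sqintB; exact: M2.
have YdM' s t : 0 <= s <= T -> 0 <= t <= T -> sqint P (fun w => Y w * (M' w t - M' w s)).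
  by move=> sT tT; apply: sqint_boundedM => //; apply: sqintB; exact: M2'.
have mYdM s t u : 0 <= s -> s <= t -> t <= u -> a' <= u -> u <= T ->
    mfunG (Ft u) (fun w => Y w * (M w t - M w s)).
  move=> s0 st tu au uT; have t0 := le_trans s0 st.
  apply: measurable_funM; first exact: (mfunFt_le HF a0' au uT mY).
  apply: measurable_funB.
    by apply: (mfunFt_le HF t0 tu uT); apply: aM; rewrite t0 (le_trans tu).
  apply: (mfunFt_le HF s0 (le_trans st tu) uT); apply: aM.
  by rewrite s0 (le_trans st)// (le_trans tu).
have mYdM' s t u : 0 <= s -> s <= t -> t <= u -> a' <= u -> u <= T ->
    mfunG (Ft u) (fun w => Y w * (M' w t - M' w s)).
  move=> s0 st tu au uT; have t0 := le_trans s0 st.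
  apply: measurable_funM; first exact: (mfunFt_le HF a0' au uT mY).
  apply: measurable_funB.
    by apply: (mfunFt_le HF t0 tu uT); apply: aM'; rewrite t0 (le_trans tu).
  apply: (mfunFt_le HF s0 (le_trans st tu) uT); apply: aM'.
  by rewrite s0 (le_trans st)// (le_trans tu).
transitivity (ip P (fun w => Y w * (M w b - M w a)) (fun w => M' w b' - M' w a')).
  by apply: eq_Rintegral => w _; rewrite /Y; ring.
have [ba|ba] := leP b a'.
  have -> : Num.max a' (Num.min b b') = a' by rewrite max_l// ge_min ba.
  under [RHS]eq_Rintegral do rewrite subrr mulr0.
  rewrite Rintegral_cst// mul0r.
  by apply: (wmartingale_orth HF wM') => //; [exact: mYdM|exact: YdM].
have ba' := ltW ba.
have -> : ip P (fun w => Y w * (M w b - M w a)) (fun w => M' w b' - M' w a') =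
    ip P (fun w => Y w * (M w b - M w a')) (fun w => M' w b' - M' w a').
  have o : ip P (fun w => Y w * (M w a' - M w a)) (fun w => M' w b' - M' w a') = 0.
    by apply: (wmartingale_orth HF wM') => //; [exact: mYdM|exact: YdM].
  rewrite -[RHS]add0r -o -ipDl//; [|exact: YdM|exact: YdM|exact: dM2'].
  by apply: eq_Rintegral => w _; ring.
have [bb|bb] := leP b b'.
  rewrite (max_r ba') -(ip_increment wM wM' mN iB a0' ba' bT mY bY).
  have o : ip P (fun w => Y w * (M w b - M w a')) (fun w => M' w b' - M' w b) = 0.
    by apply: (wmartingale_orth HF wM') => //;
      [case/andP: bT2|exact: mYdM|exact: YdM].
  rewrite -[RHS]addr0 -o -ipDr//; [|exact: dM2'|exact: dM2'|exact: YdM].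
  by apply: eq_Rintegral => w _; ring.
rewrite (max_r ab') -(ip_increment wM wM' mN iB a0' ab' bT' mY bY).
have o : ip P (fun w => Y w * (M' w b' - M' w a')) (fun w => M w b - M w b') = 0.
  by apply: (wmartingale_orth HF wM) => //;
    [case/andP: bT2'|exact: ltW|exact: mYdM'|exact: YdM'].
have -> : ip P (fun w => Y w * (M w b - M w a')) (fun w => M' w b' - M' w a') =
   ip P (fun w => Y w * (M w b' - M w a')) (fun w => M' w b' - M' w a') +
   ip P (fun w => Y w * (M w b - M w b')) (fun w => M' w b' - M' w a').
  rewrite -ipDl//; [|exact: YdM|exact: YdM|exact: dM2'].
  by apply: eq_Rintegral => w _; ring.
rewrite -[RHS]addr0 -o; congr (_ + _).
by apply: eq_Rintegral => w _; ring.
Qed.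

Lemma ip_increments M M' B X X' a b a' b' :
  wmartingale P Ft T M -> wmartingale P Ft T M' ->
  martingale P Ft T (fun w t => M w t * M' w t - B w t) ->
  (forall t, 0 <= t <= T -> P.-integrable setT (fun w => (B w t)%:E)) ->
  0 <= a -> a <= b -> b <= T -> 0 <= a' -> a' <= b' -> b' <= T ->
  mfunG (Ft a) X -> bounded_rv X -> mfunG (Ft a') X' -> bounded_rv X' ->
  let p := Num.max a a' in
  ip P (fun w => X w * (M w b - M w a)) (fun w => X' w * (M' w b' - M' w a')) =
  \int[P]_w (X w * X' w * (B w (Num.max p (Num.min b b')) - B w p)).
Proof.
move=> wM wM' mN iB a0 ab bT a0' ab' bT' mX bX mX' bX' /=.
have [aa|aa] := leP a a'; first exact: ip_increments_le.
rewrite ipC [Num.min b b']minC.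
have mN' : martingale P Ft T (fun w t => M' w t * M w t - B w t).
  by under eq_fun do under eq_fun do rewrite mulrC.
rewrite (ip_increments_le wM' wM mN' iB a0' ab' bT' (ltW aa) ab bT mX' bX' mX bX).
by apply: eq_Rintegral => w _; rewrite [X w * _]mulrC.
Qed.

End Increments.

Local Notation oc p q := (indic `]p, q]%classic).

Lemma indic_mul {U : Type} {R : realType} (A B : set U) t :
  \1_A t * \1_B t = \1_(A `&` B) t :> R.
Proof. by rewrite indicI. Qed.

(** * Isometry of the stochastic integral *)

Section SimpleIsometry.
Context {d} {Om : measurableType d} {R : realType} (P : probability Om R).
Variables (Ft : R -> set (set Om)) (T : R).
Hypothesis HF : filtration Ft T.
Hypothesis T0 : 0 < T.

Lemma simple_int_increment H (M : Om -> R -> R) s w : simple_predictable Ft T H ->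
  0 <= s <= T -> simple_int H M w T - simple_int H M w s =
  \sum_(k < sp_size H) sp_coef H k w *
    (M w (Num.max (sp_right H k) s) - M w (Num.max (sp_left H k) s)).
Proof.
move=> sH /andP[s0 sT]; rewrite /simple_int -sumrB; apply: eq_bigr => k _.
have [l0 lr rT _ _] := sH k (ltn_ord k).
rewrite -mulrBr; congr (_ * _).
rewrite (min_l rT) (min_l (le_trans (ltW lr) rT)).
have [ls|ls] := leP (sp_left H k) s; have [rs|rs] := leP (sp_right H k) s; try ring.
Qed.

Section Pair.
Variables (M M' : Om -> R -> R) (B : Om -> R -> R).
Hypothesis wM : wmartingale P Ft T M.
Hypothesis wM' : wmartingale P Ft T M'.
Hypothesis mN : martingale P Ft T (fun w t => M w t * M' w t - B w t).
Hypothesis iB : forall t, 0 <= t <= T -> P.-integrable setT (fun w => (B w t)%:E).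

Let coefP H s : simple_predictable Ft T H -> 0 <= s <= T -> forall k : 'I_(sp_size H),
  [/\ 0 <= Num.max (sp_left H k) s <= T,
   Num.max (sp_left H k) s <= Num.max (sp_right H k) s,
   Num.max (sp_right H k) s <= T,
   mfunG (Ft (Num.max (sp_left H k) s)) (sp_coef H k) & bounded_rv (sp_coef H k)].
Proof.
move=> sH /andP[s0 sT] k; have [l0 lr rT mc bc] := sH k (ltn_ord k).
have lT := le_trans (ltW lr) rT.
have ls0 : 0 <= Num.max (sp_left H k) s by rewrite le_max l0.
have lsT : Num.max (sp_left H k) s <= T by rewrite ge_max lT.
split; [by rewrite ls0| |by rewrite ge_max rT| |exact: bc].
  by rewrite ge_max !le_max (ltW lr) lexx orbT.
by apply: (mfunFt_le HF l0 _ lsT mc); rewrite le_max lexx.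
Qed.

Lemma simple_increment_sqint H (N : Om -> R -> R) s : simple_predictable Ft T H ->
  wmartingale P Ft T N -> 0 <= s <= T -> forall k : 'I_(sp_size H),
  sqint P (fun w => sp_coef H k w *
    (N w (Num.max (sp_right H k) s) - N w (Num.max (sp_left H k) s))).
Proof.
move=> sH [_ N2 _] sT k; have [lT lr rT mc bc] := coefP sH sT k.
apply: sqint_boundedM => //; first exact: (mfunFt_measurable HF lT mc).
by apply: sqintB; apply: N2 => //; rewrite rT andbT (le_trans _ lr)//; case/andP: lT.
Qed.

Lemma simple_int_sqint H (N : Om -> R -> R) s : simple_predictable Ft T H ->
  wmartingale P Ft T N -> 0 <= s <= T ->
  sqint P (fun w => simple_int H N w T - simple_int H N w s).
Proof.
move=> sH wN sT; under eq_fun do rewrite (simple_int_increment N _ sH sT).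
by apply: sqint_sum => k _; exact: simple_increment_sqint.
Qed.

(** [B] is left general: the bracket of one martingale leads to the isometry, and [B = 0] to the
    orthogonality of integrals against two different martingales of the basis. *)
Lemma ip_simple_int H H' s : simple_predictable Ft T H -> simple_predictable Ft T H' ->
  0 <= s <= T ->
  ip P (fun w => simple_int H M w T - simple_int H M w s)
       (fun w => simple_int H' M' w T - simple_int H' M' w s) =
  \sum_(j < sp_size H) \sum_(k < sp_size H')
    let p := Num.max (Num.max (sp_left H j) s) (Num.max (sp_left H' k) s) in
    let q := Num.min (Num.max (sp_right H j) s) (Num.max (sp_right H' k) s) in
    \int[P]_w (sp_coef H j w * sp_coef H' k w * (B w (Num.max p q) - B w p)).
Proof.
move=> sH sH' sT.
under [X in ip P X _]eq_fun do rewrite (simple_int_increment M _ sH sT).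
under [X in ip P _ X]eq_fun do rewrite (simple_int_increment M' _ sH' sT).
have s2 := simple_increment_sqint sH wM sT.
have s2' := simple_increment_sqint sH' wM' sT.
rewrite ip_suml; [|by move=> k _; exact: s2|by apply: sqint_sum => k _; exact: s2'].
apply: eq_bigr => j _; rewrite ipC.
rewrite ip_suml; [|by move=> k _; exact: s2'|exact: s2].
apply: eq_bigr => k _; rewrite ipC /=.
have [/andP[l0 _] lr rT mc bc] := coefP sH sT j.
have [/andP[l0' _] lr' rT' mc' bc'] := coefP sH' sT k.
exact: (ip_increments HF wM wM' mN iB).
Qed.

End Pair.

Section Bracket.
Variable A : Om -> cumulative R R.
Hypothesis A0 : forall w t, t <= 0 -> A w t = 0.
Hypothesis mA : forall t, 0 <= t <= T -> measurable_fun setT (fun w => A w t).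
Hypothesis iA : forall t, 0 <= t <= T -> P.-integrable setT (fun w => (A w t)%:E).
Variable K : {measure set (Om * R) -> \bar R}.
Hypothesis HK : is_bracketK P T A K.

Definition strip (s : R) (t : R) : R := oc s T t.

Lemma measurable_rect (X : Om -> R) p q : measurable_fun setT X ->
  measurable_fun setT (fun z : Om * R => X z.1 * oc p q z.2 : R).
Proof.
move=> mX; apply: measurable_funM; first exact: (measurableT_comp mX).
have mi : measurable_fun setT (oc p q : R -> R) by exact: measurable_indic.
exact: (measurableT_comp mi measurable_snd).
Qed.

Let rect_ge0 (X : Om -> R) p q : (forall w, 0 <= X w) -> measurable_fun setT X ->
  0 <= p -> p <= q -> q <= T ->
  (\int[K]_z (X z.1 * oc p q z.2)%:E =
   \int[P]_w (X w * (A w q - A w p))%:E)%E.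
Proof.
move=> X0 mX p0 pq qT.
have [_ KE] := HK.
have [|z|_ ->] := KE (fun z => (X z.1 * oc p q z.2)%:E).
- by apply/measurable_EFinP; exact: measurable_rect.
- by rewrite lee_fin mulr_ge0// indicE.
apply: eq_integral => w _ /=.
have mi : measurable_fun setT (fun t => (oc p q t)%:E : \bar R).
  by apply/measurable_EFinP; exact: measurable_indic.
rewrite (bracket_intE); last 2 first.
- apply/measurable_EFinP; apply: measurable_funM => //.
- by move=> t; rewrite lee_fin mulr_ge0// indicE.
under eq_integral do rewrite EFinM.
rewrite ge0_integralZl_EFin//.
by rewrite integral_indic// setIT EFinM bracket_kernel_oc.
Qed.

(** [is_bracketK] speaks of nonnegative integrands only, so a signed coefficient is split into its
    positive and negative parts, both bounded. *)
Lemma bracketK_rect (X : Om -> R) p q : bounded_rv X -> measurable_fun setT X ->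
  0 <= p -> p <= q -> q <= T ->
  \int[K]_z (X z.1 * oc p q z.2) =
  \int[P]_w (X w * (A w q - A w p)).
Proof.
move=> [C XC] mX p0 pq qT.
have pT : 0 <= p <= T by rewrite p0 (le_trans pq).
have qT' : 0 <= q <= T by rewrite qT (le_trans p0).
pose Xp w := Num.max (X w) 0; pose Xn w := Num.max (- X w) 0.
have XE w : X w = Xp w - Xn w.
  rewrite /Xp /Xn; case: (lerP 0 (X w)) => hx; first by rewrite max_r ?subr0// oppr_le0.
  by rewrite max_l ?sub0r ?opprK// oppr_ge0 ltW.
have Xp0 w : 0 <= Xp w by rewrite le_max lexx orbT.
have Xn0 w : 0 <= Xn w by rewrite le_max lexx orbT.
have mXp : measurable_fun setT Xp by exact: measurable_maxr.
have mXn : measurable_fun setT Xn.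
  by apply: measurable_maxr => //; exact: measurable_funN.
have bXp w : `|Xp w| <= C.
  rewrite ger0_norm// ge_max (le_trans (ler_norm _))//=.
  exact: le_trans (normr_ge0 _) (XC w).
have bXn w : `|Xn w| <= C.
  rewrite ger0_norm// ge_max (le_trans (ler_norm _)) ?normrN//=.
  exact: le_trans (normr_ge0 _) (XC w).
have iA' t : 0 <= t <= T -> P.-integrable setT (EFin \o (fun w => A w t)) by exact: iA.
have dA : P.-integrable setT (EFin \o (fun w => A w q - A w p)).
  by apply: eq_integrable (integrableB measurableT (iA' q qT') (iA' p pT)).
have iK (Y : Om -> R) : measurable_fun setT Y -> (forall w, `|Y w| <= C) ->
    K.-integrable setT (EFin \o (fun z : Om * R => Y z.1 * oc p q z.2)).
  move=> mY bY; apply: (sqint_integrable HK.1); apply: (sqint_bounded (C := C) HK.1).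
    exact: measurable_rect.
  move=> z; rewrite normrM indicE; case: (_ \in _); rewrite ?normr1 ?mulr1//.
  by rewrite normr0 mulr0 (le_trans _ (bY z.1)).
transitivity (\int[K]_z (Xp z.1 * oc p q z.2) -
    \int[K]_z (Xn z.1 * oc p q z.2)).
  rewrite -RintegralB//; [|exact: iK|exact: iK].
  by apply: eq_Rintegral => z _; rewrite XE mulrBl.
have bp : bounded_rv Xp by exists C.
have bn : bounded_rv Xn by exists C.
transitivity (\int[P]_w (Xp w * (A w q - A w p)) - \int[P]_w (Xn w * (A w q - A w p))).
  by congr (_ - _); congr fine; exact: rect_ge0.
rewrite -RintegralB//; [|exact: integrable_boundedM|exact: integrable_boundedM].
by apply: eq_Rintegral => w _; rewrite XE; ring.
Qed.

Lemma simple_val_strip H s w t : simple_predictable Ft T H -> 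
  simple_val H w t * strip s t = \sum_(k < sp_size H) sp_coef H k w *
    oc (Num.max (sp_left H k) s) (Num.max (sp_right H k) s) t.
Proof.
move=> sH; rewrite /simple_val mulr_suml; apply: eq_bigr => k _.
have [l0 lr rT _ _] := sH k (ltn_ord k).
rewrite -mulrA; congr (_ * _); rewrite /strip indic_mul; congr (indic _ _).
apply/seteqP; split => u /=; rewrite !in_itv /= gt_max le_max.
  by move=> [/andP[-> ur] /andP[-> _]]; rewrite ur.
move=> /andP[/andP[-> su] /orP[ur|us]]; first by rewrite ur su (le_trans ur).
by move: su; rewrite ltNge us.
Qed.

Lemma simple_val_sqint H s : simple_predictable Ft T H ->
  sqint K (fun z => simple_val H z.1 z.2 * strip s z.2).
Proof.
move=> sH; under eq_fun do rewrite (simple_val_strip _ _ _ sH).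
apply: sqint_sum => k _; have [l0 lr rT mc [C bC]] := sH k (ltn_ord k).
apply: (sqint_bounded (C := C) HK.1).
  apply: measurable_rect; apply: (mfunFt_measurable HF _ mc).
  by rewrite l0 (le_trans (ltW lr)).
move=> z; rewrite normrM indicE; case: (_ \in _); rewrite ?normr1 ?mulr1//.
by rewrite normr0 mulr0 (le_trans _ (bC z.1)).
Qed.

(** Both sides expand into the same double sum: on the left the bracket increment over the overlap
    of two clamped intervals, on the right the product of their indicators, which is the indicator
    of that overlap. *)
Lemma simple_isometry (M : Om -> R -> R) H H' s : wmartingale P Ft T M ->
  martingale P Ft T (fun w t => M w t * M w t - A w t) ->
  simple_predictable Ft T H -> simple_predictable Ft T H' -> 0 <= s <= T ->
  ip P (fun w => simple_int H M w T - simple_int H M w s)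
       (fun w => simple_int H' M w T - simple_int H' M w s) =
  ip K (fun z => simple_val H z.1 z.2 * strip s z.2)
       (fun z => simple_val H' z.1 z.2 * strip s z.2).
Proof.
move=> wM mN sH sH' sT; rewrite (ip_simple_int wM wM mN iA sH sH' sT).
have VE G (sG : simple_predictable Ft T G) : (fun z => simple_val G z.1 z.2 * strip s z.2) =
  (fun z => \sum_(k < sp_size G) sp_coef G k z.1 *
    oc (Num.max (sp_left G k) s) (Num.max (sp_right G k) s) z.2).
  by apply/funext => z; exact: simple_val_strip.
have V2 G (sG : simple_predictable Ft T G) (k : 'I_(sp_size G)) : sqint K (fun z => sp_coef G k z.1 *
    oc (Num.max (sp_left G k) s) (Num.max (sp_right G k) s) z.2).
  have [l0 lr rT mc [C bC]] := sG k (ltn_ord k).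
  apply: (sqint_bounded (C := C) HK.1).
    apply: measurable_rect; apply: (mfunFt_measurable HF _ mc).
    by rewrite l0 (le_trans (ltW lr)).
  move=> z; rewrite normrM indicE; case: (_ \in _); rewrite ?normr1 ?mulr1//.
  by rewrite normr0 mulr0 (le_trans _ (bC z.1)).
rewrite (VE _ sH) (VE _ sH').
rewrite ip_suml; [|by move=> k _; exact: V2|by apply: sqint_sum => k _; exact: V2].
apply: eq_bigr => j _; rewrite ipC ip_suml; [|by move=> k _; exact: V2|exact: V2].
apply: eq_bigr => k _; rewrite ipC /=.
pose p := Num.max (Num.max (sp_left H j) s) (Num.max (sp_left H' k) s).
pose q := Num.max p (Num.min (Num.max (sp_right H j) s) (Num.max (sp_right H' k) s)).
rewrite -/p -/q.
have [l0 lr rT mc bc] := sH j (ltn_ord j).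
have [l0' lr' rT' mc' bc'] := sH' k (ltn_ord k).
case/andP: sT => s0 sT.
have pT : p <= T by rewrite !ge_max sT (le_trans (ltW lr) rT) (le_trans (ltW lr') rT').
have qT : q <= T by rewrite ge_max pT ge_min ge_max rT sT.
rewrite -(@bracketK_rect (fun w => sp_coef H j w * sp_coef H' k w)); last 5 first.
- exact: bounded_rvM.
- apply: measurable_funM; [apply: (mfunFt_measurable HF _ mc)|apply: (mfunFt_measurable HF _ mc')].
    by rewrite l0 (le_trans (ltW lr)).
  by rewrite l0' (le_trans (ltW lr')).
- by rewrite !le_max s0 !orbT.
- by rewrite le_max lexx.
- exact: qT.
apply: eq_Rintegral => z _; rewrite mulrACA; congr (_ * _).
rewrite indic_mul; congr (indic _ _); apply/seteqP; split => u /=.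
  rewrite !in_itv /= => /andP[pu]; move: (pu); rewrite {1}/p gt_max => /andP[-> ->] /=.
  rewrite /q le_max => /orP[up|]; last by rewrite le_min => /andP[-> ->].
  by move: pu; rewrite ltNge up.
rewrite !in_itv /= => -[/andP[u1 u2] /andP[u3 u4]].
by rewrite /q /p gt_max u1 u3 /= le_max le_min u2 u4 orbT.
Qed.

End Bracket.

End SimpleIsometry.

(** * Passage to general integrands *)

Section StochInt.
Context {d} {Om : measurableType d} {R : realType} (P : probability Om R).
Variables (Ft : R -> set (set Om)) (T : R).
Hypothesis HF : filtration Ft T.
Hypothesis T0 : 0 < T.

Lemma nrm_ecvg {d'} {X : measurableType d'} (m : {measure set X -> \bar R})
    (fn : nat -> X -> R) : (forall n, sqint m (fn n)) ->
  (\int[m]_x (fn n x ^+ 2)%:E)%E @[n --> \oo] --> 0%E ->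
  nrm m (fn n) @[n --> \oo] --> 0.
Proof.
move=> f2 h; rewrite -[X in _ --> X]sqrtr0.
apply: (@continuous_cvg _ _ _ _ _ (fun n => ip m (fn n) (fn n)) (@Num.sqrt R) 0); first exact: sqrt_continuous.
have : (ip m (fn n) (fn n))%:E @[n --> \oo] --> (0 : R)%:E.
  by apply: cvg_trans h; apply: near_eq_cvg; near=> n; rewrite ipE.
by move/fine_cvg.
Unshelve. all: by end_near. Qed.

Lemma nrmB {d'} {X : measurableType d'} (m : {measure set X -> \bar R}) (f g : X -> R) :
  sqint m f -> sqint m g -> nrm m (fun x => f x - g x) <= nrm m f + nrm m g.
Proof.
move=> f2 g2; have := nrmD f2 (sqintN g2); move=> /le_trans; apply.
by rewrite lerD2l /nrm /ip; under eq_Rintegral do rewrite mulrNN.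
Qed.

Lemma nrm_cvg_le {d'} {X : measurableType d'} (m : {measure set X -> \bar R})
    (fn gn : nat -> X -> R) : (forall n, measurable_fun setT (fn n)) ->
  (forall n, sqint m (gn n)) -> (forall n x, `|fn n x| <= `|gn n x|) ->
  nrm m (gn n) @[n --> \oo] --> 0 -> nrm m (fn n) @[n --> \oo] --> 0.
Proof.
move=> mf g2 fg h.
apply: (@squeeze_cvgr _ _ _ _ (fun=> 0) (fun n => nrm m (gn n))) => //; last exact: cvg_cst.
near=> n; rewrite sqrtr_ge0/=; apply: ler_wsqrtr.
have f2 : sqint m (fn n) by apply: sqint_le (g2 n).
rewrite -lee_fin !ipE//; apply: ge0_le_integral => //.
- by move=> x _; rewrite lee_fin sqr_ge0.
- exact/measurable_EFinP/measurable_funX.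
- by apply/measurable_EFinP; apply: measurable_funX; case: (g2 n).
- by move=> x _; rewrite lee_fin -real_normK ?num_real// -[leRHS]real_normK ?num_real// ler_pXn2r ?nnegrE.
Unshelve. all: by end_near. Qed.

Lemma predictable_rect_measurable : predictable_rectangles Ft T `<=` measurable.
Proof.
move=> C [[A A0 ->]|[A [s [t [s0 st tT As ->]]]]]; apply: measurableX => //.
  by apply: (Ft_measurable HF _ A0); rewrite lexx ltW.
by apply: (Ft_measurable HF _ As); rewrite s0 (le_trans (ltW st)).
Qed.


Lemma measurable_horizon : measurable (@horizon _ Om R Ft T).
Proof.
have -> : @horizon _ Om R Ft T = ((setT `*` [set 0]) `|` (setT `*` `]0, T]))%classic.
  apply/seteqP; split => -[w t].
    rewrite /horizon/= in_itv/= => -[_ /andP[t0 tT]]; have [->|t0'] := eqVneq t 0; first by left.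
    by right; split => //; rewrite /= in_itv/= tT lt_neqAle eq_sym t0' t0.
  move=> [[_ /= ->]|[_]]; first by split; rewrite //= in_itv/= lexx ltW.
  by rewrite /= in_itv/= => /andP[/ltW t0 tT]; split; rewrite //= in_itv/= t0.
have sT t : 0 <= t <= T -> Ft t setT.
  move=> tT; have [/(_ t tT)[F0 FD _] _ _] := HF.
  by rewrite -(setD0 setT); exact: FD.
apply: measurableU; apply: sub_sigma_algebra.
  by left; exists setT => //; apply: sT; rewrite lexx ltW.
by right; exists setT, 0, T; split => //; apply: sT; rewrite lexx ltW.
Qed.

Lemma predictable_measurable {d'} {E : measurableType d'} (Z : Om -> R -> E) :
  predictable Ft T Z ->
  measurable_fun (setT `*` `[0, T])%classic (fun z : Om * R => Z z.1 z.2).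
Proof.
move=> pZ.
have mi := measurable_idG predictable_rect_measurable.
have mi' : measurable_fun (setT `*` `[0, T])%classic
    (idfun : Om * R -> g_sigma_algebraType (predictable_rectangles Ft T)).
  exact: (measurable_funS measurableT _ mi).
have sub : [set (idfun z : g_sigma_algebraType (predictable_rectangles Ft T)) |
    z in (setT `*` `[0, T])%classic] `<=` @horizon _ Om R Ft T.
  by move=> z [y hy <-].
exact: (measurable_comp measurable_horizon sub pZ mi').
Qed.

Lemma predictable_strip_measurable (Z : Om -> R -> R) s : 0 <= s ->
  predictable Ft T Z ->
  measurable_fun setT (fun z : Om * R => Z z.1 z.2 * strip T s z.2).
Proof.
move=> s0 /predictable_measurable mZ.
have mD : measurable ((setT `*` `[0, T])%classic : set (Om * R)) by exact: measurableX.
have := mZ; 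
  rewrite -[X in measurable_fun X]setTI => /(measurable_restrict _ mD measurableT) mr.
have -> : (fun z : Om * R => Z z.1 z.2 * strip T s z.2) =
   (fun z : Om * R => ((fun z => Z z.1 z.2) \_ (setT `*` `[0, T])%classic) z * strip T s z.2).
  apply/funext => z; rewrite /strip indicE; case: (boolP (z.2 \in (`]s, T]%classic : set R))) => [/set_mem|_]; last by rewrite !mulr0.
  rewrite /= in_itv/= => /andP[sz zT]; rewrite patchE mem_set//.
  by split => //=; rewrite in_itv/= zT (le_trans s0 (ltW sz)).
apply: measurable_funM => //.
have mi : measurable_fun setT (strip T s) by exact: measurable_indic.
exact: (measurableT_comp mi measurable_snd).
Qed.

Lemma strip_le (Z : Om -> R -> R) s z : 0 <= s ->
  `|Z z.1 z.2 * strip T s z.2| <= `|Z z.1 z.2 * \1_(`[0, T]%classic) z.2|.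
Proof.
move=> s0; rewrite !normrM ler_wpM2l// /strip !indicE.
case: (boolP (z.2 \in (`]s, T]%classic : set R))) => [/set_mem|_]; last by rewrite /= normr0.
rewrite /= in_itv/= => /andP[sz zT]; rewrite mem_set//= in_itv/= zT.
by rewrite (le_trans s0 (ltW sz)).
Qed.

Section OneBracket.
Variables (A : Om -> cumulative R R) (K : {measure set (Om * R) -> \bar R}).
Hypothesis HK : is_bracketK P T A K.

(** Processes are constrained on [[0, T]] only. Cutting by the closed horizon gives a function
    measurable on the whole product, and [bracket_int], which integrates over [[0, T]], does not see
    the cut. *)
Definition onT (h : Om -> R -> R) (z : Om * R) : R := h z.1 z.2 * \1_(`[0, T]%classic) z.2.

Lemma onT_measurable h : measurable_fun (setT `*` `[0, T])%classic (fun z : Om * R => h z.1 z.2) ->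
  measurable_fun setT (onT h).
Proof.
have mD : measurable ((setT `*` `[0, T])%classic : set (Om * R)) by exact: measurableX.
move=> mZ; move: mZ; 
  rewrite -[X in measurable_fun X]setTI => /(measurable_restrict _ mD measurableT) mr.
have -> // : onT h = ((fun z => h z.1 z.2) \_ (setT `*` `[0, T])%classic).
apply/funext => z; rewrite /onT indicE patchE.
case: (boolP (z.2 \in (`[0, T]%classic : set R))) => zT.
  by rewrite mulr1 mem_set//; split => //; exact: set_mem zT.
by rewrite mulr0 memNset// => -[_] /= h2; move/negP: zT; apply; rewrite mem_set.
Qed.

Lemma bracketK_onT h : measurable_fun (setT `*` `[0, T])%classic (fun z : Om * R => h z.1 z.2) ->
  (\int[K]_z (onT h z ^+ 2)%:E =
   \int[P]_w bracket_int T A w (fun t => (h w t ^+ 2)%:E))%E.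
Proof.
move=> mh; have [_ /(_ (fun z => (onT h z ^+ 2)%:E))[||_ ->]] := HK.
- by apply/measurable_EFinP; apply: measurable_funX; exact: onT_measurable.
- by move=> z; rewrite lee_fin sqr_ge0.
apply: eq_integral => w _; apply: eq_integral => t tT.
by rewrite /onT indicE /= tT mulr1.
Qed.

Lemma stoch_int_sqint M Z I s : 0 <= s -> is_stoch_int P Ft T M A Z I ->
  sqint K (fun z => Z z.1 z.2 * strip T s z.2).
Proof.
move=> s0 [pZ Z2 _ _ _]; have mZ := predictable_measurable pZ.
have oT : sqint K (onT Z) by split; [exact: onT_measurable|rewrite bracketK_onT].
apply: sqint_le oT; first exact: predictable_strip_measurable.
by move=> z; exact: strip_le.
Qed.

(** The approximations in [is_stoch_int] converge at each time; subtracting the times [T] and [s]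
    gives the increment over []s, T]], while the same simple processes converge to [Z] on the strip.
    Isometry and orthogonality then follow by continuity of [ip]. *)
Lemma stoch_int_approx M Z I s : wmartingale P Ft T M ->
  is_stoch_int P Ft T M A Z I -> 0 <= s <= T -> exists H : nat -> simple_process,
  [/\ forall n, simple_predictable Ft T (H n),
      nrm K (fun z => simple_val (H n) z.1 z.2 * strip T s z.2 - Z z.1 z.2 * strip T s z.2)
        @[n --> \oo] --> 0
    & nrm P (fun w => (simple_int (H n) M w T - simple_int (H n) M w s) -
                      (I w T - I w s)) @[n --> \oo] --> 0].
Proof.
move=> wM sI sT; have /andP[s0 sT'] := sT.
have Zs2 := stoch_int_sqint s0 sI.
case: sI => pZ Z2 /(sq_martingale_wmartingale HF)[_ I2 _] I0 [H [sH HZ HI]].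
have mZ := predictable_measurable pZ.
have oT : sqint K (onT Z) by split; [exact: onT_measurable|rewrite bracketK_onT].
have sv n : sqint K (fun z => simple_val (H n) z.1 z.2 * strip T 0 z.2).
  exact: (simple_val_sqint HF HK _ (sH n)).
have sqle n z : `|(simple_val (H n) z.1 z.2 * strip T s z.2 - Z z.1 z.2 * strip T s z.2)| <=
    `|onT (fun w t => simple_val (H n) w t - Z w t) z|.
  by rewrite -mulrBl; exact: (strip_le (fun w t => simple_val (H n) w t - Z w t)).
have svT n : simple_val (H n) = (fun w t => simple_val (H n) w t * strip T 0 t).
  apply/funext => w; apply/funext => t; rewrite (simple_val_strip _ _ _ (sH n)).
  apply: eq_bigr => k _; have [l0 lr rT _ _] := sH n k (ltn_ord k).
  by rewrite !max_l// (le_trans l0 (ltW lr)).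
have osv n : onT (fun w t => simple_val (H n) w t - Z w t) =
    (fun z => simple_val (H n) z.1 z.2 * strip T 0 z.2 - onT Z z).
  apply/funext => z; rewrite /onT mulrBl [in LHS]svT -mulrA /strip indic_mul setIidl//.
  by move=> t /=; rewrite !in_itv/= => /andP[/ltW -> ->].
have o2 n : sqint K (onT (fun w t => simple_val (H n) w t - Z w t)).
  by rewrite osv; exact: sqintB.
have mv n : measurable_fun (setT `*` `[0, T])%classic
    (fun z : Om * R => simple_val (H n) z.1 z.2 - Z z.1 z.2).
  apply: measurable_funB => //; rewrite svT.
  by apply: (measurable_funS measurableT) => //; exact: (sv n).1.
have sv' n : sqint K (fun z => simple_val (H n) z.1 z.2 * strip T s z.2).
  exact: (simple_val_sqint HF HK _ (sH n)).
exists H; split => //.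
- apply: (nrm_cvg_le _ o2 sqle).
    by move=> n; have [] := sqintB (sv' n) Zs2.
  apply: nrm_ecvg => //; apply: cvg_trans HZ; apply: near_eq_cvg; near=> n.
  by rewrite bracketK_onT.
- have HsT := HI s sT.
  have T01 : 0 <= T <= T by rewrite lexx ltW.
  have HT := HI T T01.
  have J2 n t : 0 <= t <= T -> sqint P (fun w => simple_int (H n) M w t - I w t).
    move=> tT; apply: sqintB; last exact: I2.
    have [_ M2 _] := wM; apply: sqint_sum => k _.
    have [l0 lr rT mc bc] := sH n k (ltn_ord k).
    apply: sqint_boundedM => //.
      by apply: (mfunFt_measurable HF _ mc); rewrite l0 (le_trans (ltW lr)).
    have /andP[t0 tT'] := tT.
    by apply: sqintB; apply: M2; rewrite le_min ge_min t0 ?tT' ?orbT andbT ?l0 ?(le_trans l0 (ltW lr)).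
  have n1 := nrm_ecvg (fun n => J2 n _ T01) HT.
  have n2 := nrm_ecvg (fun n => J2 n _ sT) HsT.
  apply: (@squeeze_cvgr _ _ _ _ (fun=> 0) (fun n => nrm P (fun w => simple_int (H n) M w T - I w T) +
      nrm P (fun w => simple_int (H n) M w s - I w s))) => //; last 2 first.
  + exact: cvg_cst.
  + by rewrite -[X in _ --> X](addr0 0); apply: cvgD.
  near=> n; rewrite sqrtr_ge0/=.
  rewrite (_ : (fun w => _ - _) = (fun w => (simple_int (H n) M w T - I w T) -
      (simple_int (H n) M w s - I w s))); first by apply: nrmB; exact: J2.
  by apply/funext => w; ring.
Unshelve. all: by end_near. Qed.

(* Bilinear, so that differences of integrals need no separate treatment. *)
Lemma stoch_int_isometry M Z I Z' I' s : wmartingale P Ft T M ->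
  martingale P Ft T (fun w t => M w t * M w t - A w t) ->
  (forall t, 0 <= t <= T -> P.-integrable setT (fun w => (A w t)%:E)) ->
  is_stoch_int P Ft T M A Z I -> is_stoch_int P Ft T M A Z' I' -> 0 <= s <= T ->
  ip P (fun w => I w T - I w s) (fun w => I' w T - I' w s) =
  ip K (fun z => Z z.1 z.2 * strip T s z.2) (fun z => Z' z.1 z.2 * strip T s z.2).
Proof.
move=> wM mN iA hI hI' sT; have /andP[s0 _] := sT.
have [H [sH HZ HI]] := stoch_int_approx wM hI sT.
have [H' [sH' HZ' HI']] := stoch_int_approx wM hI' sT.
have T01 : 0 <= T <= T by rewrite lexx ltW.
have Z2 := stoch_int_sqint s0 hI; have Z2' := stoch_int_sqint s0 hI'.
have dI2 J W : is_stoch_int P Ft T M A W J -> sqint P (fun w => J w T - J w s).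
  by move=> [_ _ /(sq_martingale_wmartingale HF)[_ J2 _] _ _]; apply: sqintB; exact: J2.
have v2 G : simple_predictable Ft T G -> sqint K (fun z => simple_val G z.1 z.2 * strip T s z.2).
  by move=> sG; exact: (simple_val_sqint HF HK _ sG).
have c1 := ip_cvg (fun n => v2 _ (sH n)) (fun n => v2 _ (sH' n)) Z2 Z2' HZ HZ'.
have i2 G : simple_predictable Ft T G -> sqint P (fun w => simple_int G M w T - simple_int G M w s).
  by move=> sG; exact: (simple_int_sqint HF sG wM sT).
have c2 := ip_cvg (fun n => i2 _ (sH n)) (fun n => i2 _ (sH' n)) (dI2 _ _ hI) (dI2 _ _ hI') HI HI'.
have e : (fun n => ip P (fun w => simple_int (H n) M w T - simple_int (H n) M w s)
       (fun w => simple_int (H' n) M w T - simple_int (H' n) M w s)) = (fun n =>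
  ip K (fun z => simple_val (H n) z.1 z.2 * strip T s z.2)
       (fun z => simple_val (H' n) z.1 z.2 * strip T s z.2)).
  by apply/funext => n; exact: (simple_isometry HF iA HK wM mN (sH n) (sH' n) sT).
by rewrite e in c2; exact: cvg_unique c2 c1.
Qed.

End OneBracket.

(** The vanishing covariation kills every term of the double sum for simple integrands, and the
    limit keeps this. *)
Lemma stoch_int_orth M A Z I M' A' Z' I' K K' s : wmartingale P Ft T M -> wmartingale P Ft T M' ->
  martingale P Ft T (fun w t => M w t * M' w t - 0) ->
  is_bracketK P T A K -> is_bracketK P T A' K' ->
  is_stoch_int P Ft T M A Z I -> is_stoch_int P Ft T M' A' Z' I' -> 0 <= s <= T ->
  ip P (fun w => I w T - I w s) (fun w => I' w T - I' w s) = 0.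
Proof.
move=> wM wM' mN HK HK' hI hI' sT; have /andP[s0 _] := sT.
have [H [sH HZ HI]] := stoch_int_approx HK wM hI sT.
have [H' [sH' HZ' HI']] := stoch_int_approx HK' wM' hI' sT.
have T01 : 0 <= T <= T by rewrite lexx ltW.
have dI2 J N B W : is_stoch_int P Ft T N B W J -> sqint P (fun w => J w T - J w s).
  by move=> [_ _ /(sq_martingale_wmartingale HF)[_ J2 _] _ _]; apply: sqintB; exact: J2.
have i2 N G : wmartingale P Ft T N -> simple_predictable Ft T G ->
    sqint P (fun w => simple_int G N w T - simple_int G N w s).
  by move=> wN sG; exact: (simple_int_sqint HF sG wN sT).
have c2 := ip_cvg (fun n => i2 _ _ wM (sH n)) (fun n => i2 _ _ wM' (sH' n))
  (dI2 _ _ _ _ hI) (dI2 _ _ _ _ hI') HI HI'.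
have i0 t : 0 <= t <= T -> P.-integrable setT (fun w => (0 : R)%:E).
  by move=> _; exact: integrable0.
suff e : (fun n => ip P (fun w => simple_int (H n) M w T - simple_int (H n) M w s)
       (fun w => simple_int (H' n) M' w T - simple_int (H' n) M' w s)) = (fun=> 0).
  by rewrite e in c2; exact: (cvg_unique _ c2 (cvg_cst 0)).
apply/funext => n; rewrite (ip_simple_int HF wM wM' mN i0 (sH n) (sH' n) sT).
rewrite big1// => j _; rewrite big1// => k _ /=.
under eq_Rintegral do rewrite subrr mulr0.
by rewrite /Rintegral integral0.
Qed.

End StochInt.

Lemma nrmB_cvg {d} {X : measurableType d} {R : realType} (m : {measure set X -> \bar R})
    (f g : nat -> X -> R) :
  (forall n, sqint m (f n)) -> (forall n, sqint m (g n)) ->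
  nrm m (f n) @[n --> \oo] --> 0 -> nrm m (g n) @[n --> \oo] --> 0 ->
  nrm m (fun w => f n w - g n w) @[n --> \oo] --> 0.
Proof.
move=> f2 g2 f0 g0.
apply: (@squeeze_cvgr _ _ _ _ (fun=> 0) (fun n => nrm m (f n) + nrm m (g n))) => //; last 2 first.
- exact: cvg_cst.
- by rewrite -[X in _ --> X](addr0 0); apply: cvgD.
near=> n; rewrite sqrtr_ge0/=; exact: (nrmB (f2 n) (g2 n)).
Unshelve. all: by end_near. Qed.

Lemma ipBB {d} {X : measurableType d} {R : realType} (m : {measure set X -> \bar R})
    (f g f' g' : X -> R) : sqint m f -> sqint m g -> sqint m f' -> sqint m g' ->
  ip m (fun x => f x - g x) (fun x => f' x - g' x) =
  ip m f f' - ip m f g' - (ip m g f' - ip m g g').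
Proof.
by move=> f2 g2 f2' g2'; rewrite ipBl ?ipBr//; exact: sqintB.
Qed.

(** * Isometry for the series of stochastic integrals *)

Section SeriesIsometry.
Context {d} {Om : measurableType d} {R : realType} (P : probability Om R).
Variables (Ft : R -> set (set Om)) (T : R).
Hypothesis HF : filtration Ft T.
Hypothesis T0 : 0 < T.
Variables (M : nat -> Om -> R -> R) (A : nat -> Om -> cumulative R R).
Hypothesis HB : martingale_basis P Ft T M A.

Lemma basis_wmartingale i : wmartingale P Ft T (M i).
Proof. by have [+ _ _ _ _] := HB; move=> /(_ i) /(sq_martingale_wmartingale HF). Qed.

Lemma basis_bracket i : martingale P Ft T (fun w t => M i w t * M i w t - A i w t).
Proof. by have [_ /(_ i)[[_ _ _ ?] _] _ _ _] := HB. Qed.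

Lemma basis_orth i j : i != j -> martingale P Ft T (fun w t => M i w t * M j w t - 0).
Proof. by have [_ _ /(_ i j) h _ _] := HB; move=> /h [_ []]. Qed.

Lemma basis_bracket_ge0 i w t : t <= 0 -> A i w t = 0.
Proof. have [_ /(_ i)[_ h] _ _ _] := HB; exact: h. Qed.

Lemma basis_integrable i t : 0 <= t <= T -> P.-integrable setT (fun w => (A i w t)%:E).
Proof.
move=> tT; have [_ /(_ t tT) iN _] := basis_bracket i.
have [_ /(_ t tT) M2 _] := basis_wmartingale i.
have iM := sqint_mul M2 M2.
apply: eq_integrable (integrableB measurableT iM iN) => //.
by move=> w _ /=; rewrite -EFinB; congr EFin; ring.
Qed.

Lemma basis_measurable i t : 0 <= t <= T -> measurable_fun setT (fun w => A i w t).
Proof. by move=> /(basis_integrable i) /measurable_int /measurable_EFinP. Qed.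

Lemma basis_bracketK : exists K : nat -> {measure set (Om * R) -> \bar R},
  forall i, is_bracketK P T (A i) (K i).
Proof.
have h i : exists K, is_bracketK P T (A i) K.
  apply: bracketK_exists => //.
  - exact: basis_bracket_ge0.
  - exact: basis_measurable.
  - by apply: basis_integrable; rewrite lexx ltW.
by exists (fun i => projT1 (cid (h i))) => i; exact: (projT2 (cid (h i))).
Qed.

Variable K : nat -> {measure set (Om * R) -> \bar R}.
Hypothesis HK : forall i, is_bracketK P T (A i) (K i).

(** Orthogonality across indices makes the squared norm of a partial sum the sum of the squared
    norms, and each of these is a bracket norm by the isometry; the partial sums converge in L2 to
    the increment of the series. Two series are treated at once because differences of solutions are
    what is estimated later. *)
Lemma series_isometry Z S Z' S' s :
  is_stoch_int_series P Ft T M A Z S -> is_stoch_int_series P Ft T M A Z' S' ->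
  0 <= s <= T ->
  let D w := (S w T - S w s) - (S' w T - S' w s) in
  let W i z := Z i z.1 z.2 * strip T s z.2 - Z' i z.1 z.2 * strip T s z.2 in
  (forall i, sqint (K i) (W i)) /\
  \sum_(i < n) ip (K i) (W i) (W i) @[n --> \oo] --> ip P D D.
Proof.
move=> [sS S0 [I hI IS]] [sS' S'0 [I' hI' IS']] sT D W; have /andP[s0 sT'] := sT.
have T01 : 0 <= T <= T by rewrite lexx ltW.
have Z2 i := stoch_int_sqint HF T0 (HK i) s0 (hI i).
have Z2' i := stoch_int_sqint HF T0 (HK i) s0 (hI' i).
have J2 N : sq_martingale P Ft T N -> forall t, 0 <= t <= T -> sqint P (N^~ t).
  by move=> /(sq_martingale_wmartingale HF)[].
have sI i : sq_martingale P Ft T (I i) by case: (hI i).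
have sI' i : sq_martingale P Ft T (I' i) by case: (hI' i).
have W2 i : sqint (K i) (W i) by apply: sqintB.
split=> //.
pose dI i w := (I i w T - I i w s) - (I' i w T - I' i w s).
have dS2 N : sq_martingale P Ft T N -> sqint P (fun w => N w T - N w s).
  by move=> sN; apply: sqintB; exact: J2.
have dI2 i : sqint P (dI i) by apply: sqintB; exact: dS2.
have ipdI i : ip P (dI i) (dI i) = ip (K i) (W i) (W i).
  rewrite /dI /W (ipBB (Z2 i) (Z2' i) (Z2 i) (Z2' i)).
  rewrite (ipBB (dS2 _ (sI i)) (dS2 _ (sI' i)) (dS2 _ (sI i)) (dS2 _ (sI' i))).
  have iso J1 Z1 J1' Z1' (h1 : is_stoch_int P Ft T (M i) (A i) Z1 J1)
      (h2 : is_stoch_int P Ft T (M i) (A i) Z1' J1') :=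
    stoch_int_isometry HF T0 (HK i) (basis_wmartingale i) (basis_bracket i)
      (@basis_integrable i) h1 h2 sT.
  by rewrite (iso _ _ _ _ (hI i) (hI i)) (iso _ _ _ _ (hI i) (hI' i))
             (iso _ _ _ _ (hI' i) (hI i)) (iso _ _ _ _ (hI' i) (hI' i)).
have ipdIj i j : i != j -> ip P (dI i) (dI j) = 0.
  move=> ij; rewrite /dI (ipBB (dS2 _ (sI i)) (dS2 _ (sI' i)) (dS2 _ (sI j)) (dS2 _ (sI' j))).
  have orth J1 Z1 J1' Z1' (h1 : is_stoch_int P Ft T (M i) (A i) Z1 J1)
      (h2 : is_stoch_int P Ft T (M j) (A j) Z1' J1') :=
    stoch_int_orth HF T0 (basis_wmartingale i) (basis_wmartingale j) (basis_orth ij)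
      (HK i) (HK j) h1 h2 sT.
  rewrite (orth _ _ _ _ (hI i) (hI j)) (orth _ _ _ _ (hI i) (hI' j))
          (orth _ _ _ _ (hI' i) (hI j)) (orth _ _ _ _ (hI' i) (hI' j)).
  by rewrite !subr0.
pose X n w := \sum_(i < n) dI i w.
have X2 n : sqint P (X n) by apply: sqint_sum.
have XX n : ip P (X n) (X n) = \sum_(i < n) ip (K i) (W i) (W i).
  rewrite {1}/X ip_suml; [|by move=> i _; exact: dI2|exact: X2].
  apply: eq_bigr => i _; rewrite ipC ip_suml; [|by move=> j _; exact: dI2|exact: dI2].
  rewrite (bigD1 i)//= ipdI big1 ?addr0// => j ji.
  by rewrite ipdIj.
have D2 : sqint P D by apply: sqintB; exact: dS2.
under eq_fun do rewrite -XX.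
have cT N (J : nat -> Om -> R -> R) (sN : sq_martingale P Ft T N)
    (sJ : forall i, sq_martingale P Ft T (J i))
    (h : forall t : R, 0 <= t <= T ->
       (\int[P]_w ((\sum_(i < n) J i w t - N w t) ^+ 2)%:E)%E @[n --> \oo] --> 0%E) t :
    0 <= t <= T -> nrm P (fun w => \sum_(i < n) J i w t - N w t) @[n --> \oo] --> 0.
  move=> tT; apply: nrm_ecvg; last exact: h.
  by move=> n; apply: sqintB; [apply: sqint_sum => i _; exact: J2|exact: J2].
have E n : (fun w => X n w - D w) = (fun w =>
   ((\sum_(i < n) I i w T - S w T) - (\sum_(i < n) I i w s - S w s)) -
   ((\sum_(i < n) I' i w T - S' w T) - (\sum_(i < n) I' i w s - S' w s))).
  apply/funext => w; rewrite /X /D /dI !sumrB; ring.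
suff XD : nrm P (fun w => X n w - D w) @[n --> \oo] --> 0 by apply: ip_cvg.
under eq_fun do rewrite E.
have aJ2 (N : Om -> R -> R) (J : nat -> Om -> R -> R) n t : sq_martingale P Ft T N ->
    (forall i, sq_martingale P Ft T (J i)) -> 0 <= t <= T ->
    sqint P (fun w => \sum_(i < n) J i w t - N w t).
  by move=> sN sJ tT; apply: sqintB; [apply: sqint_sum => i _; exact: J2|exact: J2].
apply: nrmB_cvg; try by move=> n; apply: sqintB; exact: aJ2.
  by apply: nrmB_cvg; try (by move=> n; exact: aJ2); exact: cT.
by apply: nrmB_cvg; try (by move=> n; exact: aJ2); exact: cT.
Qed.

End SeriesIsometry.

(** * Downward induction over intervals *)

Section DownwardInduction.
Context {R : realType}.
Variables (T : R) (mu : {finite_measure set R -> \bar R}).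
Hypothesis T0 : 0 < T.

(** Abstracts the mass [B |-> E \int_B |g|^2 dmu]: a single time or an open interval can be split
    off at the left end of an interval reaching [T]. *)
Definition interval_additive (al : set R -> R) : Prop :=
  [/\ forall B, 0 <= al B, al `]T, T]%classic = 0,
      forall t, 0 < t <= T -> al `[t, T]%classic = al [set t] + al `]t, T]%classic
    & forall a b, 0 <= a -> a < b -> b <= T ->
        al `]a, T]%classic = al `]a, b[%classic + al `[b, T]%classic].

(** To be read as: [al] is the mass of the difference of two inputs of the fixed point map, and [be]
    the mass of the difference of the corresponding outputs. *)
Variable Adm : (set R -> R) -> (set R -> R) -> Prop.
Hypothesis Adm_add : forall al be, Adm al be -> interval_additive al /\ interval_additive be.
Variables (e C : R) (th Ct : R -> R).
Hypothesis e0 : 0 < e.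
Hypothesis C0 : 0 <= C.
Hypothesis Ct0 : forall t, 0 < t <= T -> 0 <= Ct t.
Hypothesis th01 : forall t, 0 < t <= T -> 0 <= th t < 1.
Hypothesis Adm_open : forall al be, Adm al be -> forall a b, 0 <= a -> a < b -> b <= T ->
  (mu `]a, b[%classic <= e%:E)%E ->
  be `]a, b[%classic <= 2^-1 * al `]a, b[%classic + C * al `[b, T]%classic.
Hypothesis Adm_point : forall al be, Adm al be -> forall t, 0 < t <= T ->
  be [set t] <= th t * al [set t] + Ct t * al `]t, T]%classic.

(** [Q] plays the role of the squared weighted norm on [D]: [lo] and [hi] make it equivalent to the
    plain mass, with constants independent of [al], and [r] is the contraction ratio. *)
Definition contracted (D : set R) : Prop :=
  exists (Q : (set R -> R) -> R) (lo hi r : R),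
  [/\ 0 < lo, 0 <= hi, 0 <= r < 1,
      forall al, interval_additive al -> lo * al D <= Q al /\ Q al <= hi * al D
    & forall al be, Adm al be -> Q be <= r * Q al].

(** The new piece receives a weight [eta]. Its output feels the input on [rest] with a constant [c]
    of any size; a small [eta] absorbs this into the slack [1 - r] already available on [rest],
    where the contraction is unaffected by the piece. *)
Let extend (piece rest D : set R) (q c : R) :
  0 <= c -> 0 <= q < 1 ->
  (forall al, interval_additive al -> al D = al piece + al rest) ->
  (forall al be, Adm al be -> be piece <= q * al piece + c * al rest) ->
  contracted rest -> contracted D.
Proof.
move=> C0' /andP[q0 q1] addD hb [Q [lo [hi [r [lo0 hi0 /andP[r0 r1] Qlh Qr]]]]].
(* Chosen so that [eta * c <= lo * ((1 - r) / 2)]; the 1 added to [c] only avoids a division by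
   zero. *)
pose eta := lo * (1 - r) / (2 * (c + 1)).
have C1 : 0 < c + 1 by rewrite ltr_wpDl.
have eta0 : 0 < eta by rewrite divr_gt0 ?mulr_gt0// subr_gt0.
(* Half of the slack pays for the interaction, which leaves the ratio [(1 + r) / 2] on [rest]. *)
pose q' := Num.max q ((1 + r) / 2).
have q'1 : q' < 1 by rewrite gt_max q1 /=; lra.
have q'0 : 0 <= q' by rewrite le_max q0.
exists (fun al => eta * al piece + Q al), (Num.min eta lo), (eta + hi), q'; split.
- by rewrite lt_min eta0.
- by rewrite addr_ge0// ltW.
- by rewrite q'0.
- move=> al aal; have [lQ Qh] := Qlh _ aal; have [al0 _ _ _] := aal.
  rewrite (addD _ aal); have p0 := al0 piece; have s0 := al0 rest.
  have m1 : Num.min eta lo <= eta by rewrite ge_min lexx.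
  have m2 : Num.min eta lo <= lo by rewrite ge_min lexx orbT.
  split.
    rewrite mulrDr; apply: lerD; first exact: ler_wpM2r.
    by apply: le_trans lQ; exact: ler_wpM2r.
  rewrite mulrDl; have := mulr_ge0 (ltW eta0) s0; have := mulr_ge0 hi0 p0; nra.
- move=> al be ab; have [aal abe] := Adm_add ab.
  have [lQ Qh] := Qlh _ aal; have [al0 _ _ _] := aal.
  have p0 := al0 piece; have s0 := al0 rest.
  have hp := hb _ _ ab; have hQ := Qr _ _ ab.
  have e1 : eta * c <= lo * ((1 - r) / 2).
    rewrite /eta mulrAC ler_pdivrMr ?mulr_gt0//.
    rewrite (_ : lo * ((1 - r) / 2) * (2 * (c + 1)) = lo * (1 - r) * (c + 1)); last by field.
    by apply: ler_wpM2l; [rewrite mulr_ge0 ?(ltW lo0)// subr_ge0 ltW|rewrite lerDl].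
  have Q0 : 0 <= Q al by apply: le_trans lQ; rewrite mulr_ge0// ltW.
  have e2 : eta * c * al rest <= (1 - r) / 2 * Q al.
    apply: (@le_trans _ _ (lo * ((1 - r) / 2) * al rest)); first exact: ler_wpM2r.
    rewrite mulrAC mulrC ler_wpM2l// divr_ge0// subr_ge0 ltW//.
  have e3 : eta * be piece <= eta * q * al piece + eta * c * al rest.
    by have := ler_wpM2l (ltW eta0) hp; rewrite mulrDr !mulrA.
  have e4 : eta * q * al piece <= q' * (eta * al piece).
    rewrite mulrA (mulrC eta); apply: ler_wpM2r => //; apply: ler_wpM2r; first exact: ltW.
    by rewrite le_max lexx.
  have e5 : (1 + r) / 2 * Q al <= q' * Q al.
    by apply: ler_wpM2r => //; rewrite le_max lexx orbT.
  rewrite mulrDr; lra.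
Qed.

Let contracted_point t : 0 < t <= T -> contracted `]t, T]%classic -> contracted `[t, T]%classic.
Proof.
move=> tT; apply: (extend (Ct0 tT) (th01 tT)).
  by move=> al [_ _ h _]; exact: h.
by move=> al be ab; exact: Adm_point.
Qed.

Let contracted_open a b : 0 <= a -> a < b -> b <= T -> (mu `]a, b[%classic <= e%:E)%E ->
  contracted `[b, T]%classic -> contracted `]a, T]%classic.
Proof.
move=> a0 ab bT mab; apply: (@extend `]a, b[%classic _ _ 2^-1 C).
- exact: C0.
- by rewrite invr_ge0 ler0n invf_lt1 ?ltr1n.
- by move=> al [_ _ _ h]; exact: h.
- by move=> al be adm; exact: Adm_open.
Qed.

(** Continuity of the finite measure from above at the empty set. It applies to []t, t + h]] and to
    []t - h, t[] precisely because [t], a possible atom, is left out. *)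
Let mu_shrink (F : nat -> set R) : (forall n, measurable (F n)) ->
  (forall m n, (m <= n)%N -> F n `<=` F m) -> (forall t, exists n, ~ F n t) ->
  exists n, (mu (F n) <= e%:E)%E.
Proof.
move=> mF dF F0.
have cF0 : \bigcap_n F n = set0.
  by apply/seteqP; split => // t Ft; have [n] := F0 t; apply; exact: Ft.
have fin : (mu (F 0%N) < +oo)%E by rewrite -ge0_fin_numE//; exact: fin_num_measure.
have cv : (mu \o F) n @[n --> \oo] --> 0%E.
  rewrite -(measure0 mu) -cF0; apply: nonincreasing_cvg_mu => //.
    by rewrite cF0.
  by move=> m n mn; apply/subsetPset; exact: dF.
have [N _ h] : \forall n \near \oo, ((mu \o F) n < e%:E)%E.
  apply: (cv [set x | (x < e%:E)%E]); apply: open_nbhs_nbhs.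
  by split; [exact: open_ereal_lt_ereal|rewrite /= lte_fin].
by exists N; apply/ltW/h; rewrite /=.
Qed.

Let archi (x y : R) : 0 < y -> exists n : nat, x < y * n.+1%:R.
Proof.
move=> y0; exists (Num.truncn (Num.max (x / y) 0)).+1.
rewrite mulrC -ltr_pdivrMr//; apply: (@le_lt_trans _ _ (Num.max (x / y) 0)); first by rewrite le_max lexx.
apply: lt_trans (truncnS_gt _) _; by rewrite ltr_nat.
Qed.

Let mu_right t : 0 <= t < T -> exists2 b, t < b <= T & (mu `]t, b]%classic <= e%:E)%E.
Proof.
move=> /andP[t0 tT].
have Tt0 : 0 < T - t by rewrite subr_gt0.
have [//|m n mn u|u|n hn] := mu_shrink (F := fun n => `]t, t + (T - t) / n.+1%:R]%classic).
- rewrite /= !in_itv/= => /andP[-> /le_trans]; apply.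
  by rewrite lerD2l ler_pM2l// lef_pV2 ?posrE// ler_nat.
- have [ut|tu] := leP u t; first by exists 0%N; rewrite /= in_itv/= ltNge ut.
  have ut0 : 0 < u - t by rewrite subr_gt0.
  have [n hn] := archi (T - t) ut0.
  exists n; rewrite /= in_itv/= tu /= leNgt; apply/negP; rewrite negbK.
  by rewrite -ltrBrDl ltr_pdivrMr.
- exists (t + (T - t) / n.+1%:R) => //.
  rewrite ltrDl divr_gt0//= -lerBrDl ler_pdivrMr// ler_peMr ?(ltW Tt0)//.
  by rewrite ler1n.
Qed.

Let mu_left t : 0 < t <= T -> exists2 a, 0 <= a < t & (mu `]a, t[%classic <= e%:E)%E.
Proof.
move=> /andP[t0 tT].
have [//|m n mn u|u|n hn] := mu_shrink (F := fun n => `]t - t / n.+1%:R, t[%classic).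
- rewrite /= !in_itv/= => /andP[h ->]; rewrite andbT; apply: le_lt_trans h.
  by rewrite lerD2l lerN2 ler_pM2l// lef_pV2 ?posrE// ler_nat.
- have [tu|ut] := leP t u; first by exists 0%N; rewrite /= in_itv/= (ltNge u) tu andbF.
  have ut0 : 0 < t - u by rewrite subr_gt0.
  have [n hn] := archi t ut0.
  exists n; rewrite /= in_itv/= ut andbT; apply/negP; rewrite -leNgt.
  by rewrite lerBrDl -lerBrDr ler_pdivrMr// ltW.
- exists (t - t / n.+1%:R) => //.
  rewrite subr_ge0 ler_pdivrMr// ler_peMr ?(ltW t0) ?ler1n//=.
  by rewrite ltrBlDr ltrDl divr_gt0.
Qed.

(** The infimum [tau] of the times [t] with a contraction on []t, T]] is attained, thanks to a small
    interval on its right, and cannot be positive, thanks to the atom at [tau] followed by a small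
    interval on its left. *)
Lemma contracted_horizon : contracted `]0, T]%classic.
Proof.
pose S := [set t | 0 <= t <= T /\ contracted `]t, T]%classic].
have ST : S T.
  split; first by rewrite lexx ltW.
  exists (fun=> 0), 1, 1, 0; split=> //.
  - by rewrite lexx ltr01.
  - by move=> al [_ -> _ _]; rewrite mulr0.
have hS : has_inf S by split; [exists T|exists 0 => t [/andP[]]].
pose tau := inf S.
have tau0 : 0 <= tau by apply: lb_le_inf; [exists T|move=> t [/andP[]]].
have tauT : tau <= T by apply: ge_inf ST; case: hS.
have Stau : S tau.
  have [tT|Tt] := ltP tau T; last first.
    by have -> : tau = T by apply/eqP; rewrite eq_le tauT Tt.
  have [b /andP[tb bT] mb] := mu_right (introT andP (conj tau0 tT)).
  have bt0 : 0 < b - tau by rewrite subr_gt0.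
  (* A time of [S] before [b]: the open interval between [tau] and it lies in []tau, b]], where [mu]
     is at most [e]. *)
  have [t [/andP[t0 tT'] gt] tb'] := inf_adherent bt0 hS.
  have taut : tau <= t by apply: ge_inf; [case: hS|split; rewrite ?t0].
  split; first by rewrite tau0 tauT.
  have [<-//|ne] := eqVneq t tau.
  have lt : tau < t by rewrite lt_neqAle eq_sym ne.
  apply: (contracted_open tau0 lt tT').
    apply: le_trans mb; apply: le_measure; [by apply: mem_set; exact: measurable_itv..|].
    move=> u /=; rewrite !in_itv/= => /andP[-> /ltW ut] /=.
    by apply: (le_trans ut); move: tb'; rewrite subrKC => /ltW.
  by apply: contracted_point => //; rewrite (le_lt_trans tau0 lt).
have [t0|] := ltP 0 tau; last first.
  move=> le0; have t0 : tau = 0 by apply/eqP; rewrite eq_le tau0 le0.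
  by have := Stau.2; rewrite t0.
have [a /andP[a0 at_] ma] := mu_left (introT andP (conj t0 tauT)).
(* Adding the atom at [tau] and then []a, tau[] would put an earlier time into [S]. *)
have Sa : S a.
  split; first by rewrite a0 (le_trans (ltW at_)).
  apply: (contracted_open a0 at_ tauT ma); apply: contracted_point; first by rewrite t0.
  exact: Stau.2.
by have := ge_inf hS.2 Sa; rewrite leNgt at_.
Qed.

End DownwardInduction.

(** * Predictable processes *)

Section PredictableTools.
Context {d} {Om : measurableType d} {R : realType} (P : probability Om R).
Variables (Ft : R -> set (set Om)) (T : R).
Hypothesis HF : filtration Ft T.
Hypothesis T0 : 0 < T.

Local Notation PT := (g_sigma_algebraType (predictable_rectangles Ft T)).
Local Notation hz := (@horizon _ Om R Ft T).

(** Generates the sigma-algebra F_(t-) of the strict past. It is kept as a family stable under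
    intersection, in the form that Dynkin's theorem takes. *)
Definition past (t : R) : set (set Om) := [set A | exists2 s, 0 <= s < t & Ft s A].

Lemma past_measurable t : t <= T -> past t `<=` measurable.
Proof.
move=> tT A [s /andP[s0 st] As]; apply: (Ft_measurable HF _ As).
by rewrite s0 (le_trans (ltW st)).
Qed.

Lemma Ft_setT t : 0 <= t <= T -> Ft t setT.
Proof.
by move=> tT; have [/(_ t tT)[F0 FD _] _ _] := HF; rewrite -(setD0 setT); exact: FD.
Qed.

Lemma past_setI t : t <= T -> setI_closed (past t).
Proof.
move=> tT A B [s /andP[s0 st] As] [u /andP[u0 ut] Bu].
have m0 : 0 <= Num.max s u <= T by rewrite le_max s0 /= ge_max !(le_trans (ltW _) tT).
exists (Num.max s u); first by rewrite le_max s0 gt_max st ut.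
have sA : Ft (Num.max s u) A.
  by apply: (Ft_le HF s0 _ (andP m0).2 As); rewrite le_max lexx.
have uB : Ft (Num.max s u) B.
  by apply: (Ft_le HF u0 _ (andP m0).2 Bu); rewrite le_max lexx orbT.
rewrite -(Ft_sigma HF m0).
by apply: (@measurableI _ (g_sigma_algebraType (Ft (Num.max s u)))); exact: sub_sigma_algebra.
Qed.

(** A rectangle over []s, u]] that meets the time [t] has [s < t], so its base is in the strict
    past; a rectangle at time 0 has an empty section since [0 < t]. *)
Lemma section_measurable t : 0 < t <= T ->
  measurable_fun setT ((fun w => (w, t)) : g_sigma_algebraType (past t) -> PT).
Proof.
move=> /andP[t0 tT]; apply: (@measurability _ _ (g_sigma_algebraType (past t)) PT setT (fun w => (w, t)) (predictable_rectangles Ft T)) => //.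
move=> _ [C HC <-]; rewrite setTI.
case: HC => [[A A0 ->]|[A [s [u [s0 su uT As ->]]]]].
  rewrite (_ : _ @^-1` _ = set0); first exact: measurable0.
  by apply/seteqP; split => // w [_ /= t0']; rewrite t0' ltxx in t0.
have [tsu|tsu] := boolP (t \in `]s, u]).
  rewrite (_ : _ @^-1` _ = A).
    apply: sub_sigma_algebra; exists s => //.
    by rewrite s0; move: tsu; rewrite in_itv/= => /andP[].
  by apply/seteqP; split => [w []//|w Aw]; split.
rewrite (_ : _ @^-1` _ = set0); first exact: measurable0.
by apply/seteqP; split => // w [_ /=]; move/negP: tsu.
Qed.

Lemma predictable_section {d'} {E : measurableType d'} (Z : Om -> R -> E) t : 0 < t <= T ->
  predictable Ft T Z -> mfunG (past t) (Z^~ t).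
Proof.
move=> tT pZ; rewrite /mfunG.
have sub : [set ((w, t) : PT) | w in setT] `<=` hz.
  move=> z [w _ <-]; split => //=; rewrite in_itv/=.
  by case/andP: tT => /ltW -> ->.
exact: (@measurable_comp _ _ _ (g_sigma_algebraType (past t)) PT E hz (fun p => Z p.1 p.2)
  setT (fun w => (w, t)) (measurable_horizon HF T0) sub pZ (section_measurable tT)).
Qed.

(** Before [t], a predictable rectangle starting at [s <= t] has its base in [Ft t], and one
    starting later leaves no trace. *)
Lemma progressive_id t : 0 <= t <= T ->
  @measurable_fun _ _ (g_sigma_algebraType (Ft t) * R)%type PT
    (setT `*` `]0, t]%classic) idfun.
Proof.
move=> tT; have /andP[t0 tT'] := tT.
have mD : measurable ((setT `*` `]0, t]%classic) : set (g_sigma_algebraType (Ft t) * R)).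
  exact: measurableX.
apply: (@measurability _ _ (g_sigma_algebraType (Ft t) * R)%type PT _ idfun (predictable_rectangles Ft T)) => //.
move=> _ [C HC <-].
case: HC => [[A A0 ->]|[A [s [u [s0 su uT As ->]]]]].
  rewrite (_ : _ `&` _ = set0); first exact: measurable0.
  apply/seteqP; split => // -[w r] [[_ /= r0] [_ /= r00]].
  by move: r0; rewrite r00 in_itv/= ltxx.
have [st|ts] := leP s t; last first.
  rewrite (_ : _ `&` _ = set0); first exact: measurable0.
  apply/seteqP; split => // -[w r] [[_ /= r0] [_ /= r1]].
  move: r0 r1; rewrite !in_itv/= => /andP[_ rt] /andP[sr _].
  by move: (lt_le_trans sr rt); rewrite ltNge ltW.
rewrite (_ : _ `&` _ = A `*` (`]s, u] `&` `]0, t])%classic).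
  apply: measurableX; last exact: measurableI.
  by apply: sub_sigma_algebra; exact: (Ft_le HF s0 st tT' As).
apply/seteqP; split => -[w r] /=.
  by move=> [[_ r1] [Aw r2]].
by move=> [Aw [r2 r1]].
Qed.

Lemma predictable_progressive {d'} {E : measurableType d'} (Z : Om -> R -> E) t : 0 <= t <= T ->
  predictable Ft T Z ->
  @measurable_fun _ _ (g_sigma_algebraType (Ft t) * R)%type E
    (setT `*` `]0, t]%classic) (fun z => Z z.1 z.2).
Proof.
move=> tT pZ.
have sub : [set (idfun z : PT) | z in (setT `*` `]0, t]%classic)] `<=` hz.
  move=> z [[w r] [_ /= r0] <-]; split => //=; move: r0; rewrite !in_itv/= => /andP[/ltW -> rt].
  by case/andP: tT => _; exact: le_trans rt.
exact: (@measurable_comp _ _ _ (g_sigma_algebraType (Ft t) * R)%type PT E hz (fun p => Z p.1 p.2)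
  (setT `*` `]0, t]%classic) idfun (measurable_horizon HF T0) sub pZ (progressive_id tT)).
Qed.

Lemma predictable_rect_itv s t : 0 <= s -> s < t -> t <= T ->
  (measurable : set (set PT)) (setT `*` `]s, t]%classic).
Proof.
move=> s0 st tT; apply: sub_sigma_algebra; right; exists setT, s, t; split => //.
by apply: Ft_setT; rewrite s0 (le_trans (ltW st)).
Qed.

Lemma predictable_time : predictable Ft T (fun (_ : Om) t => t).
Proof.
apply: (@measurability _ _ _ _ _ _ (@RGenOInfty.G R)); first exact: RGenOInfty.measurableE.
move=> _ [C [x ->] <-].
have [x0|x0] := ltP x 0.
  rewrite (_ : _ `&` _ = hz); first exact: measurable_horizon.
  apply/seteqP; split => [z []//|-[w t] [_ h]]; split => //=.
  move: h; rewrite /= !in_itv/= andbT => /andP[t0 _]; exact: lt_le_trans x0 t0.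
have [xT|Tx] := ltP x T.
  rewrite (_ : _ `&` _ = setT `*` `]x, T]%classic); first exact: predictable_rect_itv.
  apply/seteqP; split => -[w t].
    move=> [[_ /= h1] /=]; move: h1; rewrite !in_itv/= andbT => /andP[_ tT] xt.
    by rewrite /= xt.
  move=> [_ /=]; rewrite in_itv/= => /andP[xt tT]; split => /=.
    by split => //=; rewrite in_itv/= tT (le_trans x0 (ltW xt)).
  by rewrite in_itv/= xt.
rewrite (_ : _ `&` _ = set0); first exact: measurable0.
apply/seteqP; split => // -[w t] [[_ /= h1] /=].
move: h1; rewrite !in_itv/= andbT => /andP[_ tT] xt.
by move: (lt_le_trans xt (le_trans tT Tx)); rewrite ltxx.
Qed.

Lemma predictable_of_time (f : R -> R) : measurable_fun setT f -> predictable Ft T (fun (_ : Om) => f).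
Proof. by move=> mf; exact: (measurableT_comp mf predictable_time). Qed.

Lemma predictable_step (X : Om -> R) s t : 0 <= s -> s < t -> t <= T -> mfunG (Ft s) X ->
  @measurable_fun _ _ PT R setT (fun z => X z.1 * \1_(`]s, t]%classic) z.2).
Proof.
move=> s0 st tT mX; have sT : 0 <= s <= T by rewrite s0 (le_trans (ltW st)).
have mD := predictable_rect_itv s0 st tT.
have -> : (fun z : PT => X z.1 * \1_(`]s, t]%classic) z.2) =
    ((fun z => X z.1) \_ (setT `*` `]s, t]%classic)).
  apply/funext => z; rewrite patchE indicE.
  case: (boolP (z.2 \in (`]s, t]%classic : set R))) => zt.
    by rewrite mulr1 mem_set//; split => //; exact: set_mem zt.
  by rewrite mulr0 memNset// => -[_] /= h2; move/negP: zt; apply; rewrite mem_set.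
apply/(measurable_restrict _ mD measurableT); rewrite setTI => _ B mB.
rewrite (_ : _ `&` _ = (X @^-1` B) `*` `]s, t]%classic).
  apply: sub_sigma_algebra; right; exists (X @^-1` B), s, t; split => //.
  by have := mX measurableT _ mB; rewrite setTI /measurable /= (Ft_sigma HF sT).
apply/seteqP; split => -[w r] /=; first by move=> [[_ a] b].
by move=> [a b].
Qed.

Definition left_step n (Y : Om -> R -> R) (z : Om * R) : R :=
  \sum_(k < 2 ^ n) Y z.1 (grid T n k) * \1_(`]grid T n k, grid T n k.+1]%classic) z.2.

(** A predictable version of Y_-, built from step functions that read [Y] at the left end of each
    grid interval. It is defined for every path, and equals the left limit at each time of []0, T]]
    where this exists. *)
Definition left_proc (Y : Om -> R -> R) (w : Om) (t : R) : R :=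
  lsup (fun n => left_step n Y) (w, t).

Lemma grid_lt n k : (k < 2 ^ n)%N -> grid T n k < grid T n k.+1.
Proof.
move=> kn; rewrite /grid ltr_pM2r ?invr_gt0 ?exprn_gt0// ltr_pM2l// ltr_nat.
by rewrite (minn_idPl kn) (minn_idPl (ltnW kn)).
Qed.

Lemma left_proc_predictable Y : (forall t, 0 <= t <= T -> mfunG (Ft t) (Y^~ t)) ->
  predictable Ft T (left_proc Y).
Proof.
move=> aY; rewrite /predictable /left_proc.
rewrite (_ : (fun p : PT => _) = lsup (fun n => left_step n Y)); last first.
  by apply/funext => -[w t].
apply: (@measurable_lsup _ PT R) => n; apply: (@measurable_funTS _ _ PT).
apply: (@measurable_sum _ PT) => k.
have kn : (k < 2 ^ n)%N by exact: ltn_ord.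
apply: (@predictable_step (Y^~ (grid T n k))).
- exact: grid_ge0.
- exact: grid_lt kn.
- exact: grid_leT.
- by apply: aY; exact: grid_itv.
Qed.

Lemma left_stepE n Y w t k : (k < 2 ^ n)%N -> grid T n k < t <= grid T n k.+1 ->
  left_step n Y (w, t) = Y w (grid T n k).
Proof.
move=> kn /andP[kt tk]; rewrite /left_step (bigD1 (Ordinal kn))//=.
rewrite indicE mem_set/=; last by rewrite in_itv/= kt tk.
rewrite mulr1 big1 ?addr0// => j jk.
rewrite indicE memNset ?mulr0//= in_itv/= => /andP[jt tj].
have [lt|lt|e] := ltngtP j k; last by move/eqP: jk; apply; apply/val_inj.
  by move: (lt_le_trans kt (le_trans tj (grid_le T0 n lt))); rewrite ltxx.
by move: (lt_le_trans jt (le_trans tk (grid_le T0 n lt))); rewrite ltxx.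
Qed.

Lemma left_step_cvg Y w t (l : R) : 0 < t <= T -> Y w s @[s --> t^'-] --> l ->
  left_step n Y (w, t) @[n --> \oo] --> l.
Proof.
move=> tT /cvg_at_leftP h.
have g n : exists k, (k < 2 ^ n)%N /\ grid T n k < t <= grid T n k.+1.
  by have [k kn kt] := grid_leftP n tT; exists k.
pose k n := projT1 (cid (g n)).
have kP n : (k n < 2 ^ n)%N /\ grid T n (k n) < t <= grid T n (k n).+1 by exact: (projT2 (cid (g n))).
under eq_fun => n do rewrite (left_stepE _ _ (kP n).1 (kP n).2).
apply: (h (fun n => grid T n (k n))); split.
  by move=> n; case/andP: (kP n).2.
apply: (@squeeze_cvgr _ _ _ _ (fun n => t - T / 2 ^+ n) (fun=> t)); last 2 first.
- rewrite -[X in _ --> X]subr0; apply: cvgB; first exact: cvg_cst.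
  exact: cvg_step_size.
- exact: cvg_cst.
near=> n; have /andP[kt tk] := (kP n).2; rewrite (ltW kt) andbT.
by rewrite lerBlDr (le_trans tk)// grid_step.
Unshelve. all: by end_near. Qed.

Lemma left_proc_cvg Y w t (l : R) : 0 < t <= T -> Y w s @[s --> t^'-] --> l ->
  left_proc Y w t = l.
Proof. by move=> tT h; apply: lsup_cvg; exact: left_step_cvg h. Qed.

(** [past t] is stable under intersection but need not be a sigma-algebra; Dynkin's theorem extends
    the vanishing of the integrals of [D] from it to the sigma-algebra it generates. *)
Lemma past_orth t (D h : Om -> R) : 0 < t <= T -> sqint P D ->
  (forall s A, 0 <= s < t -> Ft s A -> \int[P]_(w in A) D w = 0) ->
  mfunG (past t) h -> sqint P h -> ip P h D = 0.
Proof.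
move=> /andP[t0 tT] D2 HD mh h2.
have sm A : <<s past t >> A -> measurable A.
  apply: smallest_sub; [exact: sigma_algebra_measurable|exact: past_measurable].
have iD : P.-integrable setT (EFin \o D) by apply: sqint_integrable => //; exact: probability_lty.
have DT : \int[P]_w D w = 0.
  by apply: (HD 0 setT); [rewrite lexx t0|apply: Ft_setT; rewrite lexx ltW].
apply: (orth_mfunG (probability_lty P) (past_measurable tT)) => //.
apply: (@dynkin_induction _ (g_sigma_algebraType (past t)) (past t)) => //.
- exact: past_setI.
- by move=> A [s st As]; exact: (HD s).
- move=> A /sm mA HA; move: DT; rewrite -(setUv A) Rintegral_setU//.
  + by rewrite HA add0r.
  + exact: measurableC.
  + by rewrite setUv.
  + by apply/disj_setPS; rewrite setICr.
- move=> F mF tF HF0; have mF' n : (measurable : set (set Om)) (F n) by exact: (sm _ (mF n)).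
  have mU : (measurable : set (set Om)) (\bigcup_n F n) by exact: bigcup_measurable.
  apply: EFin_inj; rewrite EFin_Rintegral//.
  rewrite integral_bigcup//; last by apply: integrableS iD.
  rewrite eseries0// => n _ _.
  by rewrite -EFin_Rintegral// HF0.
Qed.

End PredictableTools.

Import HBNNSimple.

(** * Comparison of a density with the measure it comes from *)

Section DensityBound.
Context {d d'} {X : measurableType d} {Y : measurableType d'} {R : realType}.
Variables (phi : X -> Y) (mphi : measurable_fun setT phi).
Variables (nu K : {measure set X -> \bar R}) (rho : Y -> R) (m1 : {measure set Y -> \bar R}).
Hypothesis mrho : measurable_fun setT rho.
Hypothesis rho0 : forall y, 0 <= rho y.
Hypothesis m1E : forall C, measurable C ->
  m1 C = (\int[pushforward nu phi]_(y in C) (rho y)%:E)%E.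
Hypothesis m1K : forall C, measurable C -> (m1 C <= K (phi @^-1` C))%E.

Local Open Scope ereal_scope.

Let piece_le y (C : set Y) : measurable C -> (C !=set0 -> (0 <= y)%R) ->
  \int[nu]_x (y * \1_(phi @^-1` C) x * rho (phi x))%:E <=
  \int[K]_x (y * \1_(phi @^-1` C) x)%:E.
Proof.
move=> mC y0'; have [C0|/set0P/y0' y0] := eqVneq C set0.
  rewrite C0 preimage_set0 indic0 (_ : (fun x => _) = cst 0) ?integral0.
    by rewrite (_ : (fun x => _) = cst 0) ?integral0//; apply/funext => x; rewrite /cst mulr0.
  by apply/funext => x; rewrite /cst mulr0 mul0r.
have mpC : measurable (phi @^-1` C) by rewrite -[X in measurable X]setTI; exact: mphi.
have mrp : measurable_fun setT (rho \o phi) by exact: measurableT_comp mphi.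
under eq_integral do rewrite -mulrA EFinM.
rewrite ge0_integralZl_EFin//; last 2 first.
- by move=> x _; rewrite lee_fin mulr_ge0// indicE.
- by apply/measurable_EFinP; apply: measurable_funM => //; exact: measurable_indic.
under [leRHS]eq_integral do rewrite EFinM.
rewrite ge0_integralZl_EFin//; last first.
  by apply/measurable_EFinP; exact: measurable_indic.
rewrite lee_wpmul2l ?lee_fin// integral_indic// setIT.
apply: le_trans (m1K mC); rewrite m1E// ge0_integral_pushforward//.
- rewrite [leRHS]integral_mkcond le_eqVlt; apply/orP; left; apply/eqP.
  apply: eq_integral => x _; rewrite patchE indicE.
  by case: ifPn => _; rewrite ?mul1r ?mul0r.
- by apply: (measurable_funS measurableT) => //; exact/measurable_EFinP.
- by move=> z _; rewrite lee_fin.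
Qed.

Let nnsfun_le (h : {nnsfun Y >-> R}) :
  \int[nu]_x (h (phi x) * rho (phi x))%:E <= \int[K]_x (h (phi x))%:E.
Proof.
have mh y : measurable (h @^-1` [set y]) by [].
pose s := fset_set (range h).
have hE x : h (phi x) = (\sum_(y <- s) y * \1_(phi @^-1` (h @^-1` [set y])) x)%R.
  by rewrite {1}(fimfunE h) fsbig_finite.
have y0 y : h @^-1` [set y] !=set0 -> (0 <= y)%R by move=> [x <-].
have mpre y : measurable (phi @^-1` (h @^-1` [set y])) by rewrite -[X in measurable X]setTI; exact: mphi.
have t0 y x : (0 <= y * \1_(phi @^-1` (h @^-1` [set y])) x)%R.
  rewrite indicE; case: (boolP (x \in _)) => [xy|_]; last by rewrite mulr0.
  by rewrite mulr1; apply: y0; exists (phi x); exact: set_mem xy.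
have mt y : measurable_fun setT (fun x => y * \1_(phi @^-1` (h @^-1` [set y])) x)%R.
  by apply: measurable_funM => //; exact: measurable_indic.
have mrp : measurable_fun setT (rho \o phi) by exact: measurableT_comp mphi.
have -> : \int[nu]_x (h (phi x) * rho (phi x))%:E =
    \sum_(y <- s) \int[nu]_x (y * \1_(phi @^-1` (h @^-1` [set y])) x * rho (phi x))%:E.
  under eq_integral => x _ do rewrite hE mulr_suml -sumEFin.
  rewrite ge0_integral_sum//.
  - by move=> y; apply/measurable_EFinP; exact: measurable_funM.
  - by move=> y x _; rewrite lee_fin mulr_ge0.
have -> : \int[K]_x (h (phi x))%:E =
    \sum_(y <- s) \int[K]_x (y * \1_(phi @^-1` (h @^-1` [set y])) x)%:E.
  under eq_integral => x _ do rewrite hE -sumEFin.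
  rewrite ge0_integral_sum//.
  by move=> y; apply/measurable_EFinP.
  by move=> y x _; rewrite lee_fin.
by apply: lee_sum => y _; apply: piece_le => //; exact: y0.
Qed.

(** In the application [phi] is the identity from the product sigma-algebra, where [nu] and [K]
    live, to the predictable one, where [rho] and [m1] live. The comparison of measures is thus
    available on preimages only; it is lifted to integrals through simple functions on [Y] and then
    by Fatou. *)
Lemma density_integral_le (h : Y -> R) : measurable_fun setT h -> (forall y, (0 <= h y)%R) ->
  \int[nu]_x (h (phi x) * rho (phi x))%:E <= \int[K]_x (h (phi x))%:E.
Proof.
move=> mh h0.
have mh' : measurable_fun setT (EFin \o h) by exact/measurable_EFinP.
have [|g [gnd gh]] := approximation measurableT mh'.
  by move=> y _; rewrite lee_fin.
have gx x : (g n (phi x))%:E @[n --> \oo] --> (h (phi x))%:E by exact: gh.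
have gr x : g n (phi x) @[n --> \oo] --> h (phi x) by exact: (fine_cvg (gx x)).
apply: (@fatou_le _ _ _ nu (fun n x => (g n (phi x) * rho (phi x))%:E)).
- move=> n; apply/measurable_EFinP; apply: measurable_funM.
    exact: measurableT_comp mphi.
  exact: measurableT_comp mphi.
- apply/measurable_EFinP; apply: measurable_funM; exact: measurableT_comp mphi.
- by move=> n x; rewrite lee_fin mulr_ge0.
- apply: aeW => x; apply: cvg_EFin; first by apply: nearW.
  by apply: cvgM; [exact: gr|exact: cvg_cst].
- apply: nearW => n; apply: (le_trans (nnsfun_le (g n))); apply: ge0_le_integral.
  + by [].
  + by move=> x _; rewrite lee_fin.
  + by apply/measurable_EFinP; exact: measurableT_comp mphi.
  + by apply/measurable_EFinP; exact: measurableT_comp mphi.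
  + move=> x _; rewrite lee_fin.
    have nd : nondecreasing_seq (fun n => g n (phi x)).
      by move=> a b ab; have /lefP := gnd _ _ ab; apply.
    have := nondecreasing_cvgn_le nd (cvgP _ (gr x)) n.
    by rewrite (cvg_lim _ (gr x)).
Qed.

End DensityBound.

Lemma indic_disjU {U : Type} {R : realType} (A B : set U) t : A `&` B = set0 ->
  \1_(A `|` B) t = \1_A t + \1_B t :> R.
Proof.
move=> AB; rewrite !indicE in_setU.
case: (boolP (t \in A)) => tA; case: (boolP (t \in B)) => tB; rewrite /= ?addr0 ?add0r//.
have : (A `&` B) t by split; apply: set_mem.
by rewrite AB.
Qed.

(** * Time integrals and energy estimates *)

Section TimeIntegral.
Context {d} {Om : measurableType d} {R : realType} (P : probability Om R).
Variable mu : {finite_measure set R -> \bar R}.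
Local Notation nu := (P \x mu)%E.

Lemma mu_lty : (mu setT < +oo)%E.
Proof. by rewrite -ge0_fin_numE//; exact: fin_num_measure. Qed.

(** Stated for any sigma-algebra on [X]: with [Ft t] it yields the adaptedness of time integrals.
    Positive and negative parts are handled by Tonelli, so the integral of every section is covered,
    integrable or not. *)
Lemma measurable_Rint {d'} {X : measurableType d'} (f : X * R -> R) :
  measurable_fun setT f -> measurable_fun setT (fun x => \int[mu]_u f (x, u)).
Proof.
move=> mf; have mf' : measurable_fun setT (EFin \o f) by exact/measurable_EFinP.
apply: (measurableT_comp (@fine_measurable R setT measurableT)).
have -> : (fun x => \int[mu]_u (f (x, u))%:E)%E =
    (fun x => fubini_F mu (EFin \o f)^\+ x - fubini_F mu (EFin \o f)^\- x)%E.
  apply/funext => x; rewrite [LHS]integralE /fubini_F.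
  congr (_ - _)%E; apply: eq_integral => u _.
    by rewrite !funeposE.
  by rewrite !funenegE.
apply: emeasurable_funB.
  by apply: (measurable_fun_fubini_tonelli_F _ (measurable_funepos mf')) => z.
by apply: (measurable_fun_fubini_tonelli_F _ (measurable_funeneg mf')) => z.
Qed.

Lemma nu_lty : (nu setT < +oo)%E.
Proof.
by rewrite -setXTT product_measure1E// lte_mul_pinfty ?fin_num_measure// mu_lty.
Qed.

(** Written as an inner product in time, so that linearity and Cauchy-Schwarz are those of [ip]. The
    lemmas about it apply on the paths where [g w] is square integrable, which is almost every
    path. *)
Definition tint (g : Om -> R -> R) (B : set R) (w : Om) : R := ip mu (g w) \1_B.

Definition unc (g : Om -> R -> R) (z : Om * R) : R := g z.1 z.2.

Definition mass (g : Om -> R -> R) (B : set R) : R :=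
  ip nu (fun z => unc g z * \1_B z.2) (fun z => unc g z * \1_B z.2).

Lemma tintE g B w : measurable B -> tint g B w = \int[mu]_(u in B) g w u.
Proof.
move=> mB; rewrite /tint /ip /Rintegral; congr fine; rewrite [RHS]integral_mkcond.
apply: eq_integral => u _; rewrite patchE indicE.
by case: (boolP (u \in B)) => _; rewrite ?mulr1 ?mulr0.
Qed.

Lemma indic_mu B : measurable B -> sqint mu (\1_B : R -> R).
Proof.
move=> mB; apply: (sqint_bounded (C := 1) mu_lty); first exact: measurable_indic.
by move=> x; rewrite indicE; case: (_ \in _); rewrite ?normr1 ?normr0.
Qed.

Lemma ip_indic_mu B : measurable B -> ip mu \1_B \1_B = fine (mu B).
Proof.
move=> mB; rewrite /ip /Rintegral; congr fine.
transitivity (\int[mu]_u (\1_B u)%:E)%E; last by rewrite integral_indic// setIT.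
apply: eq_integral => u _.
by rewrite indicE; case: (_ \in _); rewrite ?mulr1 ?mulr0.
Qed.

Section OneIntegrand.
Variable g : Om -> R -> R.
Hypothesis g2 : sqint nu (unc g).

Lemma slice_measurable w : measurable_fun setT (g w).
Proof. exact: (measurableT_comp g2.1 (pair1_measurable w)). Qed.

Lemma slice_sqint : {ae P, forall w, sqint mu (g w)}.
Proof.
have := ae_integrable1 (sqint_sq g2); apply: filterS => w iw.
split; first exact: slice_measurable.
have /integrableP[_] := iw; apply: le_lt_trans; apply: ge0_le_integral => //.
- by move=> x _; rewrite lee_fin sqr_ge0.
- by apply/measurable_EFinP; apply: measurable_funX; exact: slice_measurable.
- by apply: measurableT_comp => //; apply/measurable_EFinP; apply: measurable_funX; exact: slice_measurable.
- by move=> x _; rewrite /= lee_fin ger0_norm ?sqr_ge0.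
Qed.

Lemma sqint_cut B : measurable B -> sqint nu (fun z => unc g z * \1_B z.2).
Proof.
move=> mB; apply: sqint_le g2.
  apply: measurable_funM; first exact: g2.1.
  exact: (measurableT_comp (measurable_indic mB) measurable_snd).
by move=> z; rewrite normrM indicE; case: (_ \in _); rewrite ?normr1 ?mulr1// normr0 mulr0.
Qed.

Lemma mass_tonelli B : measurable B ->
  (\int[P]_w (ip mu (fun u => g w u * \1_B u) (fun u => g w u * \1_B u))%:E)%E = (mass g B)%:E.
Proof.
move=> mB; rewrite ipE; last exact: sqint_cut.
rewrite (fubini_tonelli1 _ _)//; last 2 first.
- apply/measurable_EFinP; apply: measurable_funX; exact: (sqint_cut mB).1.
- by move=> z; rewrite lee_fin sqr_ge0.
apply: ae_eq_integral => //.
- apply: measurableT_comp => //; apply: measurableT_comp => //=.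
  apply: (@measurable_fun_fubini_tonelli_F _ _ _ _ _ _ (fun z => ((unc g z * \1_B z.2) * (unc g z * \1_B z.2))%:E)).
    by apply/measurable_EFinP; apply: measurable_funM; exact: (sqint_cut mB).1.
  by move=> z; rewrite lee_fin -expr2 sqr_ge0.
- apply: measurable_fun_fubini_tonelli_F => //.
    by apply/measurable_EFinP; apply: measurable_funX; exact: (sqint_cut mB).1.
  by move=> z; rewrite lee_fin sqr_ge0.
- apply: filterS slice_sqint => w gw _; rewrite ipE//.
  apply: sqint_indic => //.
Qed.

Lemma tint_measurable B : measurable B -> measurable_fun setT (tint g B).
Proof.
move=> mB; apply: (measurable_Rint (f := fun z : Om * R => unc g z * \1_B z.2)).
exact: (sqint_cut mB).1.
Qed.

(** Cauchy-Schwarz in time, then Tonelli. The factor [mu B] is the source of the contraction on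
    short intervals. *)
Lemma tint_sqint B : measurable B -> sqint P (tint g B) /\
  ip P (tint g B) (tint g B) <= fine (mu B) * mass g B.
Proof.
move=> mB; have mt := tint_measurable mB.
have le : (\int[P]_w (tint g B w ^+ 2)%:E <= (fine (mu B) * mass g B)%:E)%E.
  rewrite EFinM -mass_tonelli// -ge0_integralZl_EFin//; last 3 first.
  - by move=> w _; rewrite lee_fin ip_ge0.
  - apply: measurableT_comp => //; apply: measurableT_comp => //=.
    apply: (@measurable_fun_fubini_tonelli_F _ _ _ _ _ _ (fun z => ((unc g z * \1_B z.2) * (unc g z * \1_B z.2))%:E)).
      by apply/measurable_EFinP; apply: measurable_funM; exact: (sqint_cut mB).1.
    by move=> z; rewrite lee_fin -expr2 sqr_ge0.
  - by rewrite fine_ge0.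
  apply: ae_ge0_le_integral => //.
  - by move=> w _; rewrite lee_fin sqr_ge0.
  - by apply/measurable_EFinP; exact: measurable_funX.
  - by move=> w _; rewrite -EFinM lee_fin mulr_ge0 ?ip_ge0// fine_ge0.
  - apply: measurable_funeM; apply: measurableT_comp => //; apply: measurableT_comp => //=.
    apply: (@measurable_fun_fubini_tonelli_F _ _ _ _ _ _ (fun z => ((unc g z * \1_B z.2) * (unc g z * \1_B z.2))%:E)).
      by apply/measurable_EFinP; apply: measurable_funM; exact: (sqint_cut mB).1.
    by move=> z; rewrite lee_fin -expr2 sqr_ge0.
  apply: filterS slice_sqint => w gw _; rewrite -EFinM lee_fin.
  have gB : sqint mu (fun u => g w u * \1_B u) by exact: sqint_indic.
  have := ip_CauchySchwarz gB (indic_mu mB); rewrite ip_indic_mu// mulrC.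
  rewrite (_ : ip mu (fun u => g w u * \1_B u) \1_B = tint g B w)//.
  rewrite /tint /ip; apply: eq_Rintegral => u _; rewrite -mulrA; congr (_ * _).
  by rewrite indicE; case: (_ \in _); rewrite ?mulr1 ?mulr0.
have t2 : sqint P (tint g B) by split => //; exact: le_lt_trans le (ltry _).
by split => //; rewrite -lee_fin ipE.
Qed.

Lemma mass_ge0 B : 0 <= mass g B.
Proof. exact: ip_ge0. Qed.

Lemma massU B B' : measurable B -> measurable B' -> B `&` B' = set0 ->
  mass g (B `|` B') = mass g B + mass g B'.
Proof.
move=> mB mB' BB'; rewrite /mass.
rewrite -[RHS](@ip_orthD _ _ _ nu _ _ (sqint_cut mB) (sqint_cut mB')).
  by congr ip; apply/funext => z; rewrite indic_disjU// mulrDr.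
rewrite /ip /Rintegral integral0_eq// => z _; congr EFin.
have [zB|zB] := boolP (z.2 \in B); last by rewrite !indicE (negbTE zB) mulr0 mul0r.
rewrite [X in _ * X](_ : _ = 0) ?mulr0// indicE memNset ?mulr0// => zB'.
have : (B `&` B') z.2 by split; [exact: set_mem|].
by rewrite BB'.
Qed.

End OneIntegrand.

Lemma tintU g B B' w : sqint mu (g w) -> measurable B -> measurable B' -> B `&` B' = set0 ->
  tint g (B `|` B') w = tint g B w + tint g B' w.
Proof.
move=> gw mB mB' BB'; rewrite /tint -ipDr//; [|exact: indic_mu|exact: indic_mu].
by congr ip; apply/funext => u; rewrite indic_disjU.
Qed.

Lemma tintB (g h : Om -> R -> R) B w : sqint mu (g w) -> sqint mu (h w) -> measurable B ->
  tint (fun w u => g w u - h w u) B w = tint g B w - tint h B w.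
Proof. by move=> gw hw mB; rewrite /tint ipBl//; exact: indic_mu. Qed.

(** Approaching [t] from the left keeps the atom at [t] in the domain, hence the closed end of the
    limit. *)
Lemma tint_left_cvg T g w t : sqint mu (g w) -> t <= T ->
  tint g `]s, T]%classic w @[s --> t^'-] --> tint g `[t, T]%classic w.
Proof.
move=> gw tT; apply/cvg_at_leftP => u [ut ucv]; rewrite /tint.
have [_ h] : sqint mu \1_(`[t, T]%classic) /\
    nrm mu (fun x => \1_(`]u n, T]%classic) x - \1_(`[t, T]%classic) x) @[n --> \oo] --> 0.
  apply: (@nrm_dominated_cvg _ _ _ mu (fun n => \1_(`]u n, T]%classic)) _ (cst 1)).
  - by move=> n; exact: measurable_indic.
  - exact: measurable_indic.
  - apply: aeW => x; have [tx|xt] := leP t x.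
      rewrite (_ : (fun n => _) = cst (\1_(`[t, T]%classic) x)); first exact: cvg_cst.
      apply/funext => n; rewrite /cst !indicE; congr (nat_of_bool _)%:R.
      by apply/idP/idP => /set_mem h; apply: mem_set; move: h; rewrite /= !in_itv/= tx (lt_le_trans (ut n) tx).
    rewrite [X in _ --> X](_ : _ = 0); last first.
      by rewrite indicE memNset//= in_itv/= leNgt xt.
    apply: cvg_near_cst; have := ucv => /cvgr_gt/(_ _ xt); apply: filterS => n xn.
    by rewrite indicE memNset//= in_itv/= ltNge ltW.
  - by apply: aeW => x n; rewrite normr1 indicE; case: (_ \in _); rewrite ?normr1 ?normr0.
  - exact: sqint_cst mu_lty _.
apply: ip_cvg => //.
- by move=> n; exact: indic_mu.
- exact: indic_mu.
- rewrite (_ : (fun n => _) = cst 0); first exact: cvg_cst.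
  apply/funext => n; rewrite /nrm /ip; under eq_Rintegral do rewrite subrr mulr0.
  by rewrite /Rintegral integral0 sqrtr0.
Qed.

End TimeIntegral.

(** * Energy identities for the difference of two solutions *)

Section Energy.
Context {d} {Om : measurableType d} {R : realType} (P : probability Om R).
Variables (Ft : R -> set (set Om)) (T : R).
Hypothesis HF : filtration Ft T.
Hypothesis T0 : 0 < T.
Variable mu : {finite_measure set R -> \bar R}.
Local Notation nu := (P \x mu)%E.

Lemma tint_mfunFt g t : 0 <= t <= T -> predictable Ft T g ->
  mfunG (Ft t) (tint mu g `]0, t]%classic).
Proof.
move=> tT pg; rewrite /mfunG.
pose Xt := g_sigma_algebraType (Ft t).
have mD : measurable ((setT `*` `]0, t]%classic) : set (Xt * R)) by exact: measurableX.
have mf : measurable_fun setT (fun z : Xt * R => g z.1 z.2 * \1_(`]0, t]%classic) z.2).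
  rewrite (_ : (fun z => _) = (fun z : Xt * R => g z.1 z.2) \_ (setT `*` `]0, t]%classic)).
    apply/(measurable_restrict _ mD measurableT); rewrite setTI.
    exact: (predictable_progressive HF T0 tT pg).
  apply/funext => z; rewrite patchE indicE.
  case: (boolP (z.2 \in (`]0, t]%classic : set R))) => zt.
    by rewrite mulr1 mem_set//; split => //; exact: set_mem zt.
  by rewrite mulr0 memNset// => -[_] /= h2; move/negP: zt; apply; rewrite mem_set.
have h := measurable_Rint mu mf.
exact: h.
Qed.

Variables (g y s : Om -> R -> R) (U : Om -> R).
Hypothesis g2 : sqint nu (unc g).
Hypothesis pg : predictable Ft T g.
Hypothesis ay : forall t, 0 <= t <= T -> mfunG (Ft t) (y^~ t).
Hypothesis ws : wmartingale P Ft T s.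
Hypothesis U2 : sqint P U.
Hypothesis sU : {ae P, forall w, forall t, 0 <= t <= T -> `|s w t| <= U w}.
Hypothesis yE : {ae P, forall w, forall t, 0 <= t <= T ->
  y w t = tint mu g `]t, T]%classic w - (s w T - s w t)}.
Hypothesis yl : {ae P, forall w, forall t, 0 < t <= T ->
  y w u @[u --> t^'-] --> left_proc T y w t}.

Let ds t w := s w T - s w t.

Let T01 : 0 <= T <= T. Proof. by rewrite lexx ltW. Qed.

Lemma ds_sqint t : 0 <= t <= T -> sqint P (ds t).
Proof. by move=> tT; have [_ s2 _] := ws; apply: sqintB; exact: s2. Qed.

Lemma state_sqint t : 0 <= t <= T -> sqint P (y^~ t).
Proof.
move=> tT; have mI : measurable (`]t, T]%classic : set R) by exact: measurable_itv.
have h2 := sqintB (tint_sqint g2 mI).1 (ds_sqint tT).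
have my : measurable_fun setT (y^~ t) by exact: (mfunFt_measurable HF tT (ay tT)).
split => //; case: h2 => mh; apply: le_lt_trans; rewrite le_eqVlt; apply/orP; left; apply/eqP.
apply: ae_eq_integral => //.
- by apply/measurable_EFinP; exact: measurable_funX.
- by apply/measurable_EFinP; exact: measurable_funX.
- by apply: filterS yE => w h _; rewrite h.
Qed.

(** [y t] is known at time [t] and [ds t] is a later increment, so the residual integral is their
    orthogonal sum. *)
Lemma energy t : 0 <= t <= T ->
  ip P (ds t) (ds t) <= ip P (tint mu g `]t, T]%classic) (tint mu g `]t, T]%classic).
Proof.
move=> tT; have /andP[t0 tT'] := tT.
have mI : measurable (`]t, T]%classic : set R) by exact: measurable_itv.
have y2 := state_sqint tT; have d2 := ds_sqint tT.
have o : ip P (y^~ t) (ds t) = 0 by exact: (wmartingale_orth HF ws t0 tT' (lexx T) (ay tT) y2).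
rewrite (_ : ip P (tint mu g _) _ = ip P (fun w => y w t + ds t w) (fun w => y w t + ds t w)).
  by rewrite (ip_orthD y2 d2 o) lerDr ip_ge0.
have e : {ae P, forall w, tint mu g `]t, T]%classic w = y w t + ds t w}.
  by apply: filterS yE => w h; rewrite (h _ tT) /ds subrK.
by apply: ip_ae; [exact: (tint_sqint g2 mI).1|exact: (tint_sqint g2 mI).1|exact: sqintD|exact: sqintD| |].
Qed.

Section LeftLimit.
Variable t : R.
Hypothesis tT : 0 < t <= T.

Let ym := left_proc T y.
(** This is s_T - s_(t-), expressed through [g] and the predictable left limit of [y], so that
    orthogonality to the strict past can be tested against it. *)
Let D w := tint mu g `[t, T]%classic w - ym w t.
Let tn (n : nat) : R := t - t / n.+1%:R.

Let tn_itv n : 0 <= tn n < t.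
Proof.
have /andP[t0 _] := tT; rewrite /tn subr_ge0 ler_pdivrMr// ler_peMr ?(ltW t0) ?ler1n//=.
by rewrite ltrBlDr ltrDl divr_gt0.
Qed.

Let tn_itvT n : 0 <= tn n <= T.
Proof. by have /andP[-> h] := tn_itv n; case/andP: tT => _; apply: le_trans; exact: ltW. Qed.

Let tn_cvg : tn n @[n --> \oo] --> t.
Proof.
rewrite -[X in _ --> X]subr0; apply: cvgB; first exact: cvg_cst.
by rewrite -(mulr0 t); apply: cvgM; [exact: cvg_cst|exact: cvg_harmonic].
Qed.

Let tn_left (f : R -> R) (l : R) : f u @[u --> t^'-] --> l -> f (tn n) @[n --> \oo] --> l.
Proof. by move/cvg_at_leftP; apply; split => // n; case/andP: (tn_itv n). Qed.

Let ymG : mfunG (past Ft t) (ym^~ t).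
Proof. by apply: (predictable_section HF T0 tT); exact: left_proc_predictable. Qed.

Let mD : measurable_fun setT D.
Proof.
apply: measurable_funB; first exact: (tint_sqint g2 (measurable_itv _)).1.1.
by apply: (mfunG_measurable _ ymG); apply: (past_measurable HF); case/andP: tT.
Qed.

Let D_cvg : sqint P D /\ nrm P (fun w => ds (tn n) w - D w) @[n --> \oo] --> 0.
Proof.
apply: (@nrm_dominated_cvg _ _ _ P (fun n => ds (tn n)) D (fun w => 2 * U w)).
- by move=> n; exact: (ds_sqint (tn_itvT n)).1.
- exact: mD.
- have := slice_sqint g2; move: yE yl; apply: filterS3 => w ye yle gw.
  have c1 := tn_left (tint_left_cvg gw (andP tT).2).
  have c2 := tn_left (yle _ tT).
  rewrite (_ : (fun n => ds (tn n) w) =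
      (fun n => tint mu g `]tn n, T]%classic w - y w (tn n))); first exact: cvgB c1 c2.
  by apply/funext => n; rewrite (ye _ (tn_itvT n)) /ds; ring.
- move: sU; apply: filterS => w h n; rewrite /ds.
  have U0 : 0 <= U w by apply: le_trans (h _ T01); exact: normr_ge0.
  rewrite (le_trans (ler_normB _ _))// (le_trans (lerD (h _ T01) (h _ (tn_itvT n))))//.
  by rewrite ger0_norm ?mulr_ge0// mulr_natl mulr2n.
- exact: sqintZ.
Qed.

(** For [n] large, [tn n] lies between [r] and [t], and the martingale property makes the integral
    of the increment over [A] vanish; L2 convergence keeps this in the limit. *)
Let D_past r A : 0 <= r < t -> Ft r A -> \int[P]_(w in A) D w = 0.
Proof.
move=> /andP[r0 rt] Ar; have [D2 cD] := D_cvg.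
have rT : 0 <= r <= T by rewrite r0; case/andP: tT => _; apply: le_trans; exact: ltW.
have mA : measurable A by exact: (Ft_measurable HF rT Ar).
have iA : sqint P (\1_A : Om -> R) by exact: indic_sqint.
rewrite Rintegral_ip.
have c : ip P \1_A (ds (tn n)) @[n --> \oo] --> ip P \1_A D.
  apply: ip_cvg => //; first by move=> n; exact: ds_sqint (tn_itvT n).
  rewrite (_ : (fun n => _) = cst 0); first exact: cvg_cst.
  by apply/funext => n; rewrite nrm_sub0.
suff z : \forall n \near \oo, ip P \1_A (ds (tn n)) = 0.
  have c0 : ip P \1_A (ds (tn n)) @[n --> \oo] --> 0.
    exact: cvg_near_cst.
  exact: (cvg_unique _ c c0).
have := tn_cvg => /cvgr_gt/(_ _ rt); apply: filterS => n rn.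
have /andP[n0 nT] := tn_itvT n.
rewrite -Rintegral_ip /ds; have [_ _ hm] := ws.
have An : Ft (tn n) A by exact: (Ft_le HF r0 (ltW rn) nT Ar).
rewrite RintegralB//; first by rewrite (hm _ _ n0 nT (lexx T) _ An) subrr.
  by apply: (integrableS measurableT) => //; apply: sqint_integrable (probability_lty P) _ _; have [_ + _] := ws; exact.
by apply: (integrableS measurableT) => //; apply: sqint_integrable (probability_lty P) _ _; have [_ + _] := ws; exact.
Qed.

Let D_orth h : mfunG (past Ft t) h -> sqint P h -> ip P h D = 0.
Proof. by move=> mh h2; apply: (past_orth HF T0 tT D_cvg.1) => // r A; exact: D_past. Qed.

Let J : Om -> R := tint mu g `[t, T]%classic.
Let J2 : sqint P J. Proof. exact: (tint_sqint g2 (measurable_itv _)).1. Qed.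

Lemma left_state_sqint : sqint P (ym^~ t).
Proof.
rewrite (_ : ym^~ t = (fun w => J w - D w)); first by apply: sqintB => //; exact: D_cvg.1.
by apply/funext => w; rewrite /D /J opprB addrC subrK.
Qed.

Lemma left_energy : ip P (ym^~ t) (ym^~ t) <= ip P J J.
Proof.
have JE : J = (fun w => ym w t + D w) by apply/funext => w; rewrite /D /J addrC subrK.
rewrite JE (ip_orthD left_state_sqint D_cvg.1 (D_orth ymG left_state_sqint)).
by rewrite lerDl ip_ge0.
Qed.

Let jump w := g w t * fine (mu [set t]).
Let J' : Om -> R := tint mu g `]t, T]%classic.

(** Predictability of [g] makes [jump], hence [ym - jump], measurable for the strict past, so its
    sum with [D] is orthogonal. Moving the atom to the side of the state leaves the integral over
    []t, T]] alone on the other side, with mass strictly to the right. *)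
Lemma jump_energy : [/\ sqint P jump, ip P (fun w => ym w t - jump w) (fun w => ym w t - jump w) +
  ip P D D <= ip P J' J' & ip P jump jump <= fine (mu [set t]) * mass P mu g [set t]].
Proof.
have m1 : measurable ([set t] : set R) by exact: measurable_set1.
have jE w : tint mu g [set t] w = jump w.
  transitivity (ip mu (fun u => g w t * (\1_[set t] : R -> R) u) \1_[set t]).
    apply: eq_Rintegral => u _; rewrite !indicE.
    by case: (boolP (u \in [set t])) => [/set_mem ->|_]; rewrite ?mulr1// !mulr0.
  by rewrite ipZl ?ip_indic_mu//; exact: indic_mu.
have jE' : jump = tint mu g [set t] by apply/funext => w; rewrite jE.
have j2 : sqint P jump by rewrite jE'; exact: (tint_sqint g2 m1).1.
split; [exact: j2| |by rewrite jE'; exact: (tint_sqint g2 m1).2].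
have jG : mfunG (past Ft t) jump.
  by apply: measurable_funM; [exact: (predictable_section HF T0 tT pg)|exact: measurable_cst].
have h2 : sqint P (fun w => ym w t - jump w) by apply: sqintB => //; exact: left_state_sqint.
have hG : mfunG (past Ft t) (fun w => ym w t - jump w) by apply: measurable_funB.
rewrite -(ip_orthD h2 D_cvg.1 (D_orth hG h2)) le_eqVlt; apply/orP; left; apply/eqP.
have mI : measurable (`]t, T]%classic : set R) by exact: measurable_itv.
have e : {ae P, forall w, ym w t - jump w + D w = J' w}.
  apply: filterS (slice_sqint g2) => w gw; rewrite /D -jE.
  have -> : `[t, T]%classic = [set t] `|` `]t, T]%classic.
    by rewrite setU1itv// bnd_simp; case/andP: tT.
  rewrite tintU//; first by rewrite /J'; ring.
  by apply/seteqP; split => // x [-> /=]; rewrite in_itv/= ltxx.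
have J'2 : sqint P J' by exact: (tint_sqint g2 mI).1.
have s2 := sqintD h2 D_cvg.1.
exact: (ip_ae s2 s2 J'2 J'2 e e).
Qed.

Lemma left_energy_limit v : (forall a, 0 <= a < t -> v <= ip P (ds a) (ds a)) -> v <= ip P D D.
Proof.
move=> hv; have [D2 cD] := D_cvg.
have c := ip_cvg (fun n => ds_sqint (tn_itvT n)) (fun n => ds_sqint (tn_itvT n)) D2 D2 cD cD.
by apply: (ler_cvg_to (cvg_cst v) c); apply: nearW => n; apply: hv; exact: tn_itv.
Qed.

End LeftLimit.

End Energy.

(** * The linear equation *)

Section VectorMeasurability.
Context {R : realType} (K : nat).

Lemma vec_coord (k : 'I_K) : measurable_fun setT ((fun v : 'rV[R]_K => v ord0 k) : vec R K -> R).
Proof.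
move=> _ B mB; rewrite setTI; apply: sub_sigma_algebra.
apply: sub_sigma_algebra; rewrite -bigcup_seq; exists k; first by rewrite /= mem_index_enum.
by exists B => //; rewrite setTI.
Qed.

Lemma measurable_to_vec {d} {X : measurableType d} (f : X -> 'rV[R]_K) :
  (forall k, measurable_fun setT (fun x => f x ord0 k)) ->
  measurable_fun setT (f : X -> vec R K).
Proof.
move=> mf; apply: (@measurability _ _ X (vec R K) setT f (rV_borel R K)) => //.
(* The Borel family is itself generated by the coordinates, so preimages are tested at this inner
   level of generation. *)
have h : rV_borel R K `<=` [set C | (measurable : set (set X)) (f @^-1` C)].
  apply: smallest_sub.
    split => [|B mB|G mG] /=; first by rewrite preimage_set0.
      by rewrite setTD preimage_setC; exact: measurableC.
    by rewrite preimage_bigcup; apply: bigcup_measurable => i _; exact: mG.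
  move=> C; rewrite -bigcup_seq => -[k _ [B mB <-]].
  by rewrite setTI /=; have := mf k measurableT _ mB; rewrite setTI.
by move=> _ [C HC <-]; rewrite setTI; exact: h.
Qed.

Lemma measurable_to_vecseq {d} {X : measurableType d} (f : X -> nat -> 'rV[R]_K) :
  (forall i k, measurable_fun setT (fun x => f x i ord0 k)) ->
  measurable_fun setT (f : X -> vecseq R K).
Proof.
move=> mf; apply: (@measurability _ _ X (vecseq R K) setT f (rVseq_cylinders R K)) => //.
move=> _ [C [i [B HB ->]] <-]; rewrite setTI.
have mi : measurable_fun setT ((fun x => f x i) : X -> vec R K).
  by apply: measurable_to_vec => k; exact: mf.
have := mi measurableT B; rewrite setTI; apply; exact: sub_sigma_algebra.
Qed.

End VectorMeasurability.

(** The integral of a nonnegative function is a supremum over the simple functions below it, so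
    monotonicity involves no measurability. This matters for the supremum over uncountably many
    times in [S2]. *)
Lemma ge0_integral_mono {d} {X : measurableType d} {R : realType} (m : {measure set X -> \bar R})
    (f g : X -> \bar R) : (forall x, 0 <= f x)%E -> (forall x, f x <= g x)%E ->
  (\int[m]_x f x <= \int[m]_x g x)%E.
Proof.
move=> f0 fg; have g0 x : (0 <= g x)%E by exact: le_trans (f0 x) (fg x).
rewrite !ge0_integralTE//; apply: ereal_sup_le => _ [h hf <-].
by exists h => // x; exact: le_trans (hf x) (fg x).
Qed.

Section ProductNull.
Context {d} {Om : measurableType d} {R : realType} (P : probability Om R).
Variable mu : {finite_measure set R -> \bar R}.
Local Notation nu := (P \x mu)%E.

Lemma ae_fst (Q : Om -> Prop) : {ae P, forall w, Q w} -> {ae nu, forall z, Q z.1}.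
Proof.
move=> [N [mN N0 NQ]]; exists (N `*` setT); split.
- exact: measurableX.
- by rewrite product_measure1E// (_ : _ N = 0%E) ?mul0e.
- by move=> [w u] /= h; split => //; apply: NQ.
Qed.

(** Tonelli with the expectation inside: second moments bounded at each fixed time give a bound
    proportional to [mu B]. *)
Lemma slice_integral_le (h : Om * R -> R) (B : set R) C : measurable_fun setT h ->
  (forall z, 0 <= h z) -> measurable B -> 0 <= C ->
  (forall u, B u -> \int[P]_w (h (w, u))%:E <= C%:E)%E ->
  (\int[nu]_z (h z * \1_B z.2)%:E <= C%:E * mu B)%E.
Proof.
move=> mh h0 mB C0 hC.
have mhB : measurable_fun setT (fun z : Om * R => (h z * \1_B z.2)%:E).
  apply/measurable_EFinP; apply: measurable_funM => //.
  exact: (measurableT_comp (measurable_indic mB) measurable_snd).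
rewrite (fubini_tonelli2 _ _)//; last by move=> z; rewrite lee_fin mulr_ge0// indicE.
have muB : mu B = (\int[mu]_u (\1_B u)%:E)%E by rewrite integral_indic// setIT.
rewrite muB -ge0_integralZl_EFin//; last by apply/measurable_EFinP; exact: measurable_indic.
apply: ge0_integral_mono => u; rewrite /fubini_G.
  by apply: integral_ge0 => w _; rewrite lee_fin mulr_ge0// indicE.
rewrite -EFinM; have [Bu|uB] := pselect (B u).
  have e w : h (w, u) * \1_B (w, u).2 = h (w, u) by rewrite indicE mem_set// mulr1.
  under eq_integral do rewrite e.
  by rewrite indicE mem_set// mulr1; exact: hC.
have e w : h (w, u) * \1_B (w, u).2 = 0 by rewrite indicE memNset// mulr0.
under eq_integral do rewrite e.
by rewrite integral0 indicE memNset// mulr0.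
Qed.

Lemma mass0_tint (D : Om -> R -> R) T : sqint nu (unc D) -> mass P mu D `]0, T]%classic = 0 ->
  {ae P, forall w, forall t, 0 <= t <= T -> tint mu D `]t, T]%classic w = 0}.
Proof.
move=> D2 D0; have mI : measurable (`]0, T]%classic : set R) by exact: measurable_itv.
pose sl w := ip mu (fun u => D w u * \1_(`]0, T]%classic) u)
    (fun u => D w u * \1_(`]0, T]%classic) u).
have h : (\int[P]_w `|(sl w)%:E| = 0)%E.
  rewrite -[RHS](congr1 EFin D0) -(mass_tonelli D2 mI).
  by apply: eq_integral => w _; rewrite gee0_abs// lee_fin ip_ge0.
move/ae_eq_integral_abs : h => /(_ measurableT) h.
have {}h : ae_eq P setT (fun w => (sl w)%:E) (cst 0%E).
  apply: h; apply/measurable_EFinP.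
  apply: (measurable_Rint mu (f := fun z : Om * R => unc D z * \1_(`]0, T]%classic) z.2 * (unc D z * \1_(`]0, T]%classic) z.2))).
  by apply: measurable_funM; exact: (sqint_cut D2 mI).1.
move: h (slice_sqint D2); apply: filterS2 => w /(_ I) [e0] Dw t /andP[t0 tT].
have mt : measurable (`]t, T]%classic : set R) by exact: measurable_itv.
have := ip_CauchySchwarz (sqint_indic mI Dw) (indic_mu mu mt).
rewrite [X in X * _](_ : _ = 0) ?mul0r => [le0|]; last exact: e0.
have -> : tint mu D `]t, T]%classic w = ip mu (fun u => D w u * \1_(`]0, T]%classic) u) \1_(`]t, T]%classic).
  apply: eq_Rintegral => u _; rewrite -mulrA indic_mul; congr (_ * indic _ _).
  apply/seteqP; split => v /=; rewrite !in_itv/=; last by case.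
  by move=> /andP[tv ->]; rewrite (le_lt_trans t0 tv) tv.
by apply/eqP; rewrite -sqrf_eq0 eq_le le0 sqr_ge0.
Qed.

End ProductNull.

Section LinearEquation.
Context {d} {Om : measurableType d} {R : realType} (P : probability Om R).
Variables (Ft : R -> set (set Om)) (T : R).
Hypothesis HF : filtration Ft T.
Hypothesis HU : usual_conditions P Ft T.
Hypothesis T0 : 0 < T.
Variables (M : nat -> Om -> R -> R) (A : nat -> Om -> cumulative R R).
Hypothesis HB : martingale_basis P Ft T M A.
Variable mu : {finite_measure set R -> \bar R}.
Local Notation nu := (P \x mu)%E.

Definition bsde_path (q : Om -> R) (g Y S : Om -> R -> R) : Prop :=
  {ae P, forall w, forall t, 0 <= t <= T ->
    q w = Y w t - tint mu g `]t, T]%classic w + (S w T - S w t)}.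

(** The left limits are read off the equation: the time integral has them, and so does the cadlag
    process [S]. *)
Lemma bsde_path_left q g Y S : sqint nu (unc g) -> sq_martingale P Ft T S ->
  bsde_path q g Y S ->
  {ae P, forall w, forall t, 0 < t <= T -> Y w u @[u --> t^'-] --> left_proc T Y w t}.
Proof.
move=> g2 [_ cS _] hY; move: hY (slice_sqint g2); apply: filterS2 => w h gw t tT.
have /andP[t0 tT'] := tT; have [_ /(_ t tT) cl] := cS w.
have c : Y w u @[u --> t^'-] --> q w + tint mu g `[t, T]%classic w -
    (S w T - lim (S w u @[u --> t^'-])).
  have c' : (fun u => q w + tint mu g `]u, T]%classic w - (S w T - S w u)) u @[u --> t^'-] -->
      q w + tint mu g `[t, T]%classic w - (S w T - lim (S w u @[u --> t^'-])).
    apply: cvgB; first by apply: cvgD; [exact: cvg_cst|exact: tint_left_cvg].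
    by apply: cvgB; [exact: cvg_cst|exact: cl].
  apply: cvg_trans c'; apply: near_eq_cvg.
  have n0 : \forall u \near t^'-, 0 < u by exact: nbhs_left_gt.
  have n1 : \forall u \near t^'-, u < t by exact: nbhs_left_lt.
  move: n0 n1; apply: filterS2 => u u0 ut.
  have uT : 0 <= u <= T by rewrite (ltW u0) (le_trans (ltW ut)).
  by rewrite (h u uT); ring.
by rewrite (left_proc_cvg T0 tT c).
Qed.

(** Fatou along the step approximations, whose value at each time is the value of [Y] at some grid
    point; second moments bounded uniformly in time therefore pass to the left limit. *)
Lemma left_proc_sqint Y C : (forall t, 0 <= t <= T -> mfunG (Ft t) (Y^~ t)) ->
  {ae P, forall w, forall t, 0 < t <= T -> Y w u @[u --> t^'-] --> left_proc T Y w t} ->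
  (forall t, 0 <= t <= T -> (\int[P]_w (Y w t ^+ 2)%:E <= C%:E)%E) -> 0 <= C ->
  sqint nu (fun z => left_proc T Y z.1 z.2 * strip T 0 z.2).
Proof.
move=> aY yl YC C0.
have mn n : measurable_fun setT (left_step T n Y : Om * R -> R).
  apply: measurable_sum => k.
  have mk := mfunFt_measurable HF (grid_itv T0 n k) (aY _ (grid_itv T0 n k)).
  exact: (measurable_rect _ _ mk).
have mstrip : measurable_fun setT (fun z : Om * R => strip T 0 z.2).
  have mi : measurable_fun setT (strip T 0) by exact: measurable_indic.
  exact: (measurableT_comp mi measurable_snd).
have mlp : measurable_fun setT (fun z : Om * R => left_proc T Y z.1 z.2 * strip T 0 z.2).
  apply: measurable_funM => //.
  rewrite (_ : (fun z : Om * R => _) = lsup (fun n => left_step T n Y)); first exact: measurable_lsup.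
  by apply/funext => -[].
split => //.
have sE u : strip T 0 u = \1_(`]0, T]%classic) u by [].
apply: (@le_lt_trans _ _ (C%:E * mu setT)%E); last by rewrite lte_mul_pinfty// mu_lty.
apply: (@fatou_le _ _ _ nu (fun n z => ((left_step T n Y z * strip T 0 z.2) ^+ 2)%:E)).
- by move=> n; apply/measurable_EFinP; apply: measurable_funX; exact: measurable_funM.
- by apply/measurable_EFinP; exact: measurable_funX.
- by move=> n z; rewrite lee_fin sqr_ge0.
- have := ae_fst mu yl; apply: filterS => -[w u] /= h.
  apply: cvg_EFin; first exact: nearW.
  suff c : left_step T n Y (w, u) * strip T 0 u @[n --> \oo] --> left_proc T Y w u * strip T 0 u.
    exact: (cvgM c c).
  have [uT|uT] := boolP (0 < u <= T); last first.
    rewrite sE indicE memNset ?mulr0; last by rewrite /= in_itv/=; exact/negP.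
    rewrite (_ : (fun n => _) = cst 0); first exact: cvg_cst.
    by apply/funext => n; rewrite mulr0.
  apply: cvgM; last exact: cvg_cst.
  exact: (left_step_cvg T0 uT (h u uT)).
- apply: nearW => n.
  have -> : (\int[nu]_z ((left_step T n Y z * strip T 0 z.2) ^+ 2)%:E =
      \int[nu]_z ((left_step T n Y z) ^+ 2 * \1_(`]0, T]%classic) z.2)%:E)%E.
    apply: eq_integral => z _; rewrite exprMn; congr (_ * _)%:E.
    by rewrite sE indicE; case: (_ \in _); rewrite ?expr1n ?expr0n.
  apply: le_trans (slice_integral_le mu (C := C) _ _ _ _ _) _ => //.
  + exact: measurable_funX.
  + by move=> z; exact: sqr_ge0.
  + move=> u /=; rewrite in_itv/= => uT.
    have [k kn ku] := grid_leftP n uT.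
    under eq_integral => w _ do rewrite (left_stepE T0 _ _ kn ku).
    exact: YC (grid_itv T0 n k).
  + apply: lee_wpmul2l; first by rewrite lee_fin.
    by apply: le_measure => //; apply: mem_set.
Qed.

(** The solution is corrected on a null set so that one square-integrable variable dominates all
    values of all paths, a form of the [S2] bound that avoids measuring a supremum. *)
Lemma linear_bsde q g : mfunG (Ft T) q -> sqint P q -> predictable Ft T g -> sqint nu (unc g) ->
  exists (Y : Om -> R -> R) (Z : nat -> Om -> R -> R) (S : Om -> R -> R),
  [/\ forall t, 0 <= t <= T -> mfunG (Ft t) (Y^~ t), is_stoch_int_series P Ft T M A Z S,
     (forall i, predictable Ft T (Z i)) /\
     (\int[P]_w \sum_(i <oo) bracket_int T (A i) w (fun t => (Z i w t ^+ 2)%:E) < +oo)%E,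
     bsde_path q g Y S
    & exists2 U, sqint P U & forall w t, 0 <= t <= T -> `|Y w t| <= U w].
Proof.
move=> mq q2 pg g2.
have T01 : 0 <= T <= T by rewrite lexx ltW.
have mI : measurable (`]0, T]%classic : set R) by exact: measurable_itv.
pose xi w := q w + tint mu g `]0, T]%classic w.
have mxi : mfunG (Ft T) xi by apply: measurable_funD => //; exact: (tint_mfunFt HF).
have xi2 : sqint P xi by apply: sqintD => //; exact: (tint_sqint g2 mI).1.
have [N sN NT] := cadlag_martingale_exists HF HU T0 mxi xi2.
have [_ _ _ _ /(_ N sN)[Z [S [pZ Z2 sS NS]]]] := HB.
pose Y0 w t := N w t - tint mu g `]0, t]%classic w.
have [V V2 [V0 NV]] := Doob_cadlag HF T0 sN.
(* The integral of [|g|] over []0, T]] bounds all partial integrals at once. *)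
pose G w (u : R) := `|g w u|.
have G2 : sqint nu (unc G).
  apply: (sqint_le _ _ g2); last by move=> z; rewrite normr_id.
  by apply: measurableT_comp g2.1.
pose U w := V w + tint mu G `]0, T]%classic w.
have U2 : sqint P U by apply: sqintD => //; exact: (tint_sqint G2 mI).1.
have Y0U : {ae P, forall w, forall t, 0 <= t <= T -> `|Y0 w t| <= U w}.
  move: NV (slice_sqint g2); apply: filterS2 => w h gw t tT.
  rewrite (le_trans (ler_normB _ _))// lerD ?h// /tint.
  have mt : measurable (`]0, t]%classic : set R) by exact: measurable_itv.
  have Gw : sqint mu (G w).
    by apply: (sqint_le _ _ gw); [apply: measurableT_comp gw.1|move=> u; rewrite normr_id].
  have i2 := sqint_mul Gw (indic_mu mu mI).
  have le1 u : \1_(`]0, t]%classic) u <= \1_(`]0, T]%classic) u :> R.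
    rewrite !indicE ler_nat; case: (boolP (u \in `]0, t]%classic)) => // /set_mem /=.
    rewrite in_itv/= => /andP[u0 ut]; rewrite mem_set//= in_itv/= u0 (le_trans ut)//.
    by case/andP: tT.
  have i0 u B : 0 <= \1_B u :> R by rewrite indicE.
  have key f : sqint mu f -> (forall u, f u <= G w u) ->
      ip mu f \1_(`]0, t]%classic) <= ip mu (G w) \1_(`]0, T]%classic).
    move=> f2 fG; have i1 := sqint_mul f2 (indic_mu mu mt).
    apply: le_Rintegral => // u _; apply: (@le_trans _ _ (G w u * \1_(`]0, t]%classic) u)).
      by apply: ler_wpM2r; [exact: i0|exact: fG].
    by apply: ler_wpM2l; [rewrite /G|exact: le1].
  rewrite ler_norml; apply/andP; split; last by apply: key => // u; exact: ler_norm.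
  rewrite lerNl -ipNl//; last exact: indic_mu.
  by apply: key; [exact: sqintN|move=> u; rewrite /G -normrN ler_norm].
(* Default value 0 on the null event where the bound fails; completeness keeps the process
   adapted. *)
pose Y w t := if `[< forall t, 0 <= t <= T -> `|Y0 w t| <= U w >] then Y0 w t else 0.
have YE : {ae P, forall w, forall t, Y w t = Y0 w t}.
  by apply: filterS Y0U => w h t; rewrite /Y asboolT.
have tG w : 0 <= tint mu G `]0, T]%classic w.
  by apply: Rintegral_ge0 => u _; apply: mulr_ge0; [rewrite /G|rewrite indicE].
exists Y, Z, S; split => //.
- move=> t tT; apply: (mfunFt_ae HF HU.1 tT (f := Y0^~ t)).
    by apply: filterS YE => w h; rewrite h.
  have wN := sq_martingale_wmartingale HF sN; have [aN _ _] := wN.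
  by apply: measurable_funB; [exact: aN|exact: (tint_mfunFt HF)].
- rewrite /bsde_path; have NS' : {ae P, forall w, (forall t : R, 0 <= t <= T -> N w t = N w 0 + S w t) /\ sqint mu (g w)}.
    by move: NS (slice_sqint g2); apply: filterS2.
  move: YE NT NS'.
  apply: filterS3 => w hY hT [hS gw] t tT.
  have /andP[t0 tT'] := tT.
  have e : tint mu g `]0, T]%classic w = tint mu g `]0, t]%classic w + tint mu g `]t, T]%classic w.
    rewrite -tintU//; last first.
      apply/seteqP; split => // u [/=]; rewrite !in_itv/= => /andP[_ ut] /andP[tu _].
      by move: (lt_le_trans tu ut); rewrite ltxx.
    by congr (tint _ _ _ _); rewrite -itv_bndbnd_setU// bnd_simp.
  rewrite hY /Y0; move: hT (hS T T01) (hS t tT); rewrite /xi e => -> h1 h2.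
  by move: h1; rewrite h2; lra.
- exists U => // w t tT; rewrite /Y; case: asboolP => [h|_]; first exact: h.
  by rewrite normr0 addr_ge0.
Qed.

End LinearEquation.

(** * The Lipschitz driver *)

Section DriverEstimate.
Context {d} {Om : measurableType d} {R : realType} (P : probability Om R) (K : nat).
Variables (Ft : R -> set (set Om)) (T : R).
Hypothesis HF : filtration Ft T.
Hypothesis T0 : 0 < T.
Variable mu : {finite_measure set R -> \bar R}.
Local Notation nu := (P \x mu)%E.
Local Notation PT := (g_sigma_algebraType (predictable_rectangles Ft T)).
Local Notation hz := (@horizon _ Om R Ft T).

Lemma predictable_cut (Z : Om -> R -> R) (B : set R) : predictable Ft T Z ->
  measurable B -> B `<=` `]0, T]%classic ->
  @measurable_fun _ _ PT R setT (fun z => Z z.1 z.2 * \1_B z.2).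
Proof.
move=> pZ mB BT; have mh := measurable_horizon HF T0.
have -> : (fun z : PT => Z z.1 z.2 * \1_B z.2) = ((fun z : PT => Z z.1 z.2 * \1_B z.2) \_ hz).
  apply/funext => z; rewrite patchE; case: ifPn => // zh.
  rewrite indicE memNset ?mulr0// => /BT /=; rewrite in_itv/= => /andP[z0 zT].
  by move/negP: zh; apply; apply/mem_set; split => //=; rewrite in_itv/= (ltW z0).
apply/(measurable_restrict _ mh measurableT); rewrite setTI.
apply: measurable_funM; first exact: pZ.
exact: (@predictable_of_time _ _ _ _ _ HF T0 _ (measurable_indic mB)).
Qed.

Section Density.
Variables (A : Om -> cumulative R R) (KA : {measure set (Om * R) -> \bar R}).
Hypothesis HK : is_bracketK P T A KA.
Variable rho : Om * R -> R.
Hypothesis Hrho : @ac_part_density _ PT R (bracket_measure P T A) nu rho.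

Lemma density_measurable : measurable_fun setT rho /\ forall z, 0 <= rho z.
Proof.
have [m1 [m2 [_ _ _ [mrho rho0] _]]] := Hrho; split => //.
exact: (measurableT_comp mrho (measurable_idG (predictable_rect_measurable HF T0))).
Qed.

(** The absolutely continuous part is at most the whole bracket measure. The seminorm of the
    Lipschitz condition is thereby controlled by the norm of the isometry. *)
Lemma density_cut_le (Z : Om -> R -> R) (B : set R) : predictable Ft T Z ->
  measurable B -> B `<=` `]0, T]%classic ->
  (\int[nu]_z ((Z z.1 z.2 * \1_B z.2) ^+ 2 * rho z)%:E <=
   \int[KA]_z ((Z z.1 z.2 * \1_B z.2) ^+ 2)%:E)%E.
Proof.
move=> pZ mB BT; have [m1 [m2 [mE _ _ [mrho rho0] m1E]]] := Hrho.
have mid := measurable_idG (predictable_rect_measurable HF T0).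
have mC (C : set PT) : measurable C -> (measurable : set (set (Om * R))) C.
  by move=> HC; have := mid measurableT C HC; rewrite setTI.
apply: (@density_integral_le _ _ (Om * R)%type PT R idfun mid nu KA rho m1 mrho rho0 _ _
  (fun z => (Z z.1 z.2 * \1_B z.2) ^+ 2)).
- by move=> C HC; exact: m1E.
- move=> C HC; rewrite preimage_id.
  have -> : KA C = bracket_measure P T A C.
    have [_ /(_ (fun z => (\1_C z)%:E))[||_]] := HK.
    + by apply/measurable_EFinP; exact: (measurable_indic (mC _ HC)).
    + by move=> z; rewrite lee_fin indicE.
    + by rewrite integral_indic ?setIT//; exact: mC.
  by rewrite mE// leeDl.
- by apply: measurable_funX; exact: predictable_cut.
- by move=> z; exact: sqr_ge0.
Qed.

End Density.

Variable F : Om -> R -> 'rV[R]_K -> (nat -> 'rV[R]_K) -> 'rV[R]_K.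
Hypothesis pF : predictable_driver Ft T F.

(** The driver evaluated on processes given coordinate by coordinate. It is set to 0 off []0, T]],
    so that norms over all times reduce to that interval. *)
Definition drive (y : 'I_K -> Om -> R -> R) (z : 'I_K -> nat -> Om -> R -> R)
    (k : 'I_K) (w : Om) (u : R) : R :=
  F w u (\row_j y j w u) (fun i => \row_j z j i w u) ord0 k * strip T 0 u.

Let mItv : measurable (`]0, T]%classic : set R). Proof. exact: measurable_itv. Qed.

Lemma drive_predictable y z k : (forall j, predictable Ft T (y j)) ->
  (forall j i, predictable Ft T (z j i)) -> predictable Ft T (drive y z k).
Proof.
move=> py pz.
pose h (p : PT) : PT * vec R K * vecseq R K :=
  ((p, \row_j (y j p.1 p.2 * strip T 0 p.2)), fun i => \row_j (z j i p.1 p.2 * strip T 0 p.2)).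
have mh : measurable_fun setT h.
  apply: measurable_fun_pair.
    apply: measurable_fun_pair; first exact: measurable_id.
    apply: measurable_to_vec => j; rewrite (_ : (fun x => _) = (fun p : PT => y j p.1 p.2 * strip T 0 p.2)).
      exact: predictable_cut.
    by apply/funext => p; rewrite mxE.
  apply: measurable_to_vecseq => i j; rewrite (_ : (fun x => _) = (fun p : PT => z j i p.1 p.2 * strip T 0 p.2)).
    exact: predictable_cut.
  by apply/funext => p; rewrite mxE.
have mD : measurable (((hz `*` setT) `*` setT) : set (PT * vec R K * vecseq R K)).
  by apply: measurableX => //; apply: measurableX => //; exact: (measurable_horizon HF T0).
have sub : [set h p | p in hz] `<=` ((hz `*` setT) `*` setT).
  by move=> _ [p hp <-].
have mFh := measurable_comp mD sub pF (measurable_funTS mh (D := hz)).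
have mc := measurableT_comp (vec_coord k) mFh.
rewrite /predictable /drive.
rewrite (_ : (fun p : PT => _) = (fun p : PT => ((fun v : 'rV[R]_K => v ord0 k) \o
   ((fun p => F p.1.1.1 p.1.1.2 p.1.2 p.2) \o h)) p * strip T 0 p.2)); last first.
  apply/funext => p /=; rewrite /strip indicE.
  case: (boolP (p.2 \in _)) => _; last by rewrite !mulr0.
  rewrite !mulr1; congr (F _ _ _ _ _ _); first by apply/rowP => j; rewrite !mxE mulr1.
  by apply/funext => i; apply/rowP => j; rewrite !mxE mulr1.
apply: measurable_funM; first exact: mc.
exact: (@predictable_of_time _ _ _ _ _ HF T0 _ (measurable_indic mItv)).
Qed.

Variables (A : nat -> Om -> cumulative R R) (KA : nat -> {measure set (Om * R) -> \bar R}).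
Hypothesis HK : forall i, is_bracketK P T (A i) (KA i).
Variable rho : nat -> Om * R -> R.
Hypothesis Hrho : forall i, @ac_part_density _ PT R (bracket_measure P T (A i)) nu (rho i).
Variables (c : R) (ct : R -> R).
Hypothesis mct : measurable_fun `[0, T]%classic ct.
Hypothesis ctc : forall t, 0 <= t <= T -> ct t <= c.
Hypothesis Lip : \forall p \ae nu, forall y y' z z',
     ((sqnorm (F p.1 p.2 y z - F p.1 p.2 y' z'))%:E <=
      (ct p.2 * sqnorm (y - y'))%:E +
      c%:E * M_sqnorm rho p.1 p.2 (fun i => z i - z' i)%R)%E.

(** [c] and [ct] may be negative: [cmax], and [ct0] on []0, T]], are nonnegative majorants of them.
    The 1 makes [cmax] positive, as it will appear in a denominator. *)
Definition cmax : R := Num.max c 1.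
Definition ct0 (u : R) : R := Num.max (ct u) 0 * strip T 0 u.

Lemma ct0_measurable : measurable_fun setT ct0.
Proof.
have mI : measurable (`[0, T]%classic : set R) by exact: measurable_itv.
rewrite (_ : ct0 = (fun u => Num.max (ct u) 0 * strip T 0 u) \_ (`[0, T]%classic)).
  apply/(measurable_restrict _ mI measurableT); rewrite setTI.
  apply: measurable_funM; last by apply: measurable_funTS; exact: measurable_indic.
  by apply: measurable_maxr.
apply/funext => u; rewrite patchE; case: ifPn => // uT.
rewrite /ct0 /strip indicE memNset ?mulr0// => /=; rewrite in_itv/= => /andP[u0 uT'].
by move/negP: uT; apply; apply/mem_set => /=; rewrite in_itv/= (ltW u0).
Qed.

Lemma ct0_bound u : 0 <= ct0 u <= cmax.
Proof.
rewrite /ct0 /strip indicE /cmax; case: (boolP (u \in _)) => [/set_mem /=|_]; last first.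
  by rewrite mulr0 lexx /= le_max ler01 orbT.
rewrite in_itv/= => /andP[u0 uT]; rewrite mulr1 le_max lexx orbT /= ge_max.
by rewrite !le_max ler01 orbT andbT ctc ?(ltW u0).
Qed.

(** All coordinates are integrated together because the Lipschitz condition bounds the full
    Euclidean norm. The part in z passes from densities to bracket measures by [density_cut_le]. *)
Lemma drive_lipschitz y y' z z' (B : set R) :
  (forall j, predictable Ft T (y j)) -> (forall j, predictable Ft T (y' j)) ->
  (forall j i, predictable Ft T (z j i)) -> (forall j i, predictable Ft T (z' j i)) ->
  measurable B -> B `<=` `]0, T]%classic ->
  (\sum_(k < K) \int[nu]_p (((drive y z k p.1 p.2 - drive y' z' k p.1 p.2) * \1_B p.2) ^+ 2)%:E <=
   \sum_(k < K) (\int[nu]_p (ct0 p.2 * ((y k p.1 p.2 - y' k p.1 p.2) * strip T 0 p.2) ^+ 2 * \1_B p.2)%:E +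
     cmax%:E * \sum_(i <oo) \int[KA i]_p (((z k i p.1 p.2 - z' k i p.1 p.2) * \1_B p.2) ^+ 2)%:E))%E.
Proof.
move=> py py' pz pz' mB BT.
have mid := measurable_idG (predictable_rect_measurable HF T0).
have toO (f : Om * R -> R) : @measurable_fun _ _ PT R setT f -> measurable_fun setT f.
  by move=> mf; exact: (measurableT_comp mf mid).
have pB (f f' : Om -> R -> R) : predictable Ft T f -> predictable Ft T f' ->
    predictable Ft T (fun w u => f w u - f' w u) by exact: measurable_funB.
have cm0 : 0 <= cmax by rewrite le_max ler01 orbT.
have mD k : measurable_fun setT (fun p : Om * R => (drive y z k p.1 p.2 - drive y' z' k p.1 p.2) * \1_B p.2).
  by apply: toO; apply: (predictable_cut (Z := fun w u => drive y z k w u - drive y' z' k w u)) => //;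
    apply: pB; exact: drive_predictable.
have mB2 : measurable_fun setT (fun p : Om * R => \1_B p.2 : R).
  exact: (measurableT_comp (measurable_indic mB) measurable_snd).
have mY k : measurable_fun setT (fun p : Om * R =>
    ct0 p.2 * ((y k p.1 p.2 - y' k p.1 p.2) * strip T 0 p.2) ^+ 2 * \1_B p.2).
  apply: measurable_funM => //; apply: measurable_funM.
    exact: (measurableT_comp ct0_measurable measurable_snd).
  apply: measurable_funX; apply: toO.
  by apply: (predictable_cut (Z := fun w u => y k w u - y' k w u)) => //; exact: pB.
have mZ k i : measurable_fun setT (fun p : Om * R => (z k i p.1 p.2 - z' k i p.1 p.2) * \1_B p.2).
  by apply: toO; apply: (predictable_cut (Z := fun w u => z k i w u - z' k i w u)) => //; exact: pB.
have mr i := (density_measurable (Hrho i)).1.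
have r0 i := (density_measurable (Hrho i)).2.
have mZr k i : measurable_fun setT (fun p : Om * R =>
    (((z k i p.1 p.2 - z' k i p.1 p.2) * \1_B p.2) ^+ 2 * rho i p)%:E).
  by apply/measurable_EFinP; apply: measurable_funM => //; exact: measurable_funX.
have Z0 k i p : (0 <= (((z k i p.1 p.2 - z' k i p.1 p.2) * \1_B p.2) ^+ 2 * rho i p)%:E)%E.
  by rewrite lee_fin mulr_ge0 ?sqr_ge0.
have Y0 k p : (0 <= (ct0 p.2 * ((y k p.1 p.2 - y' k p.1 p.2) * strip T 0 p.2) ^+ 2 * \1_B p.2)%:E)%E.
  by rewrite lee_fin mulr_ge0 ?indicE// mulr_ge0 ?sqr_ge0//; case/andP: (ct0_bound p.2).
have mS k : measurable_fun setT (fun p : Om * R => \sum_(i <oo)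
    (((z k i p.1 p.2 - z' k i p.1 p.2) * \1_B p.2) ^+ 2 * rho i p)%:E)%E.
  by apply: ge0_emeasurable_sum => // i p _ _; exact: Z0.
have S0 k p : (0 <= \sum_(i <oo) (((z k i p.1 p.2 - z' k i p.1 p.2) * \1_B p.2) ^+ 2 * rho i p)%:E)%E.
  by apply: nneseries_ge0 => i _ _; exact: Z0.
have cS0 k p : (0 <= cmax%:E * \sum_(i <oo) (((z k i p.1 p.2 - z' k i p.1 p.2) * \1_B p.2) ^+ 2 * rho i p)%:E)%E.
  by rewrite mule_ge0.
apply: (@le_trans _ _ (\int[nu]_p (\sum_(k < K)
   ((ct0 p.2 * ((y k p.1 p.2 - y' k p.1 p.2) * strip T 0 p.2) ^+ 2 * \1_B p.2)%:E +
    cmax%:E * \sum_(i <oo) (((z k i p.1 p.2 - z' k i p.1 p.2) * \1_B p.2) ^+ 2 * rho i p)%:E)))%E).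
  rewrite -ge0_integral_sum//; last 2 first.
  - by move=> k; apply/measurable_EFinP; exact: measurable_funX.
  - by move=> k p _; rewrite lee_fin sqr_ge0.
  apply: ae_ge0_le_integral => //.
  - by move=> p _; apply: sume_ge0 => k _; rewrite lee_fin sqr_ge0.
  - by apply: emeasurable_sum => k; apply/measurable_EFinP; exact: measurable_funX.
  - by move=> p _; apply: sume_ge0 => k _; rewrite adde_ge0.
  - apply: emeasurable_sum => k; apply: emeasurable_funD; first exact/measurable_EFinP.
    exact: measurable_funeM.
  apply: filterS Lip => p hp _.
  have [pB'|pB'] := boolP (p.2 \in B); last first.
    rewrite [leLHS]big1; last by move=> k _; rewrite [\1_B _]indicE (negbTE pB') mulr0 expr0n.
    by apply: sume_ge0 => k _; rewrite adde_ge0.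
  have pT : p.2 \in (`]0, T]%classic : set R) by apply/mem_set/BT; exact: set_mem pB'.
  have s1 : strip T 0 p.2 = 1 by rewrite /strip indicE pT.
  have b1 : \1_B p.2 = 1 :> R by rewrite indicE pB'.
  have := hp (\row_j y j p.1 p.2) (\row_j y' j p.1 p.2)
    (fun i => \row_j z j i p.1 p.2) (fun i => \row_j z' j i p.1 p.2).
  rewrite -sumEFin.
  have -> : (\sum_(k < K) ((((drive y z k p.1 p.2 - drive y' z' k p.1 p.2) * \1_B p.2) ^+ 2)%:E))%E =
     (sqnorm (F p.1 p.2 (\row_j y j p.1 p.2) (fun i => \row_j z j i p.1 p.2) -
       F p.1 p.2 (\row_j y' j p.1 p.2) (fun i => \row_j z' j i p.1 p.2)))%:E.
    by rewrite sumEFin /sqnorm; congr EFin; apply: eq_bigr => k _; rewrite /drive s1 b1 !mulr1 !mxE.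
  rewrite sumEFin; move=> /le_trans; apply.
  rewrite big_split /=; apply: leeD.
    rewrite sumEFin lee_fin /sqnorm mulr_sumr; apply: ler_sum => k _.
    by rewrite s1 b1 !mulr1 !mxE ler_wpM2r ?sqr_ge0// /ct0 s1 mulr1 le_max lexx.
  rewrite -ge0_sume_distrr//.
  rewrite -nneseries_sum//.
  rewrite /M_sqnorm -surjective_pairing; apply: (@le_trans _ _ (cmax%:E * \sum_(i <oo) (sqnorm (\row_j z j i p.1 p.2 - \row_j z' j i p.1 p.2) * rho i p)%:E)%E).
    apply: lee_wpmul2r; last by rewrite lee_fin le_max lexx.
    apply: nneseries_ge0 => i _ _; rewrite lee_fin mulr_ge0// sumr_ge0// => k _; exact: sqr_ge0.
  apply: lee_wpmul2l; first by rewrite lee_fin.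
  rewrite le_eqVlt; apply/orP; left; apply/eqP; apply: eq_eseriesr => i _.
  rewrite sumEFin; congr EFin; rewrite /sqnorm mulr_suml; apply: eq_bigr => k _.
  by rewrite b1 mulr1 !mxE.
rewrite ge0_integral_sum//; last 2 first.
- move=> k; apply: emeasurable_funD; first exact/measurable_EFinP.
  exact: measurable_funeM.
- by move=> k p _; rewrite adde_ge0.
apply: lee_sum => k _; rewrite ge0_integralD//; last 2 first.
- exact/measurable_EFinP.
- exact: measurable_funeM.
apply: leeD => //; rewrite ge0_integralZl//.
apply: lee_wpmul2l; first by rewrite lee_fin.
rewrite integral_nneseries//.
apply: lee_nneseries => i; first by move=> _ _; exact: integral_ge0.
move=> _; apply: (density_cut_le (HK i) (Hrho i) (Z := fun w u => z k i w u - z' k i w u)) => //.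
exact: pB.
Qed.

End DriverEstimate.

(** * Mass estimates for a pair of states *)

Section Contraction.
Context {d} {Om : measurableType d} {R : realType} (P : probability Om R) (K : nat).
Variables (Ft : R -> set (set Om)) (T : R).
Hypothesis HF : filtration Ft T.
Hypothesis T0 : 0 < T.
Variables (M : nat -> Om -> R -> R) (A : nat -> Om -> cumulative R R).
Hypothesis HB : martingale_basis P Ft T M A.
Variable mu : {finite_measure set R -> \bar R}.
Local Notation nu := (P \x mu)%E.
Local Notation PT := (g_sigma_algebraType (predictable_rectangles Ft T)).
Variable F : Om -> R -> 'rV[R]_K -> (nat -> 'rV[R]_K) -> 'rV[R]_K.
Hypothesis pF : predictable_driver Ft T F.
Variable rho : nat -> Om * R -> R.
Hypothesis Hrho : forall i, @ac_part_density _ PT R (bracket_measure P T (A i)) nu (rho i).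
Variables (c : R) (ct : R -> R).
Hypothesis mct : measurable_fun `[0, T]%classic ct.
Hypothesis ctc : forall t, 0 <= t <= T -> ct t <= c.
Hypothesis Lip : \forall p \ae nu, forall y y' z z',
     ((sqnorm (F p.1 p.2 y z - F p.1 p.2 y' z'))%:E <=
      (ct p.2 * sqnorm (y - y'))%:E +
      c%:E * M_sqnorm rho p.1 p.2 (fun i => z i - z' i)%R)%E.
Variable q : 'I_K -> Om -> R.

(** A driver process with one solution of its linear equation. The solution is data rather than a
    function of the driver, so that estimates on pairs of states serve the chosen iterates and an
    arbitrary competitor alike. *)
Record state := State {
  st_g : 'I_K -> Om -> R -> R;
  st_Y : 'I_K -> Om -> R -> R;
  st_Z : 'I_K -> nat -> Om -> R -> R;
  st_S : 'I_K -> Om -> R -> R }.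

Definition driven (x : state) (k : 'I_K) : Om -> R -> R :=
  drive T F (fun j => left_proc T (st_Y x j)) (st_Z x) k.

Definition is_state (x : state) : Prop :=
  [/\ forall k, predictable Ft T (st_g x k) /\ sqint nu (unc (st_g x k)),
      forall k t, 0 <= t <= T -> mfunG (Ft t) ((st_Y x k)^~ t),
      forall k, is_stoch_int_series P Ft T M A (st_Z x k) (st_S x k),
      forall k, bsde_path P T mu (q k) (st_g x k) (st_Y x k) (st_S x k)
    & forall k, sqint nu (unc (driven x k))].

Definition dmass (g h : 'I_K -> Om -> R -> R) (B : set R) : R :=
  \sum_(k < K) mass P mu (fun w u => g k w u - h k w u) B.

Definition Adm (al be : set R -> R) : Prop := exists x x',
  [/\ is_state x, is_state x', al = dmass (st_g x) (st_g x') & be = dmass (driven x) (driven x')].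

Lemma mass_additive (g : Om -> R -> R) : sqint nu (unc g) -> interval_additive T (mass P mu g).
Proof.
move=> g2; split.
- by move=> B; exact: mass_ge0.
- rewrite set_itvoc0 /mass indic0.
  rewrite /ip /Rintegral; under eq_integral do rewrite mulr0 mul0r.
  by rewrite integral0.
- move=> t /andP[t0 tT]; rewrite -massU//; last by apply/seteqP; split => // x [-> /=]; rewrite in_itv/= ltxx.
  by rewrite setU1itv// bnd_simp.
- move=> a b a0 ab bT; rewrite -massU//; last first.
    apply/seteqP; split => // x [/=]; rewrite !in_itv/= => /andP[_ xb] /andP[bx _].
    by move: (lt_le_trans xb bx); rewrite ltxx.
  congr (mass _ _ _ _); apply/seteqP; split => x /=; rewrite !in_itv/=.
    move=> /andP[ax xT]; have [bx|xb] := leP b x; first by right; rewrite xT.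
    by left; rewrite ax.
  by move=> [/andP[-> /ltW xb]|/andP[bx ->]]; rewrite ?(le_trans xb bT)// (lt_le_trans ab bx).
Qed.

Lemma dmass_additive g h : (forall k, sqint nu (unc (g k))) -> (forall k, sqint nu (unc (h k))) ->
  interval_additive T (dmass g h).
Proof.
move=> g2 h2; have gh2 k : interval_additive T (mass P mu (fun w u => g k w u - h k w u)).
  by apply: mass_additive; exact: (sqintB (g2 k) (h2 k)).
split.
- by move=> B; apply: sumr_ge0 => k _; exact: mass_ge0.
- by rewrite /dmass big1// => k _; have [_ -> _ _] := gh2 k.
- move=> t tT; rewrite /dmass -big_split; apply: eq_bigr => k _ /=.
  by have [_ _ h1 _] := gh2 k; exact: h1.
- move=> a b a0 ab bT; rewrite /dmass -big_split; apply: eq_bigr => k _ /=.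
  by have [_ _ _ h1] := gh2 k; exact: h1.
Qed.

Lemma Adm_additive al be : Adm al be -> interval_additive T al /\ interval_additive T be.
Proof.
move=> [x [x' [[g2 _ _ _ n2] [g2' _ _ _ n2'] -> ->]]].
by split; apply: dmass_additive => k //; [exact: (g2 k).2|exact: (g2' k).2].
Qed.

Section Pair.
Variables (KA : nat -> {measure set (Om * R) -> \bar R}).
Hypothesis HK : forall i, is_bracketK P T (A i) (KA i).
Variables x x' : state.
Hypothesis Sx : is_state x.
Hypothesis Sx' : is_state x'.

Let g k w u := st_g x k w u - st_g x' k w u.
Let y k w u := st_Y x k w u - st_Y x' k w u.
Let s k w u := st_S x k w u - st_S x' k w u.
Let ds k t w := s k w T - s k w t.

Let series k : sq_martingale P Ft T (st_S x k) /\ sq_martingale P Ft T (st_S x' k).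
Proof. by have [_ _ h _ _] := Sx; have [_ _ h' _ _] := Sx'; have [? _ _] := h k; have [? _ _] := h' k. Qed.

Let g2 k : sqint nu (unc (g k)).
Proof. by have [h _ _ _ _] := Sx; have [h' _ _ _ _] := Sx'; apply: sqintB; [exact: (h k).2|exact: (h' k).2]. Qed.

Let pg k : predictable Ft T (g k).
Proof. by have [h _ _ _ _] := Sx; have [h' _ _ _ _] := Sx'; apply: measurable_funB; [exact: (h k).1|exact: (h' k).1]. Qed.

Let ay k t : 0 <= t <= T -> mfunG (Ft t) ((y k)^~ t).
Proof. by move=> tT; have [_ h _ _ _] := Sx; have [_ h' _ _ _] := Sx'; apply: measurable_funB; [exact: h|exact: h']. Qed.

Let ws k : wmartingale P Ft T (s k).
Proof.
have [sS sS'] := series k.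
have [a1 b1 c1] := sq_martingale_wmartingale HF sS.
have [a2 b2 c2] := sq_martingale_wmartingale HF sS'.
split=> [t tT|t tT|r t r0 rt tT B rB].
- by apply: measurable_funB; [exact: a1|exact: a2].
- by apply: sqintB; [exact: b1|exact: b2].
have rT : 0 <= r <= T by rewrite r0 (le_trans rt).
have tT' : 0 <= t <= T by rewrite tT (le_trans r0).
have mB := Ft_measurable HF rT rB.
have iS f : sqint P f -> P.-integrable B (EFin \o f).
  by move=> f2; apply: (integrableS measurableT) => //; exact: (sqint_integrable (probability_lty P) f2).
rewrite !RintegralB//; try (by apply: iS; first [exact: b1|exact: b2]).
by rewrite (c1 _ _ r0 rt tT _ rB) (c2 _ _ r0 rt tT _ rB).
Qed.

Let sU k : exists2 U, sqint P U & {ae P, forall w, forall t, 0 <= t <= T -> `|s k w t| <= U w}.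
Proof.
have [sS sS'] := series k.
have [U U2 [U0 h]] := Doob_cadlag HF T0 sS; have [V V2 [V0 h']] := Doob_cadlag HF T0 sS'.
exists (fun w => U w + V w); first exact: sqintD.
move: h h'; apply: filterS2 => w h h' t tT.
by rewrite (le_trans (ler_normB _ _))// lerD ?h ?h'.
Qed.

Let yE k : {ae P, forall w, forall t, 0 <= t <= T ->
  y k w t = tint mu (g k) `]t, T]%classic w - (s k w T - s k w t)}.
Proof.
have [gg _ _ h _] := Sx; have [gg' _ _ h' _] := Sx'.
have sl : {ae P, forall w, sqint mu (st_g x k w) /\ sqint mu (st_g x' k w)}.
  by move: (slice_sqint (gg k).2) (slice_sqint (gg' k).2); apply: filterS2.
have hk := h k; have hk' := h' k; rewrite /bsde_path in hk hk'.
move: hk hk' sl; apply: filterS3 => w e e' [a b] t tT.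
rewrite tintB//; have := e t tT; have := e' t tT; rewrite /y /s; lra.
Qed.

Let yl k : {ae P, forall w, forall t, 0 < t <= T ->
  y k w u @[u --> t^'-] --> left_proc T (y k) w t /\
  left_proc T (y k) w t = left_proc T (st_Y x k) w t - left_proc T (st_Y x' k) w t}.
Proof.
have [gg _ _ h _] := Sx; have [gg' _ _ h' _] := Sx'; have [sS sS'] := series k.
move: (bsde_path_left T0 (gg k).2 sS (h k)) (bsde_path_left T0 (gg' k).2 sS' (h' k)).
apply: filterS2 => w e e' t tT.
have cc : y k w u @[u --> t^'-] --> left_proc T (st_Y x k) w t - left_proc T (st_Y x' k) w t.
  by apply: cvgB; [exact: e|exact: e'].
by rewrite (left_proc_cvg T0 tT cc).
Qed.

Let yl' k : {ae P, forall w, forall t, 0 < t <= T -> y k w u @[u --> t^'-] --> left_proc T (y k) w t}.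
Proof. by apply: filterS (yl k) => w h t tT; have [] := h t tT. Qed.

(** Isometry from [a] on, then restriction to [B]. The time [a] stays outside [B], so at an atom [t]
    this is used for [a < t] and followed by a limit. *)
Let zsum k a (B : set R) : 0 <= a <= T -> measurable B -> B `<=` `]a, T]%classic ->
  (\sum_(i <oo) \int[KA i]_p (((st_Z x k i p.1 p.2 - st_Z x' k i p.1 p.2) * \1_B p.2) ^+ 2)%:E <=
   (ip P (ds k a) (ds k a))%:E)%E.
Proof.
move=> aT mB Ba; have [_ _ h _ _] := Sx; have [_ _ h' _ _] := Sx'.
have [W2 cW] := series_isometry HF T0 HB HK (h k) (h' k) aT.
pose W i (z : Om * R) := st_Z x k i z.1 z.2 * strip T a z.2 - st_Z x' k i z.1 z.2 * strip T a z.2.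
apply: (@le_trans _ _ (\sum_(i <oo) (ip (KA i) (W i) (W i))%:E)%E).
  apply: lee_nneseries => [i _ _|i _].
    by apply: integral_ge0 => p _; rewrite lee_fin sqr_ge0.
  rewrite ipE//; apply: ge0_integral_mono => p; first by rewrite lee_fin sqr_ge0.
  rewrite lee_fin /W -mulrBl !exprMn ler_wpM2l ?sqr_ge0// /strip !indicE.
  case: (boolP (p.2 \in B)) => [/set_mem/Ba pB|_]; last by rewrite expr0n sqr_ge0.
  by rewrite mem_set.
have e n : (\sum_(0 <= i < n) (ip (KA i) (W i) (W i))%:E = (\sum_(i < n) ip (KA i) (W i) (W i))%:E)%E.
  by rewrite sumEFin big_mkord.
have cE : (\sum_(i < n) ip (KA i) (W i) (W i))%:E @[n --> \oo] --> (ip P (ds k a) (ds k a))%:E.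
  apply: cvg_EFin; first exact: nearW.
  have -> : ds k a = (fun w => (st_S x k w T - st_S x k w a) - (st_S x' k w T - st_S x' k w a)).
    by apply/funext => w; rewrite /ds /s; ring.
  exact: cW.
rewrite le_eqVlt; apply/orP; left; apply/eqP/cvg_lim => //.
by under eq_fun do rewrite e.
Qed.

Let tle B B' k : measurable B -> measurable B' -> B `<=` B' -> mass P mu (g k) B <= mass P mu (g k) B'.
Proof.
move=> mB mB' BB; rewrite -[X in _ <= mass _ _ _ X](setDUK BB).
rewrite massU//; first by rewrite lerDl mass_ge0.
- exact: measurableD.
- by rewrite setDIK.
Qed.

Let muT := fine (mu setT).
Let muT0 : 0 <= muT. Proof. exact: fine_ge0. Qed.
Let mu_le B : measurable B -> fine (mu B) <= muT.
Proof.
move=> mB; apply: fine_le; [exact: fin_num_measure|exact: fin_num_measure|].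
by apply: le_measure => //; apply: mem_set.
Qed.

Let tint_le B k : measurable B -> ip P (tint mu (g k) B) (tint mu (g k) B) <= muT * mass P mu (g k) B.
Proof.
move=> mB; apply: le_trans (tint_sqint (g2 k) mB).2 _.
by apply: ler_wpM2r; [exact: mass_ge0|exact: mu_le].
Qed.

(* Splitting the residual integral at [b] keeps the small factor [mu `]a, b[]
   in front of the mass of the open piece. *)
Let tint_split k a b : 0 <= a -> a < b -> b <= T ->
  ip P (tint mu (g k) `]a, T]%classic) (tint mu (g k) `]a, T]%classic) <=
  2 * (fine (mu `]a, b[%classic) * mass P mu (g k) `]a, b[%classic) +
  2 * (muT * mass P mu (g k) `[b, T]%classic).
Proof.
move=> a0 ab bT.
have m1 : measurable (`]a, b[%classic : set R) by exact: measurable_itv.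
have m2 : measurable (`[b, T]%classic : set R) by exact: measurable_itv.
have m3 : measurable (`]a, T]%classic : set R) by exact: measurable_itv.
have [t1 l1] := tint_sqint (g2 k) m1; have [t2 _] := tint_sqint (g2 k) m2.
have [t3 _] := tint_sqint (g2 k) m3; have t12 := sqintD t1 t2.
have e : {ae P, forall w, tint mu (g k) `]a, T]%classic w =
    tint mu (g k) `]a, b[%classic w + tint mu (g k) `[b, T]%classic w}.
  apply: filterS (slice_sqint (g2 k)) => w gw; rewrite -tintU//; last first.
    apply/seteqP; split => // v [/=]; rewrite !in_itv/= => /andP[_ xb] /andP[bx _].
    by move: (lt_le_trans xb bx); rewrite ltxx.
  congr (tint _ _ _ _); apply/seteqP; split => v /=; rewrite !in_itv/=.
    move=> /andP[av xT]; have [bx|xb] := leP b v; first by right; rewrite xT.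
    by left; rewrite av.
  by move=> [/andP[-> /ltW xb]|/andP[bx ->]]; rewrite ?(le_trans xb bT)// (lt_le_trans ab bx).
rewrite (ip_ae t3 t3 t12 t12 e e); apply: le_trans (ipD_le t1 t2) _.
by apply: lerD; rewrite ler_pM2l//; exact: tint_le.
Qed.

Let dnext2 k : sqint nu (unc (fun w u => driven x k w u - driven x' k w u)).
Proof. by have [_ _ _ _ h] := Sx; have [_ _ _ _ h'] := Sx'; exact: (sqintB (h k) (h' k)). Qed.

Let ymE k u w := left_proc T (y k) w u.

(** Separates what is to be bounded in the output: the left-limit state at each time of [B],
    integrated at the cost of a factor [mu B], and the bracket norm of the integrands on [B]. *)
Lemma next_mass_le (B : set R) (ey ez : 'I_K -> R) : measurable B -> B `<=` `]0, T]%classic ->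
  (forall k, 0 <= ey k) ->
  (forall k u, B u -> ct0 T ct u * ip P (ymE k u) (ymE k u) <= ey k) ->
  (forall k, (\sum_(i <oo) \int[KA i]_p
     (((st_Z x k i p.1 p.2 - st_Z x' k i p.1 p.2) * \1_B p.2) ^+ 2)%:E <= (ez k)%:E)%E) ->
  dmass (driven x) (driven x') B <= \sum_(k < K) (ey k * fine (mu B) + cmax c * ez k).
Proof.
move=> mB BT ey0 hy hz; rewrite -lee_fin /dmass -sumEFin.
have pl (w : state) k : is_state w -> predictable Ft T (left_proc T (st_Y w k)).
  by move=> [_ h _ _ _]; apply: left_proc_predictable => //; exact: h.
have pz (w : state) k i : is_state w -> predictable Ft T (st_Z w k i).
  by move=> [_ _ h _ _]; have [_ _ [J hJ _]] := h k; case: (hJ i).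
have := drive_lipschitz HF T0 pF HK Hrho mct ctc Lip (fun j => pl x j Sx) (fun j => pl x' j Sx')
  (fun j i => pz x j i Sx) (fun j i => pz x' j i Sx') mB BT.
under eq_bigr => k _ do rewrite -(@ipE _ _ _ nu _ (sqint_cut (dnext2 k) mB)).
move/le_trans; apply; rewrite -sumEFin; apply: lee_sum => k _; rewrite EFinD.
apply: leeD; last first.
  by rewrite EFinM; apply: lee_wpmul2l; [rewrite lee_fin le_max ler01 orbT|exact: hz].
have mlp (w : state) : is_state w -> measurable_fun setT
    (fun p : Om * R => left_proc T (st_Y w k) p.1 p.2 * strip T 0 p.2).
  by move=> Sw; exact: (predictable_strip_measurable HF T0 (lexx 0) (pl w k Sw)).
pose h (p : Om * R) := ct0 T ct p.2 *
  ((left_proc T (st_Y x k) p.1 p.2 - left_proc T (st_Y x' k) p.1 p.2) * strip T 0 p.2) ^+ 2.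
have ct00 u : 0 <= ct0 T ct u by case/andP: (ct0_bound ctc u).
have mh : measurable_fun setT h.
  apply: measurable_funM; first exact: (measurableT_comp (ct0_measurable mct) measurable_snd).
  apply: measurable_funX.
  rewrite (_ : (fun p : Om * R => _) = (fun p : Om * R => left_proc T (st_Y x k) p.1 p.2 * strip T 0 p.2 -
     left_proc T (st_Y x' k) p.1 p.2 * strip T 0 p.2)); last by apply/funext => p; rewrite mulrBl.
  by apply: measurable_funB; exact: mlp.
apply: (@le_trans _ _ ((ey k)%:E * mu B)%E); last by rewrite EFinM fineK// fin_num_measure.
apply: (slice_integral_le mu (h := h)) => //; first by move=> z; rewrite mulr_ge0 ?sqr_ge0.
move=> u Bu; rewrite /h /=.
have uT : 0 < u <= T by have := BT u Bu; rewrite /= in_itv.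
have sl : sqint P (ymE k u).
  have [U U2 hU] := sU k.
  exact: (left_state_sqint HF T0 (g2 k) (@ay k) (ws k) U2 hU (yE k) (yl' k) uT).
apply: (@le_trans _ _ (ct0 T ct u * ip P (ymE k u) (ymE k u))%:E); last first.
  by rewrite lee_fin; exact: (hy k u Bu).
rewrite EFinM ipE// -ge0_integralZl_EFin//; last 2 first.
- by move=> w _; rewrite lee_fin sqr_ge0.
- by apply/measurable_EFinP; apply: measurable_funX; exact: sl.1.
rewrite le_eqVlt; apply/orP; left; apply/eqP; apply: ae_eq_integral => //.
- apply/measurable_EFinP; exact: (measurableT_comp mh (pair2_measurable u)).
- apply: measurable_funeM; apply/measurable_EFinP; apply: measurable_funX; exact: sl.1.
apply: filterS (yl k) => w hw _; have [_ e] := hw u uT.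
by rewrite /ymE e -EFinM /strip indicE mem_set ?mulr1//= in_itv.
Qed.

(** Without driver mass the energy bound kills [s_T - s_t] at each time. Dyadic times share one null
    set, and cadlag paths carry the equality from them to all times. *)
Lemma pair_unique : (forall k, mass P mu (g k) `]0, T]%classic = 0) ->
  (forall k, {ae P, forall w, forall t, 0 <= t <= T -> st_Y x k w t = st_Y x' k w t}) /\
  (forall k, \sum_(i <oo) \int[KA i]_p
     (((st_Z x k i p.1 p.2 - st_Z x' k i p.1 p.2) * \1_(`]0, T]%classic) p.2) ^+ 2)%:E = 0)%E.
Proof.
move=> gm.
have ds0 k t : 0 <= t <= T -> ip P (ds k t) (ds k t) = 0.
  move=> tT; have /andP[t0 tT'] := tT; apply/eqP; rewrite eq_le ip_ge0 andbT.
  apply: le_trans (energy HF T0 (g2 k) (@ay k) (ws k) (yE k) tT) _.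
  have mt : measurable (`]t, T]%classic : set R) by exact: measurable_itv.
  apply: le_trans (tint_le k mt) _.
  rewrite [X in _ * X](_ : _ = 0) ?mulr0//; apply/eqP; rewrite eq_le mass_ge0 andbT.
  rewrite -(gm k); apply: tle => //.
  by move=> v /=; rewrite !in_itv/= => /andP[tv ->]; rewrite (le_lt_trans t0 tv).
split=> k.
  have dz n j : {ae P, forall w, ds k (grid T n j) w = 0}.
    by apply: sqint_ae0; [exact: ds_sqint (ws k) _ (grid_itv T0 n j)|exact: ds0 (grid_itv T0 n j)].
  have dz' : {ae P, forall w, forall n j, ds k (grid T n j) w = 0}.
    by apply: ae_foralln => n; apply: ae_foralln => j; exact: dz.
  move: dz' (yE k) (mass0_tint (g2 k) (gm k)); apply: filterS3 => w h hy ht t tT.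
  have [sS sS'] := series k; have [_ /(_ w)[r1 l1] _] := sS; have [_ /(_ w)[r2 l2] _] := sS'.
  have cf : cadlag T (fun u => s k w T - s k w u).
    split=> u uT.
      by apply: cvgB; [exact: cvg_cst|apply: cvgB; [exact: r1|exact: r2]].
    by apply: is_cvgB; [exact: is_cvg_cst|apply: is_cvgB; [exact: l1|exact: l2]].
  have f0 : `|s k w T - s k w t| <= 0.
    apply: (dyadic_bound T0 cf _ tT) => _ [n [j ->]].
    by have := h n j; rewrite /ds => ->; rewrite normr0.
  have {}f0 : s k w T - s k w t = 0 by apply/eqP; rewrite -normr_le0.
  by apply/eqP; rewrite -subr_eq0; have := hy t tT; rewrite /y f0 ht// subr0 => ->.
apply/eqP; rewrite eq_le; apply/andP; split.
  have T00 : 0 <= (0 : R) <= T by rewrite lexx ltW.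
  have mI : measurable (`]0, T]%classic : set R) by exact: measurable_itv.
  have := zsum k T00 mI (@subset_refl _ _).
  by rewrite (ds0 k 0 T00).
by apply: nneseries_ge0 => i _ _; apply: integral_ge0 => p _; rewrite lee_fin sqr_ge0.
Qed.

(** The state costs [muT] and gains the small factor by integration over []a, b[]; the integrands
    gain it through [tint_split], whose constant is 2. This is the [muT + 2] in front of the mass of
    the piece. *)
Lemma Adm_open_pair a b : 0 <= a -> a < b -> b <= T ->
  dmass (driven x) (driven x') `]a, b[%classic <=
  cmax c * fine (mu `]a, b[%classic) * (muT + 2) * dmass (st_g x) (st_g x') `]a, b[%classic +
  cmax c * (muT * muT + 2 * muT) * dmass (st_g x) (st_g x') `[b, T]%classic.
Proof.
move=> a0 ab bT; have aT : a <= T by rewrite (le_trans (ltW ab)).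
have m1 : measurable (`]a, b[%classic : set R) by exact: measurable_itv.
have cm0 : 0 <= cmax c by rewrite le_max ler01 orbT.
pose m k B := mass P mu (g k) B.
have m0 k B : 0 <= m k B by exact: mass_ge0.
have mS k : m k `]a, T]%classic = m k `]a, b[%classic + m k `[b, T]%classic.
  by have [_ _ _ h1] := mass_additive (g2 k); exact: h1.
apply: le_trans (next_mass_le (ey := fun k => cmax c * (muT * m k `]a, T]%classic))
  (ez := fun k => ip P (ds k a) (ds k a)) m1 _ _ _ _) _.
- move=> v /=; rewrite !in_itv/= => /andP[av vb]; rewrite (le_lt_trans a0 av)/=.
  exact: le_trans (ltW vb) bT.
- by move=> k; rewrite !mulr_ge0.
- move=> k u /=; rewrite in_itv/= => /andP[au ub].
  have uT : 0 < u <= T by rewrite (le_lt_trans a0 au) (le_trans (ltW ub)).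
  have [c00 c0c] := andP (ct0_bound (c := c) ctc u).
  have [U U2 hU] := sU k.
  apply: ler_pM => //; first exact: ip_ge0.
  apply: le_trans (left_energy HF T0 (g2 k) (@ay k) (ws k) U2 hU (yE k) (yl' k) uT) _.
  apply: le_trans (tint_le k (measurable_itv _)) _.
  rewrite ler_wpM2l//; apply: tle => //.
  by move=> v /=; rewrite !in_itv/= => /andP[uv ->]; rewrite (lt_le_trans au uv).
- move=> k; apply: zsum => //; first by rewrite a0.
  by move=> v /=; rewrite !in_itv/= => /andP[-> vb]; exact: le_trans (ltW vb) bT.
rewrite /dmass !mulr_sumr -big_split /=; apply: ler_sum => k _.
have aT' : 0 <= a <= T by rewrite a0.
have e1 := energy HF T0 (g2 k) (@ay k) (ws k) (yE k) aT'.
have e2 := tint_split k a0 ab bT.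
rewrite -/(g k) -/(m k _) -/(m k _) mS.
set f := fine (mu _) in e2 *.
have f0 : 0 <= f by exact: fine_ge0.
have fT : f <= muT by exact: mu_le.
rewrite -/(m k _) -/(m k _) in e2.
have e3 := le_trans e1 e2.
have h1 : cmax c * ip P (ds k a) (ds k a) <= cmax c * (2 * (f * m k `]a, b[%classic) + 2 * (muT * m k `[b, T]%classic)).
  exact: ler_wpM2l.
have h2 : cmax c * muT * m k `[b, T]%classic * f <= cmax c * muT * m k `[b, T]%classic * muT.
  by apply: ler_wpM2l => //; rewrite !mulr_ge0.
have := lerD h1 h2; lra.
Qed.

(** Young's inequality with weight [e] for y_(t-) as the sum of the jump and the remainder. Of the
    two factors [mu{t}], one comes from the jump and one from integrating over the atom; the
    remainder and the integrands at [t] are paid by the mass strictly to the right. *)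
Lemma Adm_point_pair t e : 0 < t <= T -> 0 < e ->
  dmass (driven x) (driven x') [set t] <=
  (1 + e) * (ct0 T ct t * fine (mu [set t]) ^+ 2) * dmass (st_g x) (st_g x') [set t] +
  ((1 + e^-1) * cmax c * muT * muT + cmax c * muT) * dmass (st_g x) (st_g x') `]t, T]%classic.
Proof.
move=> tT e0; have /andP[t0 tT'] := tT.
have m1 : measurable ([set t] : set R) by exact: measurable_set1.
have mI : measurable (`]t, T]%classic : set R) by exact: measurable_itv.
have cm0 : 0 <= cmax c by rewrite le_max ler01 orbT.
have [c00 c0c] := andP (ct0_bound (c := c) ctc t).
pose m k B := mass P mu (g k) B.
have m0 k B : 0 <= m k B by exact: mass_ge0.
set f := fine (mu [set t]); have f0 : 0 <= f by exact: fine_ge0.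
have fT : f <= muT by exact: mu_le.
have E k : [/\ ip P (ymE k t) (ymE k t) <= (1 + e) * (f * m k [set t]) +
      (1 + e^-1) * (muT * m k `]t, T]%classic) &
    (\sum_(i <oo) \int[KA i]_p
     (((st_Z x k i p.1 p.2 - st_Z x' k i p.1 p.2) * \1_[set t] p.2) ^+ 2)%:E <=
     (muT * m k `]t, T]%classic)%:E)%E].
  have [U U2 hU] := sU k.
  have [j2 jE jm] := jump_energy HF T0 (g2 k) (pg k) (@ay k) (ws k) U2 hU (yE k) (yl' k) tT.
  have yl2 := left_state_sqint HF T0 (g2 k) (@ay k) (ws k) U2 hU (yE k) (yl' k) tT.
  have tl := tint_le k mI.
  split.
    have yj2 := sqintB yl2 j2.
    have := ipDD j2 yj2; have cs := ip_CauchySchwarz j2 yj2.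
    rewrite (_ : (fun w => _ + _) = ymE k t); last by apply/funext => w; rewrite /ymE addrC subrK.
    move=> ->; move: cs jm jE tl; rewrite -/(m k _) -/(m k _) -/f.
    set p := ip P _ _; set a := ip P _ _; set b := ip P _ _; set D := ip P _ _.
    move=> cs jm jE tl.
    have D0 : 0 <= D by exact: ip_ge0.
    have a0 : 0 <= a by exact: ip_ge0.
    have b0 : 0 <= b by exact: ip_ge0.
    have am : a <= f * m k [set t] := jm.
    have bm : b <= muT * m k `]t, T]%classic by apply: le_trans tl; apply: le_trans jE; rewrite lerDl.
    (* Cauchy-Schwarz bounds the cross term by [a * b], and the square of [e * a - e^-1 * b]
       converts this into the weighted sum. *)
    have amgm : 2 * p <= e * a + e^-1 * b.
      have ei0 : 0 < e^-1 by rewrite invr_gt0.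
      have ee : e * e^-1 = 1 by rewrite mulfV// gt_eqF.
      have sq : (2 * p) ^+ 2 <= (e * a + e^-1 * b) ^+ 2.
        have h4 : (2 * p) ^+ 2 <= 4 * (a * b) by rewrite exprMn; nra.
        apply: le_trans h4 _.
        have -> : (e * a + e^-1 * b) ^+ 2 = (e * a - e^-1 * b) ^+ 2 + 4 * (e * e^-1) * (a * b) by ring.
        by rewrite ee mulr1 lerDr sqr_ge0.
      have n0 : 0 <= e * a + e^-1 * b by rewrite addr_ge0// mulr_ge0// ltW.
      apply: le_trans (ler_norm _) _; rewrite -(ger0_norm n0).
      by rewrite -ler_sqr ?nnegrE// !real_normK ?num_real.
    have h1 : (1 + e) * a <= (1 + e) * (f * m k [set t]) by apply: ler_wpM2l => //; rewrite addr_ge0// ltW.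
    have h2 : (1 + e^-1) * b <= (1 + e^-1) * (muT * m k `]t, T]%classic).
      by apply: ler_wpM2l => //; rewrite addr_ge0// invr_ge0 ltW.
    lra.
  set V := (\sum_(i <oo) _)%E.
  (* The bound holds for every [a < t]; the energies converge to that of [D], which [jump_energy]
     controls by mass to the right of the atom. *)
  have zs a : 0 <= a < t -> (V <= (ip P (ds k a) (ds k a))%:E)%E.
    move=> /andP[a0 at_]; apply: zsum => //; first by rewrite a0 (le_trans (ltW at_)).
    by move=> v /= ->; rewrite in_itv/= at_.
  have V0 : (0 <= V)%E.
    by apply: nneseries_ge0 => i _ _; apply: integral_ge0 => p _; rewrite lee_fin sqr_ge0.
  have Vf : V \is a fin_num.
    by rewrite ge0_fin_numE//; apply: le_lt_trans (zs 0 _) (ltry _); rewrite lexx t0.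
  rewrite -(fineK Vf) lee_fin.
  have vs a : 0 <= a < t -> fine V <= ip P (ds k a) (ds k a).
    by move=> h; rewrite -lee_fin fineK//; exact: zs.
  have := left_energy_limit HF T0 (g2 k) (@ay k) (ws k) U2 hU (yE k) (yl' k) tT vs.
  move/le_trans; apply; apply: le_trans tl; apply: le_trans jE.
  by rewrite lerDr ip_ge0.
apply: le_trans (next_mass_le
  (ey := fun k => ct0 T ct t * ((1 + e) * (f * m k [set t]) + (1 + e^-1) * (muT * m k `]t, T]%classic)))
  (ez := fun k => muT * m k `]t, T]%classic) m1 _ _ _ _) _.
- by move=> v /= ->; rewrite in_itv/= t0.
- move=> k; rewrite mulr_ge0// addr_ge0// mulr_ge0 ?mulr_ge0// addr_ge0// ?invr_ge0 ltW//.
- by move=> k u /= ->; apply: ler_wpM2l => //; have [] := E k.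
- by move=> k; have [] := E k.
rewrite /dmass !mulr_sumr -big_split /=; apply: ler_sum => k _.
rewrite -/(g k) -/(m k _) -/(m k _) -/f.
set X := m k [set t]; set Y := m k `]t, T]%classic.
have X0 : 0 <= X by exact: m0.
have Y0 : 0 <= Y by exact: m0.
have ei0 : 0 < e^-1 by rewrite invr_gt0.
have h1 : ct0 T ct t * ((1 + e^-1) * (muT * Y)) * f <= cmax c * ((1 + e^-1) * (muT * Y)) * muT.
  have E0 : 0 <= (1 + e^-1) * (muT * Y) by apply: mulr_ge0; [rewrite addr_ge0// ltW|exact: mulr_ge0].
  by apply: ler_pM; [exact: mulr_ge0|exact: f0|exact: ler_wpM2r|exact: fT].
rewrite mulrDr mulrDl.
rewrite (_ : (1 + e) * (ct0 T ct t * f ^+ 2) * X = ct0 T ct t * ((1 + e) * (f * X)) * f); last by ring.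
rewrite -addrA lerD2l.
rewrite (_ : ((1 + e^-1) * cmax c * muT * muT + cmax c * muT) * Y =
  cmax c * ((1 + e^-1) * (muT * Y)) * muT + cmax c * (muT * Y)); last by ring.
by rewrite lerD2r.
Qed.

End Pair.

End Contraction.

(** * Data of the driven equation *)

Section RowLimits.
Context {R : realType} (K : nat).

Lemma row_cvg {U : Type} (G : set_system U) {FG : ProperFilter G} (f : 'I_K -> U -> R) (l : 'I_K -> R) :
  (forall k, f k x @[x --> G] --> l k) ->
  (\row_k f k x : 'rV[R]_K) @[x --> G] --> (\row_k l k : 'rV[R]_K).
Proof.
move=> h B [Q HQ QB].
have : \forall x \near G, forall k, Q ord0 k (f k x).
  by apply: filter_forall => k; apply: h; have := HQ ord0 k; rewrite mxE.
apply: filterS => x hx; apply: QB => i j; rewrite mxE.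
by rewrite (ord1 i); exact: hx.
Qed.

Lemma left_lim_cvg (f : R -> 'rV[R]_K) (l : 'rV[R]_K) t : f x @[x --> t^'-] --> l ->
  f x @[x --> t^'-] --> left_lim f t.
Proof. by move=> c; rewrite /left_lim; exact: (cvgP l c). Qed.

Lemma left_lim_row (f : 'I_K -> R -> R) (l : 'I_K -> R) t :
  (forall k, f k x @[x --> t^'-] --> l k) ->
  left_lim (fun x => \row_k f k x) t = \row_k l k.
Proof.
move=> h.
have c : (\row_k f k x : 'rV[R]_K) @[x --> t^'-] --> (\row_k l k : 'rV[R]_K) by exact: row_cvg.
have c' := left_lim_cvg c.
apply/rowP => k; rewrite mxE.
have ck : f k x @[x --> t^'-] --> left_lim (fun x => \row_k f k x) t ord0 k.
  have e : f k = (fun x => (\row_j f j x : 'rV[R]_K) ord0 k) by apply/funext => x; rewrite mxE.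
  rewrite e; apply: (cvg_comp (fun x => (\row_j f j x : 'rV[R]_K)) (fun N : 'rV[R]_K => N ord0 k) c').
  exact: coord_continuous.
exact: cvg_unique ck (h k).
Qed.

End RowLimits.

Section MoreTime.
Context {R : realType} (mu : {finite_measure set R -> \bar R}).

(** The driver of an arbitrary competitor is only known to be integrable in time, so the L2 argument
    of [tint_left_cvg] is replaced by dominated convergence. *)
Lemma Rintegral_left_cvg (h : R -> R) (T t : R) : 0 < t <= T ->
  mu.-integrable `]0, T] (EFin \o h) -> exists l : R,
  \int[mu]_(u in `]s, T]) h u @[s --> t^'-] --> l.
Proof.
move=> /andP[t0 tT] ih; exists (\int[mu]_(u in `[t, T]) h u); apply/cvg_at_leftP => v [vt vcv].
have mI : measurable (`]0, T]%classic : set R) by exact: measurable_itv.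
pose h0 := (EFin \o h) \_ `]0, T].
have ih0 : mu.-integrable setT h0 by rewrite -integrable_mkcond.
have mh0 := measurable_int _ ih0.
pose fn n := h0 \_ `]v n, T]; pose f := h0 \_ `[t, T].
have mr (B : set R) : measurable B -> measurable_fun setT (h0 \_ B).
  by move=> mB; apply/(measurable_restrict _ mB measurableT); exact: measurable_funTS.
have [|||||_ _ dc] := @dominated_convergence _ _ _ mu setT measurableT fn f (abse \o h0).
- by move=> n; exact: mr.
- exact: mr.
- apply: aeW => x _; apply: cvg_near_cst.
  have [tx|xt] := leP t x.
    apply: nearW => n; rewrite /fn /f !patchE; congr (if _ then _ else _).
    by apply/idP/idP => /set_mem; rewrite /= in_itv/= => /andP[_ xT]; apply/mem_set; rewrite /= in_itv/= xT ?tx ?(lt_le_trans (vt n) tx).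
  have := vcv => /cvgr_gt/(_ _ xt); apply: filterS => n xn.
  by rewrite /fn /f !patchE !memNset//= in_itv/= ?(leNgt t x) ?xt// ltNge (ltW xn).
- exact: integrable_abse.
- apply: aeW => x n _; rewrite /fn patchE; case: ifPn => _; first exact: lexx.
  by rewrite abse0 abse_ge0.
have fin B : measurable B -> (\int[mu]_(x in setT) (h0 \_ B) x)%E \is a fin_num.
  move=> mB; apply: integrable_fin_num => //; rewrite -integrable_mkcond//.
  exact: (integrableS measurableT).
have e (a : itv_bound R) : (BRight 0 <= a)%O -> (\int[mu]_(u in [set` Interval a (BRight T)]) (h u)%:E =
    \int[mu]_(x in setT) (h0 \_ [set` Interval a (BRight T)]) x)%E.
  move=> a0; rewrite integral_mkcond; apply: eq_integral => u _.
  rewrite !patchE; case: ifPn => // /set_mem /= ua; rewrite /h0 patchE mem_set//=.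
  by move: ua; rewrite !itv_boundlr => /andP[au ->]; rewrite (le_trans a0 au).
have := vcv => /cvgr_gt/(_ _ t0) v0.
have c2 : (fine \o (fun n => \int[mu]_(x in setT) (fn n) x)%E) n @[n --> \oo] --> \int[mu]_(u in `[t, T]) h u.
  apply: fine_cvg; rewrite /Rintegral e ?bnd_simp// fineK; last exact: fin.
  exact: dc.
apply: cvg_trans c2; apply: near_eq_cvg; move: v0; apply: filterS => n vn.
by rewrite /Rintegral /= e// bnd_simp ltW.
Qed.

End MoreTime.

Section NextState.
Context {d} {Om : measurableType d} {R : realType} (P : probability Om R) (K : nat).
Variables (Ft : R -> set (set Om)) (T : R).
Hypothesis HF : filtration Ft T.
Hypothesis T0 : 0 < T.
Variables (M : nat -> Om -> R -> R) (A : nat -> Om -> cumulative R R).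
Hypothesis HB : martingale_basis P Ft T M A.
Variable mu : {finite_measure set R -> \bar R}.
Local Notation nu := (P \x mu)%E.
Local Notation PT := (g_sigma_algebraType (predictable_rectangles Ft T)).
Variable F : Om -> R -> 'rV[R]_K -> (nat -> 'rV[R]_K) -> 'rV[R]_K.
Hypothesis pF : predictable_driver Ft T F.
Variable rho : nat -> Om * R -> R.
Hypothesis Hrho : forall i, @ac_part_density _ PT R (bracket_measure P T (A i)) nu (rho i).
Variables (c : R) (ct : R -> R).
Hypothesis mct : measurable_fun `[0, T]%classic ct.
Hypothesis ctc : forall t, 0 <= t <= T -> ct t <= c.
Hypothesis Lip : \forall p \ae nu, forall y y' z z',
     ((sqnorm (F p.1 p.2 y z - F p.1 p.2 y' z'))%:E <=
      (ct p.2 * sqnorm (y - y'))%:E +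
      c%:E * M_sqnorm rho p.1 p.2 (fun i => z i - z' i)%R)%E.
Hypothesis F0 : (\int[P]_w \int[mu]_(t in `]0%R, T]) (sqnorm (F w t 0 (fun=> 0)))%:E < +oo)%E.
Variables (KA : nat -> {measure set (Om * R) -> \bar R}).
Hypothesis HK : forall i, is_bracketK P T (A i) (KA i).

(** Since [A] starts at 0, its total mass [A w T] is already carried by []0, T]]. Norms over the
    closed horizon and over []0, T]] therefore coincide. *)
Lemma bracketK_off i : KA i (setT `*` ~` `]0, T]%classic) = 0%E.
Proof.
have mI : measurable (~` `]0, T]%classic : set R) by apply: measurableC; exact: measurable_itv.
have mX : measurable ((setT `*` ~` `]0, T]%classic) : set (Om * R)) by exact: measurableX.
have [_ /(_ (fun z => (\1_(setT `*` ~` `]0, T]%classic) z)%:E))[||_]] := HK i.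
- by apply/measurable_EFinP; exact: measurable_indic.
- by move=> z; rewrite lee_fin indicE.
rewrite integral_indic// setIT => ->; apply: integral0_eq => w _.
have mb : measurable_fun setT (fun t => (\1_(~` `]0, T]%classic) t)%:E : \bar R).
  by apply/measurable_EFinP; exact: measurable_indic.
rewrite (_ : (fun t => _) = (fun t => (\1_(~` `]0, T]%classic) t)%:E)); last first.
  apply/funext => t; congr EFin; rewrite !indicE; congr (nat_of_bool _)%:R.
  by apply/idP/idP => /set_mem h; apply/mem_set; [case: h|split].
rewrite bracket_intE//.
rewrite integral_indic// setIT.
have A0 := basis_bracket_ge0 HB i.
have e0 := bracket_kernel_oc (T := T) (A i) w (lexx 0) (ltW T0) (lexx T).
have eT := bracket_kernel_setT T0 A0 w.
have mI' : measurable (`]0, T]%classic : set R) by exact: measurable_itv.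
have := measureU (bracket_kernel T (A i) w) mI' mI.
rewrite setUCr; move=> /(_ (setICr _)); rewrite [X in X = _]eT [X in (X + _)%E]e0 (A0 w 0 (lexx 0)) subr0.
move=> /eqP; rewrite addeC -sube_eq ?ltry//; first by rewrite subee// => /eqP <-.
by rewrite fin_num_adde_defl.
Qed.

Lemma onT_cut i (h : Om -> R -> R) : predictable Ft T h ->
  (\int[KA i]_z (onT T h z ^+ 2)%:E = \int[KA i]_z ((h z.1 z.2 * \1_(`]0, T]%classic) z.2) ^+ 2)%:E)%E.
Proof.
move=> ph; have mh := predictable_measurable HF T0 ph.
have mI : measurable (~` `]0, T]%classic : set R) by apply: measurableC; exact: measurable_itv.
apply: ae_eq_integral => //.
- by apply/measurable_EFinP; apply: measurable_funX; exact: onT_measurable.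
- by apply/measurable_EFinP; apply: measurable_funX; exact: (predictable_strip_measurable HF T0 (lexx 0) ph).
exists (setT `*` ~` `]0, T]%classic); split; [exact: measurableX|exact: bracketK_off|].
move=> [w u] /= hne; split => // uI; apply: hne => _; congr (_ ^+ 2)%:E.
rewrite /onT /= !indicE !mem_set//=; move: uI; rewrite /= !in_itv/= => /andP[u0 ->].
by rewrite (ltW u0).
Qed.

Lemma z_sum (h : nat -> Om -> R -> R) : (forall i, predictable Ft T (h i)) ->
  (\int[P]_w \sum_(i <oo) bracket_int T (A i) w (fun t => (h i w t ^+ 2)%:E) =
   \sum_(i <oo) \int[KA i]_z ((h i z.1 z.2 * \1_(`]0, T]%classic) z.2) ^+ 2)%:E)%E.
Proof.
move=> ph; have mh i := predictable_measurable HF T0 (ph i).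
have e i w : bracket_int T (A i) w (fun t => (h i w t ^+ 2)%:E) =
    bracket_int T (A i) w (fun t => (onT T (h i) (w, t) ^+ 2)%:E).
  by apply: eq_integral => t tT; rewrite /onT indicE /= tT mulr1.
rewrite integral_nneseries//.
- apply: eq_eseriesr => i _; rewrite -onT_cut//.
  by rewrite (bracketK_onT (HK i) (mh i)).
- move=> i; rewrite (_ : (fun w => _) = (fun w => bracket_int T (A i) w (fun t => (onT T (h i) (w, t) ^+ 2)%:E))).
    have [_ /(_ (fun z => (onT T (h i) z ^+ 2)%:E))[||//]] := HK i.
      by apply/measurable_EFinP; apply: measurable_funX; exact: onT_measurable.
    by move=> z; rewrite lee_fin sqr_ge0.
  by apply/funext => w; exact: e.
- by move=> i w _; apply: integral_ge0 => t _; rewrite lee_fin sqr_ge0.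
Qed.

Let mI : measurable (`]0, T]%classic : set R). Proof. exact: measurable_itv. Qed.

Lemma drive0_sqint k : sqint nu (unc (drive T F (fun _ _ _ => 0) (fun _ _ _ _ => 0) k)).
Proof.
have p0 : predictable Ft T (fun (_ : Om) (_ : R) => 0 : R) by exact: measurable_cst.
have pd : predictable Ft T (drive T F (fun _ _ _ => 0) (fun _ _ _ _ => 0) k).
  by apply: (drive_predictable HF T0 pF).
have md : measurable_fun setT (unc (drive T F (fun _ _ _ => 0) (fun _ _ _ _ => 0) k)).
  have := predictable_strip_measurable HF T0 (lexx 0) pd.
  rewrite (_ : (fun z : Om * R => _) = unc (drive T F (fun _ _ _ => 0) (fun _ _ _ _ => 0) k))//.
  apply/funext => z; rewrite /unc /drive -mulrA; congr (_ * _).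
  by rewrite /strip indic_mul setIid.
split => //; rewrite (fubini_tonelli1 _ _)//; last 2 first.
- by apply/measurable_EFinP; exact: measurable_funX.
- by move=> z; rewrite lee_fin sqr_ge0.
apply: le_lt_trans F0; apply: ge0_integral_mono => w.
  by apply: integral_ge0 => u _; rewrite lee_fin sqr_ge0.
rewrite /fubini_F [leRHS]integral_mkcond; apply: ge0_integral_mono => u; first by rewrite lee_fin sqr_ge0.
rewrite patchE /unc /drive /strip indicE /=.
have r0 : \row__ 0 = 0 :> 'rV[R]_K by apply/rowP => j; rewrite !mxE.
rewrite r0.
case: ifPn => _; last by rewrite mulr0 expr0n.
rewrite mulr1 lee_fin /sqnorm (bigD1 k)//= lerDl; apply: sumr_ge0 => j _; exact: sqr_ge0.
Qed.

(** Lipschitz comparison with zero inputs, for which [F0] is the bound. The hypotheses are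
    adaptedness, left limits and moments, so that the lemma applies to a linear solution and to a
    competitor not yet known to be a state. *)
Lemma next_sqint (x : state K) (C : 'I_K -> R) :
  (forall k t, 0 <= t <= T -> mfunG (Ft t) ((st_Y x k)^~ t)) ->
  (forall k, {ae P, forall w, forall t, 0 < t <= T ->
     st_Y x k w u @[u --> t^'-] --> left_proc T (st_Y x k) w t}) ->
  (forall k, 0 <= C k) ->
  (forall k t, 0 <= t <= T -> (\int[P]_w (st_Y x k w t ^+ 2)%:E <= (C k)%:E)%E) ->
  (forall k i, predictable Ft T (st_Z x k i)) ->
  (forall k, (\int[P]_w \sum_(i <oo) bracket_int T (A i) w (fun t => (st_Z x k i w t ^+ 2)%:E) < +oo)%E) ->
  forall k, predictable Ft T (driven T F x k) /\ sqint nu (unc (driven T F x k)).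
Proof.
move=> aY yl C0 YC pz zf k.
have py j : predictable Ft T (left_proc T (st_Y x j)) by apply: left_proc_predictable => //; exact: aY.
have p0 : predictable Ft T (fun (_ : Om) (_ : R) => 0 : R) by exact: measurable_cst.
have pd j : predictable Ft T (driven T F x j) by exact: (drive_predictable HF T0 pF).
split => //.
have ss u : strip T 0 u * strip T 0 u = strip T 0 u :> R by rewrite /strip indic_mul setIid.
have md j : measurable_fun setT (unc (driven T F x j)).
  have := predictable_strip_measurable HF T0 (lexx 0) (pd j).
  rewrite (_ : (fun z : Om * R => _) = unc (driven T F x j))//.
  by apply/funext => z; rewrite /unc /driven /drive -mulrA ss.
have L := drive_lipschitz HF T0 pF HK Hrho mct ctc Lip py (fun _ => p0) pz (fun _ _ => p0) mI (@subset_refl _ _).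
have d0 := drive0_sqint.
have fin : (\sum_(j < K) (\int[nu]_p (ct0 T ct p.2 * ((left_proc T (st_Y x j) p.1 p.2 - 0) * strip T 0 p.2) ^+ 2 * \1_(`]0, T]%classic) p.2)%:E +
     (cmax c)%:E * \sum_(i <oo) \int[KA i]_p (((st_Z x j i p.1 p.2 - 0) * \1_(`]0, T]%classic) p.2) ^+ 2)%:E) < +oo)%E.
  apply: lte_sum_pinfty => j _; apply: lte_add_pinfty.
    have l2 := left_proc_sqint HF T0 mu (aY j) (yl j) (YC j) (C0 j).
    apply: (@le_lt_trans _ _ (\int[nu]_p ((cmax c)%:E * ((left_proc T (st_Y x j) p.1 p.2 * strip T 0 p.2) ^+ 2)%:E))%E).
      apply: ge0_integral_mono => p; have /andP[c0 cc] := ct0_bound (T := T) ctc p.2.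
        by rewrite lee_fin mulr_ge0 ?indicE// mulr_ge0 ?sqr_ge0.
      rewrite -EFinM lee_fin subr0; apply: (@le_trans _ _ (ct0 T ct p.2 * (left_proc T (st_Y x j) p.1 p.2 * strip T 0 p.2) ^+ 2)).
        apply: ler_piMr; first by rewrite mulr_ge0 ?sqr_ge0.
        by rewrite indicE; case: (_ \in _).
      by apply: ler_wpM2r; rewrite ?sqr_ge0.
    rewrite ge0_integralZl_EFin//; last 3 first.
    - by move=> p _; rewrite lee_fin sqr_ge0.
    - by apply/measurable_EFinP; apply: measurable_funX; exact: l2.1.
    - by rewrite le_max ler01 orbT.
    by rewrite lte_mul_pinfty ?l2.2// lee_fin le_max ler01 orbT.
  rewrite lte_mul_pinfty//; first by rewrite lee_fin le_max ler01 orbT.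
  rewrite (_ : (\sum_(i <oo) _)%E = (\sum_(i <oo) \int[KA i]_p ((st_Z x j i p.1 p.2 * \1_(`]0, T]%classic) p.2) ^+ 2)%:E)%E).
    by rewrite -z_sum.
  by apply: eq_eseriesr => i _; apply: eq_integral => p _; rewrite subr0.
pose D j p := (drive T F (fun j => left_proc T (st_Y x j)) (st_Z x) j p.1 p.2 -
  drive T F (fun _ _ _ => 0) (fun _ _ _ _ => 0) j p.1 p.2) * \1_(`]0, T]%classic) p.2.
have D2 : sqint nu (D k).
  split.
    apply: measurable_funM; last exact: (measurableT_comp (measurable_indic mI) measurable_snd).
    by apply: measurable_funB; [exact: md|exact: (d0 k).1].
  apply: le_lt_trans (le_lt_trans L fin).
  rewrite (bigD1 k)//= leeDl//; apply: sume_ge0 => j _.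
  by apply: integral_ge0 => p _; rewrite lee_fin sqr_ge0.
rewrite (_ : unc (driven T F x k) = (fun p => D k p + unc (drive T F (fun _ _ _ => 0) (fun _ _ _ _ => 0) k) p)).
  exact: (sqintD D2 (d0 k)).
apply/funext => p; rewrite /D /unc /driven.
have st j y z : drive T F y z j p.1 p.2 * \1_(`]0, T]%classic) p.2 = drive T F y z j p.1 p.2.
  by rewrite /drive -mulrA (ss p.2).
by rewrite mulrBl !st subrK.
Qed.

End NextState.

Section Assembling.
Context {d} {Om : measurableType d} {R : realType} (P : probability Om R).
Variables (Ft : R -> set (set Om)) (T : R).
Hypothesis HF : filtration Ft T.
Hypothesis T0 : 0 < T.

Lemma ae_forallF {I : finType} (Q : I -> Om -> Prop) : (forall i, {ae P, forall w, Q i w}) ->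
  {ae P, forall w, forall i, Q i w}.
Proof. by move=> h; apply: filter_forall. Qed.

Lemma predictable_to_vec {K : nat} (Z : Om -> R -> 'rV[R]_K) :
  (forall k, predictable Ft T (fun w t => Z w t ord0 k)) ->
  predictable Ft T (Z : Om -> R -> vec R K).
Proof.
move=> h; rewrite /predictable.
have mh := measurable_horizon HF T0.
pose Z0 (p : g_sigma_algebraType (predictable_rectangles Ft T)) : vec R K :=
  if p \in @horizon _ Om R Ft T then Z p.1 p.2 else 0.
have m0 : measurable_fun setT Z0.
  apply: measurable_to_vec => k.
  rewrite (_ : (fun x => _) = (fun p => Z p.1 p.2 ord0 k) \_ (@horizon _ Om R Ft T)).
    by apply/(measurable_restrict _ mh measurableT); rewrite setTI; exact: h.
  by apply/funext => p; rewrite patchE /Z0; case: ifPn => //; rewrite mxE.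
apply: (@eq_measurable_fun _ _ _ _ _ Z0); last exact: measurable_funTS.
by move=> p ph; rewrite /Z0 ph.
Qed.

Variables (M : nat -> Om -> R -> R) (A : nat -> Om -> cumulative R R).
Variables (KA : nat -> {measure set (Om * R) -> \bar R}).
Hypothesis HK : forall i, is_bracketK P T (A i) (KA i).

Lemma H2_sqnormE {K : nat} (Z : nat -> Om -> R -> 'rV[R]_K) :
  (forall i k, predictable Ft T (fun w t => Z i w t ord0 k)) ->
  H2_sqnorm P T A Z = (\sum_(k < K) \int[P]_w \sum_(i <oo)
     bracket_int T (A i) w (fun t => (Z i w t ord0 k ^+ 2)%:E))%E.
Proof.
move=> pZ; have mZ i k := predictable_measurable HF T0 (pZ i k).
pose b i k w := bracket_int T (A i) w (fun t => (Z i w t ord0 k ^+ 2)%:E).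
have b0 i k w : (0 <= b i k w)%E by apply: integral_ge0 => t _; rewrite lee_fin sqr_ge0.
have bE i k w : b i k w = bracket_int T (A i) w (fun t => (onT T (fun w t => Z i w t ord0 k) (w, t) ^+ 2)%:E).
  by apply: eq_integral => t tT; rewrite /onT indicE /= tT mulr1.
have mo i k : measurable_fun setT (fun z => (onT T (fun w t => Z i w t ord0 k) z ^+ 2)%:E).
  by apply/measurable_EFinP; apply: measurable_funX; exact: onT_measurable.
have mb i k : measurable_fun setT (b i k).
  rewrite (_ : b i k = (fun w => bracket_int T (A i) w (fun t => (onT T (fun w t => Z i w t ord0 k) (w, t) ^+ 2)%:E))).
    have [_ /(_ _ (mo i k))[|//]] := HK i.
    by move=> z; rewrite lee_fin sqr_ge0.
  by apply/funext => w; exact: bE.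
have sE i w : bracket_int T (A i) w (fun t => (sqnorm (Z i w t))%:E) = (\sum_(k < K) b i k w)%E.
  have -> : bracket_int T (A i) w (fun t => (sqnorm (Z i w t))%:E) =
     bracket_int T (A i) w (fun t => \sum_(k < K) (onT T (fun w t => Z i w t ord0 k) (w, t) ^+ 2)%:E)%E.
    apply: eq_integral => t tT; rewrite sumEFin; congr EFin; apply: eq_bigr => k _.
    by rewrite /onT indicE /= tT mulr1.
  rewrite bracket_intE; last 2 first.
  - apply: emeasurable_sum => k; exact: (measurableT_comp (mo i k) (pair1_measurable w)).
  - by move=> t; apply: sume_ge0 => k _; rewrite lee_fin sqr_ge0.
  rewrite ge0_integral_sum//; last 2 first.
  - by move=> k; exact: (measurableT_comp (mo i k) (pair1_measurable w)).
  - by move=> k t _; rewrite lee_fin sqr_ge0.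
  apply: eq_bigr => k _; rewrite bE bracket_intE//.
  - exact: (measurableT_comp (mo i k) (pair1_measurable w)).
  - by move=> t; rewrite lee_fin sqr_ge0.
rewrite /H2_sqnorm.
have -> : (\int[P]_w \sum_(i <oo) bracket_int T (A i) w (fun t => (sqnorm (Z i w t))%:E) =
   \int[P]_w (\sum_(k < K) \sum_(i <oo) b i k w))%E.
  apply: eq_integral => w _; rewrite -nneseries_sum//.
  by apply: eq_eseriesr => i _; exact: sE.
rewrite ge0_integral_sum//.
- by move=> k; apply: ge0_emeasurable_sum => // i w _ _; exact: b0.
- by move=> k w _; apply: nneseries_ge0 => i _ _; exact: b0.
Qed.

End Assembling.

(** * Fixed point *)

Section FixedPoint.
Context {d} {Om : measurableType d} {R : realType} (P : probability Om R) (K : nat).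
Variables (Ft : R -> set (set Om)) (T : R).
Hypothesis HF : filtration Ft T.
Hypothesis HU : usual_conditions P Ft T.
Hypothesis T0 : 0 < T.
Variables (M : nat -> Om -> R -> R) (A : nat -> Om -> cumulative R R).
Hypothesis HB : martingale_basis P Ft T M A.
Variable mu : {finite_measure set R -> \bar R}.
Local Notation nu := (P \x mu)%E.
Local Notation PT := (g_sigma_algebraType (predictable_rectangles Ft T)).
Variable F : Om -> R -> 'rV[R]_K -> (nat -> 'rV[R]_K) -> 'rV[R]_K.
Hypothesis pF : predictable_driver Ft T F.
Variable rho : nat -> Om * R -> R.
Hypothesis Hrho : forall i, @ac_part_density _ PT R (bracket_measure P T (A i)) nu (rho i).
Variables (c : R) (ct : R -> R).
Hypothesis mct : measurable_fun `[0, T]%classic ct.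
Hypothesis ctc : forall t, 0 <= t <= T -> ct t <= c.
Hypothesis Lip : \forall p \ae nu, forall y y' z z',
     ((sqnorm (F p.1 p.2 y z - F p.1 p.2 y' z'))%:E <=
      (ct p.2 * sqnorm (y - y'))%:E +
      c%:E * M_sqnorm rho p.1 p.2 (fun i => z i - z' i)%R)%E.
Hypothesis ctmu : forall t : R, 0 <= t <= T -> ct t * fine (mu [set t]) ^+ 2 < 1.
Hypothesis F0 : (\int[P]_w \int[mu]_(t in `]0%R, T]) (sqnorm (F w t 0 (fun=> 0)))%:E < +oo)%E.
Variables (KA : nat -> {measure set (Om * R) -> \bar R}).
Hypothesis HK : forall i, is_bracketK P T (A i) (KA i).
Variable q : 'I_K -> Om -> R.
Hypothesis mq : forall k, mfunG (Ft T) (q k).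
Hypothesis q2 : forall k, sqint P (q k).

Local Notation is_state := (is_state P Ft T M A mu F q).
Local Notation driven := (driven T F).
Local Notation Adm := (Adm P Ft T M A mu F q).

Lemma Adm_contracted : contracted T Adm `]0, T]%classic.
Proof.
pose muT := fine (mu setT); have muT0 : 0 <= muT by exact: fine_ge0.
have cm0 : 0 < cmax c by rewrite lt_max ltr01 orbT.
(* Makes [cmax c * e * (muT + 2)] equal to 1/2, the ratio asked on open pieces. *)
pose e := (2 * cmax c * (muT + 2))^-1.
have D0 : 0 < 2 * cmax c * (muT + 2) by rewrite !mulr_gt0// ltr_wpDl.
have e0 : 0 < e by rewrite invr_gt0.
pose ka t := ct0 T ct t * fine (mu [set t]) ^+ 2.
(* With this weight [(1 + ep t) * ka t < 1], which amounts to [0 < (1 - ka t) * (2 - ka t)]. *)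
pose ep t := (1 - ka t) / 2.
have kaP t : 0 < t <= T -> 0 <= ka t < 1.
  move=> /andP[t0 tT]; have tT' : 0 <= t <= T by rewrite (ltW t0).
  have /andP[c00 _] := ct0_bound (T := T) ctc t.
  rewrite mulr_ge0 ?sqr_ge0//= /ka /ct0 /strip indicE mem_set ?mulr1; last by rewrite /= in_itv/= t0.
  have [h|h] := leP (ct t) 0; last exact: ctmu.
  by rewrite mul0r ltr01.
have epP t : 0 < t <= T -> 0 < ep t by move=> /kaP/andP[_ k1]; rewrite divr_gt0// subr_gt0.
apply: (@contracted_horizon R T mu T0 Adm _ e (cmax c * (muT * muT + 2 * muT))
  (fun t => (1 + ep t) * ka t) (fun t => (1 + (ep t)^-1) * cmax c * muT * muT + cmax c * muT)).
- by move=> al be; exact: Adm_additive.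
- exact: e0.
- by rewrite mulr_ge0 ?addr_ge0 ?mulr_ge0// ltW.
- move=> t tT; have e1 := ltW (epP t tT).
  by rewrite addr_ge0// !mulr_ge0// ?addr_ge0 ?invr_ge0// ltW.
- move=> t tT; have /andP[k0 k1] := kaP t tT; have e1 := epP t tT.
  rewrite mulr_ge0 ?addr_ge0 ?(ltW e1)//=; rewrite /ep in e1 *; nra.
- move=> al be [x [x' [Sx Sx' -> ->]]] a b a0 ab bT mab.
  have h := Adm_open_pair HF T0 HB pF Hrho mct ctc Lip HK Sx Sx' a0 ab bT.
  apply: (le_trans h); rewrite lerD2r; apply: ler_wpM2r.
    by apply: sumr_ge0 => k _; exact: mass_ge0.
  have mI : measurable (`]a, b[%classic : set R) by exact: measurable_itv.
  have fe : fine (mu `]a, b[%classic) <= e by rewrite -lee_fin fineK// fin_num_measure.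
  apply: (@le_trans _ _ (cmax c * e * (muT + 2))).
    by apply: ler_wpM2r; [rewrite addr_ge0|apply: ler_wpM2l => //; exact: ltW].
  rewrite le_eqVlt; apply/orP; left; apply/eqP; rewrite /e; field.
  by rewrite !gt_eqF// ltr_wpDl.
- move=> al be [x [x' [Sx Sx' -> ->]]] t tT.
  exact: (Adm_point_pair HF T0 HB pF Hrho mct ctc Lip HK Sx Sx' tT (epP t tT)).
Qed.

Definition good_state (x : state K) : Prop :=
  [/\ is_state x, forall k i, predictable Ft T (st_Z x k i),
      forall k, (\int[P]_w \sum_(i <oo) bracket_int T (A i) w (fun t => (st_Z x k i w t ^+ 2)%:E) < +oo)%E
    & forall k, exists2 U, sqint P U & forall w t, 0 <= t <= T -> `|st_Y x k w t| <= U w].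

Lemma solve (g : 'I_K -> Om -> R -> R) :
  (forall k, predictable Ft T (g k) /\ sqint nu (unc (g k))) ->
  exists x, [/\ st_g x = g, good_state x &
    forall k, predictable Ft T (driven x k) /\ sqint nu (unc (driven x k))].
Proof.
move=> hg.
have [Y h1] := choice (fun k => linear_bsde HF HU T0 HB (mq k) (q2 k) (hg k).1 (hg k).2).
have [Z h2] := choice h1; have [S h3] := choice h2.
pose x := State g Y Z S.
have n2 k : predictable Ft T (driven x k) /\ sqint nu (unc (driven x k)).
  have hU j : exists U, sqint P U /\ forall w t, 0 <= t <= T -> `|Y j w t| <= U w.
    by case: (h3 j) => _ _ _ _ [U U2 YU]; exists U.
  have [U {}hU] := choice hU.
  have U2 j : sqint P (U j) by case: (hU j).
  have YU j : forall w t, 0 <= t <= T -> `|Y j w t| <= U j w by case: (hU j).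
  refine (next_sqint HF T0 HB pF Hrho mct ctc Lip F0 HK (x := x) (C := fun j => ip P (U j) (U j)) _ _ _ _ _ _ k).
  - by move=> j t tT; case: (h3 j) => + _ _ _ _; apply.
  - move=> j; case: (h3 j) => _ [sS _ _] _ pth _.
    exact: (bsde_path_left T0 (hg j).2 sS pth).
  - by move=> j; exact: ip_ge0.
  - move=> j t tT; rewrite ipE//; apply: ge0_integral_mono => w; first by rewrite lee_fin sqr_ge0.
    rewrite lee_fin -real_normK ?num_real// ler_sqr ?nnegrE//; first exact: YU.
    exact: le_trans (normr_ge0 _) (YU j w t tT).
  - by move=> j i; case: (h3 j) => _ _ [+ _] _ _; apply.
  - by move=> j; case: (h3 j) => _ _ [_ +] _ _.
exists x; split=> //; split.
- split=> //.
  + by move=> j t tT; case: (h3 j) => + _ _ _ _; apply.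
  + by move=> j; case: (h3 j).
  + by move=> j; case: (h3 j).
  + by move=> j; exact: (n2 j).2.
- by move=> j i; case: (h3 j) => _ _ [+ _] _ _; apply.
- by move=> j; case: (h3 j) => _ _ [_ +] _ _.
- by move=> j; case: (h3 j).
Qed.

Lemma driven_cut x k z : driven x k z.1 z.2 * \1_(`]0, T]%classic) z.2 = driven x k z.1 z.2 :> R.
Proof. by rewrite /driven /drive -mulrA /strip indic_mul setIid. Qed.

Lemma dmass_nrm (g h : 'I_K -> Om -> R -> R) k :
  (forall z, (g k z.1 z.2 - h k z.1 z.2) * \1_(`]0, T]%classic) z.2 = g k z.1 z.2 - h k z.1 z.2) ->
  nrm nu (fun z => unc (g k) z - unc (h k) z) ^+ 2 <= dmass P mu g h `]0, T]%classic.
Proof.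
move=> e; rewrite sqr_sqrtr ?ip_ge0//.
rewrite (_ : ip _ _ _ = mass P mu (fun w u => g k w u - h k w u) `]0, T]%classic).
  by rewrite /dmass (bigD1 k)//= lerDl; apply: sumr_ge0 => j _; exact: mass_ge0.
by rewrite /mass; congr ip; apply/funext => z; rewrite /unc e.
Qed.

Lemma mass_le_nrm (g h : Om -> R -> R) B : measurable B -> sqint nu (unc g) -> sqint nu (unc h) ->
  mass P mu (fun w u => g w u - h w u) B <= nrm nu (fun z => unc g z - unc h z) ^+ 2.
Proof.
move=> mB g2 h2; have gh := sqintB g2 h2; rewrite sqr_sqrtr ?ip_ge0// -lee_fin.
have gB : sqint nu (fun z => unc (fun w u => g w u - h w u) z * \1_B z.2) by exact: (sqint_cut gh mB).
rewrite /mass !ipE//; apply: ge0_integral_mono => z; first by rewrite lee_fin sqr_ge0.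
rewrite lee_fin exprMn ler_piMr ?sqr_ge0// indicE.
Qed.

Lemma cvg_geom_bound (s r : R) : 0 <= r < 1 -> s * r ^+ n / (1 - r) @[n --> \oo] --> 0.
Proof.
move=> /andP[r0 r1]; rewrite -(mul0r (1 - r)^-1); apply: cvgM; last exact: cvg_cst.
by apply: (@cvg_geometric _ s r); rewrite ger0_norm.
Qed.

(** Picard iteration with one solution chosen at each step; the choice is harmless because the
    contraction holds for any two states. The limit driver is solved once more, and its output is
    compared with the iterates rather than computed. *)
Lemma fixed_state : exists x, good_state x /\ st_g x = driven x.
Proof.
have [Q [lo [hi [r [lo0 hi0 r01 Qlh Qr]]]]] := Adm_contracted; have /andP[r0 r1] := r01.
have mI : measurable (`]0, T]%classic : set R) by exact: measurable_itv.
pose G0 : Type := {g : 'I_K -> Om -> R -> R | forall k, predictable Ft T (g k) /\ sqint nu (unc (g k))}.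
have z0 k : predictable Ft T ((fun _ _ _ => 0) k : Om -> R -> R) /\ sqint nu (unc ((fun (_ : 'I_K) _ _ => 0) k)).
  by split; [exact: measurable_cst|exact: sqint0].
have [sol solP] := choice (fun g : G0 => solve (projT2 g)).
have dP g : forall k, predictable Ft T (driven (sol g) k) /\ sqint nu (unc (driven (sol g) k)).
  by case: (solP g).
pose stp (g : G0) : G0 := exist _ (driven (sol g)) (dP g).
pose gs n : G0 := iter n stp (exist _ (fun _ _ _ => 0) z0).
pose x n := sol (gs n).
have xg n : st_g (x n) = projT1 (gs n) by case: (solP (gs n)).
have xS n : good_state (x n) by case: (solP (gs n)).
have xn n : st_g (x n.+1) = driven (x n) by rewrite xg.
have g2 n k : sqint nu (unc (st_g (x n) k)) by case: (xS n) => -[h _ _ _ _] _ _ _; exact: (h k).2.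
have pg n k : predictable Ft T (st_g (x n) k) by case: (xS n) => -[h _ _ _ _] _ _ _; exact: (h k).1.
(* All iterates vanish off []0, T]], so their distance over all times is the mass over []0, T]],
   where the contraction is known. *)
have cut n k z : st_g (x n) k z.1 z.2 * \1_(`]0, T]%classic) z.2 = st_g (x n) k z.1 z.2.
  by case: n => [|n]; rewrite ?xn ?driven_cut// xg /= mul0r.
have cutB m n k z : (st_g (x m) k z.1 z.2 - st_g (x n) k z.1 z.2) * \1_(`]0, T]%classic) z.2 =
    st_g (x m) k z.1 z.2 - st_g (x n) k z.1 z.2 by rewrite mulrBl !cut.
pose al n := dmass P mu (st_g (x n.+1)) (st_g (x n)).
have aA n : Adm (al n) (al n.+1).
  have [S1 _ _ _] := xS n.+1; have [S2 _ _ _] := xS n.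
  by exists (x n.+1), (x n); split => //; rewrite /al !xn.
have Qn n : Q (al n) <= r ^+ n * Q (al 0%N).
  elim: n => [|n IH]; first by rewrite expr0 mul1r.
  by apply: le_trans (Qr _ _ (aA n)) _; rewrite exprS -mulrA ler_wpM2l.
have aadd n : interval_additive T (al n) by have [] := Adm_additive (aA n).
(* [Q] is comparable to squared norms, hence the square roots. *)
pose s := Num.sqrt (Q (al 0%N) / lo); pose r' := Num.sqrt r.
have r'0 : 0 <= r' by exact: sqrtr_ge0.
have r'1 : r' < 1 by rewrite -sqrtr1 ltr_sqrt.
have Q0 : 0 <= Q (al 0%N).
  have [h _] := Qlh _ (aadd 0%N); apply: le_trans h; apply: mulr_ge0; first exact: ltW.
  by have [h _ _ _] := aadd 0%N; exact: h.
have nb k n : nrm nu (fun z => unc (st_g (x n.+1) k) z - unc (st_g (x n) k) z) <= s * r' ^+ n.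
  rewrite -ler_sqr ?nnegrE ?sqrtr_ge0 ?mulr_ge0 ?exprn_ge0 ?sqrtr_ge0//.
  apply: le_trans (dmass_nrm (k := k) _) _; first by move=> z; exact: cutB.
  rewrite exprMn sqr_sqrtr ?divr_ge0 ?(ltW lo0)// exprAC sqr_sqrtr//.
  rewrite mulrAC ler_pdivlMr// mulrC; have [h _] := Qlh _ (aadd n).
  by apply: le_trans h _; rewrite mulrC; exact: Qn.
pose gl k w u := lsup (fun n z => unc (st_g (x n) k) z) (w, u).
have s0 : 0 <= s by exact: sqrtr_ge0.
have gl2 k : sqint nu (unc (gl k)) /\ forall n,
    nrm nu (fun z => unc (gl k) z - unc (st_g (x n) k) z) <= s * r' ^+ n / (1 - r').
  have [a b] := fast_cauchy_lim (nu_lty P mu) s0 r'0 r'1 (fun n => g2 n k) (nb k).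
  rewrite (_ : unc (gl k) = lsup (fun n => unc (st_g (x n) k))); first by [].
  by apply/funext => -[].
have pgl k : predictable Ft T (gl k).
  rewrite /predictable (_ : (fun p : PT => _) = lsup (fun n => unc (st_g (x n) k))).
    by apply: (@measurable_lsup _ PT R) => n; exact: pg.
  by apply/funext => -[].
have [y [yg Gy ny]] := solve (fun k => conj (pgl k) (gl2 k).1).
have [Sy Zy Z2y UY] := Gy.
pose dl n := \sum_(k < K) nrm nu (fun z => unc (gl k) z - unc (st_g (x n) k) z) ^+ 2.
have dl0 : dl n @[n --> \oo] --> 0.
  pose b n := s * r' ^+ n / (1 - r').
  have b0 : b n @[n --> \oo] --> 0 by apply: cvg_geom_bound; rewrite r'0.
  apply: (@squeeze_cvgr _ _ _ _ (fun=> 0) (fun n => K%:R * (b n * b n))); last 2 first.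
  - exact: cvg_cst.
  - rewrite -[X in _ --> X](_ : K%:R * (0 * 0) = 0); last by rewrite !mulr0.
    by apply: cvgM; [exact: cvg_cst|exact: cvgM].
  apply: nearW => n; apply/andP; split; first by apply: sumr_ge0 => k _; exact: sqr_ge0.
  apply: (@le_trans _ _ (\sum_(k < K) b n * b n)).
    apply: ler_sum => k _; rewrite -expr2 ler_sqr ?nnegrE ?sqrtr_ge0 ?(gl2 k).2//.
    exact: le_trans (sqrtr_ge0 _) ((gl2 k).2 n).
  by rewrite sumr_const card_ord mulr_natl.
have be n : dmass P mu (driven y) (driven (x n)) `]0, T]%classic <= lo^-1 * hi * dl n.
  have adm : Adm (dmass P mu (st_g y) (st_g (x n))) (dmass P mu (driven y) (driven (x n))).
    by exists y, (x n); split => //; case: (xS n).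
  have [aa ab] := Adm_additive adm.
  have [h1 _] := Qlh _ ab; have [_ h2] := Qlh _ aa; have h3 := Qr _ _ adm.
  have dm : dmass P mu (st_g y) (st_g (x n)) `]0, T]%classic <= dl n.
    rewrite /dmass yg; apply: ler_sum => k _; apply: mass_le_nrm => //; exact: (gl2 k).1.
  have Qa0 : 0 <= Q (dmass P mu (st_g y) (st_g (x n))).
    have [h _] := Qlh _ aa; apply: le_trans h; apply: mulr_ge0; first exact: ltW.
    by have [h _ _ _] := aa; exact: h.
  rewrite -mulrA ler_pdivlMl//; apply: le_trans h1 _; apply: le_trans h3 _.
  apply: (@le_trans _ _ (Q (dmass P mu (st_g y) (st_g (x n))))).
    by rewrite ler_piMl// ltW.
  by apply: le_trans h2 _; exact: ler_wpM2l.
(* Both [driven y] and [gl] are limits of the iterates [st_g (x n.+1)]: the former by contraction,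
   the latter by construction. *)
have d0 k : mass P mu (fun w u => driven y k w u - gl k w u) `]0, T]%classic = 0.
  apply/eqP; rewrite eq_le mass_ge0 andbT.
  have c0 : 2 * (lo^-1 * hi * dl n) + 2 * dl n.+1 @[n --> \oo] --> 0.
    rewrite -[X in _ --> X](_ : 2 * (lo^-1 * hi * 0) + 2 * 0 = 0); last by rewrite !mulr0 addr0.
    apply: cvgD; last by apply: cvgM; [exact: cvg_cst|rewrite (cvg_shiftS dl)].
    by apply: cvgM; [exact: cvg_cst|apply: cvgM; [exact: cvg_cst|exact: dl0]].
  apply: (ler_cvg_to (cvg_cst _) c0); apply: nearW => n.
  have m1 := sqint_cut (g := fun w u => driven y k w u - st_g (x n.+1) k w u) (sqintB (ny k).2 (g2 n.+1 k)) mI.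
  have m2 := sqint_cut (g := fun w u => st_g (x n.+1) k w u - gl k w u) (sqintB (g2 n.+1 k) (gl2 k).1) mI.
  have := ipD_le m1 m2.
  rewrite (_ : (fun z => _ + _) = (fun z => unc (fun w u => driven y k w u - gl k w u) z * \1_(`]0, T]%classic) z.2)); last first.
    by apply/funext => z; rewrite /unc; ring.
  move=> /le_trans; apply; apply: lerD; rewrite ler_pM2l//.
    apply: le_trans (be n); rewrite /dmass -xn (bigD1 k)//= lerDl.
    by apply: sumr_ge0 => j _; exact: mass_ge0.
  apply: (@le_trans _ _ (nrm nu (fun z => unc (gl k) z - unc (st_g (x n.+1) k) z) ^+ 2)).
    apply: le_trans (mass_le_nrm mI (gl2 k).1 (g2 n.+1 k)).
    rewrite /mass le_eqVlt; apply/orP; left; apply/eqP; apply: eq_Rintegral => z _; rewrite /unc; ring.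
  rewrite /dl (bigD1 k)//= lerDl; apply: sumr_ge0 => j _; exact: sqr_ge0.
(* Storing [driven y] in place of [gl] makes the fixed point an equality of functions; the linear
   equation survives because the time integrals agree almost surely. *)
exists (State (driven y) (st_Y y) (st_Z y) (st_S y)); split=> //.
split=> //; have [a1 a2 a3 a4 a5] := Sy; split=> // k /=.
have t0 := mass0_tint (D := fun w u => driven y k w u - gl k w u) (sqintB (ny k).2 (gl2 k).1) (d0 k).
have sl : {ae P, forall w, sqint mu (driven y k w) /\ sqint mu (gl k w)}.
  by move: (slice_sqint (ny k).2) (slice_sqint (gl2 k).1); apply: filterS2.
have pth := a4 k; rewrite /bsde_path yg in pth *; move: pth t0 sl.
apply: filterS3 => w hp h0 [b1 b2] t tT.
have mt : measurable (`]t, T]%classic : set R) by exact: measurable_itv.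
have := h0 t tT; rewrite tintB// => /eqP; rewrite subr_eq0 => /eqP ->.
exact: hp.
Qed.

(** For two fixed points the input mass is also the output mass, so [Q al <= r * Q al] with [r < 1]
    forces the driver mass to vanish. *)
Lemma state_unique x x' : is_state x -> is_state x' -> st_g x = driven x -> st_g x' = driven x' ->
  (forall k, {ae P, forall w, forall t, 0 <= t <= T -> st_Y x k w t = st_Y x' k w t}) /\
  (forall k, \sum_(i <oo) \int[KA i]_p
     (((st_Z x k i p.1 p.2 - st_Z x' k i p.1 p.2) * \1_(`]0, T]%classic) p.2) ^+ 2)%:E = 0)%E.
Proof.
move=> Sx Sx' gx gx'; apply: (pair_unique HF T0 HB HK Sx Sx') => k.
have [Q [lo [hi [r [lo0 hi0 /andP[r0 r1] Qlh Qr]]]]] := Adm_contracted.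
pose al := dmass P mu (st_g x) (st_g x').
have adm : Adm al al by exists x, x'; split; rewrite // /al gx gx'.
have [aa _] := Adm_additive adm; have [h1 _] := Qlh _ aa; have h2 := Qr _ _ adm.
have al0 : 0 <= al `]0, T]%classic by have [h _ _ _] := aa; exact: h.
have : al `]0, T]%classic <= 0.
  have : Q al <= 0 by nra.
  by move=> /(le_trans h1); rewrite pmulr_rle0.
rewrite /al /dmass (bigD1 k)//= => le0; apply/eqP; rewrite eq_le mass_ge0 andbT.
by apply: le_trans le0; rewrite lerDl; apply: sumr_ge0 => j _; exact: mass_ge0.
Qed.

End FixedPoint.

(** What remains is the translation between vectors and coordinates and between the left limit of
    the equation and its predictable version [left_proc]. A competitor becomes a state once its left
    limits and the square integrability of its driver are established. *)
Theorem theorem6p1 (R : realType) (T : R) (K : nat)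
    (d : measure_display) (Om : measurableType d) (P : probability Om R)
    (Ft : R -> set (set Om))
    (M : nat -> Om -> R -> R) (A : nat -> Om -> cumulative R R)
    (mu : {finite_measure set R -> \bar R})
    (rho : nat -> Om * R -> R)
    (F : Om -> R -> 'rV[R]_K -> (nat -> 'rV[R]_K) -> 'rV[R]_K)
    (c : R) (ct : R -> R) (Q : Om -> 'rV[R]_K) :
  0 < T ->
  filtration Ft T ->
  usual_conditions P Ft T ->
  trivial_sigma_algebra P (Ft 0) ->
  separable_L2 P (Ft T) ->
  martingale_basis P Ft T M A ->
  mu (~` `[0, T]) = 0%E ->
  (forall a b : R, 0 <= a -> a < b -> b <= T -> (0 < mu `]a, b[%classic)%E) ->
  (forall i, @ac_part_density _
     (g_sigma_algebraType (predictable_rectangles Ft T)) R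
     (bracket_measure P T (A i)) (P \x mu)%E (rho i)) ->
  predictable_driver Ft T F ->
  progressive_driver Ft T F ->
  (\int[P]_w \int[mu]_(t in `]0%R, T]) (sqnorm (F w t 0 (fun=> 0)))%:E < +oo)%E ->
  measurable_fun `[0, T] ct ->
  (forall t : R, 0 <= t <= T -> ct t <= c) ->
  (\forall p \ae (P \x mu)%E, forall y y' z z',
     ((sqnorm (F p.1 p.2 y z - F p.1 p.2 y' z'))%:E <=
      (ct p.2 * sqnorm (y - y'))%:E +
      c%:E * M_sqnorm rho p.1 p.2 (fun i => z i - z' i)%R)%E) ->
  (forall t : R, 0 <= t <= T -> ct t * fine (mu [set t]) ^+ 2 < 1) ->
  measurable_fun setT (Q : g_sigma_algebraType (Ft T) -> vec R K) ->
  (\int[P]_w (sqnorm (Q w))%:E < +oo)%E ->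
  exists (Y : Om -> R -> 'rV[R]_K) (Z : nat -> Om -> R -> 'rV[R]_K),
    [/\ S2 P Ft T Y, H2 P Ft T A Z, bsde_solution P Ft T F mu M A Q Y Z
      & forall Y' Z', S2 P Ft T Y' -> H2 P Ft T A Z' ->
          bsde_solution P Ft T F mu M A Q Y' Z' ->
          (\forall w \ae P, forall t : R, 0 <= t <= T -> Y' w t = Y w t) /\
          H2_sqnorm P T A (fun i w t => Z' i w t - Z i w t) = 0%E].
Proof.
move=> T0 HF HU _ _ HB _ _ Hrho pF _ F0 mct ctc Lip ctmu mQ Q2.
have T01 : 0 <= T <= T by rewrite lexx ltW.
have mI : measurable (`]0, T]%classic : set R) by exact: measurable_itv.
have [KA HK] := basis_bracketK HF T0 HB.
pose q k w := Q w ord0 k.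
have mq k : mfunG (Ft T) (q k) by exact: (measurableT_comp (vec_coord k) mQ).
have q2 k : sqint P (q k).
  split; first exact: (mfunFt_measurable HF T01 (mq k)).
  apply: le_lt_trans Q2; apply: ge0_integral_mono => w; first by rewrite lee_fin sqr_ge0.
  by rewrite lee_fin /sqnorm (bigD1 k)//= lerDl; apply: sumr_ge0 => j _; exact: sqr_ge0.
have [x [[Sx Zx Z2x Ux] gx]] := fixed_state HF HU T0 HB pF Hrho mct ctc Lip ctmu F0 HK mq q2.
have [gx2 aYx sx px nx] := Sx.
pose Y w t := \row_k st_Y x k w t.
pose Z i w t := \row_k st_Z x k i w t.
have H2E (Z1 : nat -> Om -> R -> 'rV[R]_K) :
    (forall i k, predictable Ft T (fun w t => Z1 i w t ord0 k)) ->
    H2_sqnorm P T A Z1 = (\sum_(k < K) \int[P]_w \sum_(i <oo)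
       bracket_int T (A i) w (fun t => (Z1 i w t ord0 k ^+ 2)%:E))%E.
  by move=> pZ1; exact: (H2_sqnormE HF T0 HK pZ1).
have drivenE (x1 : state K) w u : 0 < u <= T ->
    (forall k, st_Y x1 k w v @[v --> u^'-] --> left_proc T (st_Y x1 k) w u) ->
    forall k, F w u (left_lim (fun v => \row_j st_Y x1 j w v) u)
      (fun i => \row_j st_Z x1 j i w u) ord0 k = driven T F x1 k w u.
  move=> uT h k; have e1 : strip T 0 u = 1 by rewrite /strip indicE mem_set//= in_itv.
  by rewrite (left_lim_row h) /driven /drive e1 mulr1.
have slx k : {ae P, forall w, sqint mu (st_g x k w)} by exact: slice_sqint (gx2 k).2.
have ylx k : {ae P, forall w, forall t, 0 < t <= T ->
    st_Y x k w u @[u --> t^'-] --> left_proc T (st_Y x k) w t}.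
  by have [sS _ _] := sx k; exact: (bsde_path_left T0 (gx2 k).2 sS (px k)).
(* Almost surely the limit of the vector path and the coordinatewise [left_proc] agree on []0, T]],
   so the equation may be written with either. *)
have drx : {ae P, forall w, forall u, 0 < u <= T -> forall k,
    F w u (left_lim (Y w) u) (fun i => Z i w u) ord0 k = st_g x k w u}.
  have /ae_forallF : forall k, {ae P, forall w, forall t, 0 < t <= T ->
    st_Y x k w u @[u --> t^'-] --> left_proc T (st_Y x k) w t} by exact: ylx.
  apply: filterS => w h u uT k; rewrite gx; apply: (drivenE x w u uT) => j.
  exact: h.
exists Y, Z; split.
- split.
    by move=> t tT; apply: measurable_to_vec => k; under eq_fun do rewrite mxE; exact: aYx.
  pose U k := projT1 (cid2 (Ux k)).
  have U2 k : sqint P (U k) by rewrite /U; case: (cid2 (Ux k)).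
  have YU k : forall w t, 0 <= t <= T -> `|st_Y x k w t| <= U k w by rewrite /U; case: (cid2 (Ux k)).
  apply: (@le_lt_trans _ _ (\int[P]_w (\sum_(k < K) (U k w ^+ 2)%:E))%E).
    apply: ge0_integral_mono => w.
      apply: (@le_trans _ _ (sqnorm (Y w 0))%:E); first by rewrite lee_fin sumr_ge0// => k _; exact: sqr_ge0.
      by apply: ereal_sup_ubound; exists 0 => //=; rewrite in_itv/= lexx ltW.
    apply: ge_ereal_sup => v [t /=]; rewrite in_itv/= => tT <-; rewrite sumEFin lee_fin.
    apply: ler_sum => k _; rewrite mxE -real_normK ?num_real// ler_sqr ?nnegrE//; first exact: YU.
    exact: le_trans (normr_ge0 _) (YU k w t tT).
  rewrite ge0_integral_sum//; last 2 first.
  + by move=> k; apply/measurable_EFinP; apply: measurable_funX; exact: (U2 k).1.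
  + by move=> k w _; rewrite lee_fin sqr_ge0.
  by apply: lte_sum_pinfty => k _; exact: (U2 k).2.
- split.
    move=> i; apply: (predictable_to_vec HF T0) => k.
    rewrite (_ : (fun w t => _) = st_Z x k i); first exact: Zx.
    by apply/funext => w; apply/funext => t; rewrite mxE.
  rewrite H2E.
    apply: lte_sum_pinfty => k _; apply: le_lt_trans (Z2x k).
    rewrite le_eqVlt; apply/orP; left; apply/eqP; apply: eq_integral => w _.
    by apply: eq_eseriesr => i _; apply: eq_integral => t _; rewrite mxE.
  move=> i k; rewrite (_ : (fun w t => _) = st_Z x k i); first exact: Zx.
  by apply/funext => w; apply/funext => t; rewrite mxE.
- split.
    have /ae_forallF : forall k, {ae P, forall w, sqint mu (st_g x k w)} by exact: slx.
    move: drx; apply: filterS2 => w dw sw k.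
    have ig : mu.-integrable `]0, T]%classic (EFin \o st_g x k w).
      by apply: (integrableS measurableT) => //; exact: (sqint_integrable (mu_lty mu) (sw k)).
    apply: eq_integrable ig => // u /set_mem /=; rewrite in_itv/= => uT.
    by rewrite dw.
  exists (fun w t => \row_k st_S x k w t).
    move=> k; rewrite (_ : (fun i w t => _) = st_Z x k); last first.
      by apply/funext => i; apply/funext => w; apply/funext => t; rewrite mxE.
    rewrite (_ : (fun w t => _) = st_S x k); first exact: sx.
    by apply/funext => w; apply/funext => t; rewrite mxE.
  have /ae_forallF : forall k, {ae P, forall w, forall t, 0 <= t <= T ->
     q k w = st_Y x k w t - tint mu (st_g x k) `]t, T]%classic w + (st_S x k w T - st_S x k w t)} by exact: px.
  move: drx; apply: filterS2 => w dw pw t tT; apply/rowP => k; rewrite !mxE.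
  rewrite -/(q k w) (pw k t tT); congr (_ - _ + _).
  have mt : measurable (`]t, T]%classic : set R) by exact: measurable_itv.
  rewrite tintE//; apply: eq_Rintegral => u /set_mem /=; rewrite in_itv/= => /andP[tu uT].
  by rewrite dw// uT andbT; case/andP: tT => t0 _; exact: le_lt_trans t0 tu.
move=> Y' Z' [aY' Y'2] [pZ' Z'2] [iF' [S' sS' pS']].
(* [driven] reads only the fields [st_Y] and [st_Z]; the inner record with dummy driver and
   martingale part thus makes the competitor a fixed point by definition. *)
pose x' := State (fun k => driven T F (State (fun _ _ _ => 0) (fun k w t => Y' w t ord0 k)
   (fun k i w t => Z' i w t ord0 k) (fun _ _ _ => 0)) k)
  (fun k w t => Y' w t ord0 k) (fun k i w t => Z' i w t ord0 k) (fun k w t => S' w t ord0 k).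
have gx' : st_g x' = driven T F x' by [].
have pz' k i : predictable Ft T (fun w t => Z' i w t ord0 k).
  by exact: (measurableT_comp (vec_coord k) (pZ' i)).
have ay' k t : 0 <= t <= T -> mfunG (Ft t) (fun w => Y' w t ord0 k).
  by move=> tT; exact: (measurableT_comp (vec_coord k) (aY' t tT)).
have yl' k : {ae P, forall w, forall t, 0 < t <= T ->
    Y' w u ord0 k @[u --> t^'-] --> left_proc T (st_Y x' k) w t}.
  move: iF' pS'; apply: filterS2 => w iw hw t tT; have /andP[t0 tT'] := tT.
  (* The integrability clause of [bsde_solution] supplies the left limit of the time integral, and
     the equation passes it on to [Y']. *)
  have [l cl] := Rintegral_left_cvg tT (iw k).
  have [[_ /(_ w)[_ /(_ t tT) cS] _] _ _] := sS' k.
  have cc : Y' w u ord0 k @[u --> t^'-] --> Q w ord0 k + l - (S' w T ord0 k - lim (S' w v ord0 k @[v --> t^'-])).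
    have c' : (Q w ord0 k + \int[mu]_(v in `]u, T]) F w v (left_lim (Y' w) v) (fun i => Z' i w v) ord0 k -
        (S' w T ord0 k - S' w u ord0 k)) @[u --> t^'-] -->
        Q w ord0 k + l - (S' w T ord0 k - lim (S' w v ord0 k @[v --> t^'-])).
      apply: cvgB; first by apply: cvgD; [exact: cvg_cst|exact: cl].
      by apply: cvgB; [exact: cvg_cst|exact: cS].
    apply: cvg_trans c'; apply: near_eq_cvg.
    have n0 : \forall u \near t^'-, 0 < u by exact: nbhs_left_gt.
    have n1 : \forall u \near t^'-, u < t by exact: nbhs_left_lt.
    move: n0 n1; apply: filterS2 => u u0 ut.
    have uT : 0 <= u <= T by rewrite (ltW u0) (le_trans (ltW ut)).
    by have := hw u uT => ->; rewrite !mxE; ring.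
  by have e := left_proc_cvg (Y := st_Y x' k) T0 tT cc; rewrite e.
have drx' : {ae P, forall w, forall u, 0 < u <= T -> forall k,
    F w u (left_lim (Y' w) u) (fun i => Z' i w u) ord0 k = driven T F x' k w u}.
  have /ae_forallF : forall k, {ae P, forall w, forall t, 0 < t <= T ->
    Y' w u ord0 k @[u --> t^'-] --> left_proc T (st_Y x' k) w t} by exact: yl'.
  apply: filterS => w h u uT k; rewrite -(drivenE x' w u uT) => [|j]; last exact: h.
  congr (F _ _ _ _ _ _).
    congr left_lim; apply/funext => v; apply/rowP => j; by rewrite mxE.
  by apply/funext => i; apply/rowP => j; rewrite mxE.
pose C := fine (\int[P]_w ereal_sup [set (sqnorm (Y' w t))%:E | t in `[0%R, T]])%E.
have sup0 w : (0 <= ereal_sup [set (sqnorm (Y' w t))%:E | t in `[0%R, T]])%E.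
  apply: (@le_trans _ _ (sqnorm (Y' w 0))%:E); first by rewrite lee_fin sumr_ge0// => k _; exact: sqr_ge0.
  by apply: ereal_sup_ubound; exists 0 => //=; rewrite in_itv/= lexx ltW.
have CE : C%:E = (\int[P]_w ereal_sup [set (sqnorm (Y' w t))%:E | t in `[0%R, T]])%E.
  by rewrite /C fineK// ge0_fin_numE//; exact: integral_ge0.
have Z2' k : (\int[P]_w \sum_(i <oo) bracket_int T (A i) w (fun t => (Z' i w t ord0 k ^+ 2)%:E) < +oo)%E.
  apply: le_lt_trans Z'2; rewrite (H2E Z')// (bigD1 k)//= leeDl// sume_ge0// => j _.
  by apply: integral_ge0 => w _; apply: nneseries_ge0 => i _ _; apply: integral_ge0 => t _; rewrite lee_fin sqr_ge0.
(* The [S2] bound yields one constant [C] for the second moments at all times, and [H2] the bracket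
   moments. *)
have nx' : forall k, predictable Ft T (driven T F x' k) /\ sqint (P \x mu)%E (unc (driven T F x' k)).
  apply: (next_sqint HF T0 HB pF Hrho mct ctc Lip F0 HK (x := x') (C := fun _ => C)) => //.
  - by move=> _; rewrite -lee_fin CE; exact: integral_ge0.
  - move=> k t tT; rewrite CE; apply: ge0_integral_mono => w; first by rewrite lee_fin sqr_ge0.
    apply: (@le_trans _ _ (sqnorm (Y' w t))%:E); last by apply: ereal_sup_ubound; exists t => //=; rewrite in_itv.
    by rewrite lee_fin /sqnorm (bigD1 k)//= lerDl; apply: sumr_ge0 => j _; exact: sqr_ge0.
have Sx' : is_state P Ft T M A mu F q x'.
  split; [exact: nx'|exact: ay'|exact: sS'| |by move=> k; exact: (nx' k).2].
  move=> k; rewrite /bsde_path; move: drx' pS'; apply: filterS2 => w dw pw t tT.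
    have := congr1 (fun v : 'rV[R]_K => v ord0 k) (pw t tT); rewrite /q => ->; rewrite !mxE.
    congr (_ - _ + _); have mt : measurable (`]t, T]%classic : set R) by exact: measurable_itv.
    rewrite tintE//; apply: eq_Rintegral => u /set_mem /=; rewrite in_itv/= => /andP[tu uT].
    by rewrite dw// uT andbT; case/andP: tT => t0 _; exact: le_lt_trans t0 tu.
have [hY hZ] := state_unique HF T0 HB pF Hrho mct ctc Lip ctmu HK Sx' Sx gx' gx.
split.
  have /ae_forallF : forall k, {ae P, forall w, forall t, 0 <= t <= T -> st_Y x' k w t = st_Y x k w t} by exact: hY.
  by apply: filterS => w h t tT; apply/rowP => k; rewrite mxE; exact: h.
have pd k i : predictable Ft T (fun w t => Z' i w t ord0 k - st_Z x k i w t).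
  by apply: measurable_funB; [exact: pz'|exact: Zx].
have e i k : (fun w t => (Z' i w t - Z i w t) ord0 k) = (fun w t => Z' i w t ord0 k - st_Z x k i w t).
  by apply/funext => w; apply/funext => t; rewrite !mxE.
rewrite H2E => [|i k]; last by rewrite e.
rewrite big1// => k _; rewrite -[RHS](hZ k).
rewrite -(z_sum HF T0 HB HK (pd k)); apply: eq_integral => w _; apply: eq_eseriesr => i _.
by apply: eq_integral => t _; rewrite !mxE.
Qed.
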